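(* Let $M$ be a smooth manifold. For a triple $(E,\nabla_E,\alpha)$ as in the definition of $\widehat K_{\rm ch}(M)$ put $$\mathfrak B(E,\nabla_E,\alpha)=\widetilde{\rm ch}(\nabla_E^*,\nabla_E)-\alpha+\overline\alpha\ \in\ \Omega^{\rm odd}(M,\mathbb C)/d\Omega^{\rm even}(M,\mathbb C),$$ where $\nabla_E^*$ is the adjoint transpose of $\nabla_E$ for any hermitian metric on $E$. Then $\mathfrak B$ induces a well defined group morphism from $\widehat K_{\rm ch}(M)$ to the subgroup of purely imaginary forms in $\Omega^{\rm odd}(M,\mathbb C)/d\Omega^{\rm even}(M,\mathbb C)$, it satisfies $$d\,\mathfrak B(E,\nabla_E,\alpha)=2i\,\mathfrak{Im}\big(\widehat{\rm ch}(E,\nabla_E,\alpha)\big),$$ and it sends $MK^0(M)$ into $iH^{\rm odd}(M,\mathbb R)$.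
   Context: For a connection $\nabla$ on a smooth complex vector bundle, ${\rm ch}(\nabla)={\rm Tr}\exp\left(-\frac1{2\pi i}\nabla^2\right)$. For two connections $\nabla_0,\nabla_1$ on the same bundle, $\widetilde{\rm ch}(\nabla_0,\nabla_1)=-\frac1{2\pi i}\int_0^1{\rm Tr}\left(\frac{\partial\nabla_t}{\partial t}\exp\left(-\frac1{2\pi i}\nabla_t^2\right)\right)dt$ for any smooth path $\nabla_t$ of connections from $\nabla_0$ to $\nabla_1$; it is an odd form, well defined modulo exact forms, with $d\widetilde{\rm ch}(\nabla_0,\nabla_1)={\rm ch}(\nabla_1)-{\rm ch}(\nabla_0)$. For a hermitian metric $h^E$ on $E$ the adjoint transpose $\nabla_E^*$ of $\nabla_E$ is defined by $h^E((\nabla_E^* )_{\tt v}\sigma,\theta)={\tt v}.h^E(\sigma,\theta)-h^E(\sigma,(\nabla_E)_{\tt v}\theta)$. $\widehat K_{\rm ch}(M)$ (free multiplicative $K$-theory) is the quotient of the free abelian group generated by triples $(E,\nabla_E,\alpha)$, where $E$ is a smooth complex vector bundle on $M$, $\nabla_E$ a connection on $E$ and $\alpha$ an odd degree complex differential form modulo exact forms, by the relations: $(E_1,\nabla_{E_1},\alpha_1)=(E_2,\nabla_{E_2},\alpha_2)$ whenever there is a smooth bundle isomorphism $f\colon E_1\to E_2$ with $\alpha_2=\alpha_1+\widetilde{\rm ch}(\nabla_{E_1},f^*\nabla_{E_2})$; and $(E,\nabla_E,\alpha)+(F,\nabla_F,\beta)=(E\oplus F,\nabla_E\oplus\nabla_F,\alpha+\beta)$.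 The Chern character is the group morphism $\widehat{\rm ch}(E,\nabla_E,\alpha)={\rm ch}(\nabla_E)-d\alpha\in\Omega^{\rm even}(M,\mathbb C)$. $MK^0(M)\subset\widehat K_{\rm ch}(M)$ is the preimage of $\mathbb Z$ (integer constant functions) under $\widehat{\rm ch}$. An element of $\Omega^{\rm odd}/d\Omega^{\rm even}$ is purely imaginary if it is represented by a purely imaginary form; the differential $d$ is well defined on $\Omega^{\rm odd}/d\Omega^{\rm even}$. *)

(* Defs.v *)
From HB Require Import structures.
From mathcomp Require Import all_boot all_order all_algebra.
From mathcomp Require Import all_classical all_reals all_analysis.
From mathcomp Require Import complex ring.
From mathcomp.multinomials Require Import freeg.
Set Implicit Arguments.
Unset Strict Implicit.
Unset Printing Implicit Defensive.
Import Order.TTheory GRing.Theory Num.Theory numFieldNormedType.Exports.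
Local Open Scope classical_set_scope.
Local Open Scope ring_scope.
Local Open Scope complex_scope.
Local Open Scope quotient_scope.

(* [Ck k V f]: all iterated partial derivatives of [f] of order at most [k]
   exist and are continuous on [V]; only used for [V] open. *)
Fixpoint Ck (R : realType) (n k : nat) (V : set 'rV[R]_n) (f : 'rV[R]_n -> R)
    : Prop :=
  (forall x, V x -> {for x, continuous f}) /\
  if k is k'.+1 then
    forall i : 'I_n,
      (forall x, V x -> derivable f x (delta_mx 0 i)) /\
      Ck k' V (fun x => 'D_(delta_mx 0 i) f x)
  else True.

(* Smooth manifolds without boundary, of pure dimension n, given by an atlas
   (not required to be maximal). [chart i] and [chartV i] are only meaningful
   on [cdom i] and on its image. *)
Record manifold (R : realType) (n : nat) := Manifold {
  pt :> topologicalType;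
  manifold_hausdorff : hausdorff_space pt;
  manifold_countable : @second_countable pt;
  cidx : Type;
  cdom : cidx -> set pt;
  chart : cidx -> pt -> 'rV[R]_n;
  chartV : cidx -> 'rV[R]_n -> pt;
  cdom_cover : forall x, exists i, cdom i x;
  cdom_open : forall i, open (cdom i);
  cimg_open : forall i, open (chart i @` cdom i);
  chartK : forall i x, cdom i x -> chartV i (chart i x) = x;
  chart_continuous : forall i, {in cdom i, continuous (chart i)};
  chartV_continuous : forall i, {in chart i @` cdom i, continuous (chartV i)};
  chart_smooth : forall i j (l : 'I_n) k,
    Ck k (chart i @` (cdom i `&` cdom j)) (fun y => chart j (chartV i y) 0 l)
}.

(* Smoothness of a function on an open set [U]; the values off [U] are
   irrelevant. *)
Definition smooth_on (R : realType) (n : nat) (M : manifold R n) (U : set M)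
    (f : M -> R) : Prop :=
  forall (i : cidx M) k, Ck k (chart i @` (cdom i `&` U)) (f \o @chartV _ _ M i).

Definition csmooth_on (R : realType) (n : nat) (M : manifold R n) (U : set M)
    (f : M -> R[i]) : Prop :=
  smooth_on U (fun x => complex.Re (f x)) /\
  smooth_on U (fun x => complex.Im (f x)).

(* Vector fields, as derivations of the algebra of smooth real functions. They
   are extended by 0 to the other functions, so that two vector fields which
   agree on smooth functions are equal. *)
Record vfield (R : realType) (n : nat) (M : manifold R n) := VField {
  vf :> (M -> R) -> M -> R;
  vf_out : forall f, ~ smooth_on setT f -> vf f = 0;
  vf_smooth : forall f, smooth_on setT f -> smooth_on setT (vf f);
  vf_linear : forall (a : R) f g, smooth_on setT f -> smooth_on setT g ->
    vf (a *: f + g) = a *: vf f + vf g;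
  vf_leibniz : forall f g, smooth_on setT f -> smooth_on setT g ->
    vf (f * g) = f * vf g + g * vf f
}.

Section CkTheory.
Context {R : realType} {n : nat}.
Implicit Types (V : set 'rV[R]_n) (f g : 'rV[R]_n -> R).

Lemma Ck_sub k V W f : V `<=` W -> Ck k W f -> Ck k V f.
Proof.
move=> VW; elim: k f => [|k IH] f /= [fc fd]; split=> //.
- by move=> x /VW; exact: fc.
- by move=> x /VW; exact: fc.
- move=> i; have [fi fk] := fd i; split; first by move=> x /VW; exact: fi.
  exact: IH.
Qed.

Lemma near_eq_continuous {T U : topologicalType} (f g : T -> U) x :
  (\forall y \near x, f y = g y) ->
  {for x, continuous f} -> {for x, continuous g}.
Proof.
move=> fg; rewrite /prop_for /continuous_at -(nbhs_singleton fg).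
by apply: cvg_trans; apply: (near_eq_cvg (F := nbhs x)).
Qed.

Lemma Ck_eq k V f g : open V -> (forall x, V x -> f x = g x) ->
  Ck k V f -> Ck k V g.
Proof.
move=> Vo; elim: k f g => [|k IH] f g fg /= [fc fd].
all: have fgn x : V x -> \forall y \near x, f y = g y
  by move=> Vx; apply: filterS (open_nbhs_nbhs (conj Vo Vx)) => y; exact: fg.
all: have gc x : V x -> {for x, continuous g}
  by move=> Vx; apply: near_eq_continuous (fc _ Vx); exact: fgn.
  by [].
split=> // i; have [fi fk] := fd i; split.
  by move=> x Vx; apply: near_eq_derivable (fi x Vx); exact: fgn.
by apply: IH fk => x Vx; apply: near_eq_derive; exact: fgn.
Qed.

Lemma Ck_pred k V f : Ck k.+1 V f -> Ck k V f.
Proof.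
elim: k f => [|k IH] f [fc fd]; first by [].
by split=> // i; have [fi fk] := fd i; split=> //; apply: IH.
Qed.

Lemma Ck_cst k V (a : R) : Ck k V (fun=> a).
Proof.
elim: k a => [|k IH] a /=; split=> //; try by move=> x _; exact: cst_continuous.
move=> i; split; first by move=> x _; exact: derivable_cst.
have -> : (fun x : 'rV[R]_n => 'D_(delta_mx 0 i) (fun=> a : R) x) = (fun=> 0).
  by apply/funext => x; exact: derive_cst.
exact: IH.
Qed.

Lemma Ck_add k V f g : open V -> Ck k V f -> Ck k V g ->
  Ck k V (fun x => f x + g x).
Proof.
move=> Vo; elim: k f g => [|k IH] f g /= [fc fd] [gc gd].
all: have c x : V x -> {for x, continuous (fun x => f x + g x)}
  by move=> Vx; exact: (continuousD (fc _ Vx) (gc _ Vx)).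
  by [].
split=> // i; have [fi fk] := fd i; have [gi gk] := gd i; split.
  by move=> x Vx; apply: derivableD; [exact: fi | exact: gi].
apply: (Ck_eq Vo) (IH _ _ fk gk) => x Vx.
by rewrite -deriveD; [|exact: fi | exact: gi].
Qed.

Lemma Ck_mul k V f g : open V -> Ck k V f -> Ck k V g ->
  Ck k V (fun x => f x * g x).
Proof.
move=> Vo; elim: k f g => [|k IH] f g /= [fc fd] [gc gd].
all: have c x : V x -> {for x, continuous (fun x => f x * g x)}
  by move=> Vx; exact: (continuousM (fc _ Vx) (gc _ Vx)).
  by [].
split=> // i; have [fi fk] := fd i; have [gi gk] := gd i; split.
  by move=> x Vx; apply: derivableM; [exact: fi | exact: gi].
have fp : Ck k V f by apply: Ck_pred.
have gp : Ck k V g by apply: Ck_pred.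
apply: (Ck_eq Vo) (Ck_add Vo (IH _ _ fp gk) (IH _ _ gp fk)) => x Vx.
exact/esym/(deriveM (fi _ Vx) (gi _ Vx)).
Qed.

End CkTheory.

Section SmoothTheory.
Context {R : realType} {n : nat} {M : manifold R n}.
Implicit Types (U : set M) (f g : M -> R) (X Y : vfield M).

Lemma chart_open (i : cidx M) U : open U -> open (chart i @` (cdom i `&` U)).
Proof.
move=> Uo.
have -> : chart i @` (cdom i `&` U)
    = chart i @` cdom i `&` ((@chartV _ _ M i) @^-1` U).
  apply/seteqP; split=> [y [x [xi xU] <-]|y [[x xi <-]]].
    by split; [exists x | rewrite /preimage /= chartK].
  by rewrite /preimage /= chartK // => xU; exists x.
have /continuous_inP P : open (chart i @` cdom i) by exact: cimg_open.
by have /P := @chartV_continuous _ _ M i; apply.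
Qed.

Lemma smoothW U V f : U `<=` V -> smooth_on V f -> smooth_on U f.
Proof.
move=> UV fV i k; apply: Ck_sub (fV i k).
by apply: image_subset => x [xi /UV].
Qed.

Lemma smooth_cst U (a : R) : smooth_on U (fun=> a).
Proof. by move=> i k; exact: Ck_cst. Qed.

Lemma smooth_add U f g : open U -> smooth_on U f -> smooth_on U g ->
  smooth_on U (f + g).
Proof.
by move=> Uo hf hg i k; apply: Ck_add; [exact: chart_open|exact: hf|exact: hg].
Qed.

Lemma smooth_mul U f g : open U -> smooth_on U f -> smooth_on U g ->
  smooth_on U (f * g).
Proof.
by move=> Uo hf hg i k; apply: Ck_mul; [exact: chart_open|exact: hf|exact: hg].
Qed.

Lemma smooth_scale U (a : R) f : open U -> smooth_on U f ->
  smooth_on U (a *: f).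
Proof. by move=> Uo hf; exact: smooth_mul (smooth_cst _ a) hf. Qed.

Lemma smooth_sub U f g : open U -> smooth_on U f -> smooth_on U g ->
  smooth_on U (f - g).
Proof.
move=> Uo hf hg; rewrite -scaleN1r.
by apply: smooth_add => //; exact: smooth_scale.
Qed.

Lemma vfD X f g : smooth_on setT f -> smooth_on setT g ->
  X (f + g) = X f + X g.
Proof. by move=> hf hg; have := vf_linear X 1 hf hg; rewrite !scale1r. Qed.

Lemma vfB X f g : smooth_on setT f -> smooth_on setT g ->
  X (f - g) = X f - X g.
Proof.
move=> hf hg; have := vf_linear X (-1) hg hf.
by rewrite !scaleN1r addrC => ->; rewrite addrC.
Qed.

Lemma vf0 X : X 0 = 0.
Proof.
by have := vfB X (smooth_cst setT 0) (smooth_cst setT 0); rewrite !subrr.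
Qed.

Let To : open (setT : set M). Proof. exact: openT. Qed.

(* The Lie bracket of vector fields. *)
Program Definition bracket X Y : vfield M :=
  @VField R n M (fun f => X (Y f) - Y (X f)) _ _ _ _.
Next Obligation. by move=> X Y f hf; rewrite /= (vf_out X hf) (vf_out Y hf) !vf0 subrr. Qed.
Next Obligation.
by move=> X Y f hf; apply: smooth_sub => //; do 2 apply: vf_smooth.
Qed.
Next Obligation.
move=> X Y a f g hf hg /=.
rewrite !vf_linear //; do ?by apply: vf_smooth.
by rewrite opprD addrACA scalerBr.
Qed.
Next Obligation.
move=> X Y f g hf hg /=.
have sX h : smooth_on setT h -> smooth_on setT (X h) by exact: vf_smooth.
have sY h : smooth_on setT h -> smooth_on setT (Y h) by exact: vf_smooth.
rewrite !vf_leibniz // !vfD; do ?by apply: smooth_mul => //; auto.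
rewrite !vf_leibniz //; do ?by auto.
by apply/funext => x; rewrite /GRing.add /GRing.mul /GRing.opp /=; ring.
Qed.

End SmoothTheory.

Section Forms.
Context {R : realType} {n : nat} {M : manifold R n}.
Implicit Types (X Y Z : vfield M) (Xs : seq (vfield M)).

(* Action of a real vector field on a complex function. *)
Definition cvf X (f : M -> R[i]) : M -> R[i] := fun x =>
  X (fun y => complex.Re (f y)) x +i* X (fun y => complex.Im (f y)) x.

(* A complex inhomogeneous differential form is given by its values on the
   lists of vector fields; its component of degree k is its restriction to the
   lists of length k. As in the usual identification of k-forms with
   alternating multilinear maps, linearity is over the smooth functions. *)
Definition preform : Type := seq (vfield M) -> M -> R[i].
HB.instance Definition _ := GRing.Zmodule.on preform.

Definition is_form (w : preform) : Prop :=
  [/\ forall Xs, csmooth_on setT (w Xs),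
      forall (f : M -> R) X Y Z Xs1 Xs2, smooth_on setT f ->
        (forall g, Z g = f * X g + Y g) ->
        forall x, w (Xs1 ++ Z :: Xs2) x =
          (f x)%:C * w (Xs1 ++ X :: Xs2) x + w (Xs1 ++ Y :: Xs2) x
    & forall X Xs1 Xs2 Xs3, w (Xs1 ++ X :: Xs2 ++ X :: Xs3) = 0].

Definition of_parity (b : bool) (w : preform) : Prop :=
  forall Xs, odd (size Xs) != b -> w Xs = 0.

Definition even_form (w : preform) := is_form w /\ of_parity false w.
Definition odd_form (w : preform) := is_form w /\ of_parity true w.

Definition del_nth (i : nat) Xs := take i Xs ++ drop i.+1 Xs.

(* Exterior derivative, by the invariant formula; wedge products are sums over
   shuffles, so that no factorials appear. *)
Definition dform (w : preform) : preform := fun Xs x =>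
  (\sum_(i < size Xs)
     (-1) ^+ i * cvf (tnth (in_tuple Xs) i) (w (del_nth i Xs)) x) +
  \sum_(i < size Xs) \sum_(j < size Xs | (i < j)%N)
     (-1) ^+ (i + j) *
     w (bracket (tnth (in_tuple Xs) i) (tnth (in_tuple Xs) j)
          :: del_nth i (del_nth j Xs)) x.

Definition cform (w : preform) : preform := fun Xs x => (w Xs x)^*.
Definition imform (w : preform) : preform :=
  fun Xs x => (complex.Im (w Xs x))%:C.
Definition scaleform (a : R[i]) (w : preform) : preform :=
  fun Xs x => a * w Xs x.

Definition real_form (w : preform) := forall Xs x, complex.Im (w Xs x) = 0.
Definition imaginary_form (w : preform) := forall Xs x, complex.Re (w Xs x) = 0.

(* The constant function [m], as a form of degree 0. *)
Definition int_form (m : int) : preform :=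
  fun Xs _ => if Xs is [::] then m%:~R else 0.

Lemma cvfB X (f g : M -> R[i]) : csmooth_on setT f -> csmooth_on setT g ->
  cvf X (f - g) = cvf X f - cvf X g.
Proof.
move=> [fr fi] [gr gi]; apply/funext => x.
have vr := vfB X fr gr; have vi := vfB X fi gi.
have -> : (cvf X f - cvf X g) x = cvf X f x - cvf X g x by [].
rewrite /cvf; apply/eqP; rewrite eq_complex /=; apply/andP; split; apply/eqP.
  transitivity ((X ((fun y => complex.Re (f y)) - (fun y => complex.Re (g y)))) x).
    by congr (vf X _ x); apply/funext => y; rewrite /GRing.add /GRing.opp /=;
       case: (f y) => ? ?; case: (g y) => ? ?.
  by rewrite vr.
transitivity ((X ((fun y => complex.Im (f y)) - (fun y => complex.Im (g y)))) x).
  by congr (vf X _ x); apply/funext => y; rewrite /GRing.add /GRing.opp /=;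
     case: (f y) => ? ?; case: (g y) => ? ?.
by rewrite vi.
Qed.

Lemma csmoothB (f g : M -> R[i]) : csmooth_on setT f -> csmooth_on setT g ->
  csmooth_on setT (f - g).
Proof.
move=> [fr fi] [gr gi]; split.
  have -> : (fun x => complex.Re ((f - g) x)) =
    (fun y => complex.Re (f y)) - (fun y => complex.Re (g y)).
    apply/funext => y; rewrite /GRing.add /GRing.opp /=.
    by case: (f y) => ? ?; case: (g y) => ? ?.
  by apply: smooth_sub => //; exact: openT.
have -> : (fun x => complex.Im ((f - g) x)) =
  (fun y => complex.Im (f y)) - (fun y => complex.Im (g y)).
  apply/funext => y; rewrite /GRing.add /GRing.opp /=.
  by case: (f y) => ? ?; case: (g y) => ? ?.
by apply: smooth_sub => //; exact: openT.
Qed.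

Lemma csmooth0 : csmooth_on setT (0 : M -> R[i]).
Proof. by split; exact: smooth_cst. Qed.

Lemma is_form0 : is_form 0.
Proof.
split=> [Xs||//]; first exact: csmooth0.
by move=> f X Y Z Xs1 Xs2 _ _ x; rewrite mulr0 addr0.
Qed.

Lemma is_formB w v : is_form w -> is_form v -> is_form (w - v).
Proof.
move=> [ws wl wa] [vs vl va]; split.
- by move=> Xs; apply: csmoothB.
- move=> f X Y Z Xs1 Xs2 hf hZ x.
  have E Ys : (w - v) Ys x = w Ys x - v Ys x by [].
  by rewrite !E (wl _ _ _ _ _ _ hf hZ) (vl _ _ _ _ _ _ hf hZ); ring.
- move=> X Xs1 Xs2 Xs3.
  have E Ys : (w - v) Ys = w Ys - v Ys by [].
  by rewrite E wa va subrr.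
Qed.

Lemma of_parityB b w v : of_parity b w -> of_parity b v -> of_parity b (w - v).
Proof.
move=> hw hv Xs hX; have -> : (w - v) Xs = w Xs - v Xs by [].
by rewrite hw // hv // subrr.
Qed.

Lemma dform0 : dform 0 = 0.
Proof.
apply/funext => Xs; apply/funext => x; rewrite /dform.
transitivity (0 + 0 : R[i]); last by rewrite addr0.
congr (_ + _); apply: big1 => i _; last by apply: big1 => j _; rewrite mulr0.
rewrite /cvf; have -> : (fun y => complex.Re ((0 : preform) (del_nth i Xs) y))
  = 0 :> (M -> R) by [].
by rewrite !vf0 /= mulr0.
Qed.

Lemma dformB w v : is_form w -> is_form v ->
  dform (w - v) = dform w - dform v.
Proof.
move=> [ws _ _] [vs _ _]; apply/funext => Xs; apply/funext => x.
have -> : (dform w - dform v) Xs x = dform w Xs x - dform v Xs x by [].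
have E Ys : (w - v) Ys = w Ys - v Ys by [].
rewrite /dform opprD addrACA -!sumrB; congr (_ + _); apply: eq_bigr => i _.
  by rewrite E cvfB // -mulrBr.
rewrite -sumrB; apply: eq_bigr => j _.
by rewrite E -mulrBr.
Qed.

(* Omega^odd(M, C) as an abelian group *)
Definition oform_pred : {pred preform} := fun w => `[< odd_form w >].

Lemma oform_zmod_closed : zmod_closed oform_pred.
Proof.
split=> [|w v /asboolP [w1 w2] /asboolP [v1 v2]]; apply/asboolP; split.
- exact: is_form0.
- by move=> Xs _.
- exact: is_formB.
- exact: of_parityB.
Qed.
HB.instance Definition _ := GRing.isZmodClosed.Build preform oform_pred
  oform_zmod_closed.

Record oform := Oform { oform_val :> preform; oformP : oform_val \in oform_pred }.
HB.instance Definition _ := [isSub for oform_val].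
HB.instance Definition _ := [Choice of oform by <:].
HB.instance Definition _ := [SubChoice_isSubZmodule of oform by <:].

Definition exact_pred : {pred oform} := fun w =>
  `[< exists2 v, even_form v & oform_val w = dform v >].

Lemma exact_zmod_closed : zmod_closed exact_pred.
Proof.
split=> [|w v /asboolP [a [a1 a2] wa] /asboolP [b [b1 b2] vb]]; apply/asboolP.
  exists 0; last by rewrite dform0.
  by split; [exact: is_form0 | move=> Xs _].
exists (a - b); first by split; [exact: is_formB | exact: of_parityB].
by rewrite dformB // -wa -vb.
Qed.
HB.instance Definition _ := GRing.isZmodClosed.Build oform exact_pred
  exact_zmod_closed.

(* Omega^odd(M, C) / d Omega^even(M, C) *)
Definition oform_mod : zmodType := Quotient.quot exact_pred.
End Forms.

(* A smooth complex vector bundle, given by local trivializations over an open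
   cover with smooth transition functions; [triv i x : E_x -> C^(trank i)] is
   only meaningful for [x] in [tdom i]. The rank is locally constant. A basis of
   each fibre is fixed (with no regularity in x), so that E_x is C^(rank x):
   every vector bundle is isomorphic to such a bundle. Taking the fibres in a
   fixed family of spaces is also what allows the bundles over M to form a type
   which can itself index a free abelian group. *)
Record vbundle (R : realType) (n : nat) (M : manifold R n) := VBundle {
  rank : M -> nat;
  tidx : Type;
  tdom : tidx -> set M;
  trank : tidx -> nat;
  triv : forall i x, 'M[R[i]]_(trank i, rank x);
  trivV : forall i x, 'M[R[i]]_(rank x, trank i);
  tdom_cover : forall x, exists i, tdom i x;
  tdom_open : forall i, open (tdom i);
  trivK : forall i x, tdom i x -> trivV i x *m triv i x = 1%:M;
  trivVK : forall i x, tdom i x -> triv i x *m trivV i x = 1%:M;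
  triv_smooth : forall i j k l,
    csmooth_on (tdom i `&` tdom j) (fun x => (triv j x *m trivV i x) k l)
}.

Section Bundles.
Context {R : realType} {n : nat} {M : manifold R n}.
Implicit Types (E F : vbundle M) (X Y Z : vfield M) (Xs : seq (vfield M)).

(* Not necessarily smooth sections. *)
Definition presection E := forall x : M, 'cV[R[i]]_(rank E x).

Definition smooth_section E (s : presection E) : Prop :=
  forall (i : tidx E) l, csmooth_on (tdom i) (fun x => (triv i x *m s x) l 0).

(* Covariant derivatives; their values on non-smooth sections are irrelevant. *)
Definition preconnection E := vfield M -> presection E -> presection E.

Record is_connection E (D : preconnection E) : Prop := {
  conn_smooth : forall X s, smooth_section s -> smooth_section (D X s);
  conn_add : forall X s t, smooth_section s -> smooth_section t ->
    forall x, D X (fun y => s y + t y) x = D X s x + D X t x;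
  conn_leibniz : forall X (f : M -> R[i]) s, csmooth_on setT f ->
    smooth_section s -> forall x,
    D X (fun y => f y *: s y) x = cvf X f x *: s x + f x *: D X s x;
  conn_tensorial : forall (f : M -> R) X Y Z s, smooth_on setT f ->
    (forall g, Z g = f * X g + Y g) -> smooth_section s ->
    forall x, D Z s x = (f x)%:C *: D X s x + D Y s x
}.

(* The value at [x] of the bundle endomorphism which induces the operator [T]
   on smooth sections. *)
Definition endo_at E (T : presection E -> presection E) (x : M) :
    'M[R[i]]_(rank E x) :=
  xget 0 [set A : 'M[R[i]]_(rank E x) |
           forall s, smooth_section s -> A *m s x = T s x].

(* Inhomogeneous End(E)-valued forms at a point. *)
Definition endform E (x : M) := seq (vfield M) -> 'M[R[i]]_(rank E x).

(* The signature of the shuffle which moves the entries selected by the mask [m]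
   in front of the other ones has the parity of [inversions m]. *)
Definition inversions (m : bitseq) : nat :=
  (\sum_(j < size m | nth false m j) count negb (take j m))%N.

(* Product of End(E)-valued forms (wedge product and composition). *)
Definition mul_endform E x (A B : endform E x) : endform E x := fun Xs =>
  \sum_(m : (size Xs).-tuple bool)
    ((-1) ^+ inversions m) *:
      (A (mask m Xs) *m B (mask (map negb m) Xs)).

Definition one_endform E x : endform E x :=
  fun Xs => if Xs is [::] then 1%:M else 0.

Definition pow_endform E x (A : endform E x) (k : nat) : endform E x :=
  iter k (mul_endform A) (one_endform E x).

(* The exponential of [a *: A], for [A] without component of degree 0: only the
   powers [k <= size Xs] have a component of degree [size Xs]. *)
Definition exp_endform E x (a : R[i]) (A : endform E x) : endform E x :=
  fun Xs => \sum_(k < (size Xs).+1)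
    (a ^+ k / (k`!)%:R) *: pow_endform A k Xs.

Definition curvature E (D : preconnection E) x : endform E x := fun Xs =>
  if Xs is [:: X; Y] then
    endo_at (fun s y => D X (D Y s) y - D Y (D X s) y - D (bracket X Y) s y) x
  else 0.

Definition chern_const : R[i] := - (2 * (pi : R)%:C * 'i)^-1.

Definition ch E (D : preconnection E) : preform := fun Xs x =>
  \tr (exp_endform chern_const (curvature D x) Xs).

Definition affine_path E (D0 D1 : preconnection E) (t : R) : preconnection E :=
  fun X s x => (1 - t)%:C *: D0 X s x + t%:C *: D1 X s x.

Definition conn_diff E (D0 D1 : preconnection E) x : endform E x := fun Xs =>
  if Xs is [:: X] then endo_at (fun s y => D1 X s y - D0 X s y) x else 0.

Definition cintegral01 (g : R -> R[i]) : R[i] :=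
  Rintegral lebesgue_measure `[0, 1] (fun t => complex.Re (g t)) +i*
  Rintegral lebesgue_measure `[0, 1] (fun t => complex.Im (g t)).

(* The transgression form. Since its class modulo exact forms does not depend on
   the path of connections, it is taken along the affine path, whose derivative
   is the constant [conn_diff D0 D1]. *)
Definition transgression E (D0 D1 : preconnection E) : preform := fun Xs x =>
  chern_const * cintegral01 (fun t =>
    \tr (mul_endform (conn_diff D0 D1 x)
      (exp_endform chern_const (curvature (affine_path D0 D1 t) x)) Xs)).

Definition oclass (w : oform (M := M)) : oform_mod (M := M) :=
  \pi_(Quotient.quot exact_pred) w.

(* The class modulo exact forms of an odd form given as a function on lists of
   vector fields; [insubd] is only ever applied to an odd form. *)
Definition class_of (w : preform (M := M)) : oform_mod (M := M) :=
  oclass (insubd 0 w).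

Definition ch_tilde E (D0 D1 : preconnection E) : oform_mod (M := M) :=
  class_of (transgression D0 D1).

Definition dmod (a : oform_mod (M := M)) : preform := dform (repr a : oform).
Definition conj_mod (a : oform_mod (M := M)) : oform_mod (M := M) :=
  class_of (cform (repr a : oform)).

Definition purely_imaginary (a : oform_mod (M := M)) : Prop :=
  exists2 w : oform (M := M), imaginary_form w & a = oclass w.

(* i H^odd(M, R) *)
Definition in_iHodd (a : oform_mod (M := M)) : Prop :=
  exists w : oform (M := M),
    [/\ real_form w, dform w = 0 & a = class_of (scaleform 'i w)].

Record hermitian_metric E := HermitianMetric {
  herm :> forall x : M,
    'cV[R[i]]_(rank E x) -> 'cV[R[i]]_(rank E x) -> R[i];
  herm_linear : forall x (a : R[i]) u v w,
    @herm x (a *: u + v) w = a * @herm x u w + @herm x v w;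
  herm_sym : forall x u v, @herm x v u = (@herm x u v)^*;
  herm_pos : forall x u, u != 0 -> 0 < @herm x u u;
  herm_smooth : forall (i : tidx E) (u v : 'cV_(trank i)),
    csmooth_on (tdom i) (fun x => @herm x (trivV i x *m u) (trivV i x *m v))
}.

Definition is_adjoint E (h : hermitian_metric E) (D D' : preconnection E) :=
  is_connection D' /\
  forall X s t, smooth_section s -> smooth_section t -> forall x,
    h x (D' X s x) (t x) = cvf X (fun y => h y (s y) (t y)) x
                           - h x (s x) (D X t x).

Record bundle_iso E F := BundleIso {
  iso : forall x : M, 'M[R[i]]_(rank F x, rank E x);
  isoV : forall x : M, 'M[R[i]]_(rank E x, rank F x);
  isoK : forall x, isoV x *m iso x = 1%:M;
  isoVK : forall x, iso x *m isoV x = 1%:M;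
  iso_smooth : forall (i : tidx E) (j : tidx F) k l,
    csmooth_on (tdom i `&` tdom j)
      (fun x => (triv j x *m iso x *m trivV i x) k l);
  isoV_smooth : forall (i : tidx E) (j : tidx F) k l,
    csmooth_on (tdom i `&` tdom j)
      (fun x => (triv i x *m isoV x *m trivV j x) k l)
}.

Definition pullback E F (f : bundle_iso E F) (D : preconnection F) :
    preconnection E :=
  fun X s x => isoV f x *m D X (fun y => iso f y *m s y) x.

Section DirectSum.
Variables E F : vbundle M.

Program Definition dsum : vbundle M :=
  @VBundle R n M (fun x => rank E x + rank F x)%N
    (tidx E * tidx F)%type
    (fun ij => tdom ij.1 `&` tdom ij.2)
    (fun ij => trank ij.1 + trank ij.2)%N
    (fun ij x => block_mx (triv ij.1 x) 0 0 (triv ij.2 x))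
    (fun ij x => block_mx (trivV ij.1 x) 0 0 (trivV ij.2 x)) _ _ _ _ _.
Next Obligation.
move=> x; have [i hi] := tdom_cover E x; have [j hj] := tdom_cover F x.
by exists (i, j).
Qed.
Next Obligation. by move=> [i j]; apply: openI; exact: tdom_open. Qed.
Next Obligation.
move=> [i j] x [/= hi hj]; rewrite mulmx_block !mul0mx !mulmx0 !addr0 !add0r.
by rewrite trivK // trivK // -scalar_mx_block.
Qed.
Next Obligation.
move=> [i j] x [/= hi hj]; rewrite mulmx_block !mul0mx !mulmx0 !addr0 !add0r.
by rewrite trivVK // trivVK // -scalar_mx_block.
Qed.
Next Obligation.
move=> [i j] [i' j'] k l /=.
have E0 x : block_mx (triv i' x) 0 0 (triv j' x)
    *m block_mx (trivV i x) 0 0 (trivV j x)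
  = block_mx (triv i' x *m trivV i x) 0 0 (triv j' x *m trivV j x).
  by rewrite mulmx_block !mul0mx !mulmx0 !addr0 !add0r.
rewrite (_ : (fun x => _) = (fun x => block_mx (triv i' x *m trivV i x) 0 0
  (triv j' x *m trivV j x) k l)); last by apply/funext => x; rewrite E0.
have c0 : csmooth_on (tdom i `&` tdom j `&` (tdom i' `&` tdom j'))
    (fun=> 0 : R[i]) by split; exact: smooth_cst.
case: (split_ordP k) => a ->; case: (split_ordP l) => b ->.
- rewrite (_ : (fun x => _) = fun x => (triv i' x *m trivV i x) a b).
    have [h1 h2] := @triv_smooth _ _ _ E i i' a b.
    by split; [move: h1 | move: h2]; apply: smoothW => x [[? ?] [? ?]].
  by apply/funext => x; rewrite block_mxEul.
- rewrite (_ : (fun x => _) = fun=> 0) //.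
  by apply/funext => x; rewrite block_mxEur mxE.
- rewrite (_ : (fun x => _) = fun=> 0) //.
  by apply/funext => x; rewrite block_mxEdl mxE.
- rewrite (_ : (fun x => _) = fun x => (triv j' x *m trivV j x) a b).
    have [h1 h2] := @triv_smooth _ _ _ F j j' a b.
    by split; [move: h1 | move: h2]; apply: smoothW => x [[? ?] [? ?]].
  by apply/funext => x; rewrite block_mxEdr.
Qed.

Definition dsum_conn (D : preconnection E) (D' : preconnection F) :
    preconnection dsum :=
  fun X s x => col_mx (D X (fun y => usubmx (s y)) x)
                      (D' X (fun y => dsubmx (s y)) x).
End DirectSum.

End Bundles.

Section KTheory.
Context {R : realType} {n : nat} {M : manifold R n}.

Record triple := Triple {
  tbundle : vbundle M;
  tconn : preconnection tbundle;
  tconnP : is_connection tconn;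
  tform : oform_mod (M := M)
}.
Arguments tconn : clear implicits.
HB.instance Definition _ := gen_eqMixin triple.
HB.instance Definition _ := gen_choiceMixin triple.

Definition gen (t : triple) : {freeg triple / int} := Freeg [:: (1, t)].

(* In both constructors, the connection on the left hand side is one of the
   generating triples. *)
Inductive relator : {freeg triple / int} -> Prop :=
| relator_iso (E F : vbundle M) (DE : preconnection E) (DF : preconnection F)
    (hE : is_connection DE) (hF : is_connection DF) (f : bundle_iso E F)
    (a b : oform_mod (M := M)) :
    b = a + ch_tilde DE (pullback f DF) ->
    relator (gen (Triple hE a) - gen (Triple hF b))
| relator_dsum (E F : vbundle M) (DE : preconnection E) (DF : preconnection F)
    (hE : is_connection DE) (hF : is_connection DF)
    (hEF : is_connection (dsum_conn DE DF)) (a b : oform_mod (M := M)) :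
    relator (gen (Triple hE a) + gen (Triple hF b) - gen (Triple hEF (a + b))).

(* The subgroup generated by the relators *)
Definition relation_pred : {pred {freeg triple / int}} := fun g =>
  `[< forall S : set {freeg triple / int},
        S 0 -> (forall a b, S a -> S b -> S (a - b)) ->
        (forall a, relator a -> S a) -> S g >].

Lemma relation_zmod_closed : zmod_closed relation_pred.
Proof.
split=> [|g h /asboolP hg /asboolP hh]; apply/asboolP => S S0 SB Sr //.
exact: (SB _ _ (hg _ S0 SB Sr) (hh _ S0 SB Sr)).
Qed.
HB.instance Definition _ := GRing.isZmodClosed.Build {freeg triple / int}
  relation_pred relation_zmod_closed.

Definition Kch : zmodType := Quotient.quot relation_pred.

Definition Kclass (t : triple) : Kch :=
  \pi_(Quotient.quot relation_pred) (gen t).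

Definition ch_hat_triple (t : triple) : preform (M := M) :=
  ch (tconn t) - dmod (tform t).

(* The morphism induced by [ch_hat_triple] on the quotient, computed on a
   representative. *)
Definition ch_hat (x : Kch) : preform (M := M) :=
  let g : {freeg triple / int} := repr x in
  \sum_(t <- dom g) ch_hat_triple t *~ coeff t g.

Definition MK0 : set Kch := [set x | exists m : int, ch_hat x = int_form m].

(* The value of B on a triple, for a given adjoint transpose [Dstar] of its
   connection. *)
Definition Bfrak (t : triple) (Dstar : preconnection (tbundle t)) :
    oform_mod (M := M) :=
  ch_tilde Dstar (tconn t) - tform t + conj_mod (tform t).
End KTheory.
Arguments tconn {R n M} t.
Arguments Bfrak {R n M} t Dstar.
Arguments triple {R n} M.
Arguments Kch {R n} M.
Arguments oform_mod {R n} M.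

(* Main.v *)
From HB Require Import structures.
From mathcomp Require Import all_boot all_order all_algebra.
From mathcomp Require Import all_classical all_reals all_analysis.
From mathcomp Require Import complex ring lra.
From mathcomp.multinomials Require Import freeg.
Require Import Defs.
Set Implicit Arguments.
Unset Strict Implicit.
Unset Printing Implicit Defensive.
Import Order.TTheory GRing.Theory Num.Theory numFieldNormedType.Exports.
Local Open Scope classical_set_scope.
Local Open Scope ring_scope.
Local Open Scope complex_scope.
Local Open Scope quotient_scope.

(** Forms are functions on lists of vector fields. On such functions the wedge product and
    the exterior derivative satisfy the recursions [i_X (u v) = (i_X u) v + (-1)^|u| u (i_X v)]
    and [i_X d = L_X - d i_X], from which the identities of Chern-Weil theory follow by
    induction on the list of arguments.

    Everything rests on the variation formula: along a path [A + th_s] of connections with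
    curvature [F_s], the difference of the transgressions from [A] to the two ends is
    [c \int Tr (th'_s exp (c F_s)) ds] modulo an exact form. For affine paths this is the
    cocycle relation. For the path [g_s^-1 D g_s] the integrand is exact, so the transgression
    from [D] to [g^-1 D g] is exact when [g_s = 1 + s (g - 1)] stays invertible. The adjoints
    of [D] for two metrics are related by such a [g], because it is positive; hence the class
    of the transgression from [D*] to [D] does not depend on the metric. Differentiation under
    the integral sign is elementary since the families are locally rational in [s].

    Finally the conjugate of the transgression from [D0] to [D1] is the transgression from
    [D0*] to [D1*]. With the cocycle relation this shows that B kills the relators and is
    opposite to its conjugate. *)

(* Identities of abelian groups, for which [ring] is not available. [abel] identifies atoms
   up to syntactic equality, [abelu] up to unification. *)
Section AbelianReflection.

(** Vector fields act on globally smooth functions only, and forms and connections are tested on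
    global vector fields and sections. Frames, coefficients and denominators exist only locally, so
    they are cut off by bump functions before anything is differentiated.

    The second obstacle is the integral in the transgression, through which vector fields must pass.
    Along an affine path the integrand is polynomial in the parameter, and an exact quadrature
    formula replaces the integral by a finite sum. Along [g_s^-1 D g_s] it is only rational; there
    the algebraic identity for a difference of two inverses takes the place of a theorem on
    differentiation under the integral.

    The segment from 1 to [g] has to stay invertible: for a general automorphism the transgression
    from [D] to [g^-1 D g] represents the odd Chern character of [g] and need not be exact. The
    automorphism that compares two metrics is positive, hence on the safe side.

    Opposition to the conjugate gives an imaginary representative by averaging. On [MK0] the form
    [ch_hat] is an integer constant, hence real, so this representative is closed. *)

Inductive zexpr := ZVar of nat | ZZero | ZOpp of zexpr | ZAdd of zexpr & zexpr.

Fixpoint zeval (V : zmodType) (env : seq V) (e : zexpr) : V :=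
  match e with
  | ZVar i => nth 0 env i
  | ZZero => 0
  | ZOpp a => - zeval env a
  | ZAdd a b => zeval env a + zeval env b
  end.

Fixpoint zcoef (e : zexpr) (i : nat) : int :=
  match e with
  | ZVar j => (i == j)%:R
  | ZZero => 0
  | ZOpp a => - zcoef a i
  | ZAdd a b => zcoef a i + zcoef b i
  end.

Lemma zevalE (V : zmodType) (env : seq V) e :
  zeval env e = \sum_(i < size env) env`_i *~ zcoef e i.
Proof.
elim: e => [j||a IHa|a IHa b IHb] /=.
- have [lj|lj] := ltnP j (size env).
    rewrite (bigD1 (Ordinal lj)) //= eqxx mulr1z big1 ?addr0 // => i ij.
    by case: eqP => [E|_] //; case/eqP: ij; apply/val_inj.
  rewrite nth_default // big1 // => i _; case: eqP => [E|_] //.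
  by move: lj; rewrite -E leqNgt ltn_ord.
- by rewrite big1.
- by rewrite IHa -sumrN; apply: eq_bigr => i _; rewrite mulrNz.
- by rewrite IHa IHb -big_split; apply: eq_bigr => i _; rewrite mulrzDr.
Qed.

(** Comparing integer coefficients is a computation on closed terms, so the tactics below discharge
    the hypothesis by [isT]. *)
Lemma zeval_eq (V : zmodType) (env : seq V) a b :
  all (fun i => zcoef a i == zcoef b i) (iota 0 (size env)) ->
  zeval env a = zeval env b.
Proof.
move=> /allP h; rewrite !zevalE; apply: eq_bigr => i _.
by rewrite (eqP (h i _)) // mem_iota /= ltn_ord.
Qed.

End AbelianReflection.

(** The inner matches run the tactic [cmp] only for its success or failure while a term is being
    built; a failure backtracks to the next branch. *)
Ltac zmem cmp x l :=
  lazymatch l with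
  | nil => constr:(false)
  | cons ?y ?l' => match constr:(Set) with
      | _ => let _ := match constr:(Set) with _ => cmp x y end in constr:(true)
      | _ => zmem cmp x l' end
  end.
Ltac zatoms cmp t l :=
  lazymatch t with
  | GRing.add ?a ?b => let l1 := zatoms cmp a l in zatoms cmp b l1
  | GRing.opp ?a => zatoms cmp a l
  | GRing.zero => l
  | _ => let m := zmem cmp t l in
         lazymatch m with true => l | false => constr:(cons t l) end
  end.
Ltac zindex cmp x l :=
  lazymatch l with
  | cons ?y ?l' => match constr:(Set) with
      | _ => let _ := match constr:(Set) with _ => cmp x y end in constr:(O)
      | _ => let n := zindex cmp x l' in constr:(S n) end
  end.
Ltac zreify cmp t l :=
  lazymatch t with
  | GRing.add ?a ?b => let a' := zreify cmp a l in let b' := zreify cmp b l in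
      constr:(ZAdd a' b')
  | GRing.opp ?a => let a' := zreify cmp a l in constr:(ZOpp a')
  | GRing.zero => constr:(ZZero)
  | _ => let n := zindex cmp t l in constr:(ZVar n)
  end.
Ltac abel_with cmp :=
  lazymatch goal with
  | |- @eq ?V ?a ?b =>
    let l1 := zatoms cmp a (@nil V) in let l := zatoms cmp b l1 in
    let ea := zreify cmp a l in let eb := zreify cmp b l in
    exact: (@zeval_eq _ l ea eb isT)
  end.
Ltac abel := abel_with ltac:(fun x y => constr_eq x y).
Ltac abelu := abel_with ltac:(fun x y => unify x y).

Lemma funBE (I : Type) (V : zmodType) (u v : I -> V) x : (u - v) x = u x - v x.
Proof. by []. Qed.
Lemma funNE (I : Type) (V : zmodType) (u : I -> V) x : (- u) x = - u x.
Proof. by []. Qed.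
Lemma funDE (I : Type) (V : zmodType) (u v : I -> V) x : (u + v) x = u x + v x.
Proof. by []. Qed.

(** * Forms as functions on lists *)

Section ListForms.
Variable T : Type.

(** The interior product, and below it the grading involution, which carries the signs of graded
    algebra. *)
Definition iota_ (V : Type) (X : T) (w : seq T -> V) : seq T -> V :=
  fun l => w (X :: l).

Definition eps (V : zmodType) (w : seq T -> V) : seq T -> V :=
  fun l => if odd (size l) then - w l else w l.

Definition parity (V : zmodType) (b : bool) (w : seq T -> V) :=
  forall l, odd (size l) != b -> w l = 0.

Section Product.
Variables (U V W : zmodType) (phi : U -> V -> W).

(** The wedge product: the first argument goes to one of the two factors. The pairing [phi] is
    arbitrary so that the same lemmas serve matrix products, products in reverse order and traces of
    products. *)
Fixpoint bmul (l : seq T) (u : seq T -> U) (v : seq T -> V) : W :=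
  if l is X :: l' then bmul l' (iota_ X u) v + bmul l' (eps u) (iota_ X v)
  else phi (u [::]) (v [::]).

Lemma bmul_eq l u u' v v' :
  (forall k, (size k <= size l)%N -> u k = u' k) ->
  (forall k, (size k <= size l)%N -> v k = v' k) ->
  bmul l u v = bmul l u' v'.
Proof.
elim: l u u' v v' => [|X l IH] u u' v v' hu hv /=; first by rewrite hu ?hv.
congr (_ + _); apply: IH => k hk; rewrite /iota_ ?/eps.
- by apply: hu.
- by apply: hv; apply: leqW.
- by rewrite hu //; apply: leqW.
- by apply: hv.
Qed.

Hypothesis phiBl : forall v, {morph phi^~ v : a b / a - b}.
Hypothesis phiBr : forall u, {morph phi u : a b / a - b}.

Lemma bmulBl l u u' v : bmul l (u - u') v = bmul l u v - bmul l u' v.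
Proof.
elim: l u u' v => [|X l IH] u u' v /=; first exact: phiBl.
have -> : eps (u - u') = eps u - eps u'.
  by apply/funext => k; rewrite /eps !funBE; case: ifP => _ //; abel.
by rewrite !IH opprD addrACA.
Qed.

Lemma bmulBr l u v v' : bmul l u (v - v') = bmul l u v - bmul l u v'.
Proof.
elim: l u v v' => [|X l IH] u v v' /=; first exact: phiBr.
by rewrite !IH opprD addrACA.
Qed.

Lemma bmul0l l v : bmul l 0 v = 0.
Proof. by have := bmulBl l 0 0 v; rewrite !subrr. Qed.

Lemma bmul0r l u : bmul l u 0 = 0.
Proof. by have := bmulBr l u 0 0; rewrite !subrr. Qed.

Lemma bmulNl l u v : bmul l (- u) v = - bmul l u v.
Proof. by rewrite -[- u]sub0r bmulBl bmul0l sub0r. Qed.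

Lemma bmulNr l u v : bmul l u (- v) = - bmul l u v.
Proof. by rewrite -[- v]sub0r bmulBr bmul0r sub0r. Qed.

Lemma bmulDl l u u' v : bmul l (u + u') v = bmul l u v + bmul l u' v.
Proof. by rewrite -{1}(opprK u') bmulBl bmulNl opprK. Qed.

Lemma bmulDr l u v v' : bmul l u (v + v') = bmul l u v + bmul l u v'.
Proof. by rewrite -{1}(opprK v') bmulBr bmulNr opprK. Qed.

End Product.

(** The recursion alters the left factor only by contraction and sign, and the right one only by
    contraction; hence [f] has to respect opposites and [h] sums, while [g] enters through [phi]
    alone. *)
Lemma bmul_map (U V W U' V' W' : zmodType) (phi : U -> V -> W)
    (psi : U' -> V' -> W') (f : U -> U') (g : V -> V') (h : W -> W') :
  (forall a b, h (a + b) = h a + h b) ->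
  (forall a, f (- a) = - f a) ->
  (forall a b, h (phi a b) = psi (f a) (g b)) ->
  forall l u v, h (bmul phi l u v) = bmul psi l (f \o u) (g \o v).
Proof.
move=> hD fN hphi; elim=> [|X l IH] u v /=; first exact: hphi.
rewrite hD !IH; congr (_ + bmul _ _ _ _); apply/funext => k /=.
by rewrite /eps /=; case: ifP => _.
Qed.

Section Parity.
Variables (U V : zmodType).
Implicit Types u : seq T -> U.

Lemma eps_odd u : parity true u -> eps u = - u.
Proof.
move=> hu; apply/funext => k; rewrite /eps; case: ifP => // ok.
by rewrite funNE hu ?oppr0 // ok.
Qed.

Lemma eps_even u : parity false u -> eps u = u.
Proof.
move=> hu; apply/funext => k; rewrite /eps; case: ifP => // ok.
by rewrite hu ?oppr0 // ok.
Qed.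

Lemma parity_iota b u X : parity b u -> parity (~~ b) (iota_ X u).
Proof. by move=> hu l hl; apply: hu => /=; case: (odd _) b hl => -[]. Qed.

Lemma parity_eps b u : parity b u -> parity b (eps u).
Proof. by move=> hu l hl; rewrite /eps hu // oppr0 if_same. Qed.

Lemma eps_iota u X : iota_ X (eps u) = - eps (iota_ X u).
Proof.
apply/funext => k; rewrite funNE /eps /iota_ /=.
by case: (odd _) => /=; abel.
Qed.

Lemma epsK u : eps (eps u) = u.
Proof. by apply/funext => k; rewrite /eps; case: (odd _); abel. Qed.

End Parity.

Definition sg (V : zmodType) (b : bool) (v : V) := if b then - v else v.

(** Graded commutativity: the recursion yields the same two terms in the opposite order, and for
    factors of pure parity each [eps] is a global sign. *)
Lemma bmul_flip (U V W : zmodType) (phi : U -> V -> W) :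
  (forall v, {morph phi^~ v : a b / a - b}) ->
  (forall u, {morph phi u : a b / a - b}) ->
  forall l a b u v, parity a u -> parity b v ->
  bmul phi l u v = sg (a && b) (bmul (fun v u => phi u v) l v u).
Proof.
move=> pl pr; elim=> [|X l IH] a b u v hu hv /=.
  case: a b hu hv => [] [] hu hv //=.
  by rewrite hu //; have := pl (v [::]) 0 0; rewrite !subrr => ->; rewrite oppr0.
rewrite (IH (~~ a) b) //; last exact: parity_iota.
have pl' u' : {morph (fun v u => phi u v)^~ u' : a b / a - b} by exact: pr.
have pr' v' : {morph (fun v u => phi u v) v' : a b / a - b} by exact: pl.
rewrite (IH a (~~ b)); [| exact: parity_eps| exact: parity_iota].
rewrite addrC; case: a b hu hv => [] [] hu hv /=.
- by rewrite (eps_odd hu) (eps_odd hv) !(bmulNl, bmulNr) // opprD opprK.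
- by rewrite (eps_odd hu) (eps_even hv) !(bmulNl, bmulNr) // opprK.
- by rewrite (eps_even hu) (eps_odd hv) !(bmulNl, bmulNr).
- by rewrite (eps_even hu) (eps_even hv).
Qed.

End ListForms.

(** * Lie derivative and exterior derivative on functions of lists *)

Section LieDerivative.
Variables (T : Type) (br : T -> T -> T).
Section Def.
Variables (V : zmodType) (act : T -> V -> V).

(** The recursion expresses [[L_X, i_Y] = i_[X,Y]]; arguments never have to be deleted from the
    middle of a list. *)
Fixpoint lie (X : T) (w : seq T -> V) (l : seq T) : V :=
  if l is Y :: l' then lie X (iota_ Y w) l' - w (br X Y :: l')
  else act X (w [::]).

Fixpoint dd (w : seq T -> V) (l : seq T) : V :=
  if l is X :: l' then lie X w l' - dd (iota_ X w) l' else 0.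

Lemma lie_eq X w w' l : (forall k, size k = size l -> w k = w' k) ->
  lie X w l = lie X w' l.
Proof.
elim: l w w' => [|Y l IH] w w' h /=; first by rewrite h.
by rewrite h //; congr (_ - _); apply: IH => k hk; apply: h => /=; rewrite hk.
Qed.

(** Only the values in one degree matter. A form given by a sum whose range depends on the number of
    arguments can thus be replaced by a fixed truncation before it is differentiated. *)
Lemma dd_eq w w' l : (forall k, size l = (size k).+1 -> w k = w' k) ->
  dd w l = dd w' l.
Proof.
elim: l w w' => [|X l IH] w w' h //=; congr (_ - _).
  by apply: lie_eq => k hk; apply: h => /=; rewrite hk.
by apply: IH => k hk; apply: h => /=; rewrite hk.
Qed.

Hypothesis actB : forall X, {morph act X : a b / a - b}.

Lemma lieB X w w' l : lie X (w - w') l = lie X w l - lie X w' l.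
Proof.
elim: l w w' => [|Y l IH] w w' /=; first exact: actB.
have -> : iota_ Y (w - w') = iota_ Y w - iota_ Y w' by [].
by rewrite IH funBE; abel.
Qed.

Lemma ddB w w' l : dd (w - w') l = dd w l - dd w' l.
Proof.
elim: l w w' => [|X l IH] w w' /=; first by rewrite subrr.
have -> : iota_ X (w - w') = iota_ X w - iota_ X w' by [].
by rewrite IH lieB; abel.
Qed.

Lemma dd0 l : dd 0 l = 0.
Proof. by have := ddB 0 0 l; rewrite !subrr. Qed.

Lemma lie0 X l : lie X 0 l = 0.
Proof. by have := lieB X 0 0 l; rewrite !subrr. Qed.

Lemma lieN X w l : lie X (- w) l = - lie X w l.
Proof. by rewrite -[- w]sub0r lieB lie0 sub0r. Qed.

Lemma lieD X w w' l : lie X (w + w') l = lie X w l + lie X w' l.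
Proof. by rewrite -{1}(opprK w') lieB lieN opprK. Qed.

Lemma ddN w l : dd (- w) l = - dd w l.
Proof. by rewrite -[- w]sub0r ddB dd0 sub0r. Qed.

Lemma ddD w w' l : dd (w + w') l = dd w l + dd w' l.
Proof. by rewrite -{1}(opprK w') ddB ddN opprK. Qed.

Lemma dd_sum (I : Type) (r : seq I) (P : pred I) (F : I -> seq T -> V) l :
  dd (\sum_(i <- r | P i) F i) l = \sum_(i <- r | P i) dd (F i) l.
Proof.
elim: r => [|i r IH]; first by rewrite !big_nil dd0.
by rewrite !big_cons; case: (P i); rewrite ?ddD IH.
Qed.

Lemma lie_eps X w l : lie X (eps w) l = eps (lie X w) l.
Proof.
elim: l w => [|Y l IH] w //=; rewrite eps_iota lieN IH /eps /=.
by case: (odd _) => /=; rewrite ?opprK ?opprB // addrC.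
Qed.

Lemma dd_eps w l : dd (eps w) l = - eps (dd w) l.
Proof.
elim: l w => [|X l IH] w /=; first by rewrite /eps /= oppr0.
rewrite lie_eps eps_iota ddN IH opprK /eps /=.
by case: (odd _) => /=; rewrite ?opprK ?opprB // addrC.
Qed.

Lemma dd_supp n w : (forall l, size l != n -> w l = 0) ->
  forall l, size l != n.+1 -> dd w l = 0.
Proof.
move=> hw l hl; rewrite -[RHS](dd0 l); apply: dd_eq => k hk.
by apply: hw; move: hl; rewrite hk eqSS.
Qed.

Lemma parity_dd b w : parity b w -> parity (~~ b) (dd w).
Proof.
move=> hw l hl; rewrite -[RHS](dd0 l); apply: dd_eq => k hk.
by apply: hw; move: hl; rewrite hk /=; case: (odd _) b => -[].
Qed.

(** The Jacobi identity as seen by [w] in each argument: the type of arguments carries no addition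
    in which the identity itself could be stated. *)
Definition lie_linear (w : seq T -> V) := forall l1 l2 X Y Z,
  w (l1 ++ br X (br Y Z) :: l2) =
  w (l1 ++ br (br X Y) Z :: l2) + w (l1 ++ br Y (br X Z) :: l2).

Hypothesis act_br : forall X Y v, act (br X Y) v = act X (act Y v) - act Y (act X v).

Lemma lie_br X Y w l : lie_linear w ->
  lie (br X Y) w l = lie X (lie Y w) l - lie Y (lie X w) l.
Proof.
elim: l w => [|Z l IH] w hw /=; first exact: act_br.
have hw' : lie_linear (iota_ Z w) by move=> l1 l2; exact: hw (Z :: l1) l2.
have E A : iota_ Z (lie A w) = lie A (iota_ Z w) - (fun k => w (br A Z :: k)).
  by apply/funext.
rewrite !E !lieB IH // (_ : (fun k => w (br Y Z :: k)) = iota_ (br Y Z) w) //.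
have := hw [::] l X Y Z; rewrite /= => ->.
rewrite /iota_ (_ : (fun k => w (br X Z :: k)) = iota_ (br X Z) w) //.
abel.
Qed.

End Def.
End LieDerivative.

Section LieTheory.
Variables (T : Type) (br : T -> T -> T).

(** By Cartan's formula the contraction of [d d w] with [X] consists of [[L_X, d] w] and
    [d d i_X w]. The first vanishes by [cm], which rests on [lie_br], the second by induction on the
    list. *)
Lemma dd_dd (V : zmodType) (act : T -> V -> V) :
  (forall X, {morph act X : a b / a - b}) ->
  (forall X Y v, act (br X Y) v = act X (act Y v) - act Y (act X v)) ->
  forall l w, lie_linear br w -> dd br act (dd br act w) l = 0.
Proof.
move=> aB abr.
have lind w X : lie_linear br w -> lie_linear br (iota_ X w).
  by move=> hw l1 l2; exact: hw (X :: l1) l2.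
have cm l X w : lie_linear br w ->
    lie br act X (dd br act w) l = dd br act (lie br act X w) l.
  elim: l w => [|Y l IH] w hw /=.
    by have := aB X 0 0; rewrite !subrr.
  have -> : iota_ Y (dd br act w) = lie br act Y w - dd br act (iota_ Y w) by [].
  have -> : iota_ Y (lie br act X w) = lie br act X (iota_ Y w) - iota_ (br X Y) w by [].
  rewrite lieB // ddB // (IH _ (lind _ _ _ hw)) lie_br //.
  by abel.
elim=> [|X l IH] w hw //=.
have -> : iota_ X (dd br act w) = lie br act X w - dd br act (iota_ X w) by [].
by rewrite cm // ddB // IH ?subr0 ?subrr //; exact: lind.
Qed.

Section Leibniz.
Variables (U V W : zmodType) (phi : U -> V -> W).
Variables (aU : T -> U -> U) (aV : T -> V -> V) (aW : T -> W -> W).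
Hypothesis phiBl : forall v, {morph phi^~ v : a b / a - b}.
Hypothesis phiBr : forall u, {morph phi u : a b / a - b}.
Hypothesis aUB : forall X, {morph aU X : a b / a - b}.
Hypothesis aVB : forall X, {morph aV X : a b / a - b}.
Hypothesis aWB : forall X, {morph aW X : a b / a - b}.
Hypothesis leib : forall X u v, aW X (phi u v) = phi (aU X u) v + phi u (aV X v).

Let lm (u : seq T -> U) (v : seq T -> V) : seq T -> W := fun l => bmul phi l u v.

Lemma lie_bmul X l u v :
  lie br aW X (lm u v) l = bmul phi l (lie br aU X u) v + bmul phi l u (lie br aV X v).
Proof.
elim: l u v => [|Y l IH] u v /=; first exact: leib.
have -> : iota_ Y (lm u v) = lm (iota_ Y u) v + lm (eps u) (iota_ Y v) by [].
have E1 : iota_ Y (lie br aU X u) = lie br aU X (iota_ Y u) - iota_ (br X Y) u by [].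
have E2 : iota_ Y (lie br aV X v) = lie br aV X (iota_ Y v) - iota_ (br X Y) v by [].
have E3 : eps (lie br aU X u) = lie br aU X (eps u).
  by apply/funext => k; rewrite lie_eps.
by rewrite lieD // !IH E1 E2 E3 /lm /= bmulBl // bmulBr //; abel.
Qed.

(** Cartan's formula reduces the contraction of both sides to the Leibniz rule for the Lie
    derivative and to the induction hypothesis; [eps] anticommutes with contraction and with [d]. *)
Lemma dd_bmul l u v :
  dd br aW (lm u v) l = bmul phi l (dd br aU u) v + bmul phi l (eps u) (dd br aV v).
Proof.
elim: l u v => [|X l IH] u v /=.
  have p0 a : phi 0 a = 0 by have := phiBl a 0 0; rewrite !subrr.
  have p0r a : phi a 0 = 0 by have := phiBr a 0 0; rewrite !subrr.
  by rewrite p0 p0r addr0.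
have -> : iota_ X (lm u v) = lm (iota_ X u) v + lm (eps u) (iota_ X v) by [].
have E1 : iota_ X (dd br aU u) = lie br aU X u - dd br aU (iota_ X u) by [].
have E2 : iota_ X (dd br aV v) = lie br aV X v - dd br aV (iota_ X v) by [].
have E3 : dd br aU (eps u) = - eps (dd br aU u).
  by apply/funext => k; rewrite dd_eps.
rewrite lie_bmul ddD // !IH E1 E2 E3 epsK eps_iota.
by rewrite !(bmulBl, bmulBr, bmulNl) //; abel.
Qed.

End Leibniz.

Lemma dd_map (V W : zmodType) (aV : T -> V -> V) (aW : T -> W -> W) (f : V -> W) :
  {morph f : a b / a - b} -> (forall X v, f (aV X v) = aW X (f v)) ->
  forall l w, f (dd br aV w l) = dd br aW (f \o w) l.
Proof.
move=> fB fa; have f0 : f 0 = 0 by have := fB 0 0; rewrite !subrr.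
have fl X l w : f (lie br aV X w l) = lie br aW X (f \o w) l.
  by elim: l w => [|Y l IH] w /=; rewrite ?fB ?IH ?fa.
by elim=> [|X l IH] w /=; rewrite ?f0 // fB fl IH.
Qed.

Definition form2 (V : zmodType) (K : T -> T -> V) : seq T -> V :=
  fun l => if l is [:: X; Y] then K X Y else 0.
Definition form1 (V : zmodType) (K : T -> V) : seq T -> V :=
  fun l => if l is [:: X] then K X else 0.

(** A form concentrated in degree 2 has its differential in degree 3, by [dd_supp]; the hypothesis
    is the shape in which the Bianchi identity will be supplied. *)
Lemma dd_form2 (V : zmodType) (act : T -> V -> V) (K : T -> T -> V) :
  (forall X, {morph act X : a b / a - b}) ->
  (forall X Y Z, act X (K Y Z) - act Y (K X Z) + act Z (K X Y)
     - K (br X Y) Z - K Y (br X Z) + K X (br Y Z) = 0) ->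
  dd br act (form2 K) = 0.
Proof.
move=> aB hK; apply/funext => l.
have [hl|hl] := eqVneq (size l) 3; last first.
  apply: (@dd_supp _ _ _ _ aB 2) => // k.
  by case: k => [|? [|? [|? ?]]].
case: l hl => [|X [|Y [|Z [|? ?]]]] //= _; rewrite /iota_ /=.
by rewrite -[RHS](hK X Y Z) subr0; abel.
Qed.

Lemma dd_form1 (V : zmodType) (act : T -> V -> V) (K : T -> V) :
  (forall X, {morph act X : a b / a - b}) ->
  dd br act (form1 K) = form2 (fun X Y => act X (K Y) - act Y (K X) - K (br X Y)).
Proof.
move=> aB; apply/funext => l.
have [hl|hl] := eqVneq (size l) 2; last first.
  transitivity (0 : V); last by case: l hl => [|? [|? [|? ?]]].
  apply: (@dd_supp _ _ _ _ aB 1) => // k.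
  by case: k => [|? [|? ?]].
by case: l hl => [|X [|Y [|Z l]]] //= _; rewrite /iota_ /=; abel.
Qed.

Lemma parity_form1 (V : zmodType) (K : T -> V) : parity true (form1 K).
Proof. by case=> [|? [|? ?]]. Qed.
Lemma parity_form2 (V : zmodType) (K : T -> T -> V) : parity false (form2 K).
Proof. by case=> [|? [|? [|? ?]]]. Qed.

End LieTheory.

(** * The ring of forms with values in a ring *)

Section LformRing.
Variables (T : Type) (A : pzRingType).

(** All functions on lists, alternating or not, form a ring under the wedge product, so that powers
    of the curvature and identities between products become ordinary ring algebra. *)
Definition lform : Type := seq T -> A.
HB.instance Definition _ := GRing.Zmodule.on lform.

Implicit Types u v w : lform.
Definition lone : lform := fun l => if l is [::] then 1 else 0.
Definition lmul u v : lform := fun l => bmul (fun a b : A => a * b) l u v.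

Let mBl (v : A) : {morph (fun u : A => u * v) : a b / a - b}.
Proof. by move=> a b; rewrite mulrBl. Qed.
Let mBr (u : A) : {morph (fun v : A => u * v) : a b / a - b}.
Proof. by move=> a b; rewrite mulrBr. Qed.

Lemma eps_lmul u v : eps (lmul u v) = lmul (eps u) (eps v).
Proof.
apply/funext => l; rewrite /lmul; elim: l u v => [|X l IH] u v //=.
rewrite !eps_iota bmulNl // bmulNr // -(IH (iota_ X u)) -(IH (eps u)).
set e := eps u; rewrite /eps /=; case: (odd _) => /=. by abelu.
by abelu.
Qed.

Lemma lmulA : associative lmul.
Proof.
move=> u v w; apply/funext => l; rewrite {1 3}/lmul.
elim: l u v w => [|X l IH] u v w /=; first by rewrite /lmul /= mulrA.
have E a b : iota_ X (lmul a b) = lmul (iota_ X a) b + lmul (eps a) (iota_ X b) by [].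
rewrite !E bmulDl // bmulDr // !IH eps_lmul; abel.
Qed.

Lemma lone_supp (X : T) : iota_ X lone = 0. Proof. by []. Qed.

Lemma lmul1l : left_id lone lmul.
Proof.
move=> u; apply/funext => l; rewrite /lmul; elim: l u => [|X l IH] u /=.
  exact: mul1r.
rewrite lone_supp bmul0l // add0r eps_even ?IH //.
by case.
Qed.

Lemma lmul1r : right_id lone lmul.
Proof.
move=> u; apply/funext => l; rewrite /lmul; elim: l u => [|X l IH] u /=.
  exact: mulr1.
by rewrite lone_supp bmul0r // addr0 IH.
Qed.

Lemma lmulDl : left_distributive lmul +%R.
Proof. by move=> u v w; apply/funext => l; rewrite /lmul bmulDl. Qed.
Lemma lmulDr : right_distributive lmul +%R.
Proof. by move=> u v w; apply/funext => l; rewrite /lmul bmulDr. Qed.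

HB.instance Definition _ := GRing.Zmodule_isPzRing.Build lform
  lmulA lmul1l lmul1r lmulDl lmulDr.

Lemma lformME u v l : (u * v) l = bmul (fun a b : A => a * b) l u v.
Proof. by []. Qed.

(** Graded commutativity applied to the symmetric pairing [tr (a * b)]. *)
Lemma lmul_cyc (C : zmodType) (tr : A -> C) a b u v :
  {morph tr : x y / x - y} -> (forall x y, tr (x * y) = tr (y * x)) ->
  parity a u -> parity b v ->
  forall l, tr ((u * v) l) = sg (a && b) (tr ((v * u) l)).
Proof.
move=> trB trC hu hv l; rewrite !lformME.
have tr0 : tr 0 = 0 by have := trB 0 0; rewrite !subrr.
have trN x : tr (- x) = - tr x by rewrite -[- x]sub0r trB tr0 sub0r.
have trD x y : tr (x + y) = tr x + tr y by rewrite -[in LHS](opprK y) trB trN opprK.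
have E (phi : A -> A -> A) x y :
    bmul (fun a b => tr (phi a b)) l x y = tr (bmul phi l x y).
  by rewrite (@bmul_map _ _ _ _ _ _ _ phi (fun a b => tr (phi a b)) id id tr).
have := @bmul_flip T A A C (fun a b => tr (a * b)) _ _ l a b u v hu hv.
rewrite E => ->; last 2 first.
- by move=> y x x'; rewrite mulrBl trB.
- by move=> y x x'; rewrite mulrBr trB.
rewrite -E; congr (sg _ (bmul _ _ _ _)).
by apply/funext => x; apply/funext => y; rewrite trC.
Qed.

Lemma lmul_parity a b u v : parity a u -> parity b v -> parity (a (+) b) (u * v).
Proof.
move=> hu hv l; rewrite lformME; elim: l a b u v hu hv => [|X l IH] a b u v hu hv /=.
  case: a hu => hu h; first by rewrite hu ?mul0r.
  by case: b hv h => hv h //; rewrite hv ?mulr0.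
move=> h; rewrite (IH (~~ a) b) ?(IH a (~~ b)) ?addr0 //.
- exact: parity_eps.
- exact: parity_iota.
- by move: h; case: (odd _) a b {hu hv} => -[] [].
- exact: parity_iota.
- by move: h; case: (odd _) a b {hu hv} => -[] [].
Qed.

Lemma parity_exp u k : parity false u -> parity false (u ^+ k).
Proof.
move=> hu; elim: k => [|k IH]; first by case.
by rewrite exprS; exact: (lmul_parity hu IH).
Qed.

Lemma lmul_eq u u' v v' l :
  (forall k, (size k <= size l)%N -> u k = u' k) ->
  (forall k, (size k <= size l)%N -> v k = v' k) -> (u * v) l = (u' * v') l.
Proof. exact: bmul_eq. Qed.

(** Without a component of degree 0, every factor consumes at least one argument. The exponential of
    a curvature is therefore a finite sum on each list. *)
Lemma lexp_supp u k l : u [::] = 0 -> (size l < k)%N -> (u ^+ k) l = 0.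
Proof.
move=> u0; elim: k l => [//|k IH] l lk; rewrite exprS lformME.
have vs l' v w : v [::] = 0 -> (forall j, (size j < size l')%N -> w j = 0) ->
    bmul (fun a b : A => a * b) l' v w = 0.
  elim: l' v w => [|X l' IH'] v w v0 w0 /=; first by rewrite v0 mul0r.
  rewrite (@bmul_eq _ _ _ _ _ _ _ (iota_ X v) w 0) // ?bmul0r ?add0r //.
  by apply: IH'; [rewrite /eps /= v0 | move=> j jl; exact: w0].
by apply: vs => // j jl; apply: IH; apply: leq_trans jl _.
Qed.

End LformRing.
Arguments lform : clear implicits.

Lemma ord_le_pred k (i : 'I_k) : (i <= k.-1)%N.
Proof. by case: k i => [[]//|k i]; rewrite -ltnS. Qed.

(** * Traces of powers of a closed even form *)

Section ChernWeil.
Variables (T : Type) (br : T -> T -> T) (A : pzRingType) (C : zmodType).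
Variables (aA : T -> A -> A) (aC : T -> C -> C) (tr : A -> C).
Hypothesis aAB : forall X, {morph aA X : a b / a - b}.
Hypothesis aAM : forall X a b, aA X (a * b) = aA X a * b + a * aA X b.
Hypothesis trB : {morph tr : a b / a - b}.
Hypothesis trC : forall a b, tr (a * b) = tr (b * a).
Hypothesis tra : forall X a, tr (aA X a) = aC X (tr a).

Local Notation L := (lform T A).
Local Notation d := (dd br aA : L -> L).
Implicit Types u v w F th et : L.

Let mBl (v : A) : {morph (fun u : A => u * v) : a b / a - b}.
Proof. by move=> a b; rewrite mulrBl. Qed.
Let mBr (u : A) : {morph (fun v : A => u * v) : a b / a - b}.
Proof. by move=> a b; rewrite mulrBr. Qed.

Lemma dd_lmul u v : d (u * v) = d u * v + (eps u : L) * d v.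
Proof.
apply/funext => l; rewrite funDE !lformME.
exact: (@dd_bmul T br A A A (fun a b => a * b) aA aA aA mBl mBr _ aAB aAM l u v).
Qed.

Lemma dd_lone : d 1 = 0.
Proof.
have a1 X : aA X 1 = 0.
  by have := aAM X 1 1; rewrite !mulr1 mul1r => /esym/eqP; rewrite addrC -subr_eq0 addrK => /eqP.
apply/funext => -[//|X l] /=; rewrite dd0 // subr0.
by case: l => [|Y l] /=; rewrite ?a1 // lie0 // subrr.
Qed.

Lemma dd_lexp F k : parity false F -> d F = 0 -> d (F ^+ k) = 0.
Proof.
move=> Fe dF; elim: k => [|k IH]; first by rewrite expr0 dd_lone.
by rewrite exprS dd_lmul dF IH mul0r mulr0 addr0.
Qed.

Lemma dd_tr w : dd br aC (tr \o w) = tr \o d w.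
Proof. by apply/funext => l; rewrite /= (dd_map br trB tra). Qed.

Let tr0 : tr 0 = 0. Proof. by have := trB 0 0; rewrite !subrr. Qed.
Let trN x : tr (- x) = - tr x.
Proof. by rewrite -[- x]sub0r trB tr0 sub0r. Qed.
Let trD x y : tr (x + y) = tr x + tr y.
Proof. by rewrite -[in LHS](opprK y) trB trN opprK. Qed.

Lemma lform_sumE (I : Type) (r : seq I) (P : pred I) (G : I -> L) l :
  (\sum_(i <- r | P i) G i) l = \sum_(i <- r | P i) G i l.
Proof.
elim: r => [|i r IH]; first by rewrite !big_nil.
by rewrite !big_cons; case: (P i); rewrite -IH.
Qed.

Lemma tr_sum (I : Type) (r : seq I) (P : pred I) (G : I -> A) :
  tr (\sum_(i <- r | P i) G i) = \sum_(i <- r | P i) tr (G i).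
Proof. by rewrite (big_morph tr trD tr0). Qed.

(** A sign arises only between two odd forms, so an even form commutes under the trace with the even
    and the odd part of any form. *)
Lemma tr_lmul_even u v l : parity false u -> tr ((u * v) l) = tr ((v * u) l).
Proof.
move=> hu.
pose v0 : L := fun k => if odd (size k) then 0 else v k.
pose v1 : L := fun k => if odd (size k) then v k else 0.
have -> : v = v0 + v1.
  by apply/funext => k; rewrite funDE /v0 /v1; case: ifP => _; rewrite ?addr0 ?add0r.
have p0 : parity false v0 by move=> k; rewrite /v0; case: (odd _).
have p1 : parity true v1 by move=> k; rewrite /v1; case: (odd _).
rewrite mulrDr mulrDl !funDE !trD.
by rewrite (lmul_cyc trB trC hu p0) (lmul_cyc trB trC hu p1).
Qed.

(** The Bianchi identity makes the powers of the curvature closed, and only [th] gets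
    differentiated. *)
Lemma dd_tr_linear th F k : parity false F -> d F = 0 ->
  dd br aC (tr \o (th * F ^+ k)) = tr \o (d th * F ^+ k).
Proof. by move=> Fe dF; rewrite dd_tr dd_lmul dd_lexp // mulr0 addr0. Qed.

Lemma tr_power_rule F w k l : parity false F ->
  tr ((\sum_(i < k) F ^+ i * w * F ^+ (k.-1 - i)) l) = tr ((w * F ^+ k.-1) l) *+ k.
Proof.
move=> Fe; rewrite lform_sumE tr_sum.
rewrite -[k in RHS]card_ord -[RHS]sumr_const; apply: eq_bigr => i _.
rewrite -mulrA tr_lmul_even; last exact: parity_exp.
by rewrite -mulrA -exprD subnK ?ord_le_pred // card_ord.
Qed.

(* The mixed second variation of [tr F ^+ k.+1] is symmetric up to an exact
   form. *)
Lemma dd_tr_bilinear th et F k l : parity false F -> d F = 0 ->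
  parity true th -> parity true et ->
  dd br aC (tr \o (\sum_(i < k) th * F ^+ i * et * F ^+ (k.-1 - i))) l =
  tr ((et * \sum_(i < k) F ^+ i * d th * F ^+ (k.-1 - i)) l) -
  tr ((th * \sum_(i < k) F ^+ i * d et * F ^+ (k.-1 - i)) l).
Proof.
move=> Fe dF tho eto; rewrite dd_tr /=.
have -> : d (\sum_(i < k) th * F ^+ i * et * F ^+ (k.-1 - i)) =
    \sum_(i < k) (d th * F ^+ i * et * F ^+ (k.-1 - i)
                 - th * F ^+ i * d et * F ^+ (k.-1 - i)).
  apply/funext => m; rewrite dd_sum // lform_sumE; apply: eq_bigr => i _.
  rewrite dd_lmul dd_lexp // mulr0 addr0 dd_lmul dd_lmul dd_lexp // mulr0 addr0.
  have -> : eps (th * F ^+ i) = - (th * F ^+ i).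
    by apply: eps_odd; exact: (lmul_parity tho (parity_exp i Fe)).
  by rewrite mulrDl mulNr mulNr.
rewrite sumrB funBE trB; congr (_ - _); last first.
  by rewrite mulr_sumr; congr (tr (_ l)); apply: eq_bigr => i _; rewrite !mulrA.
(* The cyclic move exchanges the two exponents, so the sum is traversed backwards. *)
rewrite mulr_sumr !lform_sumE !tr_sum (reindex_inj rev_ord_inj) /=.
apply: eq_bigr => i _.
have E1 : (k - i.+1 = k.-1 - i)%N by rewrite -subn1 -subnDA add1n.
rewrite E1 subKn ?ord_le_pred // -mulrA tr_lmul_even; last first.
  by apply: (@lmul_parity _ _ false false); [exact: (@parity_dd _ _ _ _ aAB true)|exact: parity_exp].
by rewrite !mulrA.
Qed.

End ChernWeil.

(** * Germs of smooth functions *)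

Section FlatFunction.
Variable R : realType.

(* These functions are the derivatives of [x |-> exp(-1/x)], extended by 0 to
   the negative reals, up to linear combinations. *)
Definition flat (m : nat) (x : R) : R :=
  if 0 < x then x^-1 ^+ m * expR (- x^-1) else 0.

Lemma flat_gt0 m x : 0 < x -> 0 < flat m x.
Proof.
by move=> x0; rewrite /flat x0 mulr_gt0 ?expR_gt0 // exprn_gt0 // invr_gt0.
Qed.

Lemma flat_eq0 m x : x <= 0 -> flat m x = 0.
Proof. by move=> x0; rewrite /flat ltNge x0. Qed.

Lemma flat_ge0 m x : 0 <= flat m x.
Proof. by case: (ltP 0 x) => x0; [exact/ltW/flat_gt0 | rewrite flat_eq0]. Qed.

(** One term of the exponential series, of order [m + 2] at [1 / x], gives a bound quadratic in [x];
    the difference quotients at 0 then tend to 0. *)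
Lemma flat_le m x : `|flat m x| <= (m.+2)`!%:R * x ^+ 2.
Proof.
rewrite ger0_norm ?flat_ge0 //; case: (ltP 0 x) => x0; last first.
  by rewrite flat_eq0 // mulr_ge0 // sqr_ge0.
rewrite /flat x0 expRN; set y := x^-1.
have y0 : 0 < y by rewrite invr_gt0.
have h : y ^+ m.+2 / m.+2`!%:R <= expR y.
  by apply: le_trans (expR_ge1Dxn m.+1 (ltW y0)); rewrite lerDr ler01.
have f0 : 0 < (m.+2)`!%:R :> R by rewrite ltr0n fact_gt0.
have -> : x ^+ 2 = y^-1 ^+ 2 by rewrite invrK.
rewrite [in leRHS]exprVn ler_pdivrMr ?expR_gt0 // mulrAC ler_pdivlMr ?exprn_gt0 //.
by rewrite -exprD addn2 mulrC -ler_pdivrMr // mulrC [leLHS]mulrC.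
Qed.

(** In terms of [y = 1 / x], the derivative of [y ^ m exp(-y)] is
    [(y ^ (m + 2) - m y ^ (m + 1)) exp(-y)]; at 0 the quadratic bound is used. *)
Lemma flat_derive m (x : R) :
  is_derive x (1 : R) (flat m : R -> R) (flat m.+2 x - m%:R * flat m.+1 x).
Proof.
have [x0|x0|->] := ltgtP x 0.
- rewrite !flat_eq0 ?ltW // mulr0 subr0.
  apply: (@near_eq_is_derive R R R (cst 0)).
  by near=> y; rewrite flat_eq0 // ltW //; near: y; exact: lt_nbhsl.
- have dV : is_derive x 1 (fun y : R => y^-1) (- x ^- 2).
    have := @is_deriveV R id x 1 1 (lt0r_neq0 x0) (is_derive_id _ _).
    by rewrite [_ *: _]mulr1.
  have dX : is_derive x 1 (fun y : R => y^-1 ^+ m) (m%:R * x^-1 ^+ m.-1 * - x ^- 2).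
    have -> : (fun y : R => y^-1 ^+ m) = (fun y : R => y^-1) ^+ m.
      by apply/funext => y; rewrite exprfctE.
    apply: is_derive_eq (is_deriveX _ _) _.
    by rewrite -mulr_natl.
  have dE : is_derive x 1 (fun y : R => expR (- y^-1)) (expR (- x^-1) * x ^- 2).
    have dN : is_derive x 1 (fun y : R => - y^-1) (x ^- 2).
      by apply: is_derive_eq (is_deriveN dV) _; rewrite opprK.
    exact: (@is_derive1_comp R expR (fun y => - y^-1)).
  have N : \forall y \near x, y^-1 ^+ m * expR (- y^-1) = flat m y.
    near=> y; rewrite /flat; have -> // : 0 < y; near: y; exact: lt_nbhsr.
  apply: is_derive_eq (near_eq_is_derive N (is_deriveM dX dE)) _.
  rewrite /flat x0 /GRing.scale /= -!exprVn !exprS.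
  by case: m {dX N} => [|m]; rewrite ?exprS /=; ring.
- rewrite !flat_eq0 // mulr0 subr0.
  have c : h^-1 *: (flat m (h *: 1 + 0) - flat m 0) @[h --> 0^'] --> (0 : R).
    apply/cvgr0Pnorm_lt => e e0; near=> h.
    have h0 : h != 0 by near: h; exact: nbhs_dnbhs_neq.
    have f0 : 0 < (m.+2)`!%:R :> R by rewrite ltr0n fact_gt0.
    rewrite (flat_eq0 _ (lexx 0)) subr0 addr0 /GRing.scale /= mulr1 normrM normfV.
    rewrite mulrC ltr_pdivrMr ?normr_gt0 //.
    apply: le_lt_trans (flat_le m h) _.
    rewrite -real_normK ?num_real // expr2 mulrA ltr_pM2r ?normr_gt0 //.
    rewrite mulrC -ltr_pdivlMr //; near: h.
    by apply: dnbhs0_lt; rewrite divr_gt0.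
  by apply: DeriveDef; [apply/cvg_ex; exists 0 | exact/cvg_lim].
Unshelve. all: by end_near. Qed.

End FlatFunction.

Section CkComposition.
Context {R : realType} {n : nat}.
Implicit Types (V : set 'rV[R]_n) (f g : 'rV[R]_n -> R).

(** Reduces directional derivatives to one real variable, where the chain rule is at hand. *)
Lemma is_derive_line f (x v : 'rV[R]_n) (a : R) :
  is_derive x v f a <-> is_derive (0 : R) 1 (fun h : R => f (h *: v + x)) a.
Proof.
have E : (fun h : R => h^-1 *: (f (h *: v + x) - f x)) =
  (fun h : R => h^-1 *: (f ((h *: (1 : R) + 0) *: v + x) - f (0 *: v + x))).
  by apply/funext => h; rewrite addr0 scale0r add0r [_%:A]mulr1.
split=> -[d da]; apply: DeriveDef; move: d da; rewrite /derivable /derive.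
- by rewrite E. - by rewrite E. - by rewrite -E. - by rewrite -E.
Qed.

Lemma is_derive_comp (phi : R -> R) f (x v : 'rV[R]_n) (a b : R) :
  is_derive (f x) 1 phi a -> is_derive x v f b ->
  is_derive x v (phi \o f) (a * b).
Proof.
move=> dphi /is_derive_line df; apply/is_derive_line.
apply: (@is_derive1_comp R phi (fun h : R => f (h *: v + x))).
by rewrite scale0r add0r.
Qed.

(** The induction on [k] is uniform in [m], since each derivative raises the index of [flat]. *)
Lemma Ck_flat k V m f : open V -> Ck k V f -> Ck k V (fun x => flat m (f x)).
Proof.
move=> Vo; elim: k m f => [|k IH] m f /= [fc fd].
all: have c x : V x -> {for x, continuous (fun x => flat m (f x))}.
1,3: move=> Vx; apply: (@continuous_comp _ _ _ f (flat m)); first exact: fc.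
1,2: apply/differentiable_continuous/derivable1_diffP; exact: (@ex_derive _ _ _ _ _ _ _ (flat_derive _ _)).
  by [].
split=> // i; have [fi fk] := fd i.
have D x : V x -> is_derive x (delta_mx 0 i) (fun x => flat m (f x))
    ((flat m.+2 (f x) - m%:R * flat m.+1 (f x)) * 'D_(delta_mx 0 i) f x).
  move=> Vx; apply: (@is_derive_comp (flat m)); first exact: flat_derive.
  exact/derivableP/fi.
split=> [x /D|]; first by move=> h; exact: ex_derive.
have fk0 : Ck k V f by exact: Ck_pred.
apply: (@Ck_eq _ _ k V (fun x => (flat m.+2 (f x) + (- m%:R) * flat m.+1 (f x)) *
    'D_(delta_mx 0 i) f x)) => //.
  by move=> x /D h; rewrite derive_val mulNr.
apply: Ck_mul => //; apply: Ck_add => //; first exact: IH.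
by apply: Ck_mul => //; [exact: Ck_cst | exact: IH].
Qed.

Lemma Ck_inv k V f : open V -> (forall x, V x -> f x != 0) -> Ck k V f ->
  Ck k V (fun x => (f x)^-1).
Proof.
move=> Vo f0; elim: k f f0 => [|k IH] f f0 /= [fc fd].
all: have c x : V x -> {for x, continuous (fun x => (f x)^-1)}.
1,3: by move=> Vx; apply: continuousV; [exact: f0 | exact: fc].
  by [].
split=> // i; have [fi fk] := fd i.
split=> [x Vx|]; first by apply: derivableV; [exact: f0|exact: fi].
have fk0 : Ck k V f by exact: Ck_pred.
apply: (@Ck_eq _ _ k V (fun x => (-1) * ((f x)^-1 * (f x)^-1) *
    'D_(delta_mx 0 i) f x)) => //.
  move=> x Vx; rewrite deriveV ?f0 //; last exact: fi.
  by rewrite /GRing.scale /= mulN1r expr2 invfM.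
by do 2 (apply: Ck_mul => //); [exact: Ck_cst|apply: Ck_mul => //; exact: IH].
Qed.

Lemma Ck_local k V f :
  (forall x, V x -> exists W, [/\ open W, W x & Ck k (V `&` W) f]) -> Ck k V f.
Proof.
elim: k f => [|k IH] f h /=; (split=> [x Vx|//]);
  try by have [W [_ Wx [fc _]]] := h _ Vx; apply: fc.
move=> i; split=> [x Vx|]; first by have [W [_ Wx [_ /(_ i) [fd _]]]] := h _ Vx; apply: fd.
by apply: IH => x Vx; have [W [Wo Wx [_ /(_ i) [_ fk]]]] := h _ Vx; exists W.
Qed.

End CkComposition.

Lemma ReD_ (R : rcfType) (z w : R[i]) : complex.Re (z + w) = complex.Re z + complex.Re w.
Proof. by case: z w => a b [c d]. Qed.
Lemma ImD_ (R : rcfType) (z w : R[i]) : complex.Im (z + w) = complex.Im z + complex.Im w.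
Proof. by case: z w => a b [c d]. Qed.
Lemma ReN_ (R : rcfType) (z : R[i]) : complex.Re (- z) = - complex.Re z.
Proof. by case: z => a b. Qed.
Lemma ImN_ (R : rcfType) (z : R[i]) : complex.Im (- z) = - complex.Im z.
Proof. by case: z => a b. Qed.
Lemma ReM_ (R : rcfType) (z w : R[i]) : complex.Re (z * w) =
  complex.Re z * complex.Re w - complex.Im z * complex.Im w.
Proof. by case: z w => a b [c d]. Qed.
Lemma ImM_ (R : rcfType) (z w : R[i]) : complex.Im (z * w) =
  complex.Re z * complex.Im w + complex.Im z * complex.Re w.
Proof. by case: z w => a b [c d]. Qed.
Lemma ReJ_ (R : rcfType) (z : R[i]) : complex.Re z^* = complex.Re z.
Proof. by case: z => a b. Qed.
Lemma ImJ_ (R : rcfType) (z : R[i]) : complex.Im z^* = - complex.Im z.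
Proof. by case: z => a b. Qed.
Lemma complexP_ (R : rcfType) (z w : R[i]) :
  complex.Re z = complex.Re w -> complex.Im z = complex.Im w -> z = w.
Proof. by case: z w => a b [c d] /= -> ->. Qed.

(** * Smoothness near a point and bump functions *)

Section Germs.
Context {R : realType} {n : nat} {M : manifold R n}.
Implicit Types (U W : set M) (f g : M -> R) (x y : M).

(** A pointwise notion, stable under changes away from [x]; it suits functions that are defined or
    invertible only locally. *)
Definition sm f x := exists W, [/\ open W, W x & smooth_on W f].

Lemma smooth_on_eq U f g : open U -> (forall x, U x -> f x = g x) ->
  smooth_on U f -> smooth_on U g.
Proof.
move=> Uo fg hf i k; apply: Ck_eq (hf i k); first exact: chart_open.
by move=> _ [z [iz Uz] <-] /=; rewrite chartK // fg.
Qed.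

Lemma smooth_onP U f : open U -> smooth_on U f <-> (forall x, U x -> sm f x).
Proof.
move=> Uo; split=> [h x Ux|h i k]; first by exists U.
apply: Ck_local => _ [x [ix Ux] <-]; have [W [Wo Wx hW]] := h _ Ux.
exists (chart i @` (cdom i `&` W)); split; first exact: chart_open.
  by exists x.
by apply: Ck_sub (hW i k) => y [].
Qed.

Lemma smoothTP f : smooth_on setT f <-> (forall x, sm f x).
Proof.
rewrite smooth_onP; last exact: openT.
by split=> [h x|h x _]; exact: h.
Qed.

Lemma sm_near f g x : (\forall y \near x, f y = g y) -> sm f x -> sm g x.
Proof.
move=> h; have : nbhs x [set y | f y = g y] by exact: h.
rewrite nbhsE => -[V [Vo Vx] Vfg] [W [Wo Wx hW]].
exists (V `&` W); split; [exact: openI|by []|].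
apply: (@smooth_on_eq _ f); [exact: openI | by move=> y [/Vfg] |].
by apply: smoothW hW => y [].
Qed.

Lemma sm_at_near f x : sm f x -> \forall y \near x, sm f y.
Proof.
move=> [W [Wo Wx hW]]; apply: filterS (open_nbhs_nbhs (conj Wo Wx)) => y Wy.
by exists W.
Qed.

Lemma sm_cst (a : R) x : sm (fun=> a) x.
Proof. by exists setT; split; [exact: openT| |exact: smooth_cst]. Qed.

Lemma sm2 (op : (M -> R) -> (M -> R) -> M -> R) :
  (forall U f g, open U -> smooth_on U f -> smooth_on U g -> smooth_on U (op f g)) ->
  forall f g x, sm f x -> sm g x -> sm (op f g) x.
Proof.
move=> h f g x [V [Vo Vx hV]] [W [Wo Wx hW]].
exists (V `&` W); split; [exact: openI|by []|]; apply: h; first exact: openI.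
  by apply: smoothW hV => y [].
by apply: smoothW hW => y [].
Qed.

Lemma smD f g x : sm f x -> sm g x -> sm (fun y => f y + g y) x.
Proof. by apply: (@sm2 (fun f g y => f y + g y)) => U f' g' *; exact: smooth_add. Qed.
Lemma smM f g x : sm f x -> sm g x -> sm (fun y => f y * g y) x.
Proof. by apply: (@sm2 (fun f g y => f y * g y)) => U f' g' *; exact: smooth_mul. Qed.
Lemma smN f x : sm f x -> sm (fun y => - f y) x.
Proof.
move=> h; apply: (@sm_near (fun y => (-1) * f y)).
  by apply: filterE => y; rewrite mulN1r.
by apply: smM => //; exact: sm_cst.
Qed.
Lemma smB f g x : sm f x -> sm g x -> sm (fun y => f y - g y) x.
Proof. by move=> hf hg; apply: smD => //; exact: smN. Qed.

Lemma sm_flat m f x : sm f x -> sm (fun y => flat m (f y)) x.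
Proof.
move=> [W [Wo Wx hW]]; exists W; split=> // i k; apply: Ck_flat; last exact: hW.
exact: chart_open.
Qed.

Lemma sm_continuous f x : sm f x -> {for x, continuous f}.
Proof.
move=> [W [Wo Wx hW]]; have [i ix] := cdom_cover x.
have [c _] := hW i 0%N.
have cV : {for chart i x, continuous (f \o @chartV _ _ M i)} by apply: c; exists x.
have E : \forall y \near x, (f \o @chartV _ _ M i) (chart i y) = f y.
  apply: filterS (open_nbhs_nbhs (conj (cdom_open i) ix)) => y iy /=.
  by rewrite chartK.
apply: (near_eq_continuous E).
apply: (@continuous_comp _ _ _ (chart i) (f \o @chartV _ _ M i)) => //.
by apply: chart_continuous; rewrite inE.
Qed.

Lemma sm_neq0 f x : sm f x -> f x != 0 -> \forall y \near x, f y != 0.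
Proof.
move=> /sm_continuous c f0; apply: (c [set z | z != 0]) => /=.
by apply: (open_nbhs_nbhs (conj _ _)) => //; exact: open_neq.
Qed.

Lemma smV f x : sm f x -> f x != 0 -> sm (fun y => (f y)^-1) x.
Proof.
move=> fx f0; have : nbhs x [set y | f y != 0] by exact: sm_neq0.
rewrite nbhsE => -[V [Vo Vx] Vf].
have [W [Wo Wx hW]] := fx.
exists (V `&` W); split; [exact: openI|by []|] => i k; apply: Ck_inv.
- by apply: chart_open; exact: openI.
- by move=> _ [y [iy [Vy _]] <-] /=; rewrite chartK //; exact: Vf.
- by apply: Ck_sub (hW i k); apply: image_subset => y [? []].
Qed.

Lemma sm_prod (I : Type) (r : seq I) (P : pred I) (F : I -> M -> R) x :
  (forall i, P i -> sm (F i) x) -> sm (fun y => \prod_(i <- r | P i) F i y) x.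
Proof.
move=> h; elim: r => [|i r IH].
  by apply: (sm_near _ (sm_cst 1 x)); apply: filterE => y; rewrite big_nil.
have [Pi|Pi] := boolP (P i).
  apply: (sm_near _ (smM (h _ Pi) IH)).
  by apply: filterE => y; rewrite big_cons Pi.
by apply: (sm_near _ IH); apply: filterE => y; rewrite big_cons (negbTE Pi).
Qed.

Lemma sm_chart (i : cidx M) l x : cdom i x -> sm (fun y => chart i y 0 l) x.
Proof.
move=> ix; exists (cdom i); split=> // [|j k]; first exact: cdom_open.
exact: chart_smooth.
Qed.

Definition csm (f : M -> R[i]) x :=
  sm (fun y => complex.Re (f y)) x /\ sm (fun y => complex.Im (f y)) x.
Implicit Types (F G : M -> R[i]).

Lemma csmooth_onP U F : open U -> csmooth_on U F <-> (forall x, U x -> csm F x).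
Proof.
move=> Uo; rewrite /csmooth_on !smooth_onP //.
split=> [[h1 h2] x Ux|h]; first by split; [exact: h1|exact: h2].
by split=> x Ux; have [] := h x Ux.
Qed.

Lemma csmoothTP F : csmooth_on setT F <-> (forall x, csm F x).
Proof.
rewrite csmooth_onP; last exact: openT.
by split=> [h x|h x _]; exact: h.
Qed.

Lemma csm_near F G x : (\forall y \near x, F y = G y) -> csm F x -> csm G x.
Proof.
by move=> h [h1 h2]; split; [apply: sm_near h1|apply: sm_near h2];
  apply: filterS h => y ->.
Qed.

Lemma csm_at_near F x : csm F x -> \forall y \near x, csm F y.
Proof. by move=> [/sm_at_near h1 /sm_at_near h2]; near do split. Unshelve. all: by end_near. Qed.

Lemma csm_ext F G x : F =1 G -> csm F x -> csm G x.
Proof. by move=> h; apply: csm_near; apply: filterE => y; rewrite h. Qed.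

Lemma csm_cst a x : csm (fun=> a) x.
Proof. by split; exact: sm_cst. Qed.
Lemma csm_real f x : sm f x -> csm (fun y => (f y)%:C) x.
Proof. by move=> h; split=> //; exact: sm_cst. Qed.
Lemma csmD F G x : csm F x -> csm G x -> csm (fun y => F y + G y) x.
Proof.
move=> [f1 f2] [g1 g2]; split.
  by apply: (sm_near _ (smD f1 g1)); apply: filterE => y; rewrite ReD_.
by apply: (sm_near _ (smD f2 g2)); apply: filterE => y; rewrite ImD_.
Qed.
Lemma csmM F G x : csm F x -> csm G x -> csm (fun y => F y * G y) x.
Proof.
move=> [f1 f2] [g1 g2]; split.
  apply: (sm_near _ (smB (smM f1 g1) (smM f2 g2))).
  by apply: filterE => y; rewrite ReM_.
apply: (sm_near _ (smD (smM f1 g2) (smM f2 g1))).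
by apply: filterE => y; rewrite ImM_.
Qed.
Lemma csmN F x : csm F x -> csm (fun y => - F y) x.
Proof.
move=> h; apply: (csm_ext _ (csmM (csm_cst (-1) x) h)) => y.
by rewrite mulN1r.
Qed.
Lemma csmJ F x : csm F x -> csm (fun y => (F y)^*) x.
Proof.
move=> [f1 f2]; split.
  by apply: (sm_near _ f1); apply: filterE => y; rewrite ReJ_.
by apply: (sm_near _ (smN f2)); apply: filterE => y; rewrite ImJ_.
Qed.
Lemma csm_sum (I : Type) (r : seq I) (P : pred I) (F : I -> M -> R[i]) x :
  (forall i, P i -> csm (F i) x) -> csm (fun y => \sum_(i <- r | P i) F i y) x.
Proof.
move=> h; elim: r => [|i r IH].
  by apply: (csm_ext _ (csm_cst 0 x)) => y; rewrite big_nil.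
have [Pi|Pi] := boolP (P i).
  by apply: (csm_ext _ (csmD (h _ Pi) IH)) => y; rewrite big_cons Pi.
by apply: (csm_ext _ IH) => y; rewrite big_cons (negbTE Pi).
Qed.
Lemma csm_prod (I : Type) (r : seq I) (P : pred I) (F : I -> M -> R[i]) x :
  (forall i, P i -> csm (F i) x) -> csm (fun y => \prod_(i <- r | P i) F i y) x.
Proof.
move=> h; elim: r => [|i r IH].
  by apply: (csm_ext _ (csm_cst 1 x)) => y; rewrite big_nil.
have [Pi|Pi] := boolP (P i).
  by apply: (csm_ext _ (csmM (h _ Pi) IH)) => y; rewrite big_cons Pi.
by apply: (csm_ext _ IH) => y; rewrite big_cons (negbTE Pi).
Qed.

Lemma complex_norm2 (z : R[i]) : z * z^* = (complex.Re z ^+ 2 + complex.Im z ^+ 2)%:C.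
Proof.
by apply: complexP_; rewrite ?ReM_ ?ImM_ !ReJ_ !ImJ_ /=; ring.
Qed.

Lemma complex_norm2_neq0 (z : R[i]) : z != 0 ->
  complex.Re z ^+ 2 + complex.Im z ^+ 2 != 0.
Proof.
apply: contraNneq => /eqP; rewrite paddr_eq0 ?sqr_ge0 // !sqrf_eq0.
by case/andP => /eqP h1 /eqP h2; apply/eqP/complexP_.
Qed.

Lemma complex_invE (z : R[i]) : z != 0 ->
  z^-1 = z^* * ((complex.Re z ^+ 2 + complex.Im z ^+ 2)^-1)%:C.
Proof.
move=> z0; apply: (mulfI z0); rewrite mulfV // mulrA complex_norm2.
have := complex_norm2_neq0 z0; set a := _ + _ => a0.
by apply: complexP_; rewrite ?ReM_ ?ImM_ /= ?mulfV //; ring.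
Qed.

Lemma csm_neq0 F x : csm F x -> F x != 0 -> \forall y \near x, F y != 0.
Proof.
move=> [f1 f2] F0; have := complex_norm2_neq0 F0 => h.
have := sm_neq0 (smD (smM f1 f1) (smM f2 f2)) h.
apply: filterS => y; apply: contraNneq => ->.
by rewrite /= mulr0 addr0.
Qed.

Lemma csmV F x : csm F x -> F x != 0 -> csm (fun y => (F y)^-1) x.
Proof.
move=> hF F0; have := complex_norm2_neq0 F0 => h.
have [f1 f2] := hF.
have s := smV (smD (smM f1 f1) (smM f2 f2)) h.
apply: (csm_near _ (csmM (csmJ hF) (csm_real s))).
by apply: filterS (csm_neq0 hF F0) => y Fy; rewrite complex_invE // !expr2.
Qed.

(** The support is controlled by a closed [K] inside [U], so that the product with a function smooth
    on [U] alone vanishes near every point outside [U]. *)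
Definition bump_on U (b : M -> R) := [/\ smooth_on setT b, forall x, 0 <= b x &
  exists2 K, closed K & K `<=` U /\ forall x, ~ K x -> b x = 0].

(** In a chart the bump is a product over the coordinates, positive exactly on an open cube. The
    image of the closed cube is compact, hence closed because the manifold is Hausdorff. *)
Lemma bump_exists U x0 : open U -> U x0 -> exists2 b, bump_on U b & 0 < b x0.
Proof.
move=> Uo Ux0; have [c cx0] := cdom_cover x0.
set y0 := chart c x0.
have Co : open (chart c @` (cdom c `&` U)) by exact: chart_open.
have : nbhs y0 (chart c @` (cdom c `&` U)).
  by apply: open_nbhs_nbhs; split=> //; exists x0.
rewrite -nbhs_ballE => -[e /= e0 be].
(* Half the radius, so that the closed cube still fits into the ball contained in the image of the
   chart. *)
pose r := e / 2; have r0 : 0 < r by rewrite divr_gt0.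
pose B := [set y : 'rV[R]_n | forall l, `[y0 0 l - r, y0 0 l + r]%classic (y 0 l)].
have Bcomp : compact B.
  by apply: (@rV_compact R n (fun l => `[y0 0 l - r, y0 0 l + r]%classic)) => l; exact: segment_compact.
have BU : B `<=` chart c @` (cdom c `&` U).
  move=> y By; apply: be; rewrite /ball /=; split=> // i j; rewrite ord1 /ball /=.
  have := By j; rewrite /= in_itv /= => /andP[h1 h2].
  rewrite ltr_norml; apply/andP; split; rewrite /r in h1 h2 r0; lra.
have cV : {within B, continuous (@chartV _ _ M c)}.
  apply: continuous_in_subspaceT => y; rewrite inE => /BU [x [cx _] <-].
  by apply: chartV_continuous; rewrite inE; exists x.
pose K := (@chartV _ _ M c) @` B.
have Kcl : closed K.
  apply: compact_closed; first exact: manifold_hausdorff.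
  exact: continuous_compact.
pose p x := \prod_(l < n) flat 0 (r ^+ 2 - (chart c x 0 l - y0 0 l) ^+ 2).
pose b x := if `[< cdom c x >] then p x else 0.
have b0 x : ~ K x -> b x = 0.
  move=> nK; rewrite /b; case: asboolP => // cx; apply/eqP; apply/negP => /negP pn0.
  apply: nK; exists (chart c x); last by rewrite chartK.
  move=> l /=; rewrite in_itv /=.
  have : flat 0 (r ^+ 2 - (chart c x 0 l - y0 0 l) ^+ 2) != 0.
    by move: pn0; rewrite /p (bigD1 l) //= mulf_eq0 negb_or => /andP[].
  case: (ltP 0 (r ^+ 2 - (chart c x 0 l - y0 0 l) ^+ 2)) => [h _|h]; last by rewrite flat_eq0 // eqxx.
  have : `|chart c x 0 l - y0 0 l| <= r.
    by rewrite -(@ler_pXn2r _ 2) ?nnegrE ?(ltW r0) // real_normK ?num_real // ltW // -subr_gt0.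
  by rewrite ler_norml => /andP[h1 h2]; apply/andP; split; lra.
exists b; last first.
  rewrite /b asboolT // /p; apply: prodr_gt0 => l _.
  by rewrite subrr expr0n subr0 flat_gt0 // exprn_gt0.
split.
- apply/smoothTP => x; have [cx|ncx] := pselect (cdom c x).
    apply: (@sm_near p).
      apply: filterS (open_nbhs_nbhs (conj (cdom_open c) cx)) => y cy.
      by rewrite /b asboolT.
    apply: sm_prod => l _; apply: sm_flat; apply: smB; first exact: sm_cst.
    by apply: smM; (apply: smB; [exact: sm_chart|exact: sm_cst]).
  apply: (@sm_near (fun=> 0)); last exact: sm_cst.
  have nK : (~` K) x by move=> [y /BU [z [cz _] <-]]; rewrite chartK // => zx; apply: ncx; rewrite -zx.
  have oK : open (~` K) by rewrite openC.
  by apply: filterS (open_nbhs_nbhs (conj oK nK)) => y nKy; rewrite b0.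
- by move=> x; rewrite /b; case: asboolP => // _; apply: prodr_ge0 => l _; exact: flat_ge0.
- exists K => //; split=> // x [y /BU [z [cz Uz] <-] <-].
  by rewrite chartK.
Qed.

Lemma bump_sm U b x : bump_on U b -> sm b x.
Proof. by move=> [/smoothTP h _ _]; exact: h. Qed.

Lemma bump_extend U b F : bump_on U b -> (forall x, U x -> csm F x) ->
  forall x, csm (fun y => (b y)%:C * F y) x.
Proof.
move=> hb hF x; have [Ux|nUx] := pselect (U x).
  by apply: csmM; [apply: csm_real; exact: bump_sm hb|exact: hF].
have [_ _ [K Kcl [KU Kb]]] := hb.
apply: (@csm_near (fun=> 0)); last exact: csm_cst.
have nK : (~` K) x by move=> /KU.
have oK : open (~` K) by rewrite openC.
apply: filterS (open_nbhs_nbhs (conj oK nK)) => y nKy; rewrite Kb //.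
by apply: complexP_; rewrite ?ReM_ ?ImM_ /=; ring.
Qed.

End Germs.

(** * Locality of derivations and calculus of complex functions *)

Section VectorFields.
Context {R : realType} {n : nat} {M : manifold R n}.
Implicit Types (X Y Z : vfield M) (f g : M -> R) (F G : M -> R[i]).

(** Multiplied by a bump supported where [f] and [g] agree, [f - g] becomes 0. The Leibniz rule at
    [x], where [f - g] vanishes and the bump does not, gives the claim. *)
Lemma vf_near X f g x : smooth_on setT f -> smooth_on setT g ->
  (\forall y \near x, f y = g y) -> X f x = X g x.
Proof.
move=> hf hg fg; apply/eqP; rewrite -subr_eq0; apply/eqP.
have hfg : smooth_on setT (f - g) by apply: smooth_sub => //; exact: openT.
have -> : X f x - X g x = X (f - g) x by rewrite vfB.
have : nbhs x [set y | f y = g y] by exact: fg.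
rewrite nbhsE => -[V [Vo Vx] Vfg].
have [b hb bx] := bump_exists Vo Vx; have [bs _ [K _ [KV Kb]]] := hb.
have : X (b * (f - g)) x = 0.
  have -> : b * (f - g) = 0; last by rewrite vf0.
  apply/funext => y; have [Ky|nKy] := pselect (K y).
    by rewrite /GRing.mul /GRing.add /= (Vfg _ (KV _ Ky)) funNE subrr mulr0.
  by rewrite /GRing.mul /= Kb // mul0r.
rewrite vf_leibniz // funDE => /eqP.
rewrite -[(b * _) x]/(b x * X (f - g) x) -[(_ * X b) x]/((f x - g x) * X b x).
by rewrite (nbhs_singleton fg) subrr mul0r addr0 mulf_eq0 gt_eqF //= => /eqP.
Qed.

Lemma vf_cst X (a : R) : X (fun=> a) = 0.
Proof.
have s1 : smooth_on setT (1 : M -> R) by exact: smooth_cst.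
have h1 : X 1 = 0.
  have := vf_leibniz X s1 s1; rewrite !mul1r => /esym/eqP.
  by rewrite addrC -subr_eq0 addrK => /eqP.
have -> : (fun=> a) = a *: (1 : M -> R) + 0.
  by apply/funext => y; rewrite addr0; exact: (esym (mulr1 a)).
by rewrite vf_linear //; [rewrite h1 vf0 scaler0 addr0 | exact: smooth_cst].
Qed.

Definition csmT F := forall x, csm F x.

Lemma csmT_re F : csmT F -> smooth_on setT (fun y => complex.Re (F y)).
Proof. by move=> h; apply/smoothTP => x; have [] := h x. Qed.
Lemma csmT_im F : csmT F -> smooth_on setT (fun y => complex.Im (F y)).
Proof. by move=> h; apply/smoothTP => x; have [] := h x. Qed.

Lemma cvf_csm X F : csmT F -> csmT (cvf X F).
Proof.
move=> hF x; split.
  by apply/(smoothTP _).1; apply: vf_smooth; exact: csmT_re.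
by apply/(smoothTP _).1; apply: vf_smooth; exact: csmT_im.
Qed.

Lemma cvf_near X F G x : csmT F -> csmT G -> (\forall y \near x, F y = G y) ->
  cvf X F x = cvf X G x.
Proof.
move=> hF hG h; rewrite /cvf; congr (_ +i* _); apply: vf_near.
- exact: csmT_re. - exact: csmT_re. - by apply: filterS h => y ->.
- exact: csmT_im. - exact: csmT_im. - by apply: filterS h => y ->.
Qed.

Lemma cvf_fD X F G x : csmT F -> csmT G ->
  cvf X (fun y => F y + G y) x = cvf X F x + cvf X G x.
Proof.
move=> hF hG; apply: complexP_; rewrite ?ReD_ ?ImD_ /=.
  rewrite -funDE -(vfD X (csmT_re hF) (csmT_re hG)); congr (vf X _ x).
  by apply/funext => y; rewrite ReD_.
rewrite -funDE -(vfD X (csmT_im hF) (csmT_im hG)); congr (vf X _ x).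
by apply/funext => y; rewrite ImD_.
Qed.

Lemma cvf_fB X F G x : csmT F -> csmT G ->
  cvf X (fun y => F y - G y) x = cvf X F x - cvf X G x.
Proof.
move=> hF hG; rewrite -funBE -cvfB //; exact/csmoothTP.
Qed.

Lemma cvf_fM X F G x : csmT F -> csmT G ->
  cvf X (fun y => F y * G y) x = cvf X F x * G x + F x * cvf X G x.
Proof.
move=> hF hG.
have [fr fi] := (csmT_re hF, csmT_im hF); have [gr gi] := (csmT_re hG, csmT_im hG).
have To : open (setT : set M) by exact: openT.
have E1 (u v u' v' : M -> R) : smooth_on setT u -> smooth_on setT v ->
    smooth_on setT u' -> smooth_on setT v' ->
  X (u * v - u' * v') x = u x * X v x + v x * X u x - (u' x * X v' x + v' x * X u' x).
  by move=> *; rewrite vfB; [rewrite !vf_leibniz|exact: smooth_mul|exact: smooth_mul].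
have E2 (u v u' v' : M -> R) : smooth_on setT u -> smooth_on setT v ->
    smooth_on setT u' -> smooth_on setT v' ->
  X (u * v + u' * v') x = u x * X v x + v x * X u x + (u' x * X v' x + v' x * X u' x).
  by move=> *; rewrite vfD; [rewrite !vf_leibniz|exact: smooth_mul|exact: smooth_mul].
apply: complexP_; rewrite ?ReD_ ?ImD_ ?ReM_ ?ImM_ /=.
  transitivity (X ((fun y => complex.Re (F y)) * (fun y => complex.Re (G y)) -
     (fun y => complex.Im (F y)) * (fun y => complex.Im (G y))) x).
    by congr (vf X _ x); apply/funext => y; rewrite ReM_.
  by rewrite E1 //; ring.
transitivity (X ((fun y => complex.Re (F y)) * (fun y => complex.Im (G y)) +
     (fun y => complex.Im (F y)) * (fun y => complex.Re (G y))) x).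
  by congr (vf X _ x); apply/funext => y; rewrite ImM_.
by rewrite E2 //; ring.
Qed.

Lemma cvf_real X f x : cvf X (fun y => (f y)%:C) x = (X f x)%:C.
Proof. by rewrite /cvf /= vf_cst. Qed.

Lemma cvf_cst X (a : R[i]) x : cvf X (fun=> a) x = 0.
Proof. by rewrite /cvf !vf_cst. Qed.

Lemma cvf_conj X F x : csmT F -> cvf X (fun y => (F y)^*) x = (cvf X F x)^*.
Proof.
move=> hF; apply: complexP_; rewrite ?ReJ_ ?ImJ_ /=.
  by congr (vf X _ x); apply/funext => y; rewrite ReJ_.
transitivity (X (0 - (fun y => complex.Im (F y))) x).
  by congr (vf X _ x); apply/funext => y; rewrite ImJ_ funBE sub0r.
by rewrite vfB ?vf0 ?sub0r //; [exact: smooth_cst | exact: csmT_im].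
Qed.

Lemma csmT_sum (I : Type) (r : seq I) (P : pred I) (F : I -> M -> R[i]) :
  (forall i, csmT (F i)) -> csmT (fun y => \sum_(i <- r | P i) F i y).
Proof. by move=> h x; apply: csm_sum => i _; exact: h. Qed.

Lemma cvf_sum X (I : Type) (r : seq I) (P : pred I) (F : I -> M -> R[i]) x :
  (forall i, csmT (F i)) ->
  cvf X (fun y => \sum_(i <- r | P i) F i y) x = \sum_(i <- r | P i) cvf X (F i) x.
Proof.
move=> h; elim: r => [|i r IH].
  rewrite big_nil -[RHS](cvf_cst X 0 x); congr (cvf X _ x).
  by apply/funext => y; rewrite big_nil.
rewrite big_cons -IH; case: ifP => Pi.
  rewrite -cvf_fD //; last exact: csmT_sum.
  by congr (cvf X _ x); apply/funext => y; rewrite big_cons Pi.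
by congr (cvf X _ x); apply/funext => y; rewrite big_cons Pi.
Qed.

Lemma cvf_combine X Y Z f F x : csmT F -> (forall g, Z g = f * X g + Y g) ->
  cvf Z F x = (f x)%:C * cvf X F x + cvf Y F x.
Proof.
move=> hF hZ; rewrite /cvf !hZ !funDE; apply: complexP_.
  by rewrite ReD_ ReM_ /= mul0r subr0.
by rewrite ImD_ ImM_ /= mul0r addr0.
Qed.

(** Sums of vector fields serve as instances of the relation [Z g = f * X g + Y g], in which the
    linearity of forms and connections is expressed. *)
Program Definition vfadd X Y : vfield M := @VField R n M (fun g => X g + Y g) _ _ _ _.
Next Obligation. by move=> X Y f hf; rewrite /= !vf_out // addr0. Qed.
Next Obligation.
by move=> X Y f hf; apply: smooth_add; [exact: openT|exact: vf_smooth|exact: vf_smooth].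
Qed.
Next Obligation.
by move=> X Y a f g hf hg /=; rewrite !vf_linear // scalerDr; abelu.
Qed.
Next Obligation.
by move=> X Y f g hf hg /=; rewrite !vf_leibniz // !mulrDr; abelu.
Qed.

Lemma vfaddE X Y g : vfadd X Y g = (1 : M -> R) * X g + Y g.
Proof. by rewrite mul1r. Qed.

Program Definition vfzero : vfield M := @VField R n M (fun g => 0) _ _ _ _.
Next Obligation. by []. Qed.
Next Obligation. by move=> f hf; exact: smooth_cst. Qed.
Next Obligation. by move=> a f g hf hg /=; rewrite scaler0 addr0. Qed.
Next Obligation. by move=> f g hf hg /=; rewrite !mulr0 addr0. Qed.

(** Stated in the shape [Z g = f * X g + Y g] with [f = 1], so that forms and connections apply to
    it. On functions that are not smooth both sides are 0. *)
Lemma bracket_jacobi X Y Z g : bracket X (bracket Y Z) g =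
  (1 : M -> R) * bracket (bracket X Y) Z g + bracket Y (bracket X Z) g.
Proof.
rewrite mul1r /=; have [hg|hg] := pselect (smooth_on setT g).
  have s (V : vfield M) (h : M -> R) : smooth_on setT h -> smooth_on setT (vf V h) by exact: vf_smooth.
  have E (A B C : vfield M) : A (B (C g) - C (B g)) = A (B (C g)) - A (C (B g)).
    by rewrite vfB //; apply: vf_smooth; exact: vf_smooth.
  by rewrite !E; abel.
by rewrite !(vf_out _ hg) !(subrr, vf0, addr0).
Qed.

Lemma bracket_anti X Y g : bracket X Y g = (-1 : M -> R) * bracket Y X g + vfzero g.
Proof. by rewrite /= addr0 mulN1r opprB. Qed.

End VectorFields.

Section MatrixGerms.
Context {R : realType} {n : nat} {M : manifold R n}.

Definition cmx p q (A : M -> 'M[R[i]]_(p, q)) x := forall k l, csm (fun y => A y k l) x.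

Lemma cmx_near p q (A B : M -> 'M[R[i]]_(p, q)) x :
  (\forall y \near x, A y = B y) -> cmx A x -> cmx B x.
Proof. by move=> h hA k l; apply: csm_near (hA k l); apply: filterS h => y ->. Qed.

Lemma cmx_ext p q (A B : M -> 'M[R[i]]_(p, q)) x : A =1 B -> cmx A x -> cmx B x.
Proof. by move=> h; apply: cmx_near; apply: filterE => y; rewrite h. Qed.

Lemma cmx_cst p q (A : 'M[R[i]]_(p, q)) x : cmx (fun=> A) x.
Proof. by move=> k l; exact: csm_cst. Qed.

Lemma cmxD p q (A B : M -> 'M[R[i]]_(p, q)) x :
  cmx A x -> cmx B x -> cmx (fun y => A y + B y) x.
Proof. by move=> hA hB k l; apply: csm_ext (csmD (hA k l) (hB k l)) => y; rewrite mxE. Qed.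

Lemma cmxN p q (A : M -> 'M[R[i]]_(p, q)) x : cmx A x -> cmx (fun y => - A y) x.
Proof. by move=> hA k l; apply: csm_ext (csmN (hA k l)) => y; rewrite mxE. Qed.

Lemma cmxZ p q f (A : M -> 'M[R[i]]_(p, q)) x :
  csm f x -> cmx A x -> cmx (fun y => f y *: A y) x.
Proof. by move=> hf hA k l; apply: csm_ext (csmM hf (hA k l)) => y; rewrite mxE. Qed.

Lemma cmxM p q r (A : M -> 'M[R[i]]_(p, q)) (B : M -> 'M[R[i]]_(q, r)) x :
  cmx A x -> cmx B x -> cmx (fun y => A y *m B y) x.
Proof.
move=> hA hB k l; apply: (csm_ext (F := fun y => \sum_j A y k j * B y j l)).
  by move=> y; rewrite mxE.
by apply: csm_sum => j _; exact: csmM.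
Qed.

Lemma cmx_tr p q (A : M -> 'M[R[i]]_(p, q)) x : cmx A x -> cmx (fun y => (A y)^T) x.
Proof. by move=> hA k l; apply: csm_ext (hA l k) => y; rewrite mxE. Qed.

Lemma cmx_trace p (A : M -> 'M[R[i]]_p) x : cmx A x -> csm (fun y => \tr (A y)) x.
Proof. by move=> hA; apply: csm_sum => i _; exact: hA. Qed.

Lemma cmx_det p (A : M -> 'M[R[i]]_p) x : cmx A x -> csm (fun y => \det (A y)) x.
Proof.
move=> hA; apply: csm_sum => s _; apply: csmM; first exact: csm_cst.
by apply: csm_prod => i _; exact: hA.
Qed.

Lemma cmx_inv p (A : M -> 'M[R[i]]_p) x : cmx A x -> A x \in unitmx ->
  cmx (fun y => invmx (A y)) x.
Proof.
move=> hA; rewrite unitmxE unitfE => d0 k l.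
have hd := cmx_det hA.
apply: (csm_near (F := fun y => (\det (A y))^-1 * \adj (A y) k l)).
  apply: filterS (csm_neq0 hd d0) => y dy.
  by rewrite /invmx unitmxE unitfE dy [RHS]mxE.
apply: csmM; first exact: csmV.
apply: (csm_ext (F := fun y => (-1) ^+ (l + k) * \det (row' l (col' k (A y))))).
  by move=> y; rewrite mxE.
apply: csmM; first exact: csm_cst.
apply: cmx_det => a b; apply: csm_ext (hA (fintype.lift l a) (fintype.lift k b)) => y.
by rewrite !mxE.
Qed.

Lemma cmx_conj p q (A : M -> 'M[R[i]]_(p, q)) x :
  cmx A x -> cmx (fun y => map_mx (@conjc R) (A y)) x.
Proof. by move=> hA k l; apply: csm_ext (csmJ (hA k l)) => y; rewrite mxE. Qed.

End MatrixGerms.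

(** * Sections and endomorphisms *)

Section SmoothFunctions.
Context {R : realType} {n : nat} (M : manifold R n).

(** Bundling smoothness gives an abelian group on which vector fields act everywhere, as the
    abstract calculus on lists requires. *)
Record sfun := SFun { sfv :> M -> R[i]; sfP : csmT sfv }.

Lemma sfun_eq (f g : sfun) : sfv f = sfv g -> f = g.
Proof.
case: f g => [f hf] [g hg] /= fg; rewrite -fg in hg *.
by congr SFun; exact: Prop_irrelevance.
Qed.

HB.instance Definition _ := gen_eqMixin sfun.
HB.instance Definition _ := gen_choiceMixin sfun.

Definition sf0 : sfun := SFun (fun x => csm_cst 0 x).
Definition sfadd (f g : sfun) : sfun := SFun (fun x => csmD (sfP f x) (sfP g x)).
Definition sfopp (f : sfun) : sfun := SFun (fun x => csmN (sfP f x)).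

Lemma sfaddA : associative sfadd.
Proof. by move=> f g h; apply/sfun_eq/funext => x /=; rewrite addrA. Qed.
Lemma sfaddC : commutative sfadd.
Proof. by move=> f g; apply/sfun_eq/funext => x /=; rewrite addrC. Qed.
Lemma sfadd0 : left_id sf0 sfadd.
Proof. by move=> f; apply/sfun_eq/funext => x /=; rewrite add0r. Qed.
Lemma sfaddN : left_inverse sf0 sfopp sfadd.
Proof. by move=> f; apply/sfun_eq/funext => x /=; rewrite addNr. Qed.
HB.instance Definition _ := GRing.isZmodule.Build sfun sfaddA sfaddC sfadd0 sfaddN.

Lemma sfunD (f g : sfun) x : (f + g) x = f x + g x. Proof. by []. Qed.
Lemma sfunB (f g : sfun) x : (f - g) x = f x - g x. Proof. by []. Qed.
Lemma sfunN (f : sfun) x : (- f) x = - f x. Proof. by []. Qed.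
Lemma sfun0 x : (0 : sfun) x = 0. Proof. by []. Qed.
Lemma sfun_sum (I : Type) (r : seq I) (P : pred I) (F : I -> sfun) x :
  (\sum_(i <- r | P i) F i) x = \sum_(i <- r | P i) F i x.
Proof.
elim: r => [|i r IH]; first by rewrite !big_nil.
by rewrite !big_cons; case: (P i); rewrite -IH.
Qed.

Definition sact (X : vfield M) (f : sfun) : sfun := SFun (cvf_csm X (sfP f)).

Lemma sactB X : {morph sact X : f g / f - g}.
Proof.
move=> f g; apply/sfun_eq/funext => x /=.
exact: (cvf_fB X x (sfP f) (sfP g)).
Qed.

Lemma sact_br X Y f : sact (bracket X Y) f = sact X (sact Y f) - sact Y (sact X f).
Proof. by apply/sfun_eq/funext => x /=; apply: complexP_; rewrite ?ReD_ ?ImD_ ?ReN_ ?ImN_. Qed.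

Definition sfmul (f g : sfun) : sfun := SFun (fun x => csmM (sfP f x) (sfP g x)).
Definition sfcst (a : R[i]) : sfun := SFun (fun x => csm_cst a x).

End SmoothFunctions.
Arguments sf0 {R n M}.

Section Sections.
Context {R : realType} {n : nat} {M : manifold R n}.
Variable E : vbundle M.
Implicit Types (x y : M) (i j : tidx E).

Lemma tdom_near i x : tdom i x -> \forall y \near x, tdom i y.
Proof. by move=> ix; exact: (open_nbhs_nbhs (conj (tdom_open i) ix)). Qed.

Lemma triv_sm i j x : tdom i x -> tdom j x ->
  cmx (fun y => triv j y *m trivV i y) x.
Proof.
move=> ix jx k l; have /csmooth_onP h := @triv_smooth _ _ _ E i j k l; apply: h => //.
by apply: openI; exact: tdom_open.
Qed.

Lemma smooth_sectionP (s : presection E) : smooth_section s <->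
  forall x i, tdom i x -> cmx (fun y => triv i y *m s y) x.
Proof.
split=> [h x i ix k l|h i l].
  rewrite ord1; have /csmooth_onP h' := h i k; apply: h' => //; exact: tdom_open.
by apply/csmooth_onP; [exact: tdom_open | move=> x ix; exact: h].
Qed.

Lemma smooth_section1 (s : presection E) :
  (forall x, exists2 i, tdom i x & cmx (fun y => triv i y *m s y) x) ->
  smooth_section s.
Proof.
move=> h; apply/smooth_sectionP => x j jx; have [i ix hi] := h x.
apply: cmx_near (cmxM (triv_sm ix jx) hi).
by apply: filterS (tdom_near ix) => y iy; rewrite mulmxA -[in RHS](mul1mx (s y)) -(trivK iy) !mulmxA.
Qed.

Record ssec := SSec { ssv :> forall x : M, 'cV[R[i]]_(rank E x); ssP : @smooth_section _ _ _ E ssv }.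

Lemma ssec_sm (s : ssec) x i : tdom i x -> cmx (fun y => triv i y *m s y) x.
Proof. exact: (smooth_sectionP s).1 (ssP s) _ _. Qed.

Lemma ssec_eq (s t : ssec) : (forall x, s x = t x) -> s = t.
Proof.
case: s t => [s hs] [t ht] /= st; have E' : s = t by exact: functional_extensionality_dep.
by rewrite -E' in ht *; congr SSec; exact: Prop_irrelevance.
Qed.

HB.instance Definition _ := gen_eqMixin ssec.
HB.instance Definition _ := gen_choiceMixin ssec.

Lemma ss0_smooth : smooth_section ((fun x => 0) : presection E).
Proof.
apply/smooth_sectionP => x i ix; apply: cmx_ext (cmx_cst 0 x) => y.
by rewrite mulmx0.
Qed.
Lemma ssD_smooth (s t : ssec) : smooth_section ((fun x => s x + t x) : presection E).
Proof.
apply/smooth_sectionP => x i ix.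
by apply: cmx_ext (cmxD (ssec_sm s ix) (ssec_sm t ix)) => y; rewrite mulmxDr.
Qed.
Lemma ssN_smooth (s : ssec) : smooth_section ((fun x => - s x) : presection E).
Proof.
apply/smooth_sectionP => x i ix.
by apply: cmx_ext (cmxN (ssec_sm s ix)) => y; rewrite mulmxN.
Qed.
Lemma ssZ_smooth (f : sfun M) (s : ssec) :
  smooth_section ((fun x => f x *: s x) : presection E).
Proof.
apply/smooth_sectionP => x i ix.
by apply: cmx_ext (cmxZ (sfP f x) (ssec_sm s ix)) => y; rewrite scalemxAr.
Qed.
Definition ss0 : ssec := SSec ss0_smooth.
Definition ssadd (s t : ssec) : ssec := SSec (ssD_smooth s t).
Definition ssopp (s : ssec) : ssec := SSec (ssN_smooth s).
Definition sscale (f : sfun M) (s : ssec) : ssec := SSec (ssZ_smooth f s).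

Lemma ssaddA : associative ssadd.
Proof. by move=> s t u; apply/ssec_eq => x /=; rewrite addrA. Qed.
Lemma ssaddC : commutative ssadd.
Proof. by move=> s t; apply/ssec_eq => x /=; rewrite addrC. Qed.
Lemma ssadd0 : left_id ss0 ssadd.
Proof. by move=> s; apply/ssec_eq => x /=; rewrite add0r. Qed.
Lemma ssaddN : left_inverse ss0 ssopp ssadd.
Proof. by move=> s; apply/ssec_eq => x /=; rewrite addNr. Qed.
HB.instance Definition _ := GRing.isZmodule.Build ssec ssaddA ssaddC ssadd0 ssaddN.

Lemma ssecD (s t : ssec) x : (s + t) x = s x + t x. Proof. by []. Qed.
Lemma ssec_sum (I : Type) (r : seq I) (P : pred I) (F : I -> ssec) x :
  (\sum_(i <- r | P i) F i) x = \sum_(i <- r | P i) F i x.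
Proof.
elim: r => [|i r IH]; first by rewrite !big_nil.
by rewrite !big_cons; case: (P i); rewrite -IH.
Qed.

Section Frame.
Variables (i : tidx E) (b : M -> R).
Hypothesis hb : bump_on (tdom i) b.

Lemma bump_out y : ~ tdom i y -> b y = 0.
Proof. by have [_ _ [K _ [KU Kb]]] := hb; move=> niy; apply: Kb => /KU. Qed.

Lemma fsec_smooth (v : 'cV[R[i]]_(trank i)) :
  smooth_section ((fun y => (b y)%:C *: (trivV i y *m v)) : presection E).
Proof.
apply/smooth_sectionP => x j jx k l.
have [Kb] : exists2 b', b' = b & True by exists b.
move=> _ _; have [bs b0 [K Kcl [KU Kb']]] := hb.
have [ix|nix] := pselect (tdom i x).
  apply: (csm_ext (F := fun y => (b y)%:C * ((triv j y *m trivV i y) *m v) k l)).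
    by move=> y; rewrite -scalemxAr mulmxA [RHS]mxE.
  apply: csmM; first by apply: csm_real; exact: bump_sm hb.
  by apply: cmxM; [exact: triv_sm | exact: cmx_cst].
apply: (@csm_near _ _ _ (fun=> 0)); last exact: csm_cst.
have nK : (~` K) x by move=> /KU.
have oK : open (~` K) by rewrite openC.
apply: filterS (open_nbhs_nbhs (conj oK nK)) => y nKy.
by rewrite Kb' // scale0r mulmx0 mxE.
Qed.

Definition vsec (v : 'cV[R[i]]_(trank i)) : ssec := SSec (fsec_smooth v).
Definition fsec (l : 'I_(trank i)) : ssec := vsec (delta_mx l 0).

Lemma scoef_csm (s : ssec) (l : 'I_(trank i)) :
  csmT (fun y => (b y)%:C * (triv i y *m s y) l 0).
Proof. by move=> x; apply: (bump_extend hb) => y iy; exact: ssec_sm. Qed.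
Definition scoef (s : ssec) l : sfun M := SFun (scoef_csm s l).

Lemma bump_csmT : csmT (fun y => (b y)%:C).
Proof. by move=> x; apply: csm_real; exact: bump_sm hb. Qed.
Definition sbump : sfun M := SFun bump_csmT.

(** The frame and the coefficients are each made global by one factor of the bump. An operator
    linear over the smooth functions is thus determined, wherever the bump does not vanish, by its
    values on the frame sections. *)
Lemma frame_expand (s : ssec) :
  sscale sbump (sscale sbump s) = \sum_l sscale (scoef s l) (fsec l).
Proof.
apply/ssec_eq => y; rewrite ssec_sum /=.
have [iy|niy] := pselect (tdom i y); last first.
  by rewrite bump_out // scale0r big1 // => l _; rewrite scale0r scaler0.
rewrite -{1}(mul1mx (s y)) -(trivK iy) -mulmxA.
rewrite {1}(matrix_sum_delta (triv i y *m s y)) mulmx_sumr !scaler_sumr.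
apply: eq_bigr => l _; rewrite big_ord1 -scalemxAr !scalerA.
by congr (_ *: _); rewrite mulrAC.
Qed.

End Frame.

Lemma triv_bump x : exists i, exists2 b, bump_on (tdom i) b & 0 < b x /\ tdom i x.
Proof.
have [i ix] := tdom_cover E x; have [b hb bx] := bump_exists (tdom_open i) ix.
by exists i, b.
Qed.

Lemma realc_neq0 (a : R) : 0 < a -> (a%:C : R[i]) != 0.
Proof. by move=> a0; rewrite eq_complex /= gt_eqF. Qed.

Lemma sec_value x (v : 'cV[R[i]]_(rank E x)) : exists s : ssec, s x = v.
Proof.
have [i [b hb [bx ix]]] := triv_bump x.
exists (vsec hb ((b x)%:C^-1 *: (triv i x *m v))) => /=.
rewrite -scalemxAr scalerA mulfV ?realc_neq0 // scale1r mulmxA trivK //.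
by rewrite mul1mx.
Qed.

(** Global smooth sections attain every vector of a fibre, so matrices at a point can be compared
    through their action on sections. *)
Lemma sec_span p x (A B : 'M[R[i]]_(p, rank E x)) :
  (forall s : ssec, A *m s x = B *m s x) -> A = B.
Proof.
move=> h; apply/trmx_inj/row_matrixP => k; rewrite -!tr_col; congr trmx.
have [s sx] := sec_value (delta_mx k 0); have := h s.
by rewrite sx -!colE.
Qed.

(** [sec_span] makes the matrix unique, which identifies the one selected by [xget]. *)
Lemma endo_atE (T : presection E -> presection E) x (A : 'M[R[i]]_(rank E x)) :
  (forall s : ssec, A *m s x = T s x) -> endo_at T x = A.
Proof.
move=> h; rewrite /endo_at; apply: xget_unique.
  by move=> s hs; exact: (h (SSec hs)).
by move=> B hB; apply: sec_span => s; rewrite h; apply: hB; exact: ssP.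
Qed.

Definition endo_smooth (a : forall x, 'M[R[i]]_(rank E x)) :=
  forall x i, tdom i x -> cmx (fun y => triv i y *m a y *m trivV i y) x.

Record sendo := SEndo { sev :> forall x, 'M[R[i]]_(rank E x); seP : endo_smooth sev }.

Lemma sendo_eq (a b : sendo) : (forall x, a x = b x) -> a = b.
Proof.
case: a b => [s hs] [t ht] /= st; have E' : s = t by exact: functional_extensionality_dep.
by rewrite -E' in ht *; congr SEndo; exact: Prop_irrelevance.
Qed.

HB.instance Definition _ := gen_eqMixin sendo.
HB.instance Definition _ := gen_choiceMixin sendo.

Lemma se0_smooth : endo_smooth (fun=> 0).
Proof.
by move=> x i ix; apply: cmx_ext (cmx_cst 0 x) => y; rewrite mulmx0 mul0mx.
Qed.
Lemma seD_smooth (a b : sendo) : endo_smooth (fun x => a x + b x).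
Proof.
move=> x i ix; apply: cmx_ext (cmxD (seP a ix) (seP b ix)) => y.
by rewrite mulmxDr mulmxDl.
Qed.
Lemma seN_smooth (a : sendo) : endo_smooth (fun x => - a x).
Proof.
by move=> x i ix; apply: cmx_ext (cmxN (seP a ix)) => y; rewrite mulmxN mulNmx.
Qed.
Lemma se1_smooth : endo_smooth (fun=> 1%:M).
Proof.
move=> x i ix; apply: (cmx_near (A := fun=> 1%:M)); last exact: cmx_cst.
by apply: filterS (tdom_near ix) => y iy; rewrite mulmx1 trivVK.
Qed.
Lemma seM_smooth (a b : sendo) : endo_smooth (fun x => a x *m b x).
Proof.
move=> x i ix; apply: cmx_near (cmxM (seP a ix) (seP b ix)).
apply: filterS (tdom_near ix) => y iy.
by rewrite !mulmxA -[_ *m trivV i y *m triv i y]mulmxA trivK // mulmx1.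
Qed.
Definition se0 : sendo := SEndo se0_smooth.
Definition se1 : sendo := SEndo se1_smooth.
Definition seadd (a b : sendo) : sendo := SEndo (seD_smooth a b).
Definition seopp (a : sendo) : sendo := SEndo (seN_smooth a).
Definition semul (a b : sendo) : sendo := SEndo (seM_smooth a b).

Lemma seaddA : associative seadd.
Proof. by move=> s t u; apply/sendo_eq => x /=; rewrite addrA. Qed.
Lemma seaddC : commutative seadd.
Proof. by move=> s t; apply/sendo_eq => x /=; rewrite addrC. Qed.
Lemma seadd0 : left_id se0 seadd.
Proof. by move=> s; apply/sendo_eq => x /=; rewrite add0r. Qed.
Lemma seaddN : left_inverse se0 seopp seadd.
Proof. by move=> s; apply/sendo_eq => x /=; rewrite addNr. Qed.
HB.instance Definition _ := GRing.isZmodule.Build sendo seaddA seaddC seadd0 seaddN.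

Lemma semulA : associative semul.
Proof. by move=> s t u; apply/sendo_eq => x /=; rewrite mulmxA. Qed.
Lemma semul1l : left_id se1 semul.
Proof. by move=> s; apply/sendo_eq => x /=; rewrite mul1mx. Qed.
Lemma semul1r : right_id se1 semul.
Proof. by move=> s; apply/sendo_eq => x /=; rewrite mulmx1. Qed.
Lemma semulDl : left_distributive semul +%R.
Proof. by move=> s t u; apply/sendo_eq => x /=; rewrite mulmxDl. Qed.
Lemma semulDr : right_distributive semul +%R.
Proof. by move=> s t u; apply/sendo_eq => x /=; rewrite mulmxDr. Qed.
HB.instance Definition _ := GRing.Zmodule_isPzRing.Build sendo
  semulA semul1l semul1r semulDl semulDr.

Lemma sendoD (a b : sendo) x : (a + b) x = a x + b x. Proof. by []. Qed.
Lemma sendoB (a b : sendo) x : (a - b) x = a x - b x. Proof. by []. Qed.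
Lemma sendoN (a : sendo) x : (- a) x = - a x. Proof. by []. Qed.
Lemma sendoM (a b : sendo) x : (a * b) x = a x *m b x. Proof. by []. Qed.

Lemma app_smooth (a : sendo) (s : ssec) :
  smooth_section ((fun x => a x *m s x) : presection E).
Proof.
apply/smooth_sectionP => x i ix; apply: cmx_near (cmxM (seP a ix) (ssec_sm s ix)).
apply: filterS (tdom_near ix) => y iy.
by rewrite !mulmxA -[_ *m trivV i y *m triv i y]mulmxA trivK // mulmx1.
Qed.
Definition sapp (a : sendo) (s : ssec) : ssec := SSec (app_smooth a s).

Lemma sapp_inj (a b : sendo) : (forall s, sapp a s = sapp b s) -> a = b.
Proof.
move=> h; apply/sendo_eq => x; apply: sec_span => s.
by have := congr1 (fun t : ssec => t x) (h s).
Qed.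

Lemma sappDl a b s : sapp (a + b) s = sapp a s + sapp b s.
Proof. by apply/ssec_eq => x /=; rewrite mulmxDl. Qed.
Lemma sappBl a b s : sapp (a - b) s = sapp a s - sapp b s.
Proof. by apply/ssec_eq => x /=; rewrite mulmxDl mulNmx. Qed.
Lemma sappB a s t : sapp a (s - t) = sapp a s - sapp a t.
Proof. by apply/ssec_eq => x /=; rewrite mulmxDr mulmxN. Qed.
Lemma sappNl a s : sapp (- a) s = - sapp a s.
Proof. by apply/ssec_eq => x /=; rewrite mulNmx. Qed.
Lemma sappD a s t : sapp a (s + t) = sapp a s + sapp a t.
Proof. by apply/ssec_eq => x /=; rewrite mulmxDr. Qed.
Lemma sapp0l s : sapp 0 s = 0.
Proof. by apply/ssec_eq => x /=; rewrite mul0mx. Qed.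
Lemma sappM a b s : sapp (a * b) s = sapp a (sapp b s).
Proof. by apply/ssec_eq => x /=; rewrite mulmxA. Qed.
Lemma sappZ a f s : sapp a (sscale f s) = sscale f (sapp a s).
Proof. by apply/ssec_eq => x /=; rewrite -scalemxAr. Qed.

Lemma trace_csm (a : sendo) : csmT (fun x => \tr (a x)).
Proof.
move=> x; have [i ix] := tdom_cover E x.
apply: csm_near (cmx_trace (seP a ix)).
apply: filterS (tdom_near ix) => y iy.
by rewrite mxtrace_mulC mulmxA trivK // mul1mx.
Qed.
Definition strace (a : sendo) : sfun M := SFun (trace_csm a).

Lemma straceB : {morph strace : a b / a - b}.
Proof. by move=> a b; apply/sfun_eq/funext => x /=; rewrite raddfB. Qed.
Lemma straceC a b : strace (a * b) = strace (b * a).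
Proof. by apply/sfun_eq/funext => x /=; rewrite mxtrace_mulC. Qed.

Section Tensorial.
Variable T : ssec -> ssec.
Hypothesis TD : {morph T : s t / s + t}.
Hypothesis TZ : forall f s, T (sscale f s) = sscale f (T s).

Let Tsum (I : Type) (r : seq I) (P : pred I) (F : I -> ssec) :
  T (\sum_(i <- r | P i) F i) = \sum_(i <- r | P i) T (F i).
Proof.
apply: (big_morph T TD).
have := TZ sf0 0; have Z s : sscale sf0 s = 0 by apply/ssec_eq => x /=; rewrite scale0r.
by rewrite !Z.
Qed.

Lemma tensorial_at i b (hb : bump_on (tdom i) b) y : b y != 0 ->
  forall s : ssec, ((b y)%:C^-1 *: ((\matrix_(k, l) T (fsec hb l) y k 0) *m triv i y)) *m s y
            = T s y.
Proof.
move=> by0 s; have bc : ((b y)%:C : R[i]) != 0 by rewrite eq_complex /= (negbTE by0).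
have := congr1 (fun t : ssec => t y) (congr1 T (frame_expand hb s)).
rewrite Tsum ssec_sum !TZ /= => h.
apply: (scalerI bc); apply: (scalerI bc); rewrite h.
rewrite -scalemxAl (scalerA (b y)%:C (b y)%:C^-1) mulfV // scale1r -mulmxA.
have -> : (\matrix_(k, l) T (fsec hb l) y k 0) *m (triv i y *m s y) =
    \sum_l (triv i y *m s y) l 0 *: T (fsec hb l) y.
  apply/colP => k; rewrite !mxE summxE; apply: eq_bigr => l _.
  by rewrite !mxE mulrC.
rewrite scaler_sumr; apply: eq_bigr => l _.
by rewrite TZ /= scalerA.
Qed.

(** By [frame_expand] the value of [T s] at a point depends only on the value of [s] there. By
    [sec_span] one explicit formula, from a single frame, describes the matrices at all nearby
    points, whence smoothness. *)
Lemma tensorial_endo : exists a : sendo, forall s, sapp a s = T s.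
Proof.
have ex x : exists A : 'M[R[i]]_(rank E x), forall s : ssec, A *m s x = T s x.
  have [i [b hb [bx ix]]] := triv_bump x.
  by eexists; apply: (tensorial_at hb); rewrite gt_eqF.
pose a x := sval (cid (ex x)).
have aP x (s : ssec) : a x *m s x = T s x by rewrite /a; case: cid.
have sa : endo_smooth a.
  move=> x j jx.
  have [b hb bx] := bump_exists (tdom_open j) jx.
  have bn : b x != 0 by rewrite gt_eqF.
  (* The formula of [tensorial_at], read in the trivialization: its columns are the images of the
     frame sections. *)
  apply: (cmx_near (A := fun y => (b y)%:C^-1 *:
    \matrix_(k, l) (triv j y *m T (fsec hb l) y) k 0)).
    near=> y; have jy : tdom j y by near: y; exact: tdom_near.
    have yn : b y != 0 by near: y; apply: sm_neq0 => //; exact: bump_sm hb.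
    have -> : a y = (b y)%:C^-1 *: ((\matrix_(k, l) T (fsec hb l) y k 0) *m triv j y).
      by apply: sec_span => s; rewrite aP tensorial_at.
    rewrite -scalemxAr -scalemxAl; congr (_ *: _).
    rewrite -!mulmxA trivVK // mulmx1; apply/matrixP => k l; rewrite !mxE.
    by apply: eq_bigr => m _; rewrite !mxE.
  apply: cmxZ.
    apply: csmV; first by apply: csm_real; exact: bump_sm hb.
    by rewrite eq_complex /= (negbTE bn).
  move=> k l; apply: csm_ext (ssec_sm (T (fsec hb l)) jx k 0) => y.
  by rewrite [RHS]mxE.
exists (SEndo sa) => s; apply/ssec_eq => x /=; exact: aP.
Unshelve. all: by end_near. Qed.

End Tensorial.

End Sections.

(** * Connections and curvature *)

Section Connection.
Context {R : realType} {n : nat} {M : manifold R n} {E : vbundle M}.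
Variables (D : preconnection E) (hD : is_connection D).
Implicit Types (X Y Z : vfield M) (s t : ssec E) (a b : sendo E).

Definition Dop X s : ssec E := SSec (conn_smooth hD X (ssP s)).

Lemma DopD X s t : Dop X (s + t) = Dop X s + Dop X t.
Proof. by apply/ssec_eq => x /=; exact: (conn_add hD X (ssP s) (ssP t)). Qed.

Lemma DopZ X f s : Dop X (sscale f s) = sscale (sact X f) s + sscale f (Dop X s).
Proof.
apply/ssec_eq => x /=; apply: (conn_leibniz hD X _ (ssP s)).
by apply/csmoothTP; exact: sfP.
Qed.

Lemma Dop0 X : Dop X 0 = 0.
Proof. by have := DopD X 0 0; rewrite addr0 => /esym/eqP; rewrite addrC -subr_eq0 addrK => /eqP. Qed.

Lemma DopN X s : Dop X (- s) = - Dop X s.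
Proof. by apply/eqP; rewrite -subr_eq0 opprK -DopD addNr Dop0. Qed.

Lemma DopB X s t : Dop X (s - t) = Dop X s - Dop X t.
Proof. by rewrite DopD DopN. Qed.

Lemma Dop_combine (f : M -> R) X Y Z s x : smooth_on setT f ->
  (forall g, Z g = f * X g + Y g) ->
  Dop Z s x = (f x)%:C *: Dop X s x + Dop Y s x.
Proof. by move=> hf hZ; apply: (conn_tensorial hD hf hZ (ssP s)). Qed.

Lemma Dop_jacobi X Y Z s : Dop (bracket X (bracket Y Z)) s =
  Dop (bracket (bracket X Y) Z) s + Dop (bracket Y (bracket X Z)) s.
Proof.
apply/ssec_eq => x.
rewrite (Dop_combine _ _ (smooth_cst setT 1) (bracket_jacobi X Y Z)).
by rewrite scale1r.
Qed.

Lemma Dop_vzero s : Dop vfzero s = 0.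
Proof.
apply/ssec_eq => x.
have h g : (@vfzero R n M) g = (1 : M -> R) * vfzero g + vfzero g by rewrite mulr0 addr0.
have := Dop_combine s x (smooth_cst setT 1) h; rewrite scale1r => /esym/eqP.
by rewrite addrC -subr_eq0 addrK => /eqP.
Qed.

Lemma Dop_anti X Y s : Dop (bracket X Y) s = - Dop (bracket Y X) s.
Proof.
apply/ssec_eq => x.
rewrite (Dop_combine _ _ (smooth_cst setT (-1)) (bracket_anti X Y)) Dop_vzero.
by rewrite addr0 rmorphN1 scaleN1r.
Qed.

(** The covariant derivative of an endomorphism is a commutator, in which the two terms containing
    the derivative of [f] cancel. *)
Lemma delta_ex X a : exists d : sendo E, forall s,
  sapp d s = Dop X (sapp a s) - sapp a (Dop X s).
Proof.
apply: tensorial_endo => [s t|f s].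
  by rewrite sappD !DopD sappD; abelu.
rewrite sappZ !DopZ.
apply/ssec_eq => x /=; rewrite mulmxDr -!scalemxAr scalerBr; abelu.
Qed.

Definition delta X a : sendo E := sval (cid (delta_ex X a)).

Lemma deltaE X a s : sapp (delta X a) s = Dop X (sapp a s) - sapp a (Dop X s).
Proof. by rewrite /delta; case: cid => d /= ->. Qed.

Lemma deltaB X : {morph delta X : a b / a - b}.
Proof.
move=> a b; apply/sapp_inj => s.
by rewrite sappBl !deltaE !sappBl DopB; abelu.
Qed.

Lemma deltaM X a b : delta X (a * b) = delta X a * b + a * delta X b.
Proof.
apply/sapp_inj => s.
by rewrite sappDl !sappM !deltaE !sappM sappB; abelu.
Qed.

Lemma curv_ex X Y : exists d : sendo E, forall s,
  sapp d s = Dop X (Dop Y s) - Dop Y (Dop X s) - Dop (bracket X Y) s.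
Proof.
apply: tensorial_endo => [s t|f s]; first by rewrite !DopD; abelu.
rewrite !DopZ !DopD !DopZ sact_br; apply/ssec_eq => x /=.
rewrite !scalerBr scalerDl scaleNr; abelu.
Qed.

Definition curv X Y : sendo E := sval (cid (curv_ex X Y)).

Lemma curvE X Y s : sapp (curv X Y) s =
  Dop X (Dop Y s) - Dop Y (Dop X s) - Dop (bracket X Y) s.
Proof. by rewrite /curv; case: cid => d /= ->. Qed.

Definition Fform : lform (vfield M) (sendo E) := form2 curv.

Lemma Fform_parity : parity false Fform. Proof. exact: parity_form2. Qed.

(** The second Bianchi identity. On a section it expands into iterated covariant derivatives that
    cancel in pairs, up to the terms with nested brackets, where the Jacobi identity enters. *)
Lemma dd_Fform : dd (@bracket R n M) delta Fform = 0.
Proof.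
apply: dd_form2; first exact: deltaB.
move=> X Y Z; apply/sapp_inj => s.
rewrite sapp0l !(sappDl, sappBl, sappNl) !deltaE !curvE !DopB.
rewrite (Dop_anti X (bracket Y Z)) (Dop_anti Y (bracket X Z)).
have := Dop_jacobi X Y Z s.
rewrite (Dop_anti X (bracket Y Z)) (Dop_anti Y (bracket X Z)) => J.
have -> : Dop (bracket (bracket X Y) Z) s =
   - Dop (bracket (bracket Y Z) X) s + Dop (bracket (bracket X Z) Y) s.
  by rewrite J; abelu.
abelu.
Qed.

Lemma curvatureE x l : curvature D x l = Fform l x.
Proof.
case: l => [|X [|Y [|? ?]]] //=.
by apply: endo_atE => s; have := congr1 (fun t : ssec E => t x) (curvE X Y s).
Qed.

(** The expansion of [a e_l] in a cut-off frame is differentiated, and the diagonal coordinates are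
    summed. The connection coefficients [C] occur on both sides as the trace of a product with [a],
    and cancel. *)
Lemma strace_delta X a : strace (delta X a) = sact X (strace a).
Proof.
apply/sfun_eq/funext => x /=.
have [i [b hb [bx ix]]] := triv_bump E x.
have bc := realc_neq0 bx.
set e := fsec hb; set bb := sbump hb.
pose b2 : sfun M := sfmul bb bb.
have b2E y : b2 y = (b y)%:C * (b y)%:C by [].
have trI (c : sendo E) y : tdom i y ->
    \sum_l (triv i y *m sapp c (e l) y) l 0 = (b y)%:C * \tr (c y).
  move=> iy; have -> : \tr (c y) = \tr (triv i y *m c y *m trivV i y).
    by rewrite mxtrace_mulC mulmxA trivK // mul1mx.
  rewrite /mxtrace mulr_sumr; apply: eq_bigr => l _.
  by rewrite /= -!scalemxAr mxE !mulmxA -colE mxE.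
pose g k l : sfun M := scoef hb (sapp a (e l)) k.
have gtr y : \sum_l g l l y = b2 y * \tr (a y).
  have [iy|niy] := pselect (tdom i y); last first.
    by rewrite b2E (bump_out hb) // mul0r mul0r big1 // => l _ /=; rewrite (bump_out hb) // mul0r.
  by rewrite b2E /g /= -mulr_sumr trI // mulrA.
pose C k l := (triv i x *m Dop X (e l) x) k 0.
have gE k l : g k l x = b2 x * (triv i x *m a x *m trivV i x) k l.
  by rewrite b2E /g /= -!scalemxAr mxE !mulmxA -colE [in LHS]mxE mulrA.
(* The coordinate of index [l] of the derivative of [b ^ 2 a e_l = sum_k g_kl e_k]. *)
have H l : sact X b2 x * (triv i x *m sapp a (e l) x) l 0 +
    b2 x * (triv i x *m Dop X (sapp a (e l)) x) l 0 =
    sact X (g l l) x * (b x)%:C + \sum_k g k l x * C l k.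
  have := congr1 (Dop X) (frame_expand hb (sapp a (e l))).
  have -> : sscale (sbump hb) (sscale (sbump hb) (sapp a (e l))) = sscale b2 (sapp a (e l)).
    by apply/ssec_eq => y /=; rewrite scalerA.
  have -> : Dop X (\sum_l0 sscale (scoef hb (sapp a (e l)) l0) (fsec hb l0)) =
     \sum_k (sscale (sact X (g k l)) (e k) + sscale (g k l) (Dop X (e k))).
    rewrite (big_morph (Dop X) (DopD X) (Dop0 X)); apply: eq_bigr => k _.
    by rewrite DopZ.
  pose phi (v : 'cV[R[i]]_(rank E x)) : R[i] := (triv i x *m v) l 0.
  have pD u v : phi (u + v) = phi u + phi v by rewrite /phi mulmxDr mxE.
  have p0 : phi 0 = 0 by rewrite /phi mulmx0 mxE.
  have pZ c v : phi (c *: v) = c * phi v by rewrite /phi -scalemxAr mxE.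
  have pS (f : sfun M) t : phi (sscale f t x) = f x * phi (t x) by exact: pZ.
  rewrite DopZ => /(congr1 (fun t : ssec E => phi (t x))).
  rewrite ssecD ssec_sum (big_morph phi pD p0) pD !pS => ->.
  under eq_bigr => k _ do rewrite ssecD pD !pS.
  rewrite big_split /=; congr (_ + _).
  rewrite (bigD1 l) //= big1 ?addr0 => [|k kl].
    congr (_ * _).
    by rewrite pZ /phi mulmxA trivVK // mul1mx mxE !eqxx mulr1.
  by rewrite pZ /phi mulmxA trivVK // mul1mx mxE eq_sym (negbTE kl) mulr0 mulr0.
have S1 : \sum_l (triv i x *m Dop X (sapp a (e l)) x) l 0 =
    (b x)%:C * \tr (delta X a x) + \sum_l (triv i x *m sapp a (Dop X (e l)) x) l 0.
  rewrite -(trI _ _ ix) -big_split; apply: eq_bigr => l _.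
  have A : Dop X (sapp a (e l)) = sapp (delta X a) (e l) + sapp a (Dop X (e l)).
    by rewrite deltaE subrK.
  by rewrite A ssecD mulmxDr mxE.
have S2 : \sum_l (triv i x *m sapp a (Dop X (e l)) x) l 0 =
    \sum_l \sum_k (triv i x *m a x *m trivV i x) k l * C l k.
  rewrite exchange_big; apply: eq_bigr => l _.
  rewrite (_ : triv i x *m (a x *m _) =
    (triv i x *m a x *m trivV i x) *m (triv i x *m Dop X (e l) x)).
    by rewrite mxE.
  by rewrite -!mulmxA (mulmxA (trivV i x)) trivK // mul1mx.
have S3 : \sum_l (sact X b2 x * (triv i x *m sapp a (e l) x) l 0 +
    b2 x * (triv i x *m Dop X (sapp a (e l)) x) l 0) =
    \sum_l (sact X (g l l) x * (b x)%:C + \sum_k g k l x * C l k).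
  by apply: eq_bigr => l _; exact: H.
have S4 : \sum_l sact X (g l l) x = sact X b2 x * \tr (a x) + b2 x * sact X (strace a) x.
  transitivity (cvf X (fun y => b2 y * \tr (a y)) x); last first.
    exact: (cvf_fM X x (sfP b2) (sfP (strace a))).
  transitivity (cvf X (fun y => \sum_l g l l y) x).
    by rewrite cvf_sum // => l; exact: sfP.
  by congr (cvf X _ x); apply/funext.
have S5 : \sum_l \sum_k g k l x * C l k =
    b2 x * \sum_l \sum_k (triv i x *m a x *m trivV i x) k l * C l k.
  rewrite mulr_sumr; apply: eq_bigr => l _; rewrite mulr_sumr; apply: eq_bigr => k _.
  by rewrite gE mulrA.
rewrite !big_split -!mulr_sumr -mulr_suml S1 S2 S4 S5 trI // in S3.
(* Three factors of the bump: two from the expansion and one from the frame section. *)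
apply: (mulfI bc); apply: (mulfI bc); apply: (mulfI bc).
move: S3; rewrite b2E; set u := (b x)%:C; set w := \sum_l _.
set v := sact X b2 x; set t := \tr _; set d := \tr _; set q := sact X _ _ => S3.
apply: (@addrI _ (v * (u * t) + u * u * w)).
transitivity (v * (u * t) + u * u * (u * d + w)); first by ring.
have -> : v * (u * t) + u * u * (u * d + w) = (v * t + u * u * q) * u + u * u * w by exact: S3.
by rewrite -[cvf _ _ _]/q; ring.
Qed.

End Connection.

(** * Differential forms *)

Section Shuffle.
Context {R : realType} {n : nat} {M : manifold R n} {E : vbundle M}.
Variable x : M.
Local Notation L := (lform (vfield M) 'M[R[i]]_(rank E x)).
Implicit Types A B : L.

Lemma big_tuple_cons (V : zmodType) k (F : k.+1.-tuple bool -> V) :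
  \sum_(m : k.+1.-tuple bool) F m =
  \sum_(m : k.-tuple bool) F [tuple of true :: m] +
  \sum_(m : k.-tuple bool) F [tuple of false :: m].
Proof.
rewrite (reindex (fun p : bool * k.-tuple bool => [tuple of p.1 :: p.2])); last first.
  apply: onW_bij; exists (fun m => (thead m, [tuple of behead m])).
    by case=> b m; congr pair; apply/val_inj.
  by move=> m; apply/val_inj; case: m => -[].
rewrite -(pair_big xpredT xpredT (fun (b : bool) (m : k.-tuple bool) => F [tuple of b :: m])) /=.
by rewrite big_bool.
Qed.

(** A first entry that is not selected is overtaken by every selected one. *)
Lemma inversions_cons b (m : bitseq) :
  inversions (b :: m) = ((~~ b) * count id m + inversions m)%N.
Proof.
rewrite /inversions big_mkcond /= big_ord_recl /=.
rewrite (_ : (if _ then _ else _) = 0)%N ?add0n; last by case: ifP.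
transitivity (\sum_(i < size m | nth false m i) (~~ b + count negb (take i m)))%N.
  by rewrite [RHS]big_mkcond /=; apply: eq_bigr => i _; rewrite add0n; case: ifP.
rewrite big_split /=; congr addn.
have -> : count id m = (\sum_(i < size m | nth false m i) 1)%N.
  by rewrite sum1_card -sum1_count (big_nth false) big_mkord -sum1_card.
by rewrite big_distrr /=; apply: eq_bigr => i _; rewrite muln1.
Qed.

(** Splitting the shuffles according to whether the first argument is selected gives the recursion
    of [bmul]; the extra inversions are the sign in [eps]. *)
Lemma mul_endformE A B l : mul_endform A B l = (A * B : L) l.
Proof.
rewrite lformME /mul_endform.
elim: l A B => [|X l IH] A B.
  rewrite (big_pred1 [tuple]) => [|m]; last by rewrite [m]tuple0 /= eqxx.
  by rewrite /= /inversions big_ord0 expr0 scale1r.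
rewrite [LHS](big_tuple_cons (fun m => (-1) ^+ inversions m *:
  (A (mask m (X :: l)) *m B (mask (map negb m) (X :: l))))) /= -!IH.
congr (_ + _); apply: eq_bigr => m _; rewrite inversions_cons /= ?mul0n ?add0n //.
have -> : eps A (mask m l) = (-1) ^+ count id m *: A (mask m l).
  rewrite /eps size_mask ?size_tuple // -signr_odd.
  by case: (odd _); rewrite ?expr0 ?expr1 ?scale1r ?scaleN1r.
by rewrite mul1n addnC exprD -scalerA -scalemxAl.
Qed.

Lemma pow_endformE A k : pow_endform A k = A ^+ k.
Proof.
elim: k => [|k IH] //; rewrite exprS -IH.
by apply/funext => l; rewrite -mul_endformE.
Qed.

Lemma lmulZr A B (c : R[i]) l : (A * ((fun k => c *: B k) : L)) l = c *: (A * B : L) l.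
Proof.
rewrite !lformME; elim: l A B => [|X l IH] A B /=; first exact/esym/scalemxAr.
by rewrite scalerDr -!IH.
Qed.

Lemma lmulZl A B (c : R[i]) l : (((fun k => c *: A k) : L) * B) l = c *: (A * B : L) l.
Proof.
rewrite !lformME; elim: l A B => [|X l IH] A B /=; first exact/esym/scalemxAl.
rewrite scalerDr -(IH (iota_ X A)) -(IH (eps A)). congr (_ + _).
by apply: bmul_eq => // k _; rewrite /eps; case: ifP => _; rewrite ?scalerN.
Qed.

(** Any cut-off [N] beyond the number of arguments gives the same sum, so one [N] can serve lists of
    several lengths. *)
Lemma exp_endformE A c N l : A [::] = 0 -> (size l < N)%N ->
  exp_endform c A l = \sum_(k < N) (c ^+ k / k`!%:R) *: (A ^+ k : L) l.
Proof.
move=> A0 lN; rewrite /exp_endform (big_ord_widen N (fun k => (c ^+ k / k`!%:R) *: pow_endform A k l)) //.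
rewrite big_mkcond /=; apply: eq_bigr => k _; rewrite pow_endformE.
by rewrite ltnS; case: leqP => // kl; rewrite lexp_supp ?scaler0.
Qed.

Lemma trace_exp A B c N l : A [::] = 0 -> (size l < N)%N ->
  \tr (mul_endform B (exp_endform c A) l) =
  \sum_(k < N) (c ^+ k / k`!%:R) * \tr ((B * A ^+ k : L) l).
Proof.
move=> A0 lN; rewrite mul_endformE.
pose Q (k : 'I_N) : L := fun m => (c ^+ k / k`!%:R) *: (A ^+ k : L) m.
have -> : (B * (exp_endform c A : L)) l = (B * \sum_(k < N) Q k) l.
  apply: lmul_eq => // m ml.
  by rewrite (exp_endformE c A0 (leq_ltn_trans ml lN)) lform_sumE.
rewrite mulr_sumr lform_sumE raddf_sum; apply: eq_bigr => k _.
by rewrite /Q lmulZr /= mxtraceZ.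
Qed.

Lemma trace_exp1 A c N l : A [::] = 0 -> (size l < N)%N ->
  \tr (exp_endform c A l) = \sum_(k < N) (c ^+ k / k`!%:R) * \tr ((A ^+ k : L) l).
Proof.
move=> A0 lN; rewrite (exp_endformE _ A0 lN) raddf_sum; apply: eq_bigr => k _.
by rewrite /= mxtraceZ.
Qed.

(** Vector fields differentiate smooth endomorphisms, whereas the path parameter is differentiated
    in matrices at a fixed point; this ring morphism mediates. *)
Definition ev (w : seq (vfield M) -> sendo E) : L := fun l => w l x.

Lemma evM (u v : lform (vfield M) (sendo E)) : ev (u * v) = ev u * ev v.
Proof.
apply/funext => l; rewrite /ev !lformME.
by rewrite (@bmul_map _ _ _ _ _ _ _ _ (fun a b : 'M[R[i]]_(rank E x) => a * b) (fun a : sendo E => a x) (fun a : sendo E => a x)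
  (fun a : sendo E => a x)).
Qed.

Lemma evX (u : lform (vfield M) (sendo E)) k : ev (u ^+ k) = ev u ^+ k.
Proof.
elim: k => [|k IH]; last by rewrite !exprS evM IH.
by apply/funext => -[].
Qed.

End Shuffle.

(** * Alternation and linearity at a point *)

Section Alternating.
Variable T : Type.
Section One.
Variable V : zmodType.
Implicit Types w : seq T -> V.

(** Adjacent repetitions suffice: antisymmetry moves equal arguments next to each other, and
    adjacency is what products preserve by a short induction. *)
Definition alt1 w := forall X l1 l2, w (l1 ++ X :: X :: l2) = 0.
Definition anti w := forall X Y l1 l2, w (l1 ++ X :: Y :: l2) = - w (l1 ++ Y :: X :: l2).

Lemma anti_move w : anti w -> forall X l1 l2 l3,
  w (l1 ++ X :: l2 ++ l3) = if odd (size l2) then - w (l1 ++ l2 ++ X :: l3)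
                            else w (l1 ++ l2 ++ X :: l3).
Proof.
move=> aw X l1 l2; elim: l2 l1 => [|Y l2 IH] l1 l3 //=.
rewrite aw -cat_rcons IH cat_rcons /=.
by case: (odd _) => //=; rewrite opprK.
Qed.

Lemma anti_alt w : anti w -> alt1 w -> forall X l1 l2 l3,
  w (l1 ++ X :: l2 ++ X :: l3) = 0.
Proof.
move=> aw hw X l1 l2 l3; rewrite anti_move //.
by rewrite catA hw oppr0 if_same.
Qed.

End One.

(** In a double contraction with [X] the mixed terms cancel, because [eps] anticommutes with
    contraction. *)
Lemma alt1_mul (A : pzRingType) (u v : lform T A) : alt1 u -> alt1 v -> alt1 (u * v).
Proof.
move=> hu hv X l1; elim: l1 u v hu hv => [|Y l1 IH] u v hu hv l2.
  rewrite lformME /=.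
  have -> : iota_ X (iota_ X u) = 0 by apply/funext => k; exact: (hu X [::]).
  have -> : iota_ X (iota_ X v) = 0 by apply/funext => k; exact: (hv X [::]).
  rewrite eps_iota.
  have mBl (w : A) : {morph (fun u : A => u * w) : a b / a - b} by move=> a b; rewrite mulrBl.
  have mBr (w : A) : {morph (fun v : A => w * v) : a b / a - b} by move=> a b; rewrite mulrBr.
  by rewrite bmul0l // bmul0r // bmulNl // add0r addr0 addrN.
have := IH (iota_ Y u) v _ hv l2; have := IH (eps u) (iota_ Y v) _ _ l2.
rewrite !lformME cat_cons /= => -> => [->|X' l' l''|X' l' l'']; rewrite ?addr0 //.
- by move=> X' l' l''; exact: (hu X' (Y :: l')).
- by rewrite /eps hu oppr0 if_same.
- exact: (hv X' (Y :: l')).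
Qed.

End Alternating.

Section LinearForms.
Context {R : realType} {n : nat} {M : manifold R n}.
Variable x : M.

Definition lin_at (V : lmodType R[i]) (w : seq (vfield M) -> V) :=
  forall (f : M -> R) (X Y Z : vfield M) (l1 l2 : seq (vfield M)), smooth_on setT f ->
    (forall g, Z g = f * X g + Y g) ->
    w (l1 ++ Z :: l2) = (f x)%:C *: w (l1 ++ X :: l2) + w (l1 ++ Y :: l2).

(** Polarization, with [vfadd X Y] as the sum. *)
Lemma lin_alt_anti (V : lmodType R[i]) (w : seq (vfield M) -> V) :
  lin_at w -> alt1 w -> anti w.
Proof.
move=> lw aw X Y l1 l2.
have L U W k1 k2 : w (k1 ++ vfadd U W :: k2) = w (k1 ++ U :: k2) + w (k1 ++ W :: k2).
  by rewrite (lw _ U W _ k1 k2 (smooth_cst setT 1) (vfaddE U W)) scale1r.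
have := aw (vfadd X Y) l1 l2.
rewrite L -(cat_rcons X) -(cat_rcons Y) !L !cat_rcons !aw add0r addr0 => /eqP.
by rewrite addr_eq0 => /eqP.
Qed.

Lemma lin_at_mul r (u v : lform (vfield M) 'M[R[i]]_r) :
  lin_at u -> lin_at v -> lin_at (u * v).
Proof.
move=> hu hv f X Y Z l1 l2 hf hZ.
have mBl (w : 'M[R[i]]_r) : {morph (fun u : 'M[R[i]]_r => u * w) : a b / a - b} by move=> a b; rewrite mulrBl.
have mBr (w : 'M[R[i]]_r) : {morph (fun v : 'M[R[i]]_r => w * v) : a b / a - b} by move=> a b; rewrite mulrBr.
elim: l1 u v hu hv => [|W l1 IH] u v hu hv; rewrite !lformME.
  have Zl (a b : lform (vfield M) 'M[R[i]]_r) l : bmul (fun a b => a * b) l (fun k => (f x)%:C *: a k) b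
     = (f x)%:C *: bmul (fun a b : 'M[R[i]]_r => a * b) l a b.
    elim: l a b => [|U l IH] a b /=; first exact/esym/scalemxAl.
    rewrite scalerDr -(IH (iota_ U a)) -(IH (eps a)); congr (_ + _).
    by apply: bmul_eq => // k _; rewrite /eps; case: ifP => _; rewrite ?scalerN.
  have Zr (a b : lform (vfield M) 'M[R[i]]_r) l : bmul (fun a b => a * b) l a (fun k => (f x)%:C *: b k)
     = (f x)%:C *: bmul (fun a b : 'M[R[i]]_r => a * b) l a b.
    elim: l a b => [|U l IH] a b /=; first exact/esym/scalemxAr.
    by rewrite scalerDr -!IH.
  rewrite /=.
  have -> : iota_ Z u = (fun k => (f x)%:C *: iota_ X u k) + iota_ Y u.
    by apply/funext => k; exact: (hu _ _ _ _ [::]).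
  have -> : iota_ Z v = (fun k => (f x)%:C *: iota_ X v k) + iota_ Y v.
    by apply/funext => k; exact: (hv _ _ _ _ [::]).
  by rewrite bmulDl // bmulDr // Zl Zr scalerDr; abelu.
rewrite !cat_cons /=.
have h1 : lin_at (iota_ W u) by move=> f' X' Y' Z' k1 k2; exact: (hu f' X' Y' Z' (W :: k1)).
have h2 : lin_at (iota_ W v) by move=> f' X' Y' Z' k1 k2; exact: (hv f' X' Y' Z' (W :: k1)).
have h3 : lin_at (eps u).
  move=> f' X' Y' Z' k1 k2 hf' hZ'; rewrite /eps !size_cat /= (hu _ _ _ _ _ _ hf' hZ').
  by case: ifP => _ //; rewrite opprD scalerN.
have := IH _ _ h1 hv; have := IH _ _ h3 h2; rewrite !lformME => -> ->.
by rewrite scalerDr; abelu.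
Qed.

Lemma lin_at_one r : lin_at (1 : lform (vfield M) 'M[R[i]]_r).
Proof.
move=> f X Y Z l1 l2 _ _.
have h U : (1 : lform (vfield M) 'M[R[i]]_r) (l1 ++ U :: l2) = 0 by case: l1.
by rewrite !h scaler0 addr0.
Qed.

Lemma alt1_one r : alt1 (1 : lform (vfield M) 'M[R[i]]_r).
Proof. by move=> X [|? ?] l2. Qed.

Lemma lin_at_exp r (u : lform (vfield M) 'M[R[i]]_r) k : lin_at u -> lin_at (u ^+ k).
Proof.
by move=> hu; elim: k => [|k IH]; [exact: lin_at_one | rewrite exprS; exact: lin_at_mul].
Qed.
Lemma alt1_exp r (u : lform (vfield M) 'M[R[i]]_r) k : alt1 u -> alt1 (u ^+ k).
Proof.
by move=> hu; elim: k => [|k IH]; [exact: alt1_one | rewrite exprS; exact: alt1_mul].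
Qed.

Definition form_at (V : lmodType R[i]) (w : seq (vfield M) -> V) := lin_at w /\ alt1 w.

Lemma form_at_mul r (u v : lform (vfield M) 'M[R[i]]_r) :
  form_at u -> form_at v -> form_at (u * v).
Proof. by move=> [u1 u2] [v1 v2]; split; [exact: lin_at_mul|exact: alt1_mul]. Qed.
Lemma form_at_exp r (u : lform (vfield M) 'M[R[i]]_r) k : form_at u -> form_at (u ^+ k).
Proof. by move=> [u1 u2]; split; [exact: lin_at_exp|exact: alt1_exp]. Qed.

Lemma form_at_tr r (u : lform (vfield M) 'M[R[i]]_r) : form_at u ->
  form_at (fun l => \tr (u l) : R[i]^o).
Proof.
move=> [u1 u2]; split=> [f X Y Z l1 l2 hf hZ|X l1 l2].
  by rewrite (u1 _ _ _ _ _ _ hf hZ) raddfD /= mxtraceZ.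
by rewrite u2 raddf0.
Qed.

End LinearForms.

(** * The invariant formula for the exterior derivative and classes modulo exact forms *)

Section ExteriorDerivative.
Context {R : realType} {n : nat} {M : manifold R n}.
Implicit Types (X Y Z : vfield M) (l : seq (vfield M)).
Local Notation br := (@bracket R n M).
Local Notation d0 := (@vfzero R n M).

Lemma is_formP (w : preform (M := M)) : is_form w <->
  (forall l, csmT (w l)) /\ (forall x, form_at x (fun l => w l x : R[i]^o)).
Proof.
split=> [[ws wl wa]|[ws wf]].
  split=> [l|x]; first exact/csmoothTP.
  split=> [f X Y Z l1 l2 hf hZ|X l1 l2]; first exact: wl.
  by have := wa X l1 [::] l2; rewrite /= => ->.
split=> [l|f X Y Z l1 l2 hf hZ x|X l1 l2 l3].
- by apply/csmoothTP; exact: ws.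
- exact: ((wf x).1 f X Y Z l1 l2 hf hZ).
- apply/funext => x; have [h1 h2] := wf x.
  exact: (@anti_alt _ _ (fun l => w l x : R[i]^o) (lin_alt_anti h1 h2) h2 X l1 l2 l3).
Qed.

(** Antisymmetry brings each bracket to the front of the list, at the cost of the sign
    [(-1) ^+ j]. *)
Lemma lie_sum (w : seq (vfield M) -> sfun M) X l x : anti w ->
  lie br (@sact R n M) X w l x = cvf X (w l) x -
    \sum_(j < size l) (-1) ^+ j * w (br X (nth d0 l j) :: del_nth j l) x.
Proof.
elim: l w => [|Y l IH] w aw; first by rewrite big_ord0 subr0.
have aw' : anti (iota_ Y w) by move=> U V l1 l2; exact: (aw U V (Y :: l1)).
rewrite [lie _ _ _ _ _]/(lie br (@sact R n M) X (iota_ Y w) l - w (br X Y :: l)).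
rewrite sfunB IH // big_ord_recl expr0 mul1r.
rewrite {2}/del_nth [take _ _]/= [drop _ _]/= drop0 [nth _ _ _]/=.
have -> : \sum_(i < size l) (-1) ^+ fintype.lift ord0 i *
    w (br X (nth d0 (Y :: l) (fintype.lift ord0 i)) :: del_nth (fintype.lift ord0 i) (Y :: l)) x =
    \sum_(j < size l) (-1) ^+ j * iota_ Y w (br X (nth d0 l j) :: del_nth j l) x.
  apply: eq_bigr => j _.
  by rewrite /iota_ (aw _ _ [::]) sfunN /bump /= exprS mulN1r mulrNN.
by rewrite /iota_ cat0s; abelu.
Qed.

(** Splitting off the first argument [X] of the invariant formula: the terms where [X]
    differentiates or is bracketed make up the Lie derivative, the others are minus the formula for
    the contracted form. *)
Lemma dform_dd (w : seq (vfield M) -> sfun M) l x : anti w ->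
  dform (fun l => w l) l x = dd br (@sact R n M) w l x.
Proof.
have E (v : seq (vfield M) -> sfun M) k : dform (fun l => v l) k x =
  \sum_(i < size k) (-1) ^+ i * cvf (nth d0 k i) (v (del_nth i k)) x +
  \sum_(i < size k) \sum_(j < size k | (i < j)%N) (-1) ^+ (i + j) *
     v (br (nth d0 k i) (nth d0 k j) :: del_nth i (del_nth j k)) x.
  rewrite /dform; congr (_ + _); apply: eq_bigr => i _; rewrite (tnth_nth d0) //.
  by apply: eq_bigr => j _; rewrite (tnth_nth d0).
elim: l w => [|X l IH] w aw; first by rewrite E /= !big_ord0 addr0.
have aw' : anti (iota_ X w) by move=> U V l1 l2; exact: (aw U V (X :: l1)).
rewrite [dd _ _ _ _]/(lie br (@sact R n M) X w l - dd br (@sact R n M) (iota_ X w) l).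
rewrite sfunB -IH // lie_sum // !E /=.
rewrite !big_ord_recl /= expr0 mul1r {1}/del_nth /= drop0 -!addrA; congr (_ + _).
rewrite opprD addrCA; congr (_ + _).
  rewrite big_mkcond big_ord_recl /= add0r -sumrN; apply: eq_bigr => j _.
  by rewrite /bump /= add0n add1n exprS mulN1r mulNr /del_nth /= drop0.
congr (_ + _).
  rewrite -sumrN; apply: eq_bigr => j _.
  by rewrite /bump /= add1n exprS mulN1r mulNr.
rewrite -sumrN; apply: eq_bigr => i _.
rewrite big_mkcond big_ord_recl /= add0r [in RHS]big_mkcond -sumrN; apply: eq_bigr => j _.
rewrite /bump /= !add1n ltnS; case: ifP => _; last by rewrite oppr0.
rewrite addSn addnS !exprS !mulN1r opprK /iota_ (aw _ X [::]) sfunN mulrN.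
by [].
Qed.

Section Sform.
Variables (w : preform (M := M)) (hw : is_form w).

Definition sform : seq (vfield M) -> sfun M :=
  fun l => SFun (((is_formP w).1 hw).1 l).

Lemma sform_anti : anti sform.
Proof.
move=> X Y l1 l2; apply/sfun_eq/funext => x; rewrite sfunN /=.
have [h1 h2] := ((is_formP w).1 hw).2 x.
exact: (lin_alt_anti h1 h2).
Qed.

Lemma sform_lin : lie_linear br sform.
Proof.
move=> l1 l2 X Y Z; apply/sfun_eq/funext => x; rewrite sfunD /=.
have [h1 _] := ((is_formP w).1 hw).2 x.
have := h1 _ _ _ _ l1 l2 (smooth_cst setT 1) (bracket_jacobi X Y Z).
by rewrite scale1r.
Qed.

Lemma dform_sform l x : dform w l x = dd br (@sact R n M) sform l x.
Proof. exact: (dform_dd l x sform_anti). Qed.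

End Sform.

(** Transferred from [dd_dd]. In its use [dform w] is a difference of two forms, which supplies the
    second hypothesis. *)
Lemma dform_dform (w : preform (M := M)) : is_form w -> is_form (dform w) ->
  dform (dform w) = 0.
Proof.
move=> hw hdw; apply/funext => l; apply/funext => x; rewrite (dform_sform hdw).
have -> : sform hdw = dd br (@sact R n M) (sform hw).
  by apply/funext => k; apply/sfun_eq/funext => y; rewrite -dform_sform.
by rewrite dd_dd //; [exact: sactB | exact: sact_br | exact: sform_lin].
Qed.

Lemma is_formN (w : preform (M := M)) : is_form w -> is_form (- w).
Proof. by move=> hw; rewrite -[- w]sub0r; apply: is_formB => //; exact: is_form0. Qed.

Lemma dformN (w : preform (M := M)) : is_form w -> dform (- w) = - dform w.
Proof. by move=> hw; rewrite -[- w]sub0r dformB ?dform0 ?sub0r //; exact: is_form0. Qed.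

Lemma dformD (w v : preform (M := M)) : is_form w -> is_form v ->
  dform (w + v) = dform w + dform v.
Proof.
by move=> hw hv; rewrite -[v]opprK dformB ?dformN ?opprK //; exact: is_formN.
Qed.

Lemma odd_formP (w : oform (M := M)) : odd_form (oform_val w).
Proof. exact/asboolP/(oformP w). Qed.

Lemma odd_formB (p q : preform (M := M)) : odd_form p -> odd_form q -> odd_form (p - q).
Proof. by move=> [p1 p2] [q1 q2]; split; [exact: is_formB|exact: of_parityB]. Qed.
Lemma even_formB (p q : preform (M := M)) : even_form p -> even_form q -> even_form (p - q).
Proof. by move=> [p1 p2] [q1 q2]; split; [exact: is_formB|exact: of_parityB]. Qed.
Lemma odd_form0 : odd_form (0 : preform (M := M)).
Proof. by split; [exact: is_form0|]. Qed.
Lemma even_form0 : even_form (0 : preform (M := M)).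
Proof. by split; [exact: is_form0|]. Qed.

Definition mkoform (p : preform (M := M)) (hp : odd_form p) : oform (M := M) :=
  Oform (asboolT hp : p \in oform_pred).

Lemma class_ofE (p : preform (M := M)) (hp : odd_form p) : class_of p = oclass (mkoform hp).
Proof.
rewrite /class_of; congr oclass; apply: val_inj; rewrite val_insubd /=.
by rewrite (asboolT hp : p \in oform_pred).
Qed.

Lemma class_of_val (w : oform (M := M)) : class_of (oform_val w) = oclass w.
Proof. by rewrite (class_ofE (odd_formP w)); congr oclass; apply: val_inj. Qed.

Lemma oclass_eq (w v : oform (M := M)) : oclass w = oclass v <->
  exists2 u, even_form u & oform_val w - oform_val v = dform u.
Proof.
rewrite /oclass; split=> [/eqP|h].
  by rewrite -Quotient.idealrBE => /asboolP.
by apply/eqP; rewrite -Quotient.idealrBE; apply/asboolP.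
Qed.

Lemma class_of_eq (p q u : preform (M := M)) : odd_form p -> odd_form q -> even_form u ->
  p - q = dform u -> class_of p = class_of q.
Proof.
by move=> hp hq hu e; rewrite (class_ofE hp) (class_ofE hq); apply/oclass_eq; exists u.
Qed.

Lemma class_ofB (p q : preform (M := M)) : odd_form p -> odd_form q ->
  class_of (p - q) = class_of p - class_of q.
Proof.
move=> hp hq; rewrite (class_ofE hp) (class_ofE hq) (class_ofE (odd_formB hp hq)).
by rewrite /oclass -raddfB /=; congr (\pi_ _ _); apply: val_inj.
Qed.

Lemma class_of0 : class_of (0 : preform (M := M)) = 0.
Proof. by have := class_ofB odd_form0 odd_form0; rewrite !subrr. Qed.

Lemma class_ofN (p : preform (M := M)) : odd_form p -> class_of (- p) = - class_of p.
Proof. by move=> hp; rewrite -[- p]sub0r class_ofB ?class_of0 ?sub0r //; exact: odd_form0. Qed.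

Lemma odd_formN (p : preform (M := M)) : odd_form p -> odd_form (- p).
Proof. by move=> hp; rewrite -[- p]sub0r; apply: odd_formB => //; exact: odd_form0. Qed.
Lemma odd_formD (p q : preform (M := M)) : odd_form p -> odd_form q -> odd_form (p + q).
Proof. by move=> hp hq; rewrite -[q]opprK; apply: odd_formB => //; exact: odd_formN. Qed.

Lemma class_ofD (p q : preform (M := M)) : odd_form p -> odd_form q ->
  class_of (p + q) = class_of p + class_of q.
Proof.
move=> hp hq; rewrite -[q in LHS]opprK class_ofB ?class_ofN ?opprK //.
exact: odd_formN.
Qed.

Lemma class_of_repr (a : oform_mod M) : a = class_of (oform_val (repr a : oform (M := M))).
Proof. by rewrite class_of_val /oclass reprK. Qed.

(** The chosen representative differs from [w] by an exact form, which is closed. *)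
Lemma dmod_oclass (w : oform (M := M)) : dmod (oclass w) = dform w.
Proof.
rewrite /dmod; set v : oform (M := M) := repr (oclass w).
have : oclass v = oclass w by rewrite /v /oclass reprK.
move=> /oclass_eq [u [u1 u2] e].
have [v1 _] := odd_formP v; have [w1 _] := odd_formP w.
apply/eqP; rewrite -subr_eq0 -dformB // e; apply/eqP/dform_dform => //.
by rewrite -e; exact: is_formB.
Qed.

Lemma dmod_class (p : preform (M := M)) : odd_form p -> dmod (class_of p) = dform p.
Proof. by move=> hp; rewrite (class_ofE hp) dmod_oclass. Qed.

Lemma dmodB (a b : oform_mod M) : dmod (a - b) = dmod a - dmod b.
Proof.
rewrite {1}(class_of_repr a) {1}(class_of_repr b).
have ha := odd_formP (repr a); have hb := odd_formP (repr b).
rewrite -class_ofB // dmod_class; last exact: odd_formB.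
by rewrite dformB //; [exact: ha.1|exact: hb.1].
Qed.

Section Conjugation.
Implicit Types p q : preform (M := M).

Lemma is_form_conj p : is_form p -> is_form (cform p).
Proof.
move=> /is_formP [p1 p2]; apply/is_formP; split=> [l x|x].
  exact: csmJ (p1 l x).
have [h1 h2] := p2 x; split=> [f X Y Z l1 l2 hf hZ|X l1 l2].
  rewrite /cform (h1 _ _ _ _ _ _ hf hZ) rmorphD rmorphM /=; congr (_ * _ + _).
  by apply: complexP_; rewrite ?ReJ_ ?ImJ_ //= oppr0.
by rewrite /cform h2 rmorph0.
Qed.

Lemma odd_form_conj p : odd_form p -> odd_form (cform p).
Proof.
move=> [p1 p2]; split; first exact: is_form_conj.
by move=> l hl; apply/funext => x; rewrite /cform p2 // rmorph0.
Qed.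
Lemma even_form_conj p : even_form p -> even_form (cform p).
Proof.
move=> [p1 p2]; split; first exact: is_form_conj.
by move=> l hl; apply/funext => x; rewrite /cform p2 // rmorph0.
Qed.

Lemma dform_conj p : is_form p -> dform (cform p) = cform (dform p).
Proof.
move=> /is_formP [p1 _]; apply/funext => l; apply/funext => x.
rewrite /cform /dform rmorphD !rmorph_sum; congr (_ + _); apply: eq_bigr => i _.
  rewrite rmorphM rmorphXn rmorphN1; congr (_ * _); apply: (cvf_conj _ x); exact: p1.
by rewrite rmorph_sum; apply: eq_bigr => j _; rewrite rmorphM rmorphXn rmorphN1.
Qed.

Lemma cformB p q : cform (p - q) = cform p - cform q.
Proof. by apply/funext => l; apply/funext => x; rewrite /cform !funBE rmorphB. Qed.

Lemma conj_mod_class p : odd_form p -> conj_mod (class_of p) = class_of (cform p).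
Proof.
move=> hp; rewrite /conj_mod; set v : oform (M := M) := repr _.
have : oclass v = oclass (mkoform hp) by rewrite /v (class_ofE hp) /oclass reprK.
move=> /oclass_eq [u hu e].
apply: (class_of_eq (u := cform u)).
- exact/odd_form_conj/odd_formP.
- exact: odd_form_conj.
- exact: even_form_conj.
- by rewrite dform_conj -?e ?cformB //; case: hu.
Qed.

Lemma conj_modB (a b : oform_mod M) : conj_mod (a - b) = conj_mod a - conj_mod b.
Proof.
rewrite {1}(class_of_repr a) {1}(class_of_repr b).
have ha := odd_formP (repr a); have hb := odd_formP (repr b).
rewrite -class_ofB // conj_mod_class; last exact: odd_formB.
by rewrite cformB class_ofB //; exact: odd_form_conj.
Qed.

Lemma conj_modD (a b : oform_mod M) : conj_mod (a + b) = conj_mod a + conj_mod b.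
Proof.
have c0 : conj_mod (0 : oform_mod M) = 0.
  by have := conj_modB 0 0; rewrite !subrr.
by rewrite -{1}[b]opprK conj_modB -[- b]sub0r conj_modB c0 sub0r opprK.
Qed.

Lemma dmod_conj (a : oform_mod M) : dmod (conj_mod a) = cform (dmod a).
Proof.
rewrite {1}(class_of_repr a); have ha := odd_formP (repr a).
rewrite conj_mod_class // dmod_class; last exact: odd_form_conj.
rewrite dform_conj; last by case: ha.
by [].
Qed.

End Conjugation.

End ExteriorDerivative.

(** * Integrals over the unit interval *)

Section Integral01.
Variable R : realType.
Implicit Types (f g : R -> R) (F G : R -> R[i]) (s : R).
Local Notation mu := (@lebesgue_measure R).

Definition cont01 f := {within `[0, 1], continuous f}.
Definition II f : R := Rintegral mu `[0, 1] f.

Lemma cont01_integrable f : cont01 f -> mu.-integrable `[0, 1] (EFin \o f).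
Proof. by move=> cf; apply: continuous_compact_integrable => //; exact: segment_compact. Qed.

Lemma cont01_eq f g : (forall s, 0 <= s <= 1 -> f s = g s) -> cont01 f -> cont01 g.
Proof.
move=> fg; apply: subspace_eq_continuous => s; rewrite inE /= in_itv /=.
exact: fg.
Qed.
Lemma cont01_cst a : cont01 (fun=> a).
Proof. by move=> s; exact: cst_continuous. Qed.
Lemma cont01D f g : cont01 f -> cont01 g -> cont01 (fun s => f s + g s).
Proof. by move=> cf cg s; exact: (continuousD (cf s) (cg s)). Qed.
Lemma cont01M f g : cont01 f -> cont01 g -> cont01 (fun s => f s * g s).
Proof. by move=> cf cg s; exact: (continuousM (cf s) (cg s)). Qed.
Lemma cont01_id : cont01 id.
Proof. by apply: continuous_subspaceT => s; exact: id. Qed.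
Lemma cont01X k : cont01 (fun s => s ^+ k).
Proof.
elim: k => [|k IH]; first exact: cont01_cst.
apply: (cont01_eq (f := fun s => s * s ^+ k)) => [s _|]; first by rewrite exprS.
by apply: cont01M => //; exact: cont01_id.
Qed.
Lemma cont01V f : (forall s, 0 <= s <= 1 -> f s != 0) -> cont01 f ->
  cont01 (fun s => (f s)^-1).
Proof.
move=> f0 cf; apply/continuous_within_itvP; first exact: ltr01.
have /continuous_within_itvP [|c0 c1 c2] := cf; first exact: ltr01.
split.
- move=> s s01; apply: continuousV; last exact: c0.
  by apply: f0; move: s01; rewrite in_itv /= => /andP[/ltW -> /ltW ->].
- by apply: cvgV => //; apply: f0; rewrite lexx ler01.
- by apply: cvgV => //; apply: f0; rewrite lexx ler01.
Qed.

Lemma II_eq f g : (forall s, 0 <= s <= 1 -> f s = g s) -> II f = II g.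
Proof. by move=> fg; apply: eq_Rintegral => s; rewrite inE /= in_itv /=; exact: fg. Qed.
Lemma IID f g : cont01 f -> cont01 g -> II (fun s => f s + g s) = II f + II g.
Proof. by move=> cf cg; apply: RintegralD => //; exact: cont01_integrable. Qed.
Lemma IIZ a f : cont01 f -> II (fun s => a * f s) = a * II f.
Proof. by move=> cf; apply: RintegralZl => //; exact: cont01_integrable. Qed.
Lemma II_cst a : II (fun=> a) = a.
Proof.
have E : mu (`[0%R, 1%R]%classic : set R) = 1%:E.
  apply: etrans (lebesgue_measure_itv _) _.
  by rewrite /= lte_fin ltr01 -EFinB subr0.
rewrite /II Rintegral_cst // -[RHS]mulr1; congr (_ * _).
exact: (congr1 fine E).
Qed.
Lemma II_le f g : cont01 f -> cont01 g -> (forall s, 0 <= s <= 1 -> f s <= g s) ->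
  II f <= II g.
Proof.
move=> cf cg fg; apply: le_Rintegral => //; try exact: cont01_integrable.
Qed.
Lemma II_FTC g f : cont01 g -> cont01 f ->
  (forall s : R, 0 < s < 1 -> is_derive s (1 : R) g (f s)) -> II f = g 1 - g 0.
Proof.
move=> cF cf d; rewrite /II /Rintegral.
rewrite (@continuous_FTC2 R f g 0 1) ?ltr01 //.
- have /continuous_within_itvP [|c0 c1 c2] := cF; first exact: ltr01.
  split=> // s; rewrite in_itv /= => s01.
  exact: (@ex_derive _ _ _ _ _ _ _ (d s s01)).
- move=> s; rewrite in_itv /= => s01; rewrite derive1E.
  exact: (@derive_val _ _ _ _ _ _ _ (d s s01)).
Qed.

Definition ccont F := cont01 (fun s => complex.Re (F s)) /\ cont01 (fun s => complex.Im (F s)).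

Lemma cint_E F : cintegral01 F = II (fun s => complex.Re (F s)) +i* II (fun s => complex.Im (F s)).
Proof. by []. Qed.

Lemma ccont_eq F G : (forall s, 0 <= s <= 1 -> F s = G s) -> ccont F -> ccont G.
Proof. by move=> FG [c1 c2]; split; [apply: cont01_eq c1|apply: cont01_eq c2] => s s01; rewrite FG. Qed.
Lemma ccont_cst a : ccont (fun=> a).
Proof. by split; exact: cont01_cst. Qed.
Lemma ccont_real f : cont01 f -> ccont (fun s => (f s)%:C).
Proof. by move=> h; split=> //; exact: cont01_cst. Qed.
Lemma cont01B f g : cont01 f -> cont01 g -> cont01 (fun s => f s - g s).
Proof. by move=> cf cg s; exact: (continuousB (cf s) (cg s)). Qed.
Lemma ccontD F G : ccont F -> ccont G -> ccont (fun s => F s + G s).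
Proof.
move=> [f1 f2] [g1 g2]; split.
  by apply: (cont01_eq _ (cont01D f1 g1)) => s _; rewrite ReD_.
by apply: (cont01_eq _ (cont01D f2 g2)) => s _; rewrite ImD_.
Qed.
Lemma ccontM F G : ccont F -> ccont G -> ccont (fun s => F s * G s).
Proof.
move=> [f1 f2] [g1 g2]; split.
  by apply: (cont01_eq _ (cont01B (cont01M f1 g1) (cont01M f2 g2))) => s _; rewrite ReM_.
by apply: (cont01_eq _ (cont01D (cont01M f1 g2) (cont01M f2 g1))) => s _; rewrite ImM_.
Qed.
Lemma ccont_sum (I : Type) (r : seq I) (P : pred I) (F : I -> R -> R[i]) :
  (forall i, ccont (F i)) -> ccont (fun s => \sum_(i <- r | P i) F i s).
Proof.
move=> h; elim: r => [|i r IH].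
  by apply: (ccont_eq _ (ccont_cst 0)) => s _; rewrite big_nil.
case Pi: (P i).
  by apply: (ccont_eq _ (ccontD (h i) IH)) => s _; rewrite big_cons Pi.
by apply: (ccont_eq _ IH) => s _; rewrite big_cons Pi.
Qed.

Lemma cint_eq F G : (forall s, 0 <= s <= 1 -> F s = G s) -> cintegral01 F = cintegral01 G.
Proof. by move=> FG; rewrite !cint_E; congr (_ +i* _); apply: II_eq => s s01; rewrite FG. Qed.
Lemma cintD F G : ccont F -> ccont G ->
  cintegral01 (fun s => F s + G s) = cintegral01 F + cintegral01 G.
Proof.
move=> [f1 f2] [g1 g2]; rewrite !cint_E; apply: complexP_ => /=.
  by rewrite -IID //; apply: II_eq => s _; rewrite ReD_.
by rewrite -IID //; apply: II_eq => s _; rewrite ImD_.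
Qed.
Lemma cintZ a F : ccont F -> cintegral01 (fun s => a * F s) = a * cintegral01 F.
Proof.
move=> [f1 f2]; rewrite !cint_E.
have h (b : R) (g : R -> R) : cont01 g -> cont01 (fun s => b * g s).
  by move=> hg; apply: cont01M => //; exact: cont01_cst.
apply: complexP_; rewrite ?ReM_ ?ImM_ /=.
  rewrite -!IIZ // -mulN1r -IIZ; last exact: h.
  rewrite -IID; [| exact: h | by apply: cont01M; [exact: cont01_cst|exact: h]].
  by apply: II_eq => s _; rewrite ReM_ mulN1r.
rewrite -!IIZ // -IID; try exact: h.
by apply: II_eq => s _; rewrite ImM_.
Qed.
Lemma cint_sum (I : Type) (r : seq I) (P : pred I) (F : I -> R -> R[i]) :
  (forall i, ccont (F i)) ->
  cintegral01 (fun s => \sum_(i <- r | P i) F i s) = \sum_(i <- r | P i) cintegral01 (F i).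
Proof.
move=> h; elim: r => [|i r IH].
  rewrite big_nil (cint_eq (G := fun s => 0 * 0)) => [|s _]; last by rewrite big_nil mulr0.
  by rewrite (cintZ _ (ccont_cst 0)) mul0r.
rewrite big_cons -IH; case Pi: (P i).
  by rewrite -cintD //; [apply: cint_eq => s _; rewrite big_cons Pi | exact: ccont_sum].
by apply: cint_eq => s _; rewrite big_cons Pi.
Qed.
Lemma cint_cst (a : R[i]) : cintegral01 (fun=> a) = a.
Proof. by rewrite cint_E !II_cst; case: a. Qed.

Definition cder F (F' : R[i]) (s : R) :=
  is_derive s (1 : R) (fun t => complex.Re (F t)) (complex.Re F') /\
  is_derive s (1 : R) (fun t => complex.Im (F t)) (complex.Im F').

Lemma cint_FTC F G : ccont F -> ccont G -> (forall s, 0 < s < 1 -> cder F (G s) s) ->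
  cintegral01 G = F 1 - F 0.
Proof.
move=> [f1 f2] [g1 g2] h; rewrite cint_E; apply: complexP_; rewrite ?ReD_ ?ImD_ ?ReN_ ?ImN_ /=.
  by apply: (II_FTC f1 g1) => s /h [].
by apply: (II_FTC f2 g2) => // s /h [].
Qed.

Lemma cder_unique F a b s : cder F a s -> cder F b s -> a = b.
Proof.
move=> [a1 a2] [b1 b2]; apply: complexP_.
  by rewrite -(@derive_val _ _ _ _ _ _ _ a1) (@derive_val _ _ _ _ _ _ _ b1).
by rewrite -(@derive_val _ _ _ _ _ _ _ a2) (@derive_val _ _ _ _ _ _ _ b2).
Qed.
Lemma cder_eq F a b s : a = b -> cder F a s -> cder F b s.
Proof. by move->. Qed.
Lemma cder_near F G a s : (\forall t \near s, F t = G t) -> cder F a s -> cder G a s.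
Proof.
move=> h [a1 a2]; split.
  by apply: near_eq_is_derive a1; apply: filterS h => t ->.
by apply: near_eq_is_derive a2; apply: filterS h => t ->.
Qed.
Lemma cder_ext F G a s : F =1 G -> cder F a s -> cder G a s.
Proof. by move=> h; apply: cder_near; apply: filterE => t; rewrite h. Qed.
Lemma cder_cst a s : cder (fun=> a) 0 s.
Proof. by split; exact: is_derive_cst. Qed.
Lemma cderD F G a b s : cder F a s -> cder G b s -> cder (fun t => F t + G t) (a + b) s.
Proof.
move=> [a1 a2] [b1 b2]; split; rewrite ?ReD_ ?ImD_.
  rewrite (_ : (fun t => _) = (fun t => complex.Re (F t)) + (fun t => complex.Re (G t))).
    exact: is_deriveD.
  by apply/funext => t; rewrite ReD_.
rewrite (_ : (fun t => _) = (fun t => complex.Im (F t)) + (fun t => complex.Im (G t))).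
  exact: is_deriveD.
by apply/funext => t; rewrite ImD_.
Qed.
Lemma cderM F G a b s : cder F a s -> cder G b s ->
  cder (fun t => F t * G t) (a * G s + F s * b) s.
Proof.
move=> [a1 a2] [b1 b2]; split; rewrite ?ReD_ ?ImD_ ?ReM_ ?ImM_.
  rewrite (_ : (fun t => _) = (fun t => complex.Re (F t)) * (fun t => complex.Re (G t)) -
     (fun t => complex.Im (F t)) * (fun t => complex.Im (G t))).
    apply: is_derive_eq (is_deriveB (is_deriveM a1 b1) (is_deriveM a2 b2)) _.
    by rewrite /GRing.scale /=; ring.
  by apply/funext => t; rewrite ReM_.
rewrite (_ : (fun t => _) = (fun t => complex.Re (F t)) * (fun t => complex.Im (G t)) +
     (fun t => complex.Im (F t)) * (fun t => complex.Re (G t))).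
  apply: is_derive_eq (is_deriveD (is_deriveM a1 b2) (is_deriveM a2 b1)) _.
  by rewrite /GRing.scale /=; ring.
by apply/funext => t; rewrite ImM_.
Qed.
Lemma cder_real f a s : is_derive s (1 : R) f a -> cder (fun t => (f t)%:C) a%:C s.
Proof. by move=> h; split=> //; exact: is_derive_cst. Qed.
Lemma cderZ a F b s : cder F b s -> cder (fun t => a * F t) (a * b) s.
Proof.
move=> h; apply: cder_eq (cderM (cder_cst a s) h); by rewrite mul0r add0r.
Qed.
Lemma cderN F b s : cder F b s -> cder (fun t => - F t) (- b) s.
Proof.
move=> h; rewrite -mulN1r; apply: cder_ext (cderZ (-1) h) => t.
by rewrite mulN1r.
Qed.
Lemma cder_sum (I : Type) (r : seq I) (P : pred I) (F : I -> R -> R[i]) (a : I -> R[i]) s :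
  (forall i, cder (F i) (a i) s) ->
  cder (fun t => \sum_(i <- r | P i) F i t) (\sum_(i <- r | P i) a i) s.
Proof.
move=> h; elim: r => [|i r IH].
  by rewrite big_nil; apply: cder_ext (cder_cst 0 s) => t; rewrite big_nil.
rewrite big_cons; case Pi: (P i).
  by apply: cder_ext (cderD (h i) IH) => t; rewrite big_cons Pi.
by apply: cder_ext IH => t; rewrite big_cons Pi.
Qed.

Lemma cder_horner (p : {poly R[i]}) s : cder (fun t => p.[t%:C]) (p^`()).[s%:C] s.
Proof.
elim/poly_ind: p => [|p c IH].
  rewrite deriv0 horner0; apply: cder_ext (cder_cst 0 s) => t; by rewrite horner0.
rewrite derivD derivC addr0 derivM derivX mulr1 !hornerE.
have h := cderD (cderM IH (cder_real (is_derive_id s (1 : R)))) (cder_cst c s).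
rewrite addr0 in h; apply: cder_eq (cder_ext _ h); first by rewrite mulr1.
by move=> t; rewrite !hornerE.
Qed.

Lemma ccont_horner (p : {poly R[i]}) : ccont (fun t => p.[t%:C]).
Proof.
elim/poly_ind: p => [|p c IH].
  by apply: (ccont_eq _ (ccont_cst 0)) => t _; rewrite horner0.
apply: (ccont_eq (F := fun t => p.[t%:C] * t%:C + c)) => [t _|]; first by rewrite !hornerE.
apply: ccontD; last exact: ccont_cst.
by apply: ccontM => //; apply: ccont_real; exact: cont01_id.
Qed.

(* Interpolatory quadrature turns the integrals of polynomials into finite sums, which
   vector fields differentiate termwise. *)
Lemma quadrature_ex N : exists w : 'I_N -> R[i], forall p : {poly R[i]},
  (size p <= N)%N -> cintegral01 (fun t => p.[t%:C]) = \sum_(j < N) w j * p.[j%:R].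
Proof.
case: N => [|N].
  exists (fun=> 0) => p; rewrite leqn0 size_poly_eq0 => /eqP ->; rewrite big_ord0.
  by rewrite -[RHS](cint_cst 0); apply: cint_eq => s _; rewrite horner0.
pose x (k : nat) : R[i] := k%:R.
have xi : injective x by exact: mulrIn (oner_neq0 _) .
have [L hL] : exists L : 'I_N.+1 -> {poly R[i]}, forall p : {poly R[i]},
    (size p <= N.+1)%N -> p = \sum_(j < N.+1) p.[j%:R]%:P * L j.
  by exists (fun j => tnth (lagrange N.+1 x) j) => p sp; exact: lagrange_gen.
(* The weights are the integrals of the Lagrange polynomials of the nodes. *)
exists (fun j => cintegral01 (fun t => (L j).[t%:C])) => p sp.
transitivity (cintegral01 (fun t => \sum_(j < N.+1) p.[j%:R] * (L j).[t%:C])).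
  apply: cint_eq => t _; rewrite {1}(hL p sp) horner_sum.
  by apply: eq_bigr => j _; rewrite hornerM hornerC.
rewrite cint_sum => [|j]; last exact: (ccontM (ccont_cst _) (ccont_horner _)).
by apply: eq_bigr => j _; rewrite (cintZ _ (ccont_horner (L j))) mulrC.
Qed.

(** The nodes are natural numbers, in general outside the interval of integration; this is harmless
    for polynomials, and affine paths consist of connections at every real parameter. *)
Definition qw N : 'I_N -> R[i] := sval (cid (quadrature_ex N)).

Lemma qwP N (p : {poly R[i]}) : (size p <= N)%N ->
  cintegral01 (fun t => p.[t%:C]) = \sum_(j < N) qw j * p.[j%:R].
Proof. by rewrite /qw; case: cid => w /= h; exact: h. Qed.

(** The fundamental theorem of calculus in quadrature form: the derivative has one degree less,
    hence is within the range of exactness. *)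
Lemma qw_deriv N (p : {poly R[i]}) : (size p <= N.+1)%N ->
  \sum_(j < N) qw j * (p^`()).[j%:R] = p.[1] - p.[0].
Proof.
move=> sp; rewrite -qwP; last by apply: leq_trans (size_poly _ _) _; case: (size p) sp.
by apply: cint_FTC (ccont_horner p) (ccont_horner _) _ => s _; exact: cder_horner.
Qed.

End Integral01.

(** * Families of forms: derivatives and degrees in the parameter *)

Section Families.
Variables (R : realType) (T : Type) (r : nat).
Local Notation L := (lform T 'M[R[i]]_r).
Implicit Types (s : R) (u v w : R -> L).

Definition mder p q (A : R -> 'M[R[i]]_(p, q)) (A' : 'M[R[i]]_(p, q)) s :=
  forall i j, cder (fun t => A t i j) (A' i j) s.

Lemma mderD p q (A B : R -> 'M[R[i]]_(p, q)) A' B' s :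
  mder A A' s -> mder B B' s -> mder (fun t => A t + B t) (A' + B') s.
Proof.
by move=> hA hB i j; rewrite mxE; apply: cder_ext (cderD (hA i j) (hB i j)) => t; rewrite mxE.
Qed.
Lemma mderN p q (A : R -> 'M[R[i]]_(p, q)) A' s :
  mder A A' s -> mder (fun t => - A t) (- A') s.
Proof.
by move=> hA i j; rewrite mxE; apply: cder_ext (cderN (hA i j)) => t; rewrite mxE.
Qed.
Lemma mderM p q k (A : R -> 'M[R[i]]_(p, q)) (B : R -> 'M[R[i]]_(q, k)) A' B' s :
  mder A A' s -> mder B B' s -> mder (fun t => A t *m B t) (A' *m B s + A s *m B') s.
Proof.
move=> hA hB i j; apply: (cder_ext (F := fun t => \sum_l A t i l * B t l j)).
  by move=> t; rewrite mxE.
rewrite !mxE -big_split; apply: cder_sum => l; exact: cderM.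
Qed.
Lemma mderZ p q f (A : R -> 'M[R[i]]_(p, q)) f' A' s :
  cder f f' s -> mder A A' s -> mder (fun t => f t *: A t) (f' *: A s + f s *: A') s.
Proof.
move=> hf hA i j; rewrite !mxE; apply: cder_ext (cderM hf (hA i j)) => t.
by rewrite mxE.
Qed.
Lemma mder_cst p q (A : 'M[R[i]]_(p, q)) s : mder (fun=> A) 0 s.
Proof. by move=> i j; rewrite mxE; exact: cder_cst. Qed.
Lemma mder_tr (A : R -> 'M[R[i]]_r) A' s : mder A A' s -> cder (fun t => \tr (A t)) (\tr A') s.
Proof. by move=> hA; apply: cder_sum => i; exact: hA. Qed.

Definition lder w (w' : L) s := forall l, mder (fun t => w t l) (w' l) s.

Lemma lder_cst (a : L) s : lder (fun=> a) 0 s.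
Proof. by move=> l; exact: mder_cst. Qed.

Lemma lder_ext u v (a b : L) s : (forall t, u t = v t) -> a = b -> lder u a s -> lder v b s.
Proof. by move=> uv <-; rewrite (_ : u = v) //; exact/funext. Qed.

Lemma lderM u v (u' v' : L) s : lder u u' s -> lder v v' s ->
  lder (fun t => u t * v t) (u' * v s + u s * v') s.
Proof.
move=> hu hv l; rewrite funDE !lformME; elim: l u v u' v' hu hv => [|X l IH] u v u' v' hu hv.
  exact: (mderM (hu [::]) (hv [::])).
have h1 : lder (fun t => iota_ X (u t)) (iota_ X u') s by move=> k; exact: hu.
have h2 : lder (fun t => iota_ X (v t)) (iota_ X v') s by move=> k; exact: hv.
have h3 : lder (fun t => eps (u t)) (eps u') s.
  by move=> k; rewrite /eps; case: ifP => _; [apply: mderN; exact: hu|exact: hu].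
have := mderD (IH _ _ _ _ h1 hv) (IH _ _ _ _ h3 h2).
rewrite addrACA; exact.
Qed.

Lemma lderX u (u' : L) k s : lder u u' s ->
  lder (fun t => u t ^+ k) (\sum_(i < k) u s ^+ i * u' * u s ^+ (k.-1 - i)) s.
Proof.
move=> hu; elim: k => [|k IH].
  by rewrite big_ord0; exact: lder_cst.
apply: lder_ext (lderM hu IH) => [t|]; first by rewrite exprS.
rewrite big_ord_recl /= expr0 mul1r subn0; congr (_ + _).
rewrite mulr_sumr; apply: eq_bigr => i _.
rewrite !mulrA -exprS /bump /= add1n; congr (_ * _ ^+ _).
by rewrite -subn1 -subnDA add1n.
Qed.

Definition polyN N (f : R -> R[i]) := exists2 p : {poly R[i]}, (size p <= N)%N &
  forall t, f t = p.[t%:C].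

Lemma polyN_ext N f g : f =1 g -> polyN N f -> polyN N g.
Proof. by move=> fg [p sp h]; exists p => // t; rewrite -fg. Qed.
Lemma polyNW N N' f : (N <= N')%N -> polyN N f -> polyN N' f.
Proof. by move=> h [p sp e]; exists p => //; exact: leq_trans sp h. Qed.
Lemma polyN_cst N a : polyN N.+1 (fun=> a).
Proof.
exists a%:P => [|t]; last by rewrite hornerC.
by apply: leq_trans (size_polyC_leq1 a) _.
Qed.
Lemma polyN0 N : polyN N (fun=> 0).
Proof. by exists 0 => [|t]; rewrite ?size_poly0 ?horner0. Qed.
Lemma polyN_id : polyN 2 (fun t => t%:C).
Proof. by exists 'X => [|t]; rewrite ?size_polyX ?hornerX. Qed.
Lemma polyND N f g : polyN N f -> polyN N g -> polyN N (fun t => f t + g t).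
Proof.
move=> [p sp e] [q sq e']; exists (p + q) => [|t]; last by rewrite hornerD e e'.
by apply: leq_trans (size_polyD p q) _; rewrite geq_max sp sq.
Qed.
Lemma polyNN N f : polyN N f -> polyN N (fun t => - f t).
Proof. by move=> [p sp e]; exists (- p) => [|t]; rewrite ?size_polyN ?hornerN ?e. Qed.
Lemma polyNM a b f g : polyN a.+1 f -> polyN b.+1 g -> polyN (a + b).+1 (fun t => f t * g t).
Proof.
move=> [p sp e] [q sq e']; exists (p * q) => [|t]; last by rewrite hornerM e e'.
apply: leq_trans (size_polyMleq p q) _.
have := leq_add sp sq; rewrite addSn addnS => h.
by move: h; case: (size p + size q)%N.
Qed.

Lemma polyN_sum (I : Type) (q : seq I) (P : pred I) N (F : I -> R -> R[i]) :
  (forall i, polyN N (F i)) -> polyN N (fun t => \sum_(i <- q | P i) F i t).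
Proof.
move=> h; elim: q => [|i q IH].
  by apply: polyN_ext (polyN0 N) => t; rewrite big_nil.
case Pi: (P i).
  by apply: polyN_ext (polyND (h i) IH) => t; rewrite big_cons Pi.
by apply: polyN_ext IH => t; rewrite big_cons Pi.
Qed.

(** The degree in the parameter is bounded by the number of arguments plus [a]. One degree per
    argument is enough because the curvature of an affine path is quadratic and takes two arguments;
    the shift [a] makes the bound stable under contraction. *)
Definition lpoly a u := forall l i j, polyN (size l + a).+1 (fun t => u t l i j).

Lemma lpoly_cst a (w : L) : lpoly a (fun=> w).
Proof. by move=> l i j; exact: polyN_cst. Qed.

Lemma lpolyM a b u v : lpoly a u -> lpoly b v -> lpoly (a + b) (fun t => u t * v t).
Proof.
move=> hu hv l; elim: l a b u v hu hv => [|X l IH] a b u v hu hv i j.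
  apply: (polyN_ext (f := fun t => \sum_k u t [::] i k * v t [::] k j)).
    by move=> t; rewrite lformME /= mxE.
  by apply: polyN_sum => k; exact: (polyNM (hu [::] i k) (hv [::] k j)).
have h1 : lpoly a.+1 (fun t => iota_ X (u t)).
  by move=> l' i' j'; have := hu (X :: l') i' j'; rewrite /= addSnnS.
have h2 : lpoly b.+1 (fun t => iota_ X (v t)).
  by move=> l' i' j'; have := hv (X :: l') i' j'; rewrite /= addSnnS.
have h3 : lpoly a (fun t => eps (u t)).
  move=> l' i' j'; case o: (odd (size l')).
    apply: polyN_ext (polyNN (hu l' i' j')) => t; by rewrite /eps o mxE.
  by apply: polyN_ext (hu l' i' j') => t; rewrite /eps o.
have e1 : (size l + (a.+1 + b) = size (X :: l) + (a + b))%N by rewrite /= !addSn addnS.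
have e2 : (size l + (a + b.+1) = size (X :: l) + (a + b))%N by rewrite /= addSn !addnS.
have H1 := IH _ _ _ _ h1 hv i j; have H2 := IH _ _ _ _ h3 h2 i j.
rewrite e1 in H1; rewrite e2 in H2.
apply: polyN_ext (polyND H1 H2) => t.
by rewrite [in RHS]lformME /= [in RHS]mxE.
Qed.

Lemma lpolyX u k : lpoly 0 u -> lpoly 0 (fun t => u t ^+ k).
Proof.
move=> hu; elim: k => [|k IH] l i j; first exact: (lpoly_cst 0 1).
by apply: polyN_ext (lpolyM hu IH l i j) => t; rewrite exprS.
Qed.

Lemma lpoly_tr u l : lpoly 0 u -> polyN (size l).+1 (fun t => \tr (u t l)).
Proof. by move=> hu; apply: polyN_sum => i; have := hu l i i; rewrite addn0. Qed.

End Families.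

(** * Affine paths of connections *)

Section Scaling.
Context {R : realType} {n : nat} {M : manifold R n}.

Definition sfZ (c : R[i]) (f : sfun M) : sfun M := sfmul (sfcst M c) f.
Lemma sfZE c f x : sfZ c f x = c * f x. Proof. by []. Qed.
Lemma sfZB c : {morph sfZ c : f g / f - g}.
Proof. by move=> f g; apply/sfun_eq/funext => x /=; rewrite mulrBr. Qed.
Lemma sact_sfZ c X f : sfZ c (sact X f) = sact X (sfZ c f).
Proof.
apply/sfun_eq/funext => x /=.
rewrite (cvf_fM X x (sfP (sfcst M c)) (sfP f)) /=.
by rewrite cvf_cst mul0r add0r.
Qed.

Context {E : vbundle M}.
Lemma seZ_smooth (c : R[i]) (a : sendo E) : @endo_smooth _ _ _ E (fun x => c *: a x).
Proof.
move=> x i ix; apply: cmx_ext (cmxZ (csm_cst c x) (seP a ix)) => y.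
by rewrite -scalemxAr -scalemxAl.
Qed.
Definition seZ (c : R[i]) (a : sendo E) : sendo E := SEndo (seZ_smooth c a).
Lemma seZE c a x : seZ c a x = c *: a x. Proof. by []. Qed.
Lemma seZB c : {morph seZ c : a b / a - b}.
Proof. by move=> a b; apply/sendo_eq => x; rewrite sendoB !seZE sendoB scalerBr. Qed.
Lemma sapp_seZ c a s : sapp (seZ c a) s = sscale (sfcst M c) (sapp a s).
Proof. by apply/ssec_eq => x /=; rewrite -scalemxAl. Qed.

Lemma sact_cst X c : sact X (sfcst M c) = 0.
Proof. by apply/sfun_eq/funext => x /=; exact: cvf_cst. Qed.

Lemma Dop_Z (D : preconnection E) (hD : is_connection D) X c s :
  Dop hD X (sscale (sfcst M c) s) = sscale (sfcst M c) (Dop hD X s).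
Proof.
rewrite DopZ sact_cst; apply/ssec_eq => x /=; by rewrite scale0r add0r.
Qed.

Lemma delta_seZ (D : preconnection E) (hD : is_connection D) X c a :
  seZ c (delta hD X a) = delta hD X (seZ c a).
Proof.
apply/sapp_inj => s; rewrite sapp_seZ !deltaE !sapp_seZ Dop_Z.
by apply/ssec_eq => x /=; rewrite scalerBr.
Qed.

End Scaling.

Section Comparison.
Context {R : realType} {n : nat} {M : manifold R n} {E : vbundle M}.
Implicit Types (X Y Z : vfield M) (a b : sendo E) (s t : ssec E).
Local Notation br := (@bracket R n M).
Local Notation L := (lform (vfield M) (sendo E)).

Section Two.
Variables (D D' : preconnection E) (hD : is_connection D) (hD' : is_connection D').

Lemma cdiff_ex X : exists d : sendo E, forall s,
  sapp d s = Dop hD' X s - Dop hD X s.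
Proof.
apply: tensorial_endo => [s t|f s]; first by rewrite !DopD; abelu.
rewrite !DopZ; apply/ssec_eq => x /=; rewrite scalerBr; abelu.
Qed.

Definition cdiff X : sendo E := sval (cid (cdiff_ex X)).

Lemma cdiffE X s : sapp (cdiff X) s = Dop hD' X s - Dop hD X s.
Proof. by rewrite /cdiff; case: cid => d /= ->. Qed.

Lemma Dop_cdiff X s : Dop hD' X s = Dop hD X s + sapp (cdiff X) s.
Proof. by rewrite cdiffE; abelu. Qed.

Lemma cdiff_lin x : lin_at x (fun l => form1 cdiff l x : 'M[R[i]]_(rank E x)).
Proof.
move=> f X Y Z [|W l1] [|W' l2] hf hZ /=; rewrite ?scaler0 ?addr0 //.
- apply: sec_span => s; rewrite mulmxDl -scalemxAl.
  have H A := congr1 (fun t : ssec E => t x) (cdiffE A s).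
  have {}H A : cdiff A x *m s x = Dop hD' A s x - Dop hD A s x by exact: H.
  by rewrite !H !(Dop_combine _ _ _ hf hZ) scalerBr; abelu.
- by case: l1 => [|? ?] /=; rewrite scaler0 addr0.
- by case: l1 => [|? ?] /=; rewrite scaler0 addr0.
Qed.

Lemma form1_alt (V : zmodType) (K : vfield M -> V) : alt1 (form1 K).
Proof. by move=> X [|? [|? ?]] l2. Qed.

Lemma cdiff_form x : form_at x (fun l => form1 cdiff l x : 'M[R[i]]_(rank E x)).
Proof. by split; [exact: cdiff_lin | move=> X l1 l2; rewrite form1_alt]. Qed.

Lemma conn_diffE x l : conn_diff D D' x l = form1 cdiff l x.
Proof.
case: l => [|X [|? ?]] //=.
by apply: endo_atE => s; have := congr1 (fun t : ssec E => t x) (cdiffE X s).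
Qed.

Lemma delta_diff X a : delta hD' X a = delta hD X a + cdiff X * a - a * cdiff X.
Proof.
apply/sapp_inj => s.
rewrite sappBl sappDl !sappM !deltaE !Dop_cdiff sappD; abelu.
Qed.

Definition form0 (A : pzRingType) (c : A) : lform (vfield M) A :=
  fun l => if l is [::] then c else 0.

Lemma form0_mull (A : pzRingType) (c : A) (v : lform (vfield M) A) l :
  (form0 c * v) l = c * v l.
Proof.
rewrite lformME; elim: l v => [|Y l IH] v //=.
have -> : iota_ Y (form0 c) = 0 by [].
rewrite bmul0l ?add0r; last by move=> w a b; rewrite mulrBl.
by rewrite eps_even ?IH //; case.
Qed.

Lemma form0_mulr (A : pzRingType) (c : A) (u : lform (vfield M) A) l :
  (u * form0 c) l = u l * c.
Proof.
rewrite lformME; elim: l u => [|Y l IH] u //=.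
have -> : iota_ Y (form0 c) = 0 by [].
rewrite bmul0r ?addr0 ?IH //; by move=> w a b; rewrite mulrBr.
Qed.

Lemma form1M (A : pzRingType) (K K' : vfield M -> A) :
  (form1 K : lform (vfield M) A) * form1 K' = form2 (fun X Y => K X * K' Y - K Y * K' X).
Proof.
apply/funext => -[|X l]; first by rewrite lformME /= mulr0.
have -> : ((form1 K : lform (vfield M) A) * form1 K') (X :: l) =
   (form0 (K X) * form1 K') l + ((eps (form1 K) : lform (vfield M) A) * form0 (K' X)) l.
  rewrite [LHS]lformME /= !lformME; congr (_ + _).
rewrite form0_mull form0_mulr (eps_odd (parity_form1 K)) funNE.
by case: l => [|Y [|? ?]] /=; rewrite ?mulNr ?(mulr0, mul0r, oppr0, addr0).
Qed.

(** The structure equation relative to the base connection [D]; it follows by expanding the iterated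
    derivatives of [D] plus the difference on a section. *)
Lemma Fform_diff : Fform hD' = Fform hD +
  ((dd br (delta hD) (form1 cdiff) : L) + (form1 cdiff : L) * form1 cdiff).
Proof.
have dB : forall X, {morph delta hD X : a b / a - b} by exact: deltaB.
rewrite dd_form1 // form1M.
apply/funext => l; rewrite !funDE; case: l => [|X [|Y [|? ?]]] /=; rewrite ?addr0 //.
apply/sapp_inj => s.
rewrite !(sappDl, sappBl, sappNl) !curvE !sappM !deltaE !Dop_cdiff.
rewrite !(DopD, sappD) !cdiffE; abelu.
Qed.

Lemma dd_diff (K : vfield M -> sendo E) :
  dd br (delta hD') (form1 K) = (dd br (delta hD) (form1 K) : L) +
   ((form1 cdiff : L) * form1 K + (form1 K : L) * form1 cdiff).
Proof.
rewrite !dd_form1; [| exact: deltaB | exact: deltaB].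
rewrite !form1M; apply/funext => l; rewrite !funDE.
case: l => [|X [|Y [|? ?]]] /=; rewrite ?addr0 //.
rewrite !delta_diff; abelu.
Qed.

(** Two connections may differ on sections that are not smooth, and curvature is obtained by choice;
    only the action on smooth sections matters. *)
Lemma Dop_ext_delta : (forall X s, Dop hD X s = Dop hD' X s) ->
  (Fform hD = Fform hD') * (delta hD = delta hD').
Proof.
move=> h; split.
  apply/funext => -[|X [|Y [|? ?]]] //=; apply/sapp_inj => s.
  by rewrite !curvE !h.
by apply/funext => X; apply/funext => a; apply/sapp_inj => s; rewrite !deltaE !h.
Qed.

End Two.

Section Affine.
Variables (D D' : preconnection E) (hD : is_connection D) (hD' : is_connection D').

Lemma aconn (t : R) : is_connection (affine_path D D' t).
Proof.
have S (c c' : R[i]) (s s' : ssec E) : smooth_section ((fun x => c *: s x + c' *: s' x) : presection E).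
  exact: (ssP (sscale (sfcst M c) s + sscale (sfcst M c') s')).
have DS (D1 : preconnection E) (h1 : is_connection D1) X s (hs : smooth_section s) :
    forall x, D1 X s x = Dop h1 X (SSec hs) x by [].
split.
- move=> X s hs; exact: (S _ _ (Dop hD X (SSec hs)) (Dop hD' X (SSec hs))).
- move=> X s s' hs hs' x; rewrite /affine_path.
  by rewrite (conn_add hD) // (conn_add hD') // !scalerDr; abelu.
- move=> X f s hf hs x; rewrite /affine_path.
  rewrite (conn_leibniz hD) // (conn_leibniz hD') // !scalerDr !scalerA.
  have -> : cvf X f x *: s x = ((1 - t)%:C * cvf X f x) *: s x + (t%:C * cvf X f x) *: s x.
    rewrite -scalerDl -mulrDl -rmorphD /= subrK mul1r //.
  by rewrite (mulrC (f x) (1 - t)%:C) (mulrC (f x) t%:C); abelu.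
- move=> f X Y Z s hf hZ hs x; rewrite /affine_path.
  rewrite (conn_tensorial hD hf hZ) // (conn_tensorial hD' hf hZ) // !scalerDr !scalerA.
  by rewrite (mulrC (f x)%:C (1 - t)%:C) (mulrC (f x)%:C t%:C); abelu.
Qed.

Lemma Dop_aconn (t : R) X s : Dop (aconn t) X s = Dop hD X s + sapp (seZ t%:C (cdiff hD hD' X)) s.
Proof.
apply/ssec_eq => x; rewrite sapp_seZ cdiffE /= /affine_path scalerBr.
by rewrite rmorphB scalerBl rmorph1 scale1r; abelu.
Qed.

Lemma cdiff_aconn (t : R) X : cdiff hD (aconn t) X = seZ t%:C (cdiff hD hD' X).
Proof. by apply/sapp_inj => s; rewrite cdiffE Dop_aconn; abelu. Qed.

Lemma form1_seZ c (K : vfield M -> sendo E) : form1 (fun X => seZ c (K X)) = seZ c \o form1 K.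
Proof.
apply/funext => -[|X [|? ?]] //=.
all: by apply/sendo_eq => x; rewrite seZE scaler0.
Qed.

Local Notation th := (form1 (cdiff hD hD') : L).

Lemma Fform_aconn (t : R) l x : Fform (aconn t) l x = Fform hD l x +
  (t%:C *: (dd br (delta hD) th : L) l x + t%:C ^+ 2 *: (th * th) l x).
Proof.
rewrite (Fform_diff hD (aconn t)) !funDE !sendoD; congr (_ + (_ + _)).
  rewrite (_ : cdiff hD (aconn t) = fun X => seZ t%:C (cdiff hD hD' X)); last first.
    by apply/funext => X; exact: cdiff_aconn.
  by rewrite form1_seZ -(dd_map br (@seZB _ _ _ _ _) (fun X a => delta_seZ hD X t%:C a)).
rewrite !form1M; case: l => [|X [|Y [|? ?]]] /=; rewrite ?scaler0 //.
by rewrite !cdiff_aconn scalerBr expr2 -!scalerA !seZE -!scalemxAl -!scalemxAr.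
Qed.

(** The derivative of [t d th + t ^ 2 th ^ 2] is [d th + 2 t th ^ 2], which [dd_diff] recognizes as
    the differential of [th] for the connection at [t]. *)
Lemma lder_Fform (t : R) x : lder (fun t : R => ev x (Fform (aconn t)))
  (ev x (dd br (delta (aconn t)) th)) t.
Proof.
move=> l.
have -> : ev x (dd br (delta (aconn t)) th) l = 0 +
   ((1%:C *: (dd br (delta hD) th : L) l x + t%:C *: 0) +
   ((t%:C * 1%:C + 1%:C * t%:C) *: (th * th) l x + t%:C ^+ 2 *: 0)).
  rewrite /ev (dd_diff hD (aconn t)) !funDE !sendoD !scaler0 !addr0 add0r.
  rewrite (_ : cdiff hD (aconn t) = fun X => seZ t%:C (cdiff hD hD' X)); last first.
    by apply/funext => X; exact: cdiff_aconn.
  rewrite mulr1 mul1r scale1r; congr (_ + _).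
  rewrite !form1M; case: l => [|X [|Y [|? ?]]] /=; rewrite ?addr0 ?scaler0 //.
  by rewrite scalerDl scalerBr -?scalemxAl -?scalemxAr.
have d1 : cder (fun s : R => s%:C) 1%:C t by exact: (cder_real (is_derive_id t (1 : R))).
have d2 : cder (fun s : R => s%:C ^+ 2) (t%:C * 1%:C + 1%:C * t%:C) t.
  by apply: cder_eq (cder_ext _ (cderM d1 d1)) => [|s]; [rewrite addrC|rewrite expr2].
have := mderD (mder_cst (Fform hD l x) t) (mderD (mderZ d1 (mder_cst ((dd br (delta hD) th : L) l x) t))
  (mderZ d2 (mder_cst ((th * th) l x) t))).
by rewrite (_ : (fun t0 : R => _) = (fun t : R => ev x (Fform (aconn t)) l)) //; apply/funext => s; rewrite /ev Fform_aconn.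
Qed.

Lemma lpoly_Fform x : lpoly 0 (fun t : R => ev x (Fform (aconn t))).
Proof.
move=> l i j; rewrite addn0.
have [l2|l2] := eqVneq (size l) 2; last first.
  apply: polyN_ext (polyN0 R _) => t; rewrite /ev.
  by case: l l2 => [|X [|Y [|? ?]]] //= _; rewrite mxE.
rewrite l2; apply: (polyN_ext (f := fun t : R => Fform hD l x i j +
  (t%:C * (dd br (delta hD) th : L) l x i j + (t%:C * t%:C) * (th * th) l x i j))).
  by move=> t; rewrite /ev Fform_aconn -expr2 !mxE.
apply: polyND; first exact: polyN_cst.
apply: polyND.
  by apply: (@polyNM _ 1 1); [exact: (polyN_id R) | exact: polyN_cst].
apply: (@polyNM _ 2 0); last exact: polyN_cst.
by apply: (@polyNM _ 1 1); exact: (polyN_id R).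
Qed.

End Affine.
End Comparison.

(** * The transgression form *)

Section Transgression.
Context {R : realType} {n : nat} {M : manifold R n} {E : vbundle M}.
Local Notation br := (@bracket R n M).
Local Notation L := (lform (vfield M) (sendo E)).
Local Notation cc := (@chern_const R).

Definition expc (k : nat) : R[i] := cc ^+ k / k`!%:R.

(** Matches the derivative of the term of index [k.+1] of the exponential series with the term of
    index [k] of the transgression. *)
Lemma expcS k : expc k.+1 * k.+1%:R = cc * expc k.
Proof.
have f0 (m : nat) : m.+1%:R != 0 :> R[i] by rewrite pnatr_eq0.
rewrite /expc exprS factS natrM invfM.
by rewrite mulrAC -!mulrA (mulrA k.+1%:R) mulfV ?f0 // mul1r.
Qed.

Lemma form_at_sum (I : Type) (r : seq I) (P : pred I) x (w : I -> seq (vfield M) -> R[i]^o) :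
  (forall i, form_at x (w i)) -> form_at x (fun l => \sum_(i <- r | P i) w i l : R[i]^o).
Proof.
move=> h; split=> [f X Y Z l1 l2 hf hZ|X l1 l2].
  rewrite scaler_sumr -big_split; apply: eq_bigr => i _; have [hi _] := h i.
  exact: hi.
by rewrite big1 // => i _; have [_ hi] := h i.
Qed.

Lemma form_at_Z x (c : R[i]) (w : seq (vfield M) -> R[i]^o) :
  form_at x w -> form_at x (fun l => c * w l : R[i]^o).
Proof.
move=> [h1 h2]; split=> [f X Y Z l1 l2 hf hZ|X l1 l2].
  by rewrite (h1 _ _ _ _ _ _ hf hZ) mulrDr [in RHS]/GRing.scale /= mulrCA.
by rewrite h2 mulr0.
Qed.

Lemma rfunME (f g : M -> R) x : (f * g) x = f x * g x. Proof. by []. Qed.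
Lemma rfunZE a (f : M -> R) x : (a *: f) x = a * f x. Proof. by []. Qed.

Program Definition vfcomb (f : M -> R) (hf : smooth_on setT f) (X Y : vfield M) : vfield M :=
  @VField R n M (fun g => f * X g + Y g) _ _ _ _.
Next Obligation. by move=> f hf X Y g hg /=; rewrite !vf_out // mulr0 addr0. Qed.
Next Obligation.
move=> f hf X Y g hg; apply: smooth_add; [exact: openT| |exact: vf_smooth].
by apply: smooth_mul => //; [exact: openT|exact: vf_smooth].
Qed.
Next Obligation.
move=> f hf X Y a g h hg hh /=; rewrite !vf_linear //; apply/funext => x.
by rewrite !(funDE, rfunME, rfunZE); ring.
Qed.
Next Obligation.
move=> f hf X Y g h hg hh /=; rewrite !vf_leibniz //; apply/funext => x.
by rewrite !(funDE, rfunME); ring.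
Qed.

Lemma curv_anti (D : preconnection E) (hD : is_connection D) X Y :
  curv hD X Y = - curv hD Y X.
Proof.
apply/sapp_inj => s; rewrite sappNl !curvE (Dop_anti hD X Y).
by abelu.
Qed.

Lemma Dop_double0 (s : ssec E) : s = - s -> s = 0.
Proof.
move=> h; apply/ssec_eq => y; have := congr1 (fun t : ssec E => t y) h => /eqP.
rewrite -[(- s) y]/(- (s y)) -addr_eq0 -mulr2n -scaler_nat scaler_eq0 pnatr_eq0 /=.
by move/eqP.
Qed.

(** The bracket of [f X + Y] with [W] contains [- (W f) X], collected in [V]; it compensates the
    derivative of [f] produced by the Leibniz rule. *)
Lemma curv_lin (D : preconnection E) (hD : is_connection D) f (X Y Z W : vfield M) x :
  smooth_on setT f -> (forall g, Z g = f * X g + Y g) ->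
  curv hD Z W x = (f x)%:C *: curv hD X W x + curv hD Y W x.
Proof.
move=> hf hZ.
have H A B (s : ssec E) : curv hD A B x *m s x = Dop hD A (Dop hD B s) x -
    Dop hD B (Dop hD A s) x - Dop hD (br A B) s x.
  exact: (congr1 (fun t : ssec E => t x) (curvE hD A B s)).
have ff : csmT (fun y => (f y)%:C) by move=> y; apply: csm_real; exact: (smoothTP f).1.
pose fs : sfun M := SFun ff.
have DZ s : Dop hD Z s = sscale fs (Dop hD X s) + Dop hD Y s.
  by apply/ssec_eq => y; rewrite (Dop_combine hD s y hf hZ).
have Wf : smooth_on setT (- (W f : M -> R)).
  by rewrite -[- _]sub0r; apply: smooth_sub; [exact: openT|exact: smooth_cst|exact: vf_smooth].
pose V := vfcomb Wf X (br Y W).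
have VE g : V g = - (W f : M -> R) * X g + br Y W g by [].

have bl g : br Z W g = f * br X W g + V g.
  rewrite /V /=; have [hg|hg] := pselect (smooth_on setT g); last first.
    by rewrite !(vf_out _ hg) !vf0 !subrr !mulr0 !addr0.
  have sg (U : vfield M) : smooth_on setT (U g) by exact: vf_smooth.
  have To : open (setT : set M) by exact: openT.
  rewrite !hZ vfD //; last exact: smooth_mul.
  by rewrite vf_leibniz // mulrBr (mulrC (X g)) mulNr; abelu.
apply: sec_span => s; rewrite mulmxDl -scalemxAl !H.
rewrite (Dop_combine hD s x hf bl) (Dop_combine hD s x Wf VE).
rewrite (Dop_combine hD _ x hf hZ) DZ DopD DopZ !ssecD.
have -> : sscale (sact W fs) (Dop hD X s) x = ((W f) x)%:C *: Dop hD X s x.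
  by rewrite /= cvf_real.
rewrite rmorphN scaleNr !scalerBr; abelu.
Qed.

Lemma Fform_form (D : preconnection E) (hD : is_connection D) x : form_at x (ev x (Fform hD)).
Proof.
split=> [f X Y Z l1 l2 hf hZ|X l1 l2]; last first.
  rewrite /ev /Fform; case: l1 => [|W [|W' [|? ?]]] //=.
  case: l2 => [|? ?] //=; apply: sec_span => s; rewrite mul0mx.
  have h : sapp (curv hD X X) s = 0.
    by apply: Dop_double0; rewrite {1}curv_anti sappNl.
  exact: (congr1 (fun t : ssec E => t x) h).
rewrite /ev /Fform; case: l1 => [|W [|W' l1]] /=.
- case: l2 => [|W [|? ?]] /=; rewrite ?scaler0 ?addr0 //; exact: curv_lin.
- case: l2 => [|? ?] /=; rewrite ?scaler0 ?addr0 //.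
  rewrite !(curv_anti hD W) !sendoN (curv_lin hD W x hf hZ).
  by rewrite opprD scalerN.
- by case: l1 => [|? ?] /=; rewrite scaler0 addr0.
Qed.

Definition tf (th F : L) k (l : seq (vfield M)) : sfun M := strace ((th * F ^+ k) l).

Lemma tfE th F k l x : tf th F k l x = \tr ((ev x th * ev x F ^+ k) l).
Proof. by rewrite -evX -evM. Qed.

Section Pair.
Variables (D D' : preconnection E) (hD : is_connection D) (hD' : is_connection D').
Local Notation th := (form1 (cdiff hD hD') : L).
Local Notation Ft t := (Fform (aconn hD hD' t)).

Lemma transgressionE l x N : (size l < N)%N -> transgression D D' l x =
  cc * cintegral01 (fun t => \sum_(k < N) expc k * tf th (Ft t) k l x).
Proof.
move=> lN; rewrite /transgression; congr (_ * _); apply: cint_eq => t _.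
have -> : curvature (affine_path D D' t) x = ev x (Ft t).
  by apply/funext => m; rewrite (curvatureE (aconn hD hD' t)).
have -> : conn_diff D D' x = ev x th by apply/funext => m; rewrite (conn_diffE hD hD').
rewrite (trace_exp _ _ _ lN) //.
by apply: eq_bigr => k _; rewrite tfE.
Qed.

Lemma tf_poly l x k : polyN (size l).+1 (fun t => tf th (Ft t) k l x).
Proof.
apply: (polyN_ext (f := fun t => \tr ((ev x th * ev x (Ft t) ^+ k) l))).
  by move=> t; rewrite tfE.
apply: (lpoly_tr l (u := fun t => ev x th * ev x (Ft t) ^+ k)).
by apply: (lpolyM (lpoly_cst 0 (ev x th))); apply: lpolyX; exact: lpoly_Fform.
Qed.

(** The transgression with its integral evaluated by quadrature: a finite sum of smooth functions,
    on which vector fields act termwise. It is the transgression on lists shorter than [N]. *)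
Definition Tsf N (l : seq (vfield M)) : sfun M :=
  sfZ cc (\sum_(j < N) sfZ (qw R j) (\sum_(k < N) sfZ (expc k) (tf th (Ft j%:R) k l))).

Lemma TsfE l x N : (size l < N)%N -> transgression D D' l x = Tsf N l x.
Proof.
move=> lN; rewrite (transgressionE x lN) /Tsf sfZE; congr (_ * _).
have [p sp e] : polyN N (fun t => \sum_(k < N) expc k * tf th (Ft t) k l x).
  apply: polyN_sum => k; apply: polyNW lN _.
  apply: (@polyNM _ 0 (size l)); [exact: polyN_cst | exact: tf_poly].
rewrite (cint_eq (G := fun t => p.[t%:C])) => [|t _]; last exact: e.
rewrite (qwP sp) sfun_sum; apply: eq_bigr => j _; rewrite sfZE sfun_sum; congr (_ * _).
by rewrite -(rmorph_nat (real_complex R)) -e.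
Qed.

Lemma transgression_is_form : is_form (transgression D D').
Proof.
apply/is_formP; split=> [l|x].
  have -> : transgression D D' l = Tsf (size l).+1 l.
    by apply/funext => x; exact: TsfE.
  exact: sfP.
have h N : form_at x (fun l => Tsf N l x : R[i]^o).
  have h1 : form_at x (fun l => cc * \sum_(j < N) qw R j * \sum_(k < N) expc k * tf th (Ft j%:R) k l x : R[i]^o).
    apply: form_at_Z; apply: form_at_sum => j; apply: form_at_Z; apply: form_at_sum => k.
    apply: form_at_Z.
    have := form_at_tr (form_at_mul (cdiff_form hD hD' x) (form_at_exp k (Fform_form (aconn hD hD' j%:R) x))).
    by congr form_at; apply/funext => l; rewrite tfE.
  move: h1; congr form_at; apply/funext => l.
  rewrite /Tsf sfZE sfun_sum; congr (_ * _); apply: eq_bigr => j _.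
  by rewrite sfZE sfun_sum.
split=> [f X Y Z l1 l2 hf hZ|X l1 l2].
  (* The three lists have the same length, hence the same truncation. *)
  rewrite !(TsfE _ (ltnSn _)) !size_cat /=; exact: (h _).1.
by rewrite (TsfE _ (ltnSn _)); exact: (h _).2.
Qed.

Lemma transgression_odd : odd_form (transgression D D').
Proof.
split; first exact: transgression_is_form.
move=> l hl; apply/funext => x; rewrite (TsfE x (ltnSn _)) /Tsf sfZE.
have p k t : (th * Ft t ^+ k) l = 0.
  apply: (@lmul_parity _ _ true false) => //; first exact: parity_form1.
  by apply: parity_exp; exact: Fform_parity.
rewrite sfun_sum big1 ?mulr0 // => j _; rewrite sfZE sfun_sum big1 ?mulr0 // => k _.
by rewrite sfZE /= p mxtrace0 mulr0.
Qed.

End Pair.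

End Transgression.

Section TransgressionFormula.
Context {R : realType} {n : nat} {M : manifold R n} {E : vbundle M}.
Local Notation br := (@bracket R n M).
Local Notation L := (lform (vfield M) (sendo E)).
Local Notation cc := (@chern_const R).
Local Notation act := (@sact R n M).

Lemma sumfunE (T : Type) (V : zmodType) (I : Type) (r : seq I) (P : pred I) (F : I -> T -> V) l :
  (\sum_(i <- r | P i) F i) l = \sum_(i <- r | P i) F i l.
Proof.
elim: r => [|i r IH]; first by rewrite !big_nil.
by rewrite !big_cons; case: (P i); rewrite -IH.
Qed.

Lemma sfunMn (f : sfun M) m x : (f *+ m) x = f x *+ m.
Proof. by elim: m => [|m IH]; rewrite ?mulr0n // !mulrS -IH. Qed.

Lemma dd_sfZ c (w : seq (vfield M) -> sfun M) l :
  dd br act (fun l => sfZ c (w l)) l = sfZ c (dd br act w l).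
Proof. by rewrite (dd_map br (@sfZB _ _ _ c) (sact_sfZ c)). Qed.

Lemma dd_sfsum (I : Type) (r : seq I) (P : pred I) (F : I -> seq (vfield M) -> sfun M) l :
  dd br act (fun l => \sum_(i <- r | P i) F i l) l = \sum_(i <- r | P i) dd br act (F i) l.
Proof.
rewrite -(dd_sum br (@sactB _ _ _)); congr (dd _ _ _ l).
by apply/funext => k; rewrite sumfunE.
Qed.

Lemma dd_tf (D : preconnection E) (hD : is_connection D) (th : L) k l :
  dd br act (tf th (Fform hD) k) l = tf (dd br (delta hD) th) (Fform hD) k l.
Proof.
have := dd_tr_linear (deltaB hD) (deltaM hD) (@straceB _ _ _ E) (strace_delta hD) th k
  (Fform_parity hD) (dd_Fform hD).
by move=> H; exact: (congr1 (fun f : seq (vfield M) -> sfun M => f l) H).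
Qed.

Lemma chE (D : preconnection E) (hD : is_connection D) l x N : (size l < N)%N ->
  ch D l x = \sum_(k < N) expc k * strace ((Fform hD ^+ k) l) x.
Proof.
move=> lN; rewrite /ch.
have -> : curvature D x = ev x (Fform hD) by apply/funext => m; rewrite (curvatureE hD).
rewrite (trace_exp1 _ _ lN) //.
by apply: eq_bigr => k _; rewrite -evX.
Qed.

Lemma ev_sum (I : Type) (r : seq I) (P : pred I) (F : I -> L) x :
  ev x (\sum_(i <- r | P i) F i) = \sum_(i <- r | P i) ev x (F i).
Proof.
elim: r => [|i r IH]; first by rewrite !big_nil.
by rewrite !big_cons; case: (P i); rewrite -IH.
Qed.

Lemma affine_path1 (D D' : preconnection E) : affine_path D D' 1 = D'.
Proof.
apply/funext => X; apply/funext => s; apply: functional_extensionality_dep => x.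
by rewrite /affine_path subrr scale0r add0r scale1r.
Qed.
Lemma affine_path0 (D D' : preconnection E) : affine_path D D' 0 = D.
Proof.
apply/funext => X; apply/funext => s; apply: functional_extensionality_dep => x.
by rewrite /affine_path subr0 scale0r addr0 scale1r.
Qed.

Section Pair.
Variables (D D' : preconnection E) (hD : is_connection D) (hD' : is_connection D').
Local Notation th := (form1 (cdiff hD hD') : L).
Local Notation Ft t := (Fform (aconn hD hD' t)).
Local Notation dt t := (dd br (delta (aconn hD hD' t)) : L -> L).

Lemma cder_trace_power k l x (t : R) :
  cder (fun t => strace ((Ft t ^+ k) l) x) (tf (dt t th) (Ft t) k.-1 l x *+ k) t.
Proof.
have H := mder_tr (lderX k (@lder_Fform _ _ _ _ _ _ hD hD' t x) l).
apply: cder_eq (cder_ext _ H) => [|s]; last by rewrite -evX.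
rewrite /=.
have -> : \sum_(i < k) ev x (Ft t) ^+ i * ev x (dt t th) * ev x (Ft t) ^+ (k.-1 - i) =
   ev x (\sum_(i < k) Ft t ^+ i * dt t th * Ft t ^+ (k.-1 - i)).
  by rewrite ev_sum; apply: eq_bigr => i _; rewrite !evM !evX.
have := tr_power_rule (@straceB _ _ _ E) (@straceC _ _ _ E) (dt t th) k l (Fform_parity (aconn hD hD' t)).
move=> /(congr1 (fun f : sfun M => f x)); rewrite /tf.
set A := strace _; set B := strace _ => AB; rewrite -[LHS]/(A x) AB.
exact: sfunMn.
Qed.

(** At each node the differential of the integrand is the derivative of [ch] along the path, by the
    Bianchi identity and the cyclicity of the trace; [qw_deriv] sums these derivatives to the
    difference of the end values. *)
Lemma dform_transgression : dform (transgression D D') = ch D' - ch D.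
Proof.
apply/funext => l; apply/funext => x; rewrite (dform_sform (transgression_is_form hD hD')).
pose N := (size l).+1.
have -> : dd br act (sform (transgression_is_form hD hD')) l = dd br act (Tsf hD hD' N) l.
  apply: dd_eq => k hk; apply/sfun_eq/funext => y /=.
  by apply: TsfE; rewrite /N hk.
rewrite /Tsf dd_sfZ dd_sfsum sfZE sfun_sum mulr_sumr.
pose h t := \sum_(k < N.+1) expc k * strace ((Ft t ^+ k) l) x.
have hch t : h t = ch (affine_path D D' t) l x.
  by rewrite (chE (aconn hD hD' t) x (N := N.+1)) //; apply: ltnW.
have [p sp e] : polyN N.+1 h.
  apply: polyNW (leqnSn _) _; apply: polyN_sum => k.
  apply: (@polyNM _ 0 (size l)); first exact: polyN_cst.
  apply: (polyN_ext (f := fun t => \tr ((ev x (Ft t) ^+ k) l))); first by move=> t; rewrite -evX.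
  by apply: (lpoly_tr l (u := fun t => ev x (Ft t) ^+ k)); apply: lpolyX; exact: lpoly_Fform.
(* The constant term of the series has derivative 0; the others are shifted by one index through
   [expcS]. *)
have hd t : (p^`()).[t%:C] = cc * \sum_(k < N) expc k * tf (dt t th) (Ft t) k l x.
  have d1 : cder h (p^`()).[t%:C] t by apply: cder_ext (cder_horner p t) => s; rewrite e.
  have d2 : cder h (\sum_(k < N.+1) expc k * (tf (dt t th) (Ft t) k.-1 l x *+ k)) t.
    by apply: cder_sum => k; apply: cderZ; exact: cder_trace_power.
  rewrite (cder_unique d1 d2) big_ord_recl mulr0n mulr0 add0r mulr_sumr.
  apply: eq_bigr => k _; rewrite lift0 -[_ *+ k.+1]mulr_natl !mulrA expcS.
  by rewrite /expc !mulrA.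
transitivity (\sum_(j < N) qw R j * (p^`()).[j%:R]).
  apply: eq_bigr => j _; rewrite -(rmorph_nat (real_complex R)) hd dd_sfZ sfZE dd_sfsum sfun_sum.
  rewrite mulrCA; congr (_ * (_ * _)); apply: eq_bigr => k _.
  by rewrite dd_sfZ sfZE dd_tf.
rewrite (qw_deriv sp) !funBE.
have -> : p.[1] = h 1 by rewrite e rmorph1.
have -> : p.[0] = h 0 by rewrite e rmorph0.
by rewrite !hch affine_path1 affine_path0.
Qed.

End Pair.
End TransgressionFormula.

(** * Families which are rational in the parameter *)

Section RationalFamilies.
Variable R : realType.

(** Polynomials in [s] as lists of coefficient and exponent: finitely many functions carry the whole
    dependence on [x]. *)
Definition qev (X : Type) (Q : seq ((X -> R) * nat)) (s : R) (x : X) : R :=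
  \sum_(z <- Q) z.1 x * s ^+ z.2.

Definition qmul (X : Type) (Q Q' : seq ((X -> R) * nat)) :=
  [seq ((fun x => z.1 x * y.1 x) : X -> R, (z.2 + y.2)%N) | z <- Q, y <- Q'].

Definition qcst (X : Type) (Q : seq ((X -> R) * nat)) (x : X) : seq ((X -> R) * nat) :=
  [seq ((fun=> z.1 x) : X -> R, z.2) | z <- Q].

Lemma qev_mul (X : Type) (Q Q' : seq ((X -> R) * nat)) s x :
  qev (qmul Q Q') s x = qev Q s x * qev Q' s x.
Proof.
rewrite /qev /qmul big_allpairs_dep /= mulr_suml; apply: eq_bigr => z _.
by rewrite mulr_sumr; apply: eq_bigr => y _; rewrite exprD; ring.
Qed.

Lemma qev_cst (X : Type) (Q : seq ((X -> R) * nat)) s x (y : X) :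
  qev (qcst Q x) s y = qev Q s x.
Proof. by rewrite /qev /qcst big_map. Qed.

Lemma cont01_qev (X : Type) (Q : seq ((X -> R) * nat)) x : cont01 (fun s => qev Q s x).
Proof.
rewrite /qev; elim: Q => [|z Q IH].
  by apply: (cont01_eq _ (@cont01_cst R 0)) => s _; rewrite big_nil.
apply: (cont01_eq (f := fun s => z.1 x * s ^+ z.2 + \sum_(z <- Q) z.1 x * s ^+ z.2)).
  by move=> s _; rewrite big_cons.
by apply: cont01D => //; apply: cont01M; [exact: cont01_cst|exact: cont01X].
Qed.

Definition qnz (X : Type) (Q : seq ((X -> R) * nat)) x := forall s : R, 0 <= s <= 1 -> qev Q s x != 0.

Definition ratint (X : Type) j (Q : seq ((X -> R) * nat)) (x : X) : R :=
  II (fun s => s ^+ j / qev Q s x).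

Lemma cont01_rat (X : Type) j (Q : seq ((X -> R) * nat)) x : qnz Q x ->
  cont01 (fun s => s ^+ j / qev Q s x).
Proof.
move=> h; apply: cont01M; first exact: cont01X.
by apply: cont01V => //; exact: cont01_qev.
Qed.

Lemma qnz_mul (X : Type) (Q Q' : seq ((X -> R) * nat)) x :
  qnz Q x -> qnz Q' x -> qnz (qmul Q Q') x.
Proof. by move=> h h' s s01; rewrite qev_mul mulf_neq0 ?h ?h'. Qed.
Lemma qnz_cst (X : Type) (Q : seq ((X -> R) * nat)) x (y : X) :
  qnz Q x -> qnz (qcst Q x) y.
Proof. by move=> h s s01; rewrite qev_cst h. Qed.

Lemma II_sum (I : Type) (r : seq I) (c : I -> R) (f : I -> R -> R) :
  (forall i, cont01 (f i)) ->
  cont01 (fun s => \sum_(i <- r) c i * f i s) /\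
  II (fun s => \sum_(i <- r) c i * f i s) = \sum_(i <- r) c i * II (f i).
Proof.
move=> h; elim: r => [|i r [IH1 IH2]].
  split; first by apply: (cont01_eq _ (@cont01_cst R 0)) => s _; rewrite big_nil.
  by rewrite big_nil -[RHS](II_cst 0); apply: II_eq => s _; rewrite big_nil.
have c1 : cont01 (fun s => c i * f i s) by apply: cont01M => //; exact: cont01_cst.
split.
  by apply: (cont01_eq _ (cont01D c1 IH1)) => s _; rewrite big_cons.
rewrite big_cons -IH2 -IIZ // -IID //; apply: II_eq => s _; by rewrite big_cons.
Qed.

(** From [1/Q(x) - 1/Q(x0) = (Q(x0) - Q(x)) / (Q(x) Q(x0))], expanded in the coefficients. The
    variation is now explicit: differences that vanish at [x0], times integrals of the same kind. *)
Lemma ratint_diff (X : Type) j (Q : seq ((X -> R) * nat)) x0 x : qnz Q x -> qnz Q x0 ->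
  ratint j Q x = ratint j Q x0 + \sum_(z <- Q) (z.1 x0 - z.1 x) *
     ratint (j + z.2)%N (qmul Q (qcst Q x0)) x.
Proof.
move=> hx hx0; have h2 : qnz (qmul Q (qcst Q x0)) x by apply: qnz_mul => //; exact: qnz_cst.
have [c1 c2] := II_sum Q (fun z => z.1 x0 - z.1 x) (f := fun z s => s ^+ (j + z.2)%N / qev (qmul Q (qcst Q x0)) s x)
  (fun z => @cont01_rat X (j + z.2)%N _ _ h2).
rewrite /ratint -c2 -IID //; last exact: cont01_rat.
apply: II_eq => s s01; have q1 := hx s s01; have q2 := hx0 s s01.
have -> : \sum_(z <- Q) (z.1 x0 - z.1 x) * (s ^+ (j + z.2)%N / qev (qmul Q (qcst Q x0)) s x) =
   (qev Q s x0 - qev Q s x) * (s ^+ j / (qev Q s x * qev Q s x0)).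
  have -> : qev Q s x0 - qev Q s x = \sum_(z <- Q) (z.1 x0 - z.1 x) * s ^+ z.2.
    by rewrite /qev -sumrB; apply: eq_bigr => z _; rewrite mulrBl.
  rewrite mulr_suml; apply: eq_bigr => z _.
  by rewrite qev_mul qev_cst exprD; ring.
by field; rewrite q1 q2.
Qed.

Lemma cont01_lbound (f : R -> R) : cont01 f -> (forall s, 0 <= s <= 1 -> f s != 0) ->
  exists2 d, 0 < d & forall s, 0 <= s <= 1 -> d <= `|f s|.
Proof.
move=> cf f0.
have cn : {within `[0, 1], continuous (fun s => `|f s|)}.
  by move=> s; exact: (cvg_norm (cf s)).
have [c c01 hc] := @EVT_min R (fun s => `|f s|) 0 1 ler01 cn.
exists `|f c|; first by rewrite normr_gt0 f0 // -in_itv.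
by move=> s s01; apply: hc; rewrite in_itv.
Qed.

Lemma ratint_cvg (X : topologicalType) j (Q : seq ((X -> R) * nat)) (x0 : X) :
  (forall z, List.In z Q -> {for x0, continuous z.1}) -> qnz Q x0 ->
  {for x0, continuous (ratint j Q)}.
Proof.
move=> cQ hx0.
(* [d] bounds the denominator at [x0] away from 0, uniformly in [s]; while the coefficients move by
   at most [d / 2] in total, half of the bound persists. *)
have [d d0 hd] := cont01_lbound (@cont01_qev X Q x0) hx0.
pose D x := \sum_(z <- Q) `|z.1 x0 - z.1 x|.
have D0 x : 0 <= D x by apply: sumr_ge0.
have Dlim : D x @[x --> x0] --> (0 : R).
  have -> : (0 : R) = \sum_(z <- Q) 0 by rewrite big1.
  rewrite /D; elim: Q cQ {hx0 hd D D0} => [|z Q IH] cQ.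
    by under eq_fun do rewrite big_nil; rewrite big_nil; exact: cvg_cst.
  under eq_fun do rewrite big_cons; rewrite big_cons.
  apply: cvgD; last by apply: IH => y hy; apply: cQ; right.
  have cz : z.1 x @[x --> x0] --> z.1 x0 by apply: cQ; left.
  have := cvg_norm (cvgB (cvg_cst (z.1 x0)) cz).
  by rewrite subrr normr0; exact.
have bnd x s : 0 <= s <= 1 -> `|qev Q s x0 - qev Q s x| <= D x.
  move=> /andP[s0 s1]; rewrite /qev -sumrB; apply: le_trans (ler_norm_sum _ _ _) _.
  apply: ler_sum => z _; rewrite -mulrBl normrM ler_piMr //.
  by rewrite ger0_norm ?exprn_ge0 // exprn_ile1.
have low x s : D x <= d / 2 -> 0 <= s <= 1 -> d / 2 <= `|qev Q s x|.
  move=> Dx s01; have := bnd x s s01; have := hd s s01.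
  have := ler_normD (qev Q s x0 - qev Q s x) (qev Q s x); rewrite subrK; lra.
apply/cvgrPdist_lt => e e0 /=; near=> x.
have Dx : D x <= d / 2.
  near: x; have : \forall x \near x0, `|D x| < d / 2.
    by move/cvgr0Pnorm_lt : Dlim; apply; rewrite divr_gt0.
  by apply: filterS => y; rewrite ger0_norm // => /ltW.
have De : D x < e * (d ^+ 2 / 4).
  near: x; have : \forall x \near x0, `|D x| < e * (d ^+ 2 / 4).
    by move/cvgr0Pnorm_lt : Dlim; apply; rewrite mulr_gt0 // divr_gt0 // exprn_gt0.
  by apply: filterS => y; rewrite ger0_norm.
have nzx : qnz Q x.
  by move=> s s01; have := low x s Dx s01; rewrite -normr_gt0; apply: lt_le_trans; rewrite divr_gt0.
have c1 := @cont01_rat X j _ _ nzx; have c0 := @cont01_rat X j _ _ hx0.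
have key s : 0 <= s <= 1 -> `|s ^+ j / qev Q s x0 - s ^+ j / qev Q s x| <= D x / (d ^+ 2 / 2).
  move=> s01; have q0 := hx0 s s01; have q1 := nzx s s01.
  have -> : s ^+ j / qev Q s x0 - s ^+ j / qev Q s x =
     s ^+ j * (qev Q s x - qev Q s x0) / (qev Q s x0 * qev Q s x) by field; rewrite q0 q1.
  have [s0 s1] := andP s01.
  rewrite normrM normrM normfV normrM (ger0_norm (exprn_ge0 _ s0)).
  have p0 : 0 < d ^+ 2 / 2 by rewrite divr_gt0 // exprn_gt0.
  apply: ler_pM.
  - by rewrite mulr_ge0 // exprn_ge0.
  - by rewrite invr_ge0 mulr_ge0.
  - rewrite -[leRHS]mul1r; apply: ler_pM => //; first exact: exprn_ge0.
      exact: exprn_ile1.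
    by rewrite distrC; exact: bnd.
  - rewrite lef_pV2 ?posrE ?mulr_gt0 ?normr_gt0 //.
    rewrite expr2 -mulrA; apply: ler_pM; [exact: ltW|by rewrite divr_ge0 // ltW|exact: hd|exact: low].
pose C := D x / (d ^+ 2 / 2).
have C2 : C < e.
  rewrite /C ltr_pdivrMr ?divr_gt0 ?exprn_gt0 //; apply: lt_trans De _.
  rewrite ltr_pM2l //; have : 0 < d ^+ 2 by exact: exprn_gt0.
  lra.
apply: le_lt_trans C2; rewrite ler_norml; apply/andP; split.
  rewrite lerBrDr /ratint -(II_cst (- C)) -IID //; last exact: cont01_cst.
  apply: II_le => //; first by apply: cont01D => //; exact: cont01_cst.
  by move=> s /key; rewrite ler_norml => /andP[h1 h2]; rewrite /C; lra.
rewrite lerBlDr /ratint -(II_cst C) -IID //; last exact: cont01_cst.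
apply: II_le => //; first by apply: cont01D => //; exact: cont01_cst.
by move=> s /key; rewrite ler_norml => /andP[h1 h2]; rewrite /C; lra.
Unshelve. all: by end_near. Qed.

End RationalFamilies.

(** * Smoothness of integrals with rational integrand *)

Section RatintSmooth.
Variable R : realType.

Lemma In_qmul (X : Type) (Q Q' : seq ((X -> R) * nat)) w : List.In w (qmul Q Q') ->
  exists z y, [/\ List.In z Q, List.In y Q' &
    w = ((fun x => z.1 x * y.1 x), (z.2 + y.2)%N)].
Proof.
rewrite /qmul; elim: Q => [//|z Q IH] /= h0; case: (List.in_app_or _ _ _ h0) => [h|/IH].
  have : exists2 y, List.In y Q' & w = ((fun x => z.1 x * y.1 x), (z.2 + y.2)%N).
    elim: Q' h {h0 IH} => [//|y Q' IH] /= [<-|/IH [y' h1 h2]]; first by exists y; [left|].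
    by exists y'; [right|].
  by move=> [y h1 h2]; exists z, y; split=> //; left.
by move=> [z' [y [h1 h2 h3]]]; exists z', y; split=> //; right.
Qed.

(** At a zero of [u] the difference quotient of the product is that of [u] times a value of [g], so
    continuity of [g] suffices. Together with [ratint_diff], continuity of the integrals yields
    their differentiability. *)
Lemma is_derive_mul0 (V : normedModType R) (u g : V -> R) (x v : V) (a : R) : is_derive x v u a -> u x = 0 ->
  {for x, continuous g} -> is_derive x v (fun y => u y * g y) (a * g x).
Proof.
move=> [du <-] ux gx.
have c1 : h^-1 *: (u (h *: v + x) - u x) @[h --> 0^'] --> 'D_v u x by exact: du.
have c2 : g (h *: v + x) @[h --> 0^'] --> g x.
  have : (fun h : R => h *: v + x) @ 0^' --> x.
    rewrite -[X in _ --> X]add0r -(scale0r v); apply: cvgD; last exact: cvg_cst.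
    apply: cvgZr_tmp; exact: nbhs_dnbhs.
  by move=> h; exact: (cvg_comp _ _ h gx).
have c : h^-1 *: (u (h *: v + x) * g (h *: v + x) - u x * g x) @[h --> 0^'] --> 'D_v u x * g x.
  have -> : (fun h : R => h^-1 *: (u (h *: v + x) * g (h *: v + x) - u x * g x)) =
    (fun h : R => h^-1 *: (u (h *: v + x) - u x) * g (h *: v + x)).
    by apply/funext => h; rewrite ux mul0r !subr0 /GRing.scale /= mulrA.
  exact: cvgM.
by apply: DeriveDef; [apply/cvg_ex; exists ('D_v u x * g x) | exact/cvg_lim].
Qed.

Context {n : nat}.
Implicit Types (f g u : 'rV[R]_n -> R) (x v : 'rV[R]_n).

Lemma is_derive_seq (I : Type) (r : seq I) (F : I -> 'rV[R]_n -> R) (a : I -> R) x v :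
  (forall i, List.In i r -> is_derive x v (F i) (a i)) ->
  is_derive x v (fun y => \sum_(i <- r) F i y) (\sum_(i <- r) a i).
Proof.
elim: r => [|i r IH] h.
  rewrite big_nil (_ : (fun y => _) = cst 0); first exact: is_derive_cst.
  by apply/funext => y; rewrite big_nil.
rewrite big_cons (_ : (fun y => _) = F i + (fun y => \sum_(i <- r) F i y)).
  by apply: is_deriveD; [apply: h; left | apply: IH => j hj; apply: h; right].
by apply/funext => y; rewrite big_cons.
Qed.

Lemma Ck_seq (I : Type) (r : seq I) (F : I -> 'rV[R]_n -> R) k V : open V ->
  (forall i, List.In i r -> Ck k V (F i)) -> Ck k V (fun y => \sum_(i <- r) F i y).
Proof.
move=> Vo; elim: r => [|i r IH] h.
  by apply: (Ck_eq Vo) (Ck_cst k V 0) => y _; rewrite big_nil.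
apply: (Ck_eq Vo) (Ck_add Vo (h i _) (IH _)) => [y _||j hj]; first by rewrite big_cons.
  by left.
by apply: h; right.
Qed.

Lemma Ck_continuous k V f x : Ck k V f -> V x -> {for x, continuous f}.
Proof. by case: k => [|k] [h _]; exact: h. Qed.

(** By [ratint_diff] and [is_derive_mul0] the derivative is again a combination of such integrals,
    with denominator [Q ^ 2]; the induction on [k] is uniform in [j] and [Q]. *)
Lemma Ck_ratint k V (Q : seq (('rV[R]_n -> R) * nat)) j : open V ->
  (forall z, List.In z Q -> Ck k V z.1) -> (forall y, V y -> qnz Q y) ->
  Ck k V (ratint j Q).
Proof.
move=> Vo; elim: k j Q => [|k IH] j Q hQ hnz.
  split=> // x Vx; apply: ratint_cvg; last exact: hnz.
  by move=> z hz; exact: (Ck_continuous (hQ z hz)).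
have cont x z : V x -> List.In z Q -> {for x, continuous z.1}.
  by move=> Vx hz; exact: (Ck_continuous (hQ z hz)).
split=> [x Vx|i].
  by apply: ratint_cvg; [move=> z hz; exact: cont|exact: hnz].
pose e : 'rV[R]_n := delta_mx 0 i.
pose dQ y := \sum_(z <- Q) (- 'D_e z.1 y) * ratint (j + z.2)%N (qmul Q Q) y.
have D y0 : V y0 -> is_derive y0 e (ratint j Q) (dQ y0).
  move=> Vy; pose g (z : ('rV[R]_n -> R) * nat) := ratint (j + z.2)%N (qmul Q (qcst Q y0)).
  have gE z : g z y0 = ratint (j + z.2)%N (qmul Q Q) y0.
    by apply: II_eq => s _; rewrite !qev_mul qev_cst.
  have gc z : {for y0, continuous (g z)}.
    apply: ratint_cvg; last by apply: qnz_mul; [exact: hnz|apply: qnz_cst; exact: hnz].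
    move=> w /In_qmul [a [b [ha hb ->]]] /=.
    have [b' hb' ->] : exists2 b', List.In b' Q & b = ((fun=> b'.1 y0), b'.2).
      have [b' [<- hb']] := (List.in_map_iff _ _ _).1 hb; by exists b'.
    by apply: (continuousM (cont _ _ Vy ha)); exact: cst_continuous.
  have dd : is_derive y0 e (fun y => cst (ratint j Q y0) y + \sum_(z <- Q) (z.1 y0 - z.1 y) * g z y) (dQ y0).
    apply: is_derive_eq (is_deriveD (is_derive_cst _ _ _) (is_derive_seq _)) _.
    - move=> z hz; apply: is_derive_mul0; [|by rewrite subrr|exact: gc].
      have dz : derivable z.1 y0 e by have [_ /(_ i) [h _]] := hQ z hz; exact: h.
      apply: is_derive_eq (is_deriveB (is_derive_cst _ _ _) (derivableP dz)) _.
      by [].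
    - by rewrite add0r /dQ; apply: eq_bigr => z _; rewrite gE sub0r.
  apply: near_eq_is_derive dd.
  apply: filterS (open_nbhs_nbhs (conj Vo Vy)) => y Vy'.
  by rewrite (ratint_diff j (hnz y Vy') (hnz y0 Vy)).
split=> [y Vy|]; first by have := D y Vy; move=> [].
apply: (Ck_eq Vo (f := dQ)) => [y Vy|]; first by have := D y Vy; move=> [].
apply: Ck_seq => // z hz; have [_ /(_ i) [_ hD]] := hQ z hz.
apply: Ck_mul => //.
  apply: (Ck_eq Vo (f := fun y => -1 * 'D_e z.1 y)) => [y _|]; first by rewrite mulN1r.
  by apply: Ck_mul => //; exact: Ck_cst.
apply: IH => [w /In_qmul [a [b [ha hb ->]]]|y Vy].
  by apply: Ck_mul => //; apply: Ck_pred; exact: hQ.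
by apply: qnz_mul; exact: hnz.
Qed.

End RatintSmooth.

Lemma In_allpairs (A B C : Type) (h : A -> B -> C) (l : seq A) (l' : seq B) (w : C) :
  List.In w [seq h z y | z <- l, y <- l'] ->
  exists z y, [/\ List.In z l, List.In y l' & w = h z y].
Proof.
elim: l => [//|z l IH] /= h0; case: (List.in_app_or _ _ _ h0) => [hh|/IH].
  have [y [<- hy]] := (List.in_map_iff _ _ _).1 hh.
  by exists z, y; split=> //; left.
by move=> [z' [y [h1 h2 h3]]]; exists z', y; split=> //; right.
Qed.

(** * Locally rational families of functions on the manifold *)

Section SmoothRationalFamilies.
Context {R : realType} {n : nat} {M : manifold R n}.
Local Notation clist := (seq ((M -> R[i]) * nat)).
Local Notation rlist := (seq ((M -> R) * nat)).
Implicit Types (f g : R -> M -> R[i]) (P : clist) (Q : rlist) (s : R) (x y : M).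

Definition pev P s x : R[i] := \sum_(z <- P) z.1 x * s%:C ^+ z.2.
Definition pmul P P' : clist :=
  [seq ((fun x => z.1 x * w.1 x) : M -> R[i], (z.2 + w.2)%N) | z <- P, w <- P'].
Definition toC Q : clist := [seq ((fun x => (z.1 x)%:C) : M -> R[i], z.2) | z <- Q].

Lemma pev_mul P P' s x : pev (pmul P P') s x = pev P s x * pev P' s x.
Proof.
rewrite /pev /pmul big_allpairs_dep /= mulr_suml; apply: eq_bigr => z _.
by rewrite mulr_sumr; apply: eq_bigr => y _; rewrite exprD; ring.
Qed.

Lemma pev_toC Q s x : pev (toC Q) s x = (qev Q s x)%:C.
Proof.
rewrite /pev /toC big_map /qev rmorph_sum; apply: eq_bigr => z _ /=.
by rewrite rmorphM rmorphXn.
Qed.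

Lemma pev_cat P P' s x : pev (P ++ P') s x = pev P s x + pev P' s x.
Proof. by rewrite /pev big_cat. Qed.

Definition csmL P := forall z, List.In z P -> csmT z.1.
Definition smL Q := forall z, List.In z Q -> smooth_on setT z.1.

Lemma csmL_mul P P' : csmL P -> csmL P' -> csmL (pmul P P').
Proof.
by move=> h h' w hw; have [z [y [hz hy ->]]] := In_allpairs hw => x; apply: csmM; [exact: h|exact: h'].
Qed.
Lemma smL_mul Q Q' : smL Q -> smL Q' -> smL (qmul Q Q').
Proof.
move=> h h' w /In_qmul [z [y [hz hy ->]]]; apply/smoothTP => x /=.
by apply: smM; [exact: ((smoothTP z.1).1 (h _ hz) x)|exact: ((smoothTP y.1).1 (h' _ hy) x)].
Qed.
Lemma csmL_cat P P' : csmL P -> csmL P' -> csmL (P ++ P').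
Proof. by move=> h h' z hz; case: (List.in_app_or _ _ _ hz) => [/h|/h']. Qed.
Lemma csmL_toC Q : smL Q -> csmL (toC Q).
Proof.
move=> h z hz; have [y [<- hy]] := (List.in_map_iff _ _ _).1 hz => x /=.
by apply: csm_real; exact: ((smoothTP y.1).1 (h _ hy) x).
Qed.

Lemma pev_csmT P s : csmL P -> csmT (pev P s).
Proof.
move=> hP x; rewrite /pev; elim: P hP => [|z P IH] hP.
  by apply: csm_ext (csm_cst 0 x) => y; rewrite big_nil.
apply: (csm_ext (F := fun y => z.1 y * s%:C ^+ z.2 + \sum_(z <- P) z.1 y * s%:C ^+ z.2)).
  by move=> y; rewrite big_cons.
apply: csmD; last by apply: IH => w hw; apply: hP; right.
by apply: csmM; [apply: hP; left | exact: csm_cst].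
Qed.

Lemma qev_smT Q s : smL Q -> csmT (fun x => (qev Q s x)%:C).
Proof.
move=> hQ x; apply: csm_ext (pev_csmT s (csmL_toC hQ) x) => y.
by rewrite pev_toC.
Qed.

(** The coefficients are smooth on all of [M], so that vector fields apply to them, while the
    formula is required only on [W] and for [s] in the unit interval. The denominator is real, so
    that [ratint] covers the integrals. *)
Definition krep f W P Q := [/\ open W, csmL P, smL Q & forall x, W x ->
  qnz Q x /\ forall s, 0 <= s <= 1 -> f s x = pev P s x / (qev Q s x)%:C].
Definition kfam f x := exists W P Q, W x /\ krep f W P Q.

Lemma kfam_near f g x : (\forall y \near x, forall s, 0 <= s <= 1 -> f s y = g s y) ->
  kfam f x -> kfam g x.
Proof.
move=> h [W [P [Q [Wx [Wo hP hQ hr]]]]].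
have : nbhs x [set y | forall s, 0 <= s <= 1 -> f s y = g s y] by exact: h.
rewrite nbhsE => -[V [Vo Vx] Vfg].
exists (V `&` W), P, Q; split=> //; split=> //; first exact: openI.
move=> y [Vy Wy]; have [h1 h2] := hr y Wy; split=> // s s01.
by rewrite -(Vfg _ Vy s s01) h2.
Qed.

Lemma kfam_ext f g x : (forall s y, f s y = g s y) -> kfam f x -> kfam g x.
Proof. by move=> h; apply: kfam_near; apply: filterE => y s _; rewrite h. Qed.

Lemma realC_neq0 (a : R) : a != 0 -> (a%:C : R[i]) != 0.
Proof. by move=> a0; rewrite eq_complex /= (negbTE a0). Qed.

(** A germ [u] is written as [(b u) / b] with a bump [b]; the numerator is smooth everywhere. *)
Lemma kfam_csm (u : M -> R[i]) x : csm u x -> kfam (fun=> u) x.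
Proof.
move=> ux; have : nbhs x [set y | csm u y] by exact: csm_at_near.
rewrite nbhsE => -[V [Vo Vx] Vu].
have [b hb bx] := bump_exists Vo Vx.
have [bs _ _] := hb.
have : nbhs x [set y | b y != 0].
  by apply: sm_neq0; [exact: bump_sm hb|rewrite gt_eqF].
rewrite nbhsE => -[W [Wo Wx] Wb].
exists W, [:: ((fun y => (b y)%:C * u y), 0%N)], [:: (b, 0%N)]; split=> //; split=> //.
- by move=> z [<-|//] y /=; exact: (bump_extend hb Vu).
- by move=> z [<-|//].
- move=> y Wy; have by0 := Wb y Wy.
  have qE s : qev [:: (b, 0%N)] s y = b y by rewrite /qev big_seq1 /= expr0 mulr1.
  split=> s s01; rewrite qE //.
  rewrite /pev big_seq1 /= expr0 mulr1 mulrAC mulfV ?mul1r //.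
  exact: realC_neq0.
Qed.

Lemma kfam_cst a x : kfam (fun _ _ => a) x.
Proof. by apply: kfam_csm; exact: csm_cst. Qed.

Lemma kfam_s x : kfam (fun s _ => s%:C) x.
Proof.
exists setT, [:: ((fun=> 1), 1%N)], [:: ((fun=> 1), 0%N)]; split=> //; split.
- exact: openT.
- by move=> z [<-|//] y; exact: csm_cst.
- by move=> z [<-|//]; exact: smooth_cst.
- move=> y _; have qE s : qev [:: ((fun=> 1) : M -> R, 0%N)] s y = 1 by rewrite /qev big_seq1 /= expr0 mulr1.
  split=> s s01; rewrite qE ?oner_neq0 //.
  by rewrite /pev big_seq1 /= expr1 mul1r divr1.
Qed.

Lemma kfamM f g x : kfam f x -> kfam g x -> kfam (fun s y => f s y * g s y) x.
Proof.
move=> [W [P [Q [Wx [Wo hP hQ hr]]]]] [W' [P' [Q' [Wx' [Wo' hP' hQ' hr']]]]].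
exists (W `&` W'), (pmul P P'), (qmul Q Q'); split=> //; split.
- exact: openI.
- exact: csmL_mul.
- exact: smL_mul.
- move=> y [Wy Wy']; have [h1 h2] := hr y Wy; have [h1' h2'] := hr' y Wy'.
  split; first exact: qnz_mul.
  move=> s s01; rewrite h2 // h2' // pev_mul qev_mul rmorphM invfM.
  by rewrite mulrACA.
Qed.

Lemma kfamD f g x : kfam f x -> kfam g x -> kfam (fun s y => f s y + g s y) x.
Proof.
move=> [W [P [Q [Wx [Wo hP hQ hr]]]]] [W' [P' [Q' [Wx' [Wo' hP' hQ' hr']]]]].
exists (W `&` W'), (pmul P (toC Q') ++ pmul P' (toC Q)), (qmul Q Q'); split=> //; split.
- exact: openI.
- by apply: csmL_cat; apply: csmL_mul => //; exact: csmL_toC.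
- exact: smL_mul.
- move=> y [Wy Wy']; have [h1 h2] := hr y Wy; have [h1' h2'] := hr' y Wy'.
  split; first exact: qnz_mul.
  move=> s s01; rewrite h2 // h2' // pev_cat !pev_mul !pev_toC qev_mul rmorphM /=.
  by field; rewrite !realC_neq0 ?h1 ?h1'.
Qed.

Lemma kfamN f x : kfam f x -> kfam (fun s y => - f s y) x.
Proof.
move=> h; apply: kfam_ext (kfamM (kfam_cst (-1) x) h) => s y.
by rewrite mulN1r.
Qed.

Lemma kfam_sum (I : Type) (r : seq I) (p : pred I) (F : I -> R -> M -> R[i]) x :
  (forall i, kfam (F i) x) -> kfam (fun s y => \sum_(i <- r | p i) F i s y) x.
Proof.
move=> h; elim: r => [|i r IH].
  by apply: kfam_ext (kfam_cst 0 x) => s y; rewrite big_nil.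
case Pi: (p i).
  by apply: kfam_ext (kfamD (h i) IH) => s y; rewrite big_cons Pi.
by apply: kfam_ext IH => s y; rewrite big_cons Pi.
Qed.

Lemma kfam_prod (I : Type) (r : seq I) (p : pred I) (F : I -> R -> M -> R[i]) x :
  (forall i, kfam (F i) x) -> kfam (fun s y => \prod_(i <- r | p i) F i s y) x.
Proof.
move=> h; elim: r => [|i r IH].
  by apply: kfam_ext (kfam_cst 1 x) => s y; rewrite big_nil.
case Pi: (p i).
  by apply: kfam_ext (kfamM (h i) IH) => s y; rewrite big_cons Pi.
by apply: kfam_ext IH => s y; rewrite big_cons Pi.
Qed.

Definition conjL P : clist := [seq ((fun x => (z.1 x)^*) : M -> R[i], z.2) | z <- P].
Definition reL P : rlist := [seq ((fun x => complex.Re (z.1 x)) : M -> R, z.2) | z <- P].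

Lemma pev_conj P s x : pev (conjL P) s x = (pev P s x)^*.
Proof.
rewrite /pev /conjL big_map rmorph_sum; apply: eq_bigr => z _ /=.
rewrite rmorphM rmorphXn; congr (_ * _ ^+ _).
by apply: complexP_; rewrite ?ReJ_ ?ImJ_ //= oppr0.
Qed.
Lemma qev_re P s x : qev (reL P) s x = complex.Re (pev P s x).
Proof.
rewrite /qev /reL big_map /pev (big_morph (@complex.Re R) (@ReD_ R) (erefl : complex.Re (0 : R[i]) = 0)).
apply: eq_bigr => z _ /=.
by rewrite -rmorphXn ReM_ /= mulr0 subr0.
Qed.
Lemma csmL_conj P : csmL P -> csmL (conjL P).
Proof.
move=> h z hz; have [y [<- hy]] := (List.in_map_iff _ _ _).1 hz => x /=.
by apply: csmJ; exact: h.
Qed.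
Lemma smL_re P : csmL P -> smL (reL P).
Proof.
move=> h z hz; have [y [<- hy]] := (List.in_map_iff _ _ _).1 hz => /=.
exact: csmT_re (h _ hy).
Qed.

(** The inverse of [P / Q] is [Q] times the conjugate of [P], divided by the squared modulus of [P];
    this keeps the denominator real. *)
Lemma kfamV f x : (\forall y \near x, forall s, 0 <= s <= 1 -> f s y != 0) ->
  kfam f x -> kfam (fun s y => (f s y)^-1) x.
Proof.
move=> fn [W [P [Q [Wx [Wo hP hQ hr]]]]].
have : nbhs x [set y | forall s, 0 <= s <= 1 -> f s y != 0] by exact: fn.
rewrite nbhsE => -[V [Vo Vx] Vf].
have N y s : (pev P s y * (pev P s y)^*) = (qev (reL (pmul P (conjL P))) s y)%:C.
  by rewrite qev_re pev_mul pev_conj complex_norm2.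
exists (V `&` W), (pmul (toC Q) (conjL P)), (reL (pmul P (conjL P))); split=> //; split.
- exact: openI.
- by apply: csmL_mul; [exact: csmL_toC|exact: csmL_conj].
- by apply: smL_re; apply: csmL_mul => //; exact: csmL_conj.
- move=> y [Vy Wy]; have [h1 h2] := hr y Wy.
  have p0 s : 0 <= s <= 1 -> pev P s y != 0.
    by move=> s01; have := Vf y Vy s s01; rewrite h2 // mulf_eq0 negb_or => /andP[].
  have pc0 s : 0 <= s <= 1 -> (pev P s y)^* != 0.
    by move=> s01; rewrite fmorph_eq0 p0.
  split=> s s01.
    have : (qev (reL (pmul P (conjL P))) s y)%:C != 0 :> R[i].
      by rewrite -N mulf_neq0 ?p0 ?pc0.
    by apply: contraNneq => ->.
  rewrite h2 // pev_mul pev_toC pev_conj -N invfM invrK.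
  by field; rewrite p0 ?pc0 //.
Qed.

Lemma kfam_csm_at f x s : kfam f x -> 0 <= s <= 1 -> csm (f s) x.
Proof.
move=> [W [P [Q [Wx [Wo hP hQ hr]]]]] s01.
apply: (csm_near (F := fun y => pev P s y * ((qev Q s y)%:C)^-1)).
  by apply: filterS (open_nbhs_nbhs (conj Wo Wx)) => y Wy; rewrite (hr y Wy).2.
apply: csmM; first exact: pev_csmT.
apply: csmV; first exact: qev_smT.
by rewrite realC_neq0 ?(hr x Wx).1.
Qed.

Lemma ccont_rat j Q x : qnz Q x -> ccont (fun s => (s ^+ j / qev Q s x)%:C).
Proof. by move=> h; apply: ccont_real; exact: cont01_rat. Qed.

Lemma cint_real (h : R -> R) : cintegral01 (fun s => (h s)%:C) = (II h)%:C.
Proof. by rewrite cint_E /= II_cst. Qed.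

Lemma cint_rat j Q x : qnz Q x ->
  cintegral01 (fun s => (s ^+ j / qev Q s x)%:C) = (ratint j Q x)%:C.
Proof. by move=> h; rewrite cint_real. Qed.

Lemma cint_seq (I : Type) (r : seq I) (c : I -> R[i]) (F : I -> R -> R[i]) :
  (forall i, ccont (F i)) ->
  cintegral01 (fun s => \sum_(i <- r) c i * F i s) = \sum_(i <- r) c i * cintegral01 (F i).
Proof.
move=> h; rewrite cint_sum => [|i]; last by apply: ccontM; [exact: ccont_cst|exact: h].
by apply: eq_bigr => i _; rewrite cintZ.
Qed.

Lemma krep_expand f W P Q x s : krep f W P Q -> W x -> 0 <= s <= 1 ->
  f s x = \sum_(z <- P) z.1 x * (s ^+ z.2 / qev Q s x)%:C.
Proof.
move=> [Wo hP hQ hr] Wx s01; rewrite (hr x Wx).2 // /pev mulr_suml.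
by apply: eq_bigr => z _; rewrite -mulrA rmorphM rmorphXn fmorphV.
Qed.

Lemma kfam_ccont f x : kfam f x -> ccont (fun s => f s x).
Proof.
move=> [W [P [Q [Wx hr]]]].
apply: (ccont_eq (F := fun s => \sum_(z <- P) z.1 x * (s ^+ z.2 / qev Q s x)%:C)).
  by move=> s s01; rewrite (krep_expand hr).
apply: ccont_sum => z; apply: ccontM; first exact: ccont_cst.
by apply: ccont_rat; case: hr => _ _ _ /(_ x Wx) [].
Qed.

Lemma cint_krep f W P Q x : krep f W P Q -> W x ->
  cintegral01 (fun s => f s x) = \sum_(z <- P) z.1 x * (ratint z.2 Q x)%:C.
Proof.
move=> hr Wx; have qn : qnz Q x by case: hr => _ _ _ /(_ x Wx) [].
rewrite (cint_eq (G := fun s => \sum_(z <- P) z.1 x * (s ^+ z.2 / qev Q s x)%:C)).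
  rewrite cint_seq => [|z]; last exact: ccont_rat.
  by apply: eq_bigr => z _; rewrite cint_rat.
by move=> s s01; rewrite (krep_expand hr).
Qed.

Lemma sm_ratint W j Q x : open W -> smL Q -> (forall y, W y -> qnz Q y) -> W x ->
  sm (ratint j Q) x.
Proof.
move=> Wo hQ hnz Wx; exists W; split=> // i k.
pose Q' : seq (('rV[R]_n -> R) * nat) := [seq (z.1 \o @chartV _ _ M i, z.2) | z <- Q].
have E (s : R) (y : 'rV[R]_n) : qev Q' s y = qev Q s (chartV i y) by rewrite /qev /Q' big_map.
have Vo : open (chart i @` (cdom i `&` W)) by exact: chart_open.
apply: (Ck_eq Vo (f := ratint j Q')) => [y _|].
  by apply: II_eq => s _; rewrite E.
apply: Ck_ratint => //.
  move=> z hz; have [y [<- hy]] := (List.in_map_iff _ _ _).1 hz => /=.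
  by apply: Ck_sub (hQ _ hy i k); apply: image_subset => w [].
move=> _ [y [iy Wy] <-] s s01; rewrite E chartK //; exact: hnz.
Qed.

Definition dL (X : vfield M) P : clist := [seq (cvf X z.1, z.2) | z <- P].
Definition dQ (X : vfield M) Q : rlist := [seq ((vf X z.1 : M -> R), z.2) | z <- Q].

Lemma csmL_d X P : csmL P -> csmL (dL X P).
Proof.
move=> h z hz; have [y [<- hy]] := (List.in_map_iff _ _ _).1 hz.
by apply: cvf_csm; exact: h.
Qed.
Lemma smL_d X Q : smL Q -> smL (dQ X Q).
Proof.
move=> h z hz; have [y [<- hy]] := (List.in_map_iff _ _ _).1 hz.
by apply: vf_smooth; exact: h.
Qed.

Lemma cvf_pev X P s x : csmL P -> cvf X (pev P s) x = pev (dL X P) s x.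
Proof.
move=> hP; rewrite /pev /dL big_map; elim: P hP => [|z P IH] hP.
  rewrite big_nil -[RHS](cvf_cst X 0 x); congr (cvf X _ x).
  by apply/funext => y; rewrite big_nil.
have hz : csmT z.1 by apply: hP; left.
have hP' : csmL P by move=> w hw; apply: hP; right.
rewrite big_cons -IH //=.
have -> : (fun y => \sum_(z0 <- z :: P) z0.1 y * s%:C ^+ z0.2) =
  (fun y => z.1 y * s%:C ^+ z.2 + pev P s y).
  by apply/funext => y; rewrite big_cons.
have hc : csmT (fun _ : M => s%:C ^+ z.2) by move=> y; exact: csm_cst.
rewrite cvf_fD //; last exact: pev_csmT.
  by rewrite cvf_fM // cvf_cst mulr0 addr0.
by move=> y; apply: csmM; [exact: hz|exact: hc].
Qed.

(** The quotient rule is obtained by differentiating [f Q = P] near [x], because [P / Q] itself need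
    not be smooth outside [W]. *)
Lemma cvf_krep X f W P Q x s : krep f W P Q -> csmT (f s) -> W x -> 0 <= s <= 1 ->
  cvf X (f s) x =
  (pev (dL X P) s x * (qev Q s x)%:C - pev P s x * (qev (dQ X Q) s x)%:C)
   / (qev Q s x * qev Q s x)%:C.
Proof.
move=> [Wo hP hQ hr] hf Wx s01.
have q0 y : W y -> ((qev Q s y)%:C : R[i]) != 0.
  by move=> Wy; apply: realC_neq0; exact: (hr y Wy).1.
have hq := qev_smT s hQ.
have H : cvf X (fun y => f s y * (qev Q s y)%:C) x = cvf X (pev P s) x.
  apply: cvf_near; [by move=> y; apply: csmM; [exact: hf|exact: hq]|exact: pev_csmT|].
  apply: filterS (open_nbhs_nbhs (conj Wo Wx)) => y Wy.
  by rewrite (hr y Wy).2 // mulfVK ?q0.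
have Hq : cvf X (fun y => (qev Q s y)%:C) x = (qev (dQ X Q) s x)%:C.
  have -> : (fun y => (qev Q s y)%:C : R[i]) = pev (toC Q) s.
    by apply/funext => y; rewrite pev_toC.
  rewrite cvf_pev; last exact: csmL_toC.
  rewrite -pev_toC /pev /dL /toC /dQ !big_map; apply: eq_bigr => z _ /=.
  by rewrite cvf_real.
rewrite cvf_fM // cvf_pev // Hq in H.
rewrite -H (hr x Wx).2 // rmorphM /=.
by field; exact: q0.
Qed.

Section Global.
Variable f : R -> M -> R[i].
Hypothesis hf : forall x, kfam f x.

Lemma kfam_csmT s : 0 <= s <= 1 -> csmT (f s).
Proof. by move=> s01 x; exact: kfam_csm_at. Qed.

Lemma kfam_cvf X x : kfam (fun s => cvf X (f s)) x.
Proof.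
have [W [P [Q [Wx hr]]]] := hf x; have [Wo hP hQ hw] := hr.
exists W, (pmul (dL X P) (toC Q) ++ pmul (pmul [:: ((fun=> -1), 0%N)] P) (toC (dQ X Q))), (qmul Q Q).
split=> //; split=> //.
- apply: csmL_cat; first by apply: csmL_mul; [exact: csmL_d|exact: csmL_toC].
  apply: csmL_mul; last by apply: csmL_toC; exact: smL_d.
  by apply: csmL_mul => // z [<-|//] y; exact: csm_cst.
- exact: smL_mul.
- move=> y Wy; have [h1 h2] := hw y Wy; split; first exact: qnz_mul.
  move=> s s01; rewrite (cvf_krep X hr (kfam_csmT s01) Wy s01).
  rewrite pev_cat !pev_mul !pev_toC qev_mul; congr (_ / _).
  have -> : pev [:: ((fun=> -1), 0%N)] s y = -1 by rewrite /pev big_seq1 /= expr0 mulr1.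
  by rewrite mulN1r mulNr.
Qed.

Lemma cint_csmT : csmT (fun x => cintegral01 (fun s => f s x)).
Proof.
move=> x; have [W [P [Q [Wx hr]]]] := hf x; have [Wo hP hQ hw] := hr.
apply: (csm_near (F := fun y => \sum_(z <- P) z.1 y * (ratint z.2 Q y)%:C)).
  by apply: filterS (open_nbhs_nbhs (conj Wo Wx)) => y Wy; rewrite (cint_krep hr).
elim: P hP {hr hw} (fun y Wy => (hw y Wy).1) => [|z P IH] hP qn.
  by apply: csm_ext (csm_cst 0 x) => y; rewrite big_nil.
apply: (csm_ext (F := fun y => z.1 y * (ratint z.2 Q y)%:C +
  \sum_(z <- P) z.1 y * (ratint z.2 Q y)%:C)) => [y|]; first by rewrite big_cons.
apply: csmD; last by apply: IH => // w hw; apply: hP; right.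
apply: csmM; first by apply: hP; left.
by apply: csm_real; exact: (sm_ratint _ Wo).
Qed.

Lemma eq_bigIn (I : Type) (r : seq I) (F G : I -> R[i]) :
  (forall i, List.In i r -> F i = G i) -> \sum_(i <- r) F i = \sum_(i <- r) G i.
Proof.
elim: r => [|i r IH] h; first by rewrite !big_nil.
by rewrite !big_cons h ?IH //; [move=> j hj; apply: h; right|left].
Qed.

Lemma cvf_sumIn X (I : Type) (r : seq I) (F : I -> M -> R[i]) x :
  (forall i, List.In i r -> csmT (F i)) ->
  csmT (fun y => \sum_(i <- r) F i y) /\
  cvf X (fun y => \sum_(i <- r) F i y) x = \sum_(i <- r) cvf X (F i) x.
Proof.
elim: r => [|i r IH] h.
  have E : (fun y => \sum_(i <- [::]) F i y) = (fun _ : M => 0).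
    by apply/funext => y; rewrite big_nil.
  by rewrite E big_nil cvf_cst; split=> // y; exact: csm_cst.
have [h1 h2] := IH (fun j hj => h j (or_intror hj)).
have hi : csmT (F i) by apply: h; left.
have E : (fun y => \sum_(j <- i :: r) F j y) = (fun y => F i y + \sum_(j <- r) F j y).
  by apply/funext => y; rewrite big_cons.
rewrite E big_cons -h2 cvf_fD //; split=> // y; exact: csmD.
Qed.

(* Only the finitely many coefficient functions of a local representation have to be
   differentiated: [ratint_diff] expands the denominator around [x0], and a bump function
   makes both sides global. *)
Lemma kfam_cint_cvf X x0 :
  cvf X (fun x => cintegral01 (fun s => f s x)) x0 = cintegral01 (fun s => cvf X (f s) x0).
Proof.
have [W [P [Q [Wx hr]]]] := hf x0; have [Wo hP hQ hw] := hr.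
have qn y : W y -> qnz Q y by move=> /hw [].
have [b hb bx] := bump_exists Wo Wx.
pose v x := cintegral01 (fun s => f s x); pose Q2 := qmul Q (qcst Q x0).
have vT : csmT v by exact: cint_csmT.
pose bc y := (b y)%:C : R[i].
have bT : csmT bc by move=> y; apply: csm_real; exact: bump_sm hb.
have b0 : bc x0 != 0 by apply: realC_neq0; rewrite gt_eqF.
(* The integrals are smooth on [W] only, and the bump makes them accessible to vector fields. *)
pose G (j : nat) y := bc y * (ratint j Q y)%:C.
pose H (j : nat) y := bc y * (ratint j Q2 y)%:C.
have GT j : csmT (G j).
  by apply: (bump_extend hb) => y Wy; apply: csm_real; exact: (sm_ratint _ Wo).
have qn2 y : W y -> qnz Q2 y by move=> Wy; apply: qnz_mul; [exact: qn|apply: qnz_cst; exact: qn].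
have hQ2 : smL Q2.
  apply: smL_mul => // z hz; have [y [<- hy]] := (List.in_map_iff _ _ _).1 hz.
  exact: smooth_cst.
have HT j : csmT (H j).
  by apply: (bump_extend hb) => y Wy; apply: csm_real; exact: (sm_ratint _ Wo).
have boff y : ~ W y -> bc y = 0.
  move=> nW; have [_ _ [K _ [KW Kb]]] := hb; rewrite /bc Kb //.
  by move=> /KW.
have dif (w : (M -> R) * nat) : List.In w Q -> csmT (fun y => (w.1 x0 - w.1 y)%:C).
  move=> hw1 y; apply: csm_real; apply: smB; first exact: ((smoothTP (fun=> w.1 x0)).1 (smooth_cst setT _) y).
  exact: ((smoothTP w.1).1 (hQ _ hw1) y).
have GE j : G j = fun y => bc y * (ratint j Q x0)%:C + \sum_(w <- Q) (w.1 x0 - w.1 y)%:C * H (j + w.2)%N y.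
  apply/funext => y; have [Wy|nW] := pselect (W y); last first.
    rewrite /G boff // !mul0r add0r big1 // => w _; by rewrite /H boff // mul0r mulr0.
  rewrite /G (ratint_diff j (qn y Wy) (qn x0 Wx)) rmorphD mulrDr; congr (_ + _).
  rewrite rmorph_sum mulr_sumr; apply: eq_bigr => w _.
  by rewrite rmorphM /H; ring.
(* The coefficient differences vanish at [x0], so only their own derivatives survive. *)
have cG j : cvf X (G j) x0 = cvf X bc x0 * (ratint j Q x0)%:C -
    \sum_(w <- Q) (X w.1 x0)%:C * H (j + w.2)%N x0.
  have [s1 s2] := @cvf_sumIn X _ Q (fun w y => (w.1 x0 - w.1 y)%:C * H (j + w.2)%N y) x0
    (fun w hw y => csmM (dif w hw y) (HT _ y)).
  have cT : csmT (fun _ : M => (ratint j Q x0)%:C) by move=> y; exact: csm_cst.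
  rewrite GE cvf_fD //; last by move=> y; exact: csmM.
  rewrite cvf_fM // cvf_cst mulr0 addr0; congr (_ + _).
  rewrite s2 -sumrN; elim: (Q) {hQ s1 s2 GE hQ2 qn2 HT hr hw qn GT H Q2} (H) hQ dif (HT) => [|w r IH] h hQ dif hT.
    by rewrite !big_nil.
  rewrite !big_cons IH //; first last.
    by move=> z hz; first [exact: (hQ z (or_intror hz))|exact: (dif z (or_intror hz))].
    by move=> z hz; first [exact: (hQ z (or_intror hz))|exact: (dif z (or_intror hz))].
  congr (_ + _); rewrite cvf_fM //; last by apply: dif; left.
  have -> : (w.1 x0 - w.1 x0)%:C = 0 :> R[i] by rewrite subrr.
  rewrite mul0r addr0 cvf_real -mulNr; congr (_ * _); rewrite -rmorphN; congr (_%:C).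
  have -> : (fun y => w.1 x0 - w.1 y) = (fun=> w.1 x0) - w.1 by [].
  rewrite vfB ?vf_cst ?sub0r //; first exact: smooth_cst.
  by apply: hQ; left.
have bv : (fun y => bc y * v y) = (fun y => \sum_(z <- P) z.1 y * G z.2 y).
  apply/funext => y; have [Wy|nW] := pselect (W y); last first.
    by rewrite boff // mul0r big1 // => z _; rewrite /G boff // mul0r mulr0.
  rewrite /v (cint_krep hr Wy) mulr_sumr; apply: eq_bigr => z _.
  by rewrite /G; ring.
(* The left side is completed to the derivative at [x0] of the bump times [v], for which [bv] gives
   a global formula. *)
apply: (mulfI b0); apply: (addrI (cvf X bc x0 * v x0)).
rewrite -cvf_fM // bv.
have [_ ->] := @cvf_sumIn X _ P (fun z y => z.1 y * G z.2 y) x0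
  (fun z hz y => csmM (hP z hz y) (GT _ y)).
have -> : cintegral01 (fun s => cvf X (f s) x0) = \sum_(z <- P) cvf X z.1 x0 * (ratint z.2 Q x0)%:C
   - \sum_(z <- P) z.1 x0 * \sum_(w <- Q) (X w.1 x0)%:C * (ratint (z.2 + w.2)%N Q2 x0)%:C.
  rewrite (cint_eq (G := fun s => \sum_(z <- P) cvf X z.1 x0 * (s ^+ z.2 / qev Q s x0)%:C +
     (-1) * \sum_(z <- P) z.1 x0 * \sum_(w <- Q) (X w.1 x0)%:C * (s ^+ (z.2 + w.2)%N / qev Q2 s x0)%:C)); last first.
    move=> s s01; rewrite (cvf_krep X hr) //; last exact: kfam_csmT.
    have q0 : ((qev Q s x0)%:C : R[i]) != 0 by apply: realC_neq0; exact: qn.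
    have E2 (a c : R) : (a * c)%:C = a%:C * c%:C :> R[i] by rewrite rmorphM.
    have E3 (a c : R) (j : nat) : (a ^+ j / c)%:C = a%:C ^+ j / c%:C :> R[i].
      by rewrite E2 fmorphV rmorphXn.
    rewrite mulrBl mulN1r; congr (_ - _).
      rewrite /pev /dL big_map -mulrA mulr_suml; apply: eq_bigr => z _ /=.
      by rewrite E3 E2; field.
    have -> : (qev (dQ X Q) s x0)%:C = \sum_(w <- Q) (X w.1 x0)%:C * s%:C ^+ w.2 :> R[i].
      rewrite /qev /dQ big_map rmorph_sum; apply: eq_bigr => w _ /=.
      by rewrite E2 rmorphXn.
    rewrite /pev -mulrA mulr_suml; apply: eq_bigr => z _ /=.
    rewrite -mulrA; congr (_ * _); rewrite mulr_suml mulr_sumr; apply: eq_bigr => w _.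
    by rewrite /Q2 qev_mul qev_cst E3 !E2 exprD; field.
  have c2 j : ccont (fun s => (s ^+ j / qev Q2 s x0)%:C) by apply: ccont_rat; exact: qn2.
  have c3 (z : (M -> R[i]) * nat) : ccont (fun s => \sum_(w <- Q) (X w.1 x0)%:C * (s ^+ (z.2 + w.2)%N / qev Q2 s x0)%:C).
    by apply: ccont_sum => w; apply: ccontM; [exact: ccont_cst|exact: c2].
  have c1 j : ccont (fun s => (s ^+ j / qev Q s x0)%:C) by apply: ccont_rat; exact: qn.
  rewrite cintD; first last.
    by apply: ccontM; [exact: ccont_cst|apply: ccont_sum => z; apply: ccontM; [exact: ccont_cst|exact: c3]].
    by apply: ccont_sum => z; apply: ccontM; [exact: ccont_cst|exact: c1].
  rewrite cint_seq // cintZ; last by apply: ccont_sum => z; apply: ccontM; [exact: ccont_cst|exact: c3].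
  rewrite cint_seq // mulN1r; congr (_ - _); apply: eq_bigr => z _; rewrite ?cint_real //.
  by congr (_ * _); rewrite cint_seq //; apply: eq_bigr => w _; rewrite cint_real.
have -> : \sum_(z <- P) cvf X (fun y => z.1 y * G z.2 y) x0 =
    \sum_(z <- P) (cvf X z.1 x0 * G z.2 x0 + z.1 x0 * cvf X (G z.2) x0).
  by apply: eq_bigIn => z hz; rewrite cvf_fM //; exact: hP.
rewrite mulrBr addrA {1}/v (cint_krep hr Wx) !mulr_sumr -big_split -sumrB /=.
apply: eq_bigr => z _; rewrite cG /G.
have -> : \sum_(w <- Q) (X w.1 x0)%:C * H (z.2 + w.2)%N x0 =
    bc x0 * \sum_(w <- Q) (X w.1 x0)%:C * (ratint (z.2 + w.2)%N Q2 x0)%:C.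
  by rewrite mulr_sumr; apply: eq_bigr => w _; rewrite /H; ring.
ring.
Qed.

End Global.
End SmoothRationalFamilies.

(** * Rational families of endomorphisms and of forms *)

Section KEndo.
Context {R : realType} {n : nat} {M : manifold R n} {E : vbundle M}.
Local Notation br := (@bracket R n M).
Local Notation act := (@sact R n M).
Local Notation L := (lform (vfield M) (sendo E)).
Implicit Types (a b : R -> sendo E).

Definition kendo a := forall x i, tdom i x -> forall k l,
  kfam (fun s y => (triv i y *m a s y *m trivV i y) k l) x.

Lemma kendo_eq a b : (forall s, a s = b s) -> kendo a -> kendo b.
Proof. by move=> ab ha x i ix k l; apply: kfam_ext (ha x i ix k l) => s y; rewrite ab. Qed.

Lemma kendo_cst (a : sendo E) : kendo (fun=> a).
Proof. by move=> x i ix k l; apply: kfam_csm; exact: (seP a ix). Qed.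

Lemma kendoD a b : kendo a -> kendo b -> kendo (fun s => a s + b s).
Proof.
move=> ha hb x i ix k l; apply: kfam_ext (kfamD (ha x i ix k l) (hb x i ix k l)) => s y.
by rewrite sendoD mulmxDr mulmxDl [in RHS]mxE.
Qed.

Lemma kendoN a : kendo a -> kendo (fun s => - a s).
Proof.
move=> ha x i ix k l; apply: kfam_ext (kfamN (ha x i ix k l)) => s y.
by rewrite sendoN mulmxN mulNmx [in RHS]mxE.
Qed.

Lemma kendoB a b : kendo a -> kendo b -> kendo (fun s => a s - b s).
Proof. by move=> ha hb; apply: kendoD => //; exact: kendoN. Qed.

Lemma kendoM a b : kendo a -> kendo b -> kendo (fun s => a s * b s).
Proof.
move=> ha hb x i ix k l.
apply: (kfam_near (f := fun s y => \sum_j (triv i y *m a s y *m trivV i y) k j *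
   (triv i y *m b s y *m trivV i y) j l)).
  apply: filterS (tdom_near ix) => y iy s _; rewrite sendoM.
  have -> : triv i y *m (a s y *m b s y) *m trivV i y =
      (triv i y *m a s y *m trivV i y) *m (triv i y *m b s y *m trivV i y).
    by rewrite !mulmxA -[_ *m trivV i y *m triv i y]mulmxA trivK // mulmx1.
  by rewrite [in RHS]mxE.
by apply: kfam_sum => j; exact: (kfamM (ha x i ix k j) (hb x i ix j l)).
Qed.

Lemma kendoZ (c : R -> R[i]) a : (forall x : M, kfam (fun s _ => c s) x) -> kendo a ->
  kendo (fun s => seZ (c s) (a s)).
Proof.
move=> hc ha x i ix k l; apply: kfam_ext (kfamM (hc x) (ha x i ix k l)) => s y.
by rewrite seZE -scalemxAr -scalemxAl [in RHS]mxE.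
Qed.

Lemma kendo_sum (I : Type) (r : seq I) (P : pred I) (F : I -> R -> sendo E) :
  (forall i, kendo (F i)) -> kendo (fun s => \sum_(i <- r | P i) F i s).
Proof.
move=> h; elim: r => [|i r IH].
  by apply: kendo_eq (kendo_cst 0) => s; rewrite big_nil.
case Pi: (P i).
  by apply: kendo_eq (kendoD (h i) IH) => s; rewrite big_cons Pi.
by apply: kendo_eq IH => s; rewrite big_cons Pi.
Qed.

(** Cramer's rule in a trivialization, where the determinant is a rational family without zeros for
    [s] in the unit interval. *)
Lemma kendo_inv a b : kendo a -> (forall s, 0 <= s <= 1 -> a s * b s = 1) -> kendo b.
Proof.
move=> ha ab x i ix k l.
pose A s y := triv i y *m a s y *m trivV i y.
have AB s y : 0 <= s <= 1 -> tdom i y -> A s y *m (triv i y *m b s y *m trivV i y) = 1%:M.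
  move=> s01 iy; rewrite /A !mulmxA -[_ *m trivV i y *m triv i y]mulmxA trivK // mulmx1.
  have := congr1 (fun c : sendo E => c y) (ab s s01); rewrite sendoM => /= h.
  by rewrite -[triv i y *m a s y *m b s y]mulmxA h mulmx1 trivVK.
apply: (kfam_near (f := fun s y => (\det (A s y))^-1 * (\adj (A s y)) k l)).
  apply: filterS (tdom_near ix) => y iy s s01.
  have [Au _] := mulmx1_unit (AB s y s01 iy).
  rewrite -[triv i y *m _ *m _](mulKmx Au) (AB s y s01 iy) mulmx1 /invmx Au.
  by rewrite [in RHS]mxE.
have kdet (p : nat) (B : R -> M -> 'M[R[i]]_p) : (forall k l, kfam (fun s y => B s y k l) x) ->
   kfam (fun s y => \det (B s y)) x.
  move=> hB; rewrite /determinant; apply: kfam_sum => sigma.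
  by apply: kfamM; [exact: kfam_cst|exact: kfam_prod].
have kA k' l' : kfam (fun s y => A s y k' l') x by exact: ha.
apply: kfamM.
  apply: kfamV; last exact: kdet.
  apply: filterS (tdom_near ix) => y iy s s01.
  have [Au _] := mulmx1_unit (AB s y s01 iy).
  by move: Au; rewrite unitmxE unitfE.
apply: (kfam_ext (f := fun s y => (-1) ^+ (l + k) * \det (row' l (col' k (A s y))))).
  by move=> s y; rewrite [in RHS]mxE.
apply: kfamM; first exact: kfam_cst.
apply: kdet => k' l'; apply: kfam_ext (kA (fintype.lift l k') (fintype.lift k l')) => s y.
by rewrite !mxE.
Qed.

Lemma kendo_tr a x : kendo a -> kfam (fun s y => strace (a s) y) x.
Proof.
move=> ha; have [i ix] := tdom_cover E x.
apply: (kfam_near (f := fun s y => \sum_k (triv i y *m a s y *m trivV i y) k k)).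
  apply: filterS (tdom_near ix) => y iy s _ /=.
  transitivity (\tr (triv i y *m a s y *m trivV i y)) => //.
  by rewrite mxtrace_mulC mulmxA trivK // mul1mx.
by apply: kfam_sum => k; exact: ha.
Qed.

Definition klf (w : R -> L) := forall l, kendo (fun s => w s l).

Lemma klfM (u v : R -> L) : klf u -> klf v -> klf (fun s => u s * v s).
Proof.
move=> hu hv l; elim: l u v hu hv => [|X l IH] u v hu hv.
  exact: (kendoM (hu [::]) (hv [::])).
apply: (kendoD (IH (fun s => iota_ X (u s)) _ _ hv) (IH (fun s => eps (u s)) (fun s => iota_ X (v s)) _ _)).
- by move=> k; exact: hu.
- move=> k; case o: (odd (size k)).
    by apply: kendo_eq (kendoN (hu k)) => s; rewrite /eps o.
  by apply: kendo_eq (hu k) => s; rewrite /eps o.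
- by move=> k; exact: hv.
Qed.

Lemma klfX (u : R -> L) k : klf u -> klf (fun s => u s ^+ k).
Proof.
move=> hu; elim: k => [|k IH] l; first exact: kendo_cst.
by apply: kendo_eq (klfM hu IH l) => s; rewrite exprS.
Qed.

Lemma klf_form1 (K : R -> vfield M -> sendo E) : (forall X, kendo (fun s => K s X)) ->
  klf (fun s => form1 (K s)).
Proof. by move=> h [|X [|? ?]]; [exact: (kendo_cst 0)|exact: h|exact: (kendo_cst 0)]. Qed.

Lemma kfam_lie (w : R -> seq (vfield M) -> sfun M) (W : seq (vfield M) -> sfun M) X l :
  (forall l x, kfam (fun s y => w s l y) x) ->
  (forall l x, W l x = cintegral01 (fun s => w s l x)) ->
  (forall x, kfam (fun s y => lie br act X (w s) l y) x) /\
  (forall x, lie br act X W l x = cintegral01 (fun s => lie br act X (w s) l x)).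
Proof.
elim: l w W => [|Y l IH] w W hw hW /=.
  split=> x; first exact: (kfam_cvf (hw [::])).
  rewrite -(kfam_cint_cvf (hw [::])); congr (cvf X _ x).
  by apply/funext => y; exact: hW.
have [h1 h2] := IH (fun s => iota_ Y (w s)) (iota_ Y W) (fun l => hw (Y :: l)) (fun l => hW (Y :: l)).
split=> x; first by apply: kfamD; [exact: h1|apply: kfamN; exact: hw].
rewrite h2 hW -mulN1r -cintZ; last exact: (kfam_ccont (hw _ x)).
rewrite -cintD; last 2 first.
- exact: (kfam_ccont (h1 x)).
- by apply: ccontM; [exact: ccont_cst|exact: (kfam_ccont (hw _ x))].
by apply: cint_eq => s _; rewrite mulN1r.
Qed.

(** The recursion of the exterior derivative uses only vector fields and sums, so differentiation
    under the integral passes from functions to forms by induction on the list. *)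
Lemma kfam_dd (w : R -> seq (vfield M) -> sfun M) (W : seq (vfield M) -> sfun M) l :
  (forall l x, kfam (fun s y => w s l y) x) ->
  (forall l x, W l x = cintegral01 (fun s => w s l x)) ->
  (forall x, kfam (fun s y => dd br act (w s) l y) x) /\
  (forall x, dd br act W l x = cintegral01 (fun s => dd br act (w s) l x)).
Proof.
elim: l w W => [|X l IH] w W hw hW.
  by split=> x /=; [exact: kfam_cst|rewrite cint_cst].
have [l1 l2] := kfam_lie X l hw hW.
have [h1 h2] := IH (fun s => iota_ X (w s)) (iota_ X W) (fun l => hw (X :: l)) (fun l => hW (X :: l)).
split=> x; first by apply: kfamD; [exact: l1|apply: kfamN; exact: h1].
rewrite /= l2 h2 -mulN1r -cintZ; last exact: (kfam_ccont (h1 x)).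
rewrite -cintD; last 2 first.
- exact: (kfam_ccont (l1 x)).
- by apply: ccontM; [exact: ccont_cst|exact: (kfam_ccont (h1 x))].
by apply: cint_eq => s _; rewrite mulN1r.
Qed.

Lemma cint_form (w : R -> seq (vfield M) -> sfun M) :
  (forall l x, kfam (fun s y => w s l y) x) ->
  (forall s x, 0 <= s <= 1 -> form_at x (fun l => w s l x : R[i]^o)) ->
  is_form (fun l x => cintegral01 (fun s => w s l x)).
Proof.
move=> hw fw; apply/is_formP; split=> [l|x]; first exact: cint_csmT.
split=> [f X Y Z l1 l2 hf hZ|X l1 l2].
  rewrite /GRing.scale /= -cintZ; last exact: (kfam_ccont (hw _ x)).
  rewrite -cintD; last 2 first.
  - by apply: ccontM; [exact: ccont_cst|exact: (kfam_ccont (hw _ x))].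
  - exact: (kfam_ccont (hw _ x)).
  by apply: cint_eq => s s01; exact: ((fw s x s01).1).
rewrite -[RHS](cint_cst 0); apply: cint_eq => s s01; exact: ((fw s x s01).2).
Qed.

End KEndo.

(** * Variation of the transgression *)

Section PathLemma.
Context {R : realType} {n : nat} {M : manifold R n} {E : vbundle M}.
Local Notation br := (@bracket R n M).
Local Notation act := (@sact R n M).
Local Notation L := (lform (vfield M) (sendo E)).
Local Notation cc := (@chern_const R).
Local Notation ec := (@expc R).

(** The path is [A + th_s] with [th_s = cdiff hA (hDp s)], and [et s] is the derivative of [th_s].
    The curvature of [A + t th_s] also involves covariant derivatives of [th_s], whence the separate
    regularity hypotheses on [delta]. *)
Variables (A : preconnection E) (hA : is_connection A).
Variables (Dp : R -> preconnection E) (hDp : forall s, is_connection (Dp s)).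
Variable (et : R -> vfield M -> sendo E).
Hypothesis kth : forall X, kendo (fun s => cdiff hA (hDp s) X).
Hypothesis kdth : forall X Y, kendo (fun s => delta hA X (cdiff hA (hDp s) Y)).
Hypothesis ket : forall X, kendo (fun s => et s X).
Hypothesis mth : forall X x (s : R), 0 < s < 1 ->
  mder (fun s => cdiff hA (hDp s) X x) (et s X x) s.
Hypothesis mdth : forall X Y x (s : R), 0 < s < 1 ->
  mder (fun s => delta hA X (cdiff hA (hDp s) Y) x) (delta hA X (et s Y) x) s.
Hypothesis fet : forall (s : R) x, 0 <= s <= 1 -> form_at x (ev x (form1 (et s))).

Local Notation th s := (form1 (cdiff hA (hDp s)) : L).
Local Notation ets s := (form1 (et s) : L).
Local Notation As s t := (aconn hA (hDp s) t).
Local Notation F s t := (Fform (As s t)).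

Lemma Fst_E s (t : R) l : F s t l = Fform hA l +
  (seZ t%:C ((dd br (delta hA) (th s) : L) l) + seZ (t%:C ^+ 2) ((th s * th s) l)).
Proof. by apply/sendo_eq => x; exact: Fform_aconn. Qed.

Lemma klf_th : klf (fun s => th s).
Proof. exact: klf_form1. Qed.

Lemma klf_F (t : R) : klf (fun s => F s t).
Proof.
move=> l; apply: kendo_eq (kendoD (kendo_cst (Fform hA l)) (kendoD
  (kendoZ (fun x => kfam_cst t%:C x) (a := fun s => (dd br (delta hA) (th s) : L) l) _)
  (kendoZ (fun x => kfam_cst (t%:C ^+ 2) x) (klfM klf_th klf_th l)))) => [s|].
  by rewrite Fst_E.
have E0 s : (dd br (delta hA) (th s) : L) l = form2 (fun X Y =>
    delta hA X (cdiff hA (hDp s) Y) - delta hA Y (cdiff hA (hDp s) X)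
    - cdiff hA (hDp s) (br X Y)) l.
  by rewrite dd_form1 //; exact: deltaB.
apply: (kendo_eq (fun s => esym (E0 s))).
case: l {E0} => [|X l]; first exact: (kendo_cst 0).
case: l => [|Y l]; first exact: (kendo_cst 0).
case: l => [|? ?]; last exact: (kendo_cst 0).
exact: (kendoB (kendoB (kdth X Y) (kdth Y X)) (kth (br X Y))).
Qed.

Lemma dd_et s (t : R) : dd br (delta (As s t)) (ets s) =
  (dd br (delta hA) (ets s) : L) +
  (((fun l => seZ t%:C (th s l)) : L) * ets s + ets s * ((fun l => seZ t%:C (th s l)) : L)).
Proof.
rewrite (dd_diff hA (As s t)); congr (_ + _).
rewrite (_ : cdiff hA (As s t) = fun X => seZ t%:C (cdiff hA (hDp s) X)); last first.
  by apply/funext => X; exact: cdiff_aconn.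
by rewrite form1_seZ.
Qed.

Lemma lder_th s x : 0 < s < 1 -> lder (fun s => ev x (th s)) (ev x (ets s)) s.
Proof.
by move=> s01 [|X [|? ?]]; [exact: mder_cst|exact: mth|exact: mder_cst].
Qed.

Lemma lder_ddth s x : 0 < s < 1 -> lder (fun s => ev x (dd br (delta hA) (th s)))
  (ev x (dd br (delta hA) (ets s))) s.
Proof.
move=> s01.
have E0 (K : vfield M -> sendo E) l : ev x (dd br (delta hA) (form1 K)) l = form2 (fun X Y =>
    delta hA X (K Y) x - delta hA Y (K X) x - K (br X Y) x) l.
  by rewrite /ev dd_form1; [case: l => [|X [|Y [|? ?]]]|exact: deltaB].
apply: (lder_ext (u := fun s => form2 (fun X Y =>
    delta hA X (cdiff hA (hDp s) Y) x - delta hA Y (cdiff hA (hDp s) X) x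
    - cdiff hA (hDp s) (br X Y) x))).
- by move=> t; apply/funext => l; rewrite E0.
- by apply/esym/funext => l; rewrite E0.
case=> [|X [|Y [|? ?]]]; try exact: mder_cst.
apply: mderD; last by apply: mderN; exact: mth.
by apply: mderD; [exact: mdth|apply: mderN; exact: mdth].
Qed.

Lemma ev_seZ (c : R[i]) (w : L) x : ev x (fun l => seZ c (w l)) = fun l => c *: ev x w l.
Proof. by []. Qed.

Lemma lder_F s (t : R) x : 0 < s < 1 -> lder (fun s => ev x (F s t))
  (fun l => t%:C *: ev x (dd br (delta (As s t)) (ets s)) l) s.
Proof.
move=> s01 l.
have h1 := @lder_ddth s x s01 l.
have h2 := lderM (@lder_th s x s01) (@lder_th s x s01) l.
have H := mderD (mder_cst (Fform hA l x) s) (mderD (mderZ (cder_cst t%:C s) h1)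
  (mderZ (cder_cst (t%:C ^+ 2) s) h2)).
move: H; congr mder.
  apply/funext => s'; rewrite /= /ev Fst_E !sendoD !seZE; congr (_ + (_ + _ *: _)).
  by rewrite -/(ev x _ l) evM.
rewrite dd_et !scale0r !add0r /ev !funDE !sendoD !scalerDr; congr (_ + _).
rewrite -!/(ev x _ l) !evM !ev_seZ lmulZr lmulZl.
rewrite !scalerA -expr2 -!scalerDr; congr (_ *: _); exact: addrC.
Qed.

(** Its differential is the asymmetry of the mixed second variation in the directions [th] and [et];
    an average of such forms is the primitive in the variation formula. *)
Definition Bk s (t : R) k (l : seq (vfield M)) : sfun M :=
  strace ((\sum_(i < k) th s * F s t ^+ i * ets s * F s t ^+ (k.-1 - i)) l).

Lemma cder_tf_path s (t : R) k l x : 0 < s < 1 ->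
  cder (fun s => tf (th s) (F s t) k l x)
   (tf (ets s) (F s t) k l x + t%:C * strace ((th s * \sum_(i < k)
     F s t ^+ i * dd br (delta (As s t)) (ets s) * F s t ^+ (k.-1 - i)) l) x) s.
Proof.
move=> s01.
have H := mder_tr (lderM (@lder_th s x s01) (lderX k (@lder_F s t x s01)) l).
apply: cder_eq (cder_ext _ H); last by move=> s'; rewrite tfE.
rewrite mxtraceD tfE; congr (_ + _) => /=.
rewrite -mxtraceZ -/(ev x _ l) evM -lmulZr; congr (\tr _); congr ((_ * _ : lform _ _) l).
apply/funext => m; rewrite ev_sum !sumfunE scaler_sumr; apply: eq_bigr => i _.
rewrite !evM !evX -lmulZl; congr ((_ * _ : lform _ _) m).
by apply/funext => m'; exact: lmulZr.
Qed.

(** Compared with [cder_tf_path]: the derivative in [s] of [tr(th F^k)] is the derivative in [t] of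
    [t tr(et F^k)] minus [t d Bk], by [dd_Bk]. *)
Lemma tf_deriv s (t : R) k l x :
  cder (fun t : R => t%:C * tf (ets s) (F s t) k l x)
   (tf (ets s) (F s t) k l x + t%:C * strace ((ets s * \sum_(i < k)
     F s t ^+ i * dd br (delta (As s t)) (th s) * F s t ^+ (k.-1 - i)) l) x) t.
Proof.
have H := mder_tr (lderM (lder_cst (ev x (ets s)) t)
   (lderX k (@lder_Fform _ _ _ _ _ _ hA (hDp s) t x)) l).
have H2 : cder (fun t : R => tf (ets s) (F s t) k l x) (strace ((ets s * \sum_(i < k)
     F s t ^+ i * dd br (delta (As s t)) (th s) * F s t ^+ (k.-1 - i)) l) x) t.
  apply: cder_eq (cder_ext _ H); last by move=> s'; rewrite tfE.
  rewrite mul0r add0r /= -/(ev x _ l) evM; congr (\tr _); congr ((_ * _ : lform _ _) l).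
  rewrite ev_sum; apply: eq_bigr => i _.
  by rewrite !evM !evX.
have := cderM (cder_real (is_derive_id t (1 : R))) H2.
by rewrite mul1r.
Qed.

Lemma dd_Bk s (t : R) k l : dd br act (Bk s t k) l =
  strace ((ets s * \sum_(i < k)
     F s t ^+ i * dd br (delta (As s t)) (th s) * F s t ^+ (k.-1 - i)) l) -
  strace ((th s * \sum_(i < k)
     F s t ^+ i * dd br (delta (As s t)) (ets s) * F s t ^+ (k.-1 - i)) l).
Proof.
have := (dd_tr_bilinear (@deltaB _ _ _ _ _ (As s t)) (@deltaM _ _ _ _ _ (As s t)) (@straceB _ _ _ E) (@straceC _ _ _ E)
  (strace_delta (As s t)) k l (Fform_parity (As s t)) (dd_Fform (As s t))
  (parity_form1 (cdiff hA (hDp s))) (parity_form1 (et s))).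
move=> <-. rewrite /Bk. reflexivity.
Qed.

Lemma tf_poly_et s l x k : polyN (size l).+2 (fun t : R => t%:C * tf (ets s) (F s t) k l x).
Proof.
apply: (@polyNM _ 1 (size l)); first exact: polyN_id.
apply: (polyN_ext (f := fun t => \tr ((ev x (ets s) * ev x (F s t) ^+ k) l))).
  by move=> t; rewrite tfE.
apply: (lpoly_tr l (u := fun t => ev x (ets s) * ev x (F s t) ^+ k)).
by apply: (lpolyM (lpoly_cst 0 (ev x (ets s)))); apply: lpolyX; exact: lpoly_Fform.
Qed.

Definition Bsum N s (l : seq (vfield M)) : sfun M :=
  sfZ cc (\sum_(j < N) sfZ (qw R j) (\sum_(k < N) sfZ (ec k) (sfZ j%:R (Bk s j%:R k l)))).

Lemma BsumE N s l x : Bsum N s l x =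
  cc * \sum_(j < N) qw R j * \sum_(k < N) ec k * (j%:R * Bk s j%:R k l x).
Proof.
rewrite /Bsum sfZE sfun_sum; congr (_ * _); apply: eq_bigr => j _.
rewrite sfZE sfun_sum; congr (_ * _); apply: eq_bigr => k _.
Qed.

Lemma dd_Bsum N s l x : dd br act (Bsum N s) l x =
  cc * \sum_(j < N) qw R j * \sum_(k < N) ec k * (j%:R * dd br act (Bk s j%:R k) l x).
Proof.
rewrite /Bsum dd_sfZ dd_sfsum sfZE sfun_sum; congr (_ * _); apply: eq_bigr => j _.
rewrite dd_sfZ dd_sfsum sfZE sfun_sum; congr (_ * _); apply: eq_bigr => k _.
by rewrite !dd_sfZ !sfZE.
Qed.

Lemma klf_Bk_arg (t : R) k : klf (fun s => \sum_(i < k) th s * F s t ^+ i * ets s * F s t ^+ (k.-1 - i)).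
Proof.
move=> l; apply: (kendo_eq (a := fun s => \sum_(i < k) (th s * F s t ^+ i * ets s * F s t ^+ (k.-1 - i)) l)).
  by move=> s; rewrite lform_sumE.
apply: kendo_sum => i; apply: (klfM (klfM (klfM klf_th (klfX i (klf_F t))) (klf_form1 ket))).
exact: klfX (klf_F t).
Qed.

Lemma kfam_cstM (c : R[i]) f (x : M) : kfam f x -> kfam (fun s y => c * f s y) x.
Proof. by move=> h; apply: kfamM => //; exact: kfam_cst. Qed.

Lemma kfam_Bsum N l x : kfam (fun s y => Bsum N s l y) x.
Proof.
apply: kfam_ext (fun s y => esym (BsumE N s l y)) _.
apply: kfam_cstM; apply: kfam_sum => j; apply: kfam_cstM; apply: kfam_sum => k.
apply: kfam_cstM; apply: kfam_cstM; exact: (kendo_tr x (klf_Bk_arg j%:R k l)).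
Qed.

Lemma form_Bsum N s x : 0 <= s <= 1 -> form_at x (fun l => Bsum N s l x : R[i]^o).
Proof.
move=> s01; have h : form_at x (fun l => cc * \sum_(j < N) qw R j * \sum_(k < N) ec k *
    (j%:R * \sum_(i < k) \tr ((ev x (th s) * ev x (F s j%:R) ^+ i * ev x (ets s) * ev x (F s j%:R) ^+ (k.-1 - i)) l)) : R[i]^o).
  apply: form_at_Z; apply: form_at_sum => j; apply: form_at_Z; apply: form_at_sum => k.
  do 2 apply: form_at_Z; apply: form_at_sum => i; apply: form_at_tr.
  have FF := Fform_form (As s j%:R) x.
  apply: form_at_mul; last exact: form_at_exp.
  apply: form_at_mul; last exact: fet.
  by apply: form_at_mul; [exact: cdiff_form|exact: form_at_exp].
move: h; congr form_at; apply/funext => l; rewrite BsumE; congr (_ * _).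
apply: eq_bigr => j _; congr (_ * _); apply: eq_bigr => k _; congr (_ * (_ * _)).
rewrite /Bk lform_sumE /=.
transitivity (\tr (\sum_(i < k) ev x (th s * F s j%:R ^+ i * ets s * F s j%:R ^+ (k.-1 - i)) l)).
  by rewrite raddf_sum; apply: eq_bigr => i _; rewrite !evM !evX.
congr (\tr _); elim/big_rec2: _ => // i a b _ ->; by rewrite sendoD.
Qed.

Definition path_form : preform (M := M) := fun l x => cc * cintegral01 (fun s =>
  \sum_(k < (size l).+1) ec k * tf (ets s) (Fform (hDp s)) k l x).

Lemma Dop_aconn1 s X v : Dop (As s 1) X v = Dop (hDp s) X v.
Proof.
rewrite Dop_aconn; apply/ssec_eq => y; rewrite ssecD sapp_seZ /= rmorph1 scale1r.
have := congr1 (fun t : ssec E => t y) (cdiffE hA (hDp s) X v) => /= ->.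
by rewrite addrC subrK.
Qed.

(** The identity between the derivatives in [s] and in [t] is integrated over the unit square. The
    derivative in [s] gives the difference of the transgressions; the derivative in [t] gives the
    value at [t = 1], where [A + th_s] is the path itself; the rest is exact. Integration in [t] is
    a quadrature, integration in [s] a true integral. *)
Lemma transgression_path : exists2 u : preform (M := M), even_form u &
  transgression A (Dp 1) - transgression A (Dp 0) = path_form + dform u.
Proof.
(* The differential at [l] evaluates [U] on lists with one argument less, where the truncation
   becomes [(size l).+1], the one used for the transgressions. *)
pose U : preform (M := M) := fun l x => - cintegral01 (fun s => Bsum (size l).+2 s l x).
have UN N : is_form (fun l x => - cintegral01 (fun s => Bsum N s l x)).
  have := is_formN (cint_form (kfam_Bsum N) (fun s x => @form_Bsum N s x)).
  by [].
have Uf : is_form U.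
  apply/is_formP; split=> [l|x]; first exact: ((is_formP _).1 (UN (size l).+2)).1.
  split=> [f X Y Z l1 l2 hf hZ|X l1 l2].
    rewrite /U !size_cat /=.
    exact: ((((is_formP _).1 (UN (size l1 + (size l2).+1).+2)).2 x).1 f X Y Z l1 l2 hf hZ).
  exact: ((((is_formP _).1 (UN _)).2 x).2 X l1 l2).
have Upar : of_parity false U.
  move=> l hl; apply/funext => x; rewrite /U -[RHS]oppr0; congr (- _).
  rewrite -[RHS](cint_cst 0); apply: cint_eq => s _; rewrite BsumE big1 ?mulr0 // => j _.
  rewrite big1 ?mulr0 // => k _.
  rewrite (_ : Bk s j%:R k l = 0) ?sfun0 ?mulr0 //.
  rewrite /Bk (_ : (\sum_(i < k) _) l = 0) => [|]; last first.
    rewrite lform_sumE big1 // => i _.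
    have pF m : parity false (F s j%:R ^+ m) by apply: parity_exp; exact: Fform_parity.
    have p1 := lmul_parity (lmul_parity (lmul_parity (parity_form1 (cdiff hA (hDp s))) (pF i))
      (parity_form1 (et s))) (pF (k.-1 - i)%N).
    exact: p1.
  by apply/sfun_eq/funext => y /=; rewrite mxtrace0.
exists U => //.
apply/funext => l; apply/funext => x.
rewrite !funBE !funDE (dform_sform Uf) -/(path_form l x).
pose N := (size l).+1.
pose W k : sfun M := SFun (((is_formP _).1 (UN N)).1 k).
have -> : dd br act (sform Uf) l = dd br act W l.
  by apply: dd_eq => k hk; apply/sfun_eq/funext => y; rewrite /= /U /N hk.
pose w (s : R) k := - Bsum N s k.
have wk k y : kfam (fun s z => w s k z) y by apply: kfamN; exact: kfam_Bsum.
have Ww k y : W k y = cintegral01 (fun s => w s k y).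
  rewrite /W /= -mulN1r -cintZ; last exact: (kfam_ccont (kfam_Bsum N k y)).
  by apply: cint_eq => s _; rewrite mulN1r.
have [d1 d2] := kfam_dd l wk Ww.
rewrite d2 /path_form -cintZ; last first.
  apply: ccont_sum => k; apply: ccontM; first exact: ccont_cst.
  apply: (@ccont_eq _ (fun s => tf (ets s) (F s 1) k l x)).
    by move=> s _; rewrite (Dop_ext_delta (Dop_aconn1 s)).1.
  exact: (kfam_ccont (kendo_tr x (klfM (klf_form1 ket) (klfX k (klf_F 1)) l))).
pose T s := Tsf hA (hDp s) N l x.
have TE s : T s = cc * \sum_(j < N) qw R j * \sum_(k < N) ec k * tf (th s) (F s j%:R) k l x.
  rewrite /T /Tsf sfZE sfun_sum; congr (_ * _); apply: eq_bigr => j _.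
  by rewrite sfZE sfun_sum.
have cT : ccont T.
  apply: (@ccont_eq _ (fun s => cc * \sum_(j < N) qw R j * \sum_(k < N) ec k * tf (th s) (F s j%:R) k l x)).
    by move=> s _; rewrite TE.
  apply: ccontM; first exact: ccont_cst.
  apply: ccont_sum => j; apply: ccontM; first exact: ccont_cst.
  apply: ccont_sum => k; apply: ccontM; first exact: ccont_cst.
  exact: (kfam_ccont (kendo_tr x (klfM klf_th (klfX k (klf_F j%:R)) l))).
have cG : ccont (fun s => cc * \sum_(k < N) ec k * tf (ets s) (Fform (hDp s)) k l x).
  apply: ccontM; first exact: ccont_cst.
  apply: ccont_sum => k; apply: ccontM; first exact: ccont_cst.
  apply: (@ccont_eq _ (fun s => tf (ets s) (F s 1) k l x)).
    by move=> s _; rewrite (Dop_ext_delta (Dop_aconn1 s)).1.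
  exact: (kfam_ccont (kendo_tr x (klfM (klf_form1 ket) (klfX k (klf_F 1)) l))).
have cW : ccont (fun s => dd br act (w s) l x) by exact: (kfam_ccont (d1 x)).
rewrite -(cintD cG cW) (TsfE hA (hDp 1) x (ltnSn _)) (TsfE hA (hDp 0) x (ltnSn _)).
apply/esym; apply: (cint_FTC cT (ccontD cG cW)) => s s01.
apply: (cder_ext (fun s => esym (TE s))).
have h k (t : R) := cder_tf_path t k l x s01.
have H := cderZ cc (cder_sum (index_enum 'I_N) predT (fun j : 'I_N => cderZ (qw R j)
  (cder_sum (index_enum 'I_N) predT (fun k : 'I_N => cderZ (ec k) (h k j%:R))))).
apply: cder_eq H.
have -> : dd br act (w s) l x = - dd br act (Bsum N s) l x.
  have -> : w s = - Bsum N s by [].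
  by rewrite ddN //; exact: sactB.
rewrite dd_Bsum -mulrBr; congr (_ * _).
(* The factor [t] makes [p] vanish at 0, so that [qw_deriv] leaves the value at [t = 1] alone. *)
have [p sp pe] : polyN N.+1 (fun t : R => \sum_(k < N) ec k * (t%:C * tf (ets s) (F s t) k l x)).
  apply: polyN_sum => k; apply: (@polyNM _ 0 N); first exact: polyN_cst.
  exact: tf_poly_et.
have pd (t : R) : (p^`()).[t%:C] = \sum_(k < N) ec k * (tf (ets s) (F s t) k l x +
   t%:C * strace ((ets s * \sum_(i < k)
     F s t ^+ i * dd br (delta (As s t)) (th s) * F s t ^+ (k.-1 - i)) l) x).
  have e1 : cder (fun t : R => \sum_(k < N) ec k * (t%:C * tf (ets s) (F s t) k l x)) (p^`()).[t%:C] t.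
    by apply: cder_ext (cder_horner p t) => t'; rewrite pe.
  apply: (cder_unique e1); apply: cder_sum => k; apply: cderZ; exact: tf_deriv.
have -> : \sum_(k < N) ec k * tf (ets s) (Fform (hDp s)) k l x = p.[1] - p.[0].
  have -> : p.[0] = 0.
    by rewrite -(rmorph0 (real_complex R)) -pe big1 // => k _; rewrite rmorph0 mul0r mulr0.
  rewrite subr0 -(rmorph1 (real_complex R)) -pe; apply: eq_bigr => k _.
  by rewrite rmorph1 mul1r (Dop_ext_delta (Dop_aconn1 s)).1.
rewrite -(qw_deriv sp) -sumrB; apply: eq_bigr => j _; rewrite -mulrBr; congr (_ * _).
rewrite -(rmorph_nat (real_complex R)) pd -sumrB; apply: eq_bigr => k _.
rewrite -mulrBr; congr (_ * _).
by rewrite dd_Bk sfunB; ring.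
Qed.

End PathLemma.

(** * The cocycle relation *)

Section Cocycle.
Context {R : realType} {n : nat} {M : manifold R n} {E : vbundle M}.
Local Notation br := (@bracket R n M).
Local Notation act := (@sact R n M).
Local Notation L := (lform (vfield M) (sendo E)).

Lemma deltaD (D : preconnection E) (hD : is_connection D) X a b :
  delta hD X (a + b) = delta hD X a + delta hD X b.
Proof. by apply/sapp_inj => s; rewrite sappDl !deltaE !sappDl DopD; abelu. Qed.

(** The variation formula based at [A], along the affine path from [B] to [C]: the derivative of the
    path is constant, and the resulting integral is the transgression from [B] to [C] itself. *)
Lemma ch_tilde_cocycle (A B C : preconnection E) : is_connection A -> is_connection B ->
  is_connection C -> ch_tilde A B + ch_tilde B C = ch_tilde A C.
Proof.
move=> hA hB hC.
have cE (s : R) X : cdiff hA (aconn hB hC s) X = cdiff hA hB X + seZ s%:C (cdiff hB hC X).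
  apply/sapp_inj => v; rewrite sappDl !cdiffE Dop_aconn; rewrite (Dop_cdiff hA hB X v); abelu.
have dE X Y (s : R) : delta hA X (cdiff hA (aconn hB hC s) Y) =
    delta hA X (cdiff hA hB Y) + seZ s%:C (delta hA X (cdiff hB hC Y)).
  by rewrite cE deltaD delta_seZ.
have ks (a b : sendo E) : kendo (fun s : R => a + seZ s%:C b).
  by apply: kendoD; [exact: kendo_cst|apply: kendoZ; [exact: kfam_s|exact: kendo_cst]].
have ms (a b : sendo E) x (s : R) : mder (fun s : R => (a + seZ s%:C b) x) (b x) s.
  have := mderD (mder_cst (a x) s) (mderZ (cder_real (is_derive_id s (1 : R))) (mder_cst (b x) s)).
  by rewrite add0r scaler0 addr0 scale1r.
have [] := @transgression_path R n M E A hA (affine_path B C) (aconn hB hC) (fun=> cdiff hB hC).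
- by move=> X; apply: kendo_eq (ks (cdiff hA hB X) (cdiff hB hC X)) => s; rewrite cE.
- move=> X Y; apply: kendo_eq (ks (delta hA X (cdiff hA hB Y)) (delta hA X (cdiff hB hC Y))) => s.
  by rewrite dE.
- by move=> X; exact: kendo_cst.
- move=> X x s _; have := ms (cdiff hA hB X) (cdiff hB hC X) x s; congr mder.
  by apply/funext => t; rewrite cE.
- move=> X Y x s _; have := ms (delta hA X (cdiff hA hB Y)) (delta hA X (cdiff hB hC Y)) x s.
  by congr mder; apply/funext => t; rewrite dE.
- by move=> s x _; exact: cdiff_form.
move=> u hu; rewrite affine_path1 affine_path0.
have -> : path_form (aconn hB hC) (fun=> cdiff hB hC) = transgression B C.
  apply/funext => l; apply/funext => x.
  by rewrite (transgressionE hB hC x (ltnSn _)).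
move=> e; rewrite /ch_tilde -class_ofD; [|exact: transgression_odd..].
apply/esym; apply: (class_of_eq _ _ hu); [exact: transgression_odd| |].
  by apply: odd_formD; exact: transgression_odd.
by rewrite opprD addrA e addrAC subrr add0r.
Qed.

Lemma ch_tilde_diag (A : preconnection E) : is_connection A -> ch_tilde A A = 0.
Proof. by move=> hA; apply: (addrI (ch_tilde A A)); rewrite addr0 ch_tilde_cocycle. Qed.

Lemma ch_tildeN (A B : preconnection E) : is_connection A -> is_connection B ->
  ch_tilde B A = - ch_tilde A B.
Proof.
by move=> hA hB; apply/eqP; rewrite -addr_eq0 ch_tilde_cocycle // ch_tilde_diag.
Qed.

Lemma ch_tilde_ext (A B C : preconnection E) (hA : is_connection A) (hB : is_connection B)
    (hC : is_connection C) : (forall X s, Dop hB X s = Dop hC X s) -> ch_tilde A B = ch_tilde A C.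
Proof.
move=> h; rewrite /ch_tilde; suff -> : transgression A B = transgression A C by [].
apply/funext => l; apply/funext => x.
rewrite (TsfE hA hB x (ltnSn _)) (TsfE hA hC x (ltnSn _)).
have cE : cdiff hA hC = cdiff hA hB.
  by apply/funext => X; apply/sapp_inj => s; rewrite !cdiffE h.
have eF (t : R) : Fform (aconn hA hB t) = Fform (aconn hA hC t).
  by apply: (Dop_ext_delta _).1 => X s; rewrite !Dop_aconn cE.
suff -> : Tsf hA hB (size l).+1 l = Tsf hA hC (size l).+1 l by [].
rewrite /Tsf cE; congr (sfZ _ _); apply: eq_bigr => j _; rewrite eF; reflexivity.
Qed.

End Cocycle.

Lemma comm_linv (A : pzRingType) (a b c : A) : b * c = 1 -> c * b = 1 ->
  a * b = b * a -> a * c = c * a.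
Proof. by move=> bc cb ab; rewrite -[a * c]mul1r -cb -!mulrA (mulrA b) -ab -mulrA bc mulr1. Qed.

(** * Gauge transformations joined to the identity by a segment *)

Section Gauge.
Context {R : realType} {n : nat} {M : manifold R n} {E : vbundle M}.
Local Notation br := (@bracket R n M).
Local Notation act := (@sact R n M).
Local Notation L := (lform (vfield M) (sendo E)).
Local Notation cc := (@chern_const R).
Local Notation ec := (@expc R).

Lemma dd_form0 (D : preconnection E) (hD : is_connection D) (b : sendo E) :
  dd br (delta hD) (form0 b : L) = form1 (fun X => delta hD X b).
Proof.
apply/funext => l; have [hl|hl] := eqVneq (size l) 1%N; last first.
  transitivity (0 : sendo E); last by case: l hl => [|? [|? ?]].
  apply: (@dd_supp _ _ _ _ (@deltaB _ _ _ _ _ hD) 0) => // k.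
  by case: k.
by case: l hl => [|X [|? ?]] //= _; rewrite subr0.
Qed.

(** The index [N] is a truncation. The primitive takes [(size l).+2] so that its differential, which
    lowers the number of arguments by one, meets the truncation [(size l).+1] of [p]. *)
Lemma cint_exact (w : nat -> R -> seq (vfield M) -> sfun M) (p : preform (M := M)) :
  (forall N l x, kfam (fun s y => w N s l y) x) ->
  (forall N s x, 0 <= s <= 1 -> form_at x (fun l => w N s l x : R[i]^o)) ->
  (forall N (s : R), parity false (w N s)) ->
  (forall l x, p l x = cintegral01 (fun s => dd br act (w (size l).+1 s) l x)) ->
  exists2 u, even_form u & p = dform u.
Proof.
move=> kw fw pw hp.
pose U : preform (M := M) := fun l x => cintegral01 (fun s => w (size l).+2 s l x).
have UN N : is_form (fun l x => cintegral01 (fun s => w N s l x)) by exact: (cint_form (kw N) (fw N)).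
have Uf : is_form U.
  apply/is_formP; split=> [l|x]; first exact: ((is_formP _).1 (UN (size l).+2)).1.
  split=> [f X Y Z l1 l2 hf hZ|X l1 l2].
    rewrite /U !size_cat /=.
    exact: ((((is_formP _).1 (UN (size l1 + (size l2).+1).+2)).2 x).1 f X Y Z l1 l2 hf hZ).
  exact: ((((is_formP _).1 (UN _)).2 x).2 X l1 l2).
exists U.
  split=> // l hl; apply/funext => x; rewrite /U -[RHS](cint_cst 0); apply: cint_eq => s _.
  by rewrite pw.
apply/funext => l; apply/funext => x; rewrite (dform_sform Uf) hp.
pose W k : sfun M := SFun (((is_formP _).1 (UN (size l).+1)).1 k).
have -> : dd br act (sform Uf) l = dd br act W l.
  by apply: dd_eq => k hk; apply/sfun_eq/funext => y; rewrite /= /U hk.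
have [_ ->] // := kfam_dd l (kw (size l).+1) (W := W) (fun _ _ => erefl).
Qed.

Lemma kendo_eq01 (a b : R -> sendo E) : (forall s, 0 <= s <= 1 -> a s = b s) ->
  kendo a -> kendo b.
Proof.
move=> ab ha x i ix k l; apply: kfam_near (ha x i ix k l).
by apply: filterE => y s s01; rewrite ab.
Qed.

Lemma kendo_ccont (a : R -> sendo E) x k l : kendo a -> ccont (fun s => a s x k l).
Proof.
move=> ha; have [i ix] := tdom_cover E x.
apply: (@ccont_eq _ (fun s => \sum_k1 (\sum_k2 trivV i x k k2 *
    (triv i x *m a s x *m trivV i x) k2 k1) * triv i x k1 l)).
  move=> s _; transitivity ((trivV i x *m (triv i x *m a s x *m trivV i x) *m triv i x) k l).
    by rewrite [RHS]mxE; apply: eq_bigr => k1 _; rewrite [in RHS]mxE.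
  by rewrite !mulmxA trivK // mul1mx -mulmxA trivK // mulmx1.
apply: ccont_sum => k1; apply: ccontM; last exact: ccont_cst.
apply: ccont_sum => k2; apply: ccontM; first exact: ccont_cst.
exact: (kfam_ccont (ha x i ix k2 k1)).
Qed.

Lemma conn_add_endo (D : preconnection E) (hD : is_connection D) (K : vfield M -> sendo E) :
  (forall (f : M -> R) (X Y Z : vfield M) (x : M), smooth_on setT f -> (forall g, Z g = f * X g + Y g) ->
    K Z x = (f x)%:C *: K X x + K Y x) ->
  is_connection (fun X s x => D X s x + K X x *m s x).
Proof.
move=> hK; split.
- move=> X s hs.
  exact: (ssP (Dop hD X (SSec hs) + sapp (K X) (SSec hs))).
- by move=> X s t hs ht x; rewrite (conn_add hD X hs ht) mulmxDr addrACA.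
- move=> X f s hf hs x; rewrite (conn_leibniz hD X hf hs) -scalemxAr scalerDr.
  by rewrite addrA.
- move=> f X Y Z s hf hZ hs x; rewrite (conn_tensorial hD hf hZ hs) (hK _ _ _ _ _ hf hZ).
  by rewrite mulmxDl scalerDr -scalemxAl addrACA.
Qed.

Lemma delta_lin (D : preconnection E) (hD : is_connection D) (a : sendo E) (f : M -> R) (X Y Z : vfield M) x :
  smooth_on setT f -> (forall g, Z g = f * X g + Y g) ->
  delta hD Z a x = (f x)%:C *: delta hD X a x + delta hD Y a x.
Proof.
move=> hf hZ; apply: sec_span => s; rewrite mulmxDl -scalemxAl.
have e W : delta hD W a x *m s x = Dop hD W (sapp a s) x - a x *m Dop hD W s x.
  exact: (congr1 (fun t : ssec E => t x) (deltaE hD W a s)).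
rewrite !e (Dop_combine hD _ _ hf hZ) (Dop_combine hD _ _ hf hZ) mulmxDr -scalemxAr.
by rewrite scalerBr; abelu.
Qed.

Lemma near01 (s : R) : 0 < s < 1 -> \forall t \near s, 0 < t < 1.
Proof.
move=> s01; have h : s \in `]0, 1[ by rewrite in_itv.
by apply: filterS (near_in_itvoo h) => t; rewrite in_itv.
Qed.

(** The inverse [gi s] is constrained only for [s] in the unit interval, hence the side conditions
    below. The scalar [s] is encoded as the central endomorphism [z s], so that ring rewriting
    applies. *)
Variables (D : preconnection E) (hD : is_connection D) (g : sendo E) (gi : R -> sendo E).
Local Notation h := (g - 1).
Local Notation z s := (seZ s%:C (1 : sendo E)).
Local Notation gs s := (1 + z s * h).
Hypothesis giK : forall s : R, 0 <= s <= 1 -> gs s * gi s = 1.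
Hypothesis giV : forall s : R, 0 <= s <= 1 -> gi s * gs s = 1.

Let zC (s : R) (a : sendo E) : a * z s = z s * a.
Proof. by apply/sendo_eq => x; rewrite !sendoM !seZE -scalemxAl -scalemxAr mul1mx mulmx1. Qed.
Let zE (s : R) (a : sendo E) x : (z s * a) x = s%:C *: a x.
Proof. by rewrite sendoM seZE -scalemxAl mul1mx. Qed.
Let delta1 X : delta hD X 1 = 0.
Proof.
by apply: (addrI (delta hD X 1)); rewrite addr0 -{3}(mulr1 1) deltaM mulr1 mul1r.
Qed.
Let deltaz X (s : R) a : delta hD X (z s * a) = z s * delta hD X a.
Proof. by rewrite deltaM -delta_seZ delta1 (_ : seZ _ 0 = 0) ?mul0r ?add0r //; apply/sendo_eq => x; rewrite seZE scaler0. Qed.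

(** This is [g_s^-1 D g_s - D], and [get] is its derivative in [s]: the derivative of [s g_s^-1] is
    [g_s^-1 (g_s - s (g - 1)) g_s^-1 = g_s^-2]. *)
Definition gth (s : R) X : sendo E := z s * gi s * delta hD X g.
Definition get (s : R) X : sendo E := gi s * gi s * delta hD X g.

Let gs_comm (s t : R) : gs s * gs t = gs t * gs s.
Proof.
apply/sendo_eq => y; rewrite !sendoM !sendoD !zE.
rewrite !mulmxDl !mulmxDr !mul1mx !mulmx1 -!scalemxAl -!scalemxAr !scalerA.
by rewrite [t%:C * s%:C]mulrC; abelu.
Qed.

Lemma delta_gi X (s : R) : 0 <= s <= 1 -> delta hD X (gi s) = - (z s * gi s * delta hD X g * gi s).
Proof.
move=> s01; have e : delta hD X (gs s * gi s) = 0 by rewrite giK.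
have dg : delta hD X (gs s) = z s * delta hD X g.
  by rewrite deltaD delta1 add0r deltaz deltaB delta1 subr0.
move: e; rewrite deltaM dg => /eqP; rewrite addrC addr_eq0 => /eqP e.
transitivity (gi s * gs s * delta hD X (gi s)); first by rewrite giV // mul1r.
rewrite -mulrA e mulrN !mulrA; congr (- _).
by rewrite zC.
Qed.

Lemma kendo_gi : kendo gi.
Proof.
apply: (kendo_inv (a := fun s => gs s)) => //.
apply: kendoD; first exact: kendo_cst.
apply: kendoM; last exact: kendo_cst.
by apply: kendoZ; [exact: kfam_s|exact: kendo_cst].
Qed.
Lemma kendo_z : kendo (fun s => z s).
Proof. by apply: kendoZ; [exact: kfam_s|exact: kendo_cst]. Qed.

(** All the [g_s] commute, so [t g_t^-1 - s g_s^-1 = (t - s) g_t^-1 g_s^-1]; differentiability at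
    [s] then needs only the continuity of the inverse, known from rationality. *)
Lemma mder_zgi (s : R) x : 0 < s < 1 -> mder (fun t => (z t * gi t) x) ((gi s * gi s) x) s.
Proof.
move=> s01; have [s0 s1] : 0 < s /\ s < 1 by move/andP: s01.
have s01' : 0 <= s <= 1 by rewrite !ltW.
have E1 (t : R) : 0 <= t <= 1 -> (z t * gi t) x = (z s * gi s) x + (t - s)%:C *: (gi t * gi s) x.
  move=> t01.
  have -> : (t - s)%:C *: (gi t * gi s) x = (z t * gi t - z s * gi s) x.
    rewrite -zE; congr (sev _ x).
    have -> : z (t - s) = z t * gs s - gs t * z s.
      have zz : z t * (z s * h) = z t * h * z s by rewrite -mulrA zC.
      rewrite mulrDr mulr1 mulrDl mul1r zz opprD addrACA subrr addr0.
      by apply/sendo_eq => y; rewrite sendoB !seZE rmorphB scalerBl.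
    rewrite mulrBl; congr (_ - _).
      rewrite -mulrA; congr (_ * _); rewrite mulrA.
      have -> : gs s * gi t = gi t * gs s.
        exact: (comm_linv (giK t01) (giV t01) (gs_comm s t)).
      by rewrite -mulrA giK // mulr1.
    by rewrite (zC s (gs t)) -!mulrA; congr (_ * _); rewrite mulrA giK // mul1r.
  by rewrite sendoB addrCA subrr addr0.
move=> k l; apply: (cder_near (F := fun t => (z s * gi s) x k l + (t - s)%:C * (gi t * gi s) x k l)).
  have := near01 s01.
  apply: filterS => t /andP[t0 t1].
  have t01 : 0 <= t <= 1 by rewrite !ltW.
  have me (A B : 'M[R[i]]_(rank E x)) (c : R[i]) : (A + c *: B) k l = A k l + c * B k l.
    by rewrite !mxE.
  by rewrite [in RHS](E1 t t01) me.
have [c1 c2] : ccont (fun t => (gi t * gi s) x k l).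
  apply: kendo_ccont; apply: kendoM; [exact: kendo_gi|exact: kendo_cst].
have pt f : cont01 f -> {for s, continuous f}.
  move=> cf; have /continuous_within_itvP [|c0 _ _] := cf; first exact: ltr01.
  by apply: c0; rewrite in_itv /= s01.
have der f : {for s, continuous f} -> is_derive s (1 : R) (fun t => (t - s) * f t) (f s).
  move=> cf; rewrite -[X in is_derive _ _ _ X]mul1r; apply: is_derive_mul0 => //.
    have := is_deriveB (is_derive_id s (1 : R)) (is_derive_cst s s (1 : R)).
    by rewrite subr0.
  by rewrite subrr.
apply: cder_eq (cderD (cder_cst _ s) (b := (gi s * gi s) x k l) _); first by rewrite add0r.
split; [have := der _ (pt _ c1)|have := der _ (pt _ c2)]; congr is_derive; apply/funext => t.
  by rewrite ReM_ /= mul0r subr0.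
by rewrite ImM_ /= mul0r addr0.
Qed.

Let delta_c X (s : R) : 0 <= s <= 1 ->
  delta hD X (z s * gi s) = - (z s * gi s * delta hD X g * (z s * gi s)).
Proof.
move=> s01; rewrite deltaz delta_gi // mulrN; congr (- _).
by rewrite -!mulrA; congr (_ * _); rewrite !mulrA (zC s (gi s * delta hD X g)) !mulrA.
Qed.

Let delta_gth X Y (s : R) : 0 <= s <= 1 -> delta hD X (gth s Y) =
  - (z s * gi s * delta hD X g * (z s * gi s)) * delta hD Y g +
  z s * gi s * delta hD X (delta hD Y g).
Proof. by move=> s01; rewrite /gth deltaM delta_c. Qed.

Let delta_get X Y (s : R) : 0 <= s <= 1 -> delta hD X (get s Y) =
  - (gi s * gi s * delta hD X g * (z s * gi s) + z s * gi s * delta hD X g * (gi s * gi s))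
     * delta hD Y g + gi s * gi s * delta hD X (delta hD Y g).
Proof.
move=> s01; rewrite /get !deltaM delta_gi //; congr (_ + _); congr (_ * _).
rewrite mulrN mulNr opprD addrC !mulrA; congr (- _ - _).
by rewrite (zC s (gi s)) (zC s (gi s * gi s * _)) -!mulrA.
Qed.

Definition gpath (s : R) : preconnection E := fun X v x => D X v x + gth s X x *m v x.

Lemma gconn s : is_connection (gpath s).
Proof.
apply: conn_add_endo => // f X Y Z x hf hZ.
by rewrite !(sendoM (z s * gi s)) (delta_lin hD g x hf hZ) mulmxDr -scalemxAr.
Qed.

Let Dop_gconn s X v : Dop (gconn s) X v = Dop hD X v + sapp (gth s X) v.
Proof. exact/ssec_eq. Qed.

Let cdiff_g s X : cdiff hD (gconn s) X = gth s X.
Proof. by apply/sapp_inj => v; rewrite cdiffE Dop_gconn addrAC subrr add0r. Qed.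

(** The tangent to a path of gauge transforms is the covariant derivative of the infinitesimal gauge
    transformation [g_s^-1 (g - 1)]. This makes the integrand of the variation formula exact. *)
Lemma delta_b X (s : R) : 0 <= s <= 1 -> delta (gconn s) X (gi s * h) = get s X.
Proof.
move=> s01; rewrite (delta_diff hD (gconn s)) cdiff_g deltaM deltaB delta1 subr0 delta_gi //.
have -> : get s X = gi s * delta hD X g - gi s * h * gth s X.
  have e : gi s = 1 - h * (z s * gi s).
    by apply/eqP; rewrite eq_sym subr_eq mulrA (zC s h) -[in X in X + _](mul1r (gi s)) -mulrDl giK.
  rewrite /get {2}e mulrBr mulr1 mulrBl; congr (_ - _).
  by rewrite /gth !mulrA.
by rewrite /gth !mulNr !mulrA; abelu.
Qed.

Let mder_near p q (a b : R -> 'M[R[i]]_(p, q)) c (s : R) : 0 < s < 1 ->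
  (forall t : R, 0 <= t <= 1 -> a t = b t) -> mder a c s -> mder b c s.
Proof.
move=> s01 ab ha k l; apply: cder_near (ha k l).
have := near01 s01.
by apply: filterS => t /andP[t0 t1]; rewrite ab // !ltW.
Qed.

Let kth X : kendo (fun s => cdiff hD (gconn s) X).
Proof.
apply: (kendo_eq (a := fun s => gth s X)) => [s|]; first by rewrite cdiff_g.
by apply: kendoM; [apply: kendoM; [exact: kendo_z|exact: kendo_gi]|exact: kendo_cst].
Qed.
Let kdth X Y : kendo (fun s => delta hD X (cdiff hD (gconn s) Y)).
Proof.
apply: (kendo_eq01 (a := fun s => - (z s * gi s * delta hD X g * (z s * gi s)) * delta hD Y g +
z s * gi s * delta hD X (delta hD Y g))) => [s s01|]; first by rewrite cdiff_g delta_gth.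
have kc : kendo (fun s => z s * gi s) by apply: kendoM; [exact: kendo_z|exact: kendo_gi].
apply: kendoD; last by apply: kendoM => //; exact: kendo_cst.
apply: kendoM; last exact: kendo_cst.
apply: kendoN; apply: kendoM => //; apply: kendoM => //; exact: kendo_cst.
Qed.
Let kget X : kendo (fun s => get s X).
Proof.
apply: kendoM; last exact: kendo_cst.
by apply: kendoM; exact: kendo_gi.
Qed.
Let kF : klf (fun s => Fform (gconn s)).
Proof.
move=> m; apply: (kendo_eq (a := fun s => Fform (aconn hD (gconn s) 1) m)).
  by move=> s; rewrite (Dop_ext_delta (Dop_aconn1 hD gconn s)).1.
by apply: klf_F.
Qed.

Lemma ch_tilde_gpath : ch_tilde D (gpath 1) = 0.
Proof.
have [] := @transgression_path R n M E D hD gpath gconn get.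
- exact: kth.
- exact: kdth.
- exact: kget.
- move=> X x s s01.
  have := mderM (@mder_zgi s x s01) (mder_cst (delta hD X g x) s).
  rewrite mulmx0 addr0; congr mder; apply/funext => t; by rewrite cdiff_g.
- move=> X Y x s s01; have s01' : 0 <= s <= 1 by case/andP: s01 => ? ?; rewrite !ltW.
  have dc := @mder_zgi s x s01.
  apply: (mder_near s01 (a := fun t => - ((z t * gi t) x *m delta hD X g x *m (z t * gi t) x) *m delta hD Y g x +
     (z t * gi t) x *m delta hD X (delta hD Y g) x)).
    by move=> t t01; rewrite cdiff_g delta_gth.
  have := mderD (mderM (mderN (mderM (mderM dc (mder_cst (delta hD X g x) s)) dc)) (mder_cst (delta hD Y g x) s))
    (mderM dc (mder_cst (delta hD X (delta hD Y g) x) s)).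
  by rewrite !mulmx0 !addr0 delta_get.
- move=> s x _; have := cdiff_form hD (gconn s) x; rewrite (_ : cdiff hD (gconn s) = gth s); last first.
    by apply/funext => X; exact: cdiff_g.
  move=> _; have fl : lin_at x (fun l => form1 (get s) l x : 'M[R[i]]_(rank E x)).
    move=> f X Y Z [|A [|A' l1]] l2 hf hZ //=; rewrite ?scaler0 ?addr0 //.
    case: l2 => [|? ?] /=; rewrite ?scaler0 ?addr0 //.
      by rewrite (delta_lin hD g x hf hZ) mulmxDr -scalemxAr.
  split=> // X [|A [|A' l1]] l2 //=.
move=> u hu e1.
(* The primitive is the trace of the infinitesimal gauge transformation times the exponential of the
   curvature, by the Bianchi identity. *)
have [] := @cint_exact (fun N s l => sfZ cc (\sum_(k < N) sfZ (ec k) (tf (form0 (gi s * h) : L) (Fform (gconn s)) k l)))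
  (path_form gconn get).
- move=> N l x.
  apply: (kfam_ext (f := fun s y => cc * \sum_(k < N) ec k * tf (form0 (gi s * h) : L) (Fform (gconn s)) k l y)).
    by move=> s y; rewrite sfZE sfun_sum.
  apply: kfamM; first exact: kfam_cst.
  apply: kfam_sum => k; apply: kfamM; first exact: kfam_cst.
  apply: kendo_tr; apply: (klfM (u := fun s => form0 (gi s * h))).
    case=> [|? ?]; last exact: (kendo_cst 0).
    by apply: kendoM; [exact: kendo_gi|exact: kendo_cst].
  exact: klfX.
- move=> N s x _.
  have f0 : form_at x (ev x (form0 (gi s * h) : L)).
    by split=> [f X Y Z [|? ?] l2 hf hZ|X [|? ?] l2] //; rewrite /ev /= scaler0 addr0.
  have : form_at x (fun l => cc * \sum_(k < N) ec k * \tr ((ev x (form0 (gi s * h) : L) * ev x (Fform (gconn s)) ^+ k) l) : R[i]^o).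
    apply: form_at_Z; apply: form_at_sum => k; apply: form_at_Z; apply: form_at_tr.
    by apply: form_at_mul => //; apply: form_at_exp; exact: Fform_form.
  congr form_at; apply/funext => l; rewrite sfZE sfun_sum; congr (_ * _).
  by apply: eq_bigr => k _; rewrite sfZE tfE.
- move=> N s l hl; apply/sfun_eq/funext => x; rewrite sfZE sfun_sum big1 ?mulr0 // => k _.
  rewrite sfZE /tf (_ : ((form0 (gi s * h) : L) * _) l = 0) ?mulr0 //.
    by rewrite /= mxtrace0 mulr0.
  have p0 : parity false (form0 (gi s * h) : L) by case.
  exact: (lmul_parity p0 (parity_exp k (Fform_parity (gconn s)))).
- move=> l x; rewrite /path_form.
  rewrite -cintZ; last first.
    apply: ccont_sum => k; apply: ccontM; first exact: ccont_cst.
    exact: (kfam_ccont (kendo_tr x (klfM (klf_form1 kget) (klfX k kF) l))).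
  apply: cint_eq => s s01; rewrite dd_sfZ dd_sfsum sfZE sfun_sum; congr (_ * _).
  apply: eq_bigr => k _; rewrite dd_sfZ sfZE dd_tf dd_form0.
  rewrite (_ : (fun X => delta (gconn s) X (gi s * h)) = get s) //.
  by apply/funext => X; exact: delta_b.
move=> v hv e2; rewrite e2 in e1.
have h1 : ch_tilde D (gpath 1) = ch_tilde D (gpath 0).
  apply: (class_of_eq (u := u + v)); [exact: (transgression_odd hD (gconn 1))|exact: (transgression_odd hD (gconn 0))| |].
    by rewrite -[v]opprK; apply: even_formB => //; rewrite -sub0r; apply: even_formB => //; exact: even_form0.
  by rewrite e1 addrC dformD //; [exact: hu.1|exact: hv.1].
have h0 : ch_tilde D (gpath 0) = ch_tilde D D.
  apply: (@ch_tilde_ext _ _ _ _ _ _ _ hD (gconn 0) hD) => X s.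
  rewrite Dop_gconn; apply/ssec_eq => x; rewrite ssecD.
  have -> : gth 0 X = 0.
    apply/sendo_eq => y; rewrite /gth -mulrA zE rmorph0 scale0r. reflexivity.
  by rewrite sapp0l -ssecD addr0.
rewrite h1 h0; exact: ch_tilde_diag.
Qed.

(** The intertwining relation says that [D'] acts on smooth sections as the end point of [gpath]. *)
Lemma ch_tilde_gauge (D' : preconnection E) (hD' : is_connection D') :
  (forall X v, sapp g (Dop hD' X v) = Dop hD X (sapp g v)) -> ch_tilde D D' = 0.
Proof.
move=> h; have i01 : 0 <= (1 : R) <= 1 by rewrite ler01 lexx.
have z1 : z 1 = 1 by apply/sendo_eq => x; rewrite seZE rmorph1 scale1r.
have gg : gi 1 * g = 1 by have := giV i01; rewrite z1 mul1r addrCA subrr addr0.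
rewrite -ch_tilde_gpath; apply: (@ch_tilde_ext _ _ _ _ _ _ _ hD hD' (gconn 1)) => X v.
rewrite Dop_gconn /gth z1 mul1r sappM deltaE -h sappB -!sappM gg.
rewrite (_ : sapp 1 (Dop hD' X v) = Dop hD' X v); last by apply/ssec_eq => x /=; rewrite mul1mx.
rewrite (_ : sapp 1 (Dop hD X v) = Dop hD X v); last by apply/ssec_eq => x /=; rewrite mul1mx.
by rewrite addrCA subrr addr0.
Qed.

End Gauge.

(** * Hermitian metrics and adjoint connections *)

Section Hermitian.
Context {R : realType} {n : nat} {M : manifold R n} {E : vbundle M}.
Implicit Types (s t v : ssec E) (f : sfun M).

Definition sconj f : sfun M := SFun (fun x => csmJ (sfP f x)).

Local Notation cj := (@conjc R).
Lemma conjD_ (a b : R[i]) : cj (a + b) = cj a + cj b. Proof. exact: rmorphD. Qed.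
Lemma conjB_ (a b : R[i]) : cj (a - b) = cj a - cj b. Proof. exact: rmorphB. Qed.
Lemma conjN_ (a : R[i]) : cj (- a) = - cj a. Proof. exact: rmorphN. Qed.
Lemma conjM_ (a b : R[i]) : cj (a * b) = cj a * cj b. Proof. exact: rmorphM. Qed.
Lemma conj_sum_ (I : Type) (r : seq I) (P : pred I) (F : I -> R[i]) :
  cj (\sum_(i <- r | P i) F i) = \sum_(i <- r | P i) cj (F i).
Proof. exact: rmorph_sum. Qed.
Lemma conjR_ (a : R) : cj a%:C = a%:C. Proof. by rewrite /conjc /= oppr0. Qed.

Section OneMetric.
Variable h : hermitian_metric E.

Lemma hermDl x (u v w : 'cV_(rank E x)) : h x (u + v) w = h x u w + h x v w.
Proof. by have := herm_linear h 1 u v w; rewrite scale1r mul1r. Qed.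
Lemma herm0l x w : h x 0 w = 0.
Proof. by apply: (addrI (h x 0 w)); rewrite -hermDl !addr0. Qed.
Lemma hermZl x a u w : h x (a *: u) w = a * h x u w.
Proof. by have := herm_linear h a u 0 w; rewrite addr0 herm0l addr0. Qed.
Lemma hermNl x u w : h x (- u) w = - h x u w.
Proof. by rewrite -scaleN1r hermZl mulN1r. Qed.
Lemma hermBl x (u v w : 'cV_(rank E x)) : h x (u - v) w = h x u w - h x v w.
Proof. by rewrite hermDl hermNl. Qed.
Lemma hermDr x (u v w : 'cV_(rank E x)) : h x w (u + v) = h x w u + h x w v.
Proof. by rewrite [LHS]herm_sym hermDl conjD_ -!herm_sym. Qed.
Lemma hermZr x a u w : h x w (a *: u) = cj a * h x w u.
Proof. by rewrite [LHS]herm_sym hermZl conjM_ -herm_sym. Qed.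
Lemma hermNr x u w : h x w (- u) = - h x w u.
Proof. by rewrite [LHS]herm_sym hermNl conjN_ -herm_sym. Qed.
Lemma hermBr x (u v w : 'cV_(rank E x)) : h x w (u - v) = h x w u - h x w v.
Proof. by rewrite hermDr hermNr. Qed.
Lemma herm_suml (I : Type) (r : seq I) (P : pred I) x F w :
  h x (\sum_(i <- r | P i) F i) w = \sum_(i <- r | P i) h x (F i) w.
Proof. by apply: (big_morph (fun u => h x u w)) => [u v|]; [exact: hermDl|exact: herm0l]. Qed.
Lemma herm_sumr (I : Type) (r : seq I) (P : pred I) x F w :
  h x w (\sum_(i <- r | P i) F i) = \sum_(i <- r | P i) h x w (F i).
Proof.
rewrite [LHS]herm_sym herm_suml conj_sum_; apply: eq_bigr => i _.
by rewrite -herm_sym.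
Qed.

Lemma herm_inj x (u v : 'cV_(rank E x)) : (forall t : ssec E, h x u (t x) = h x v (t x)) -> u = v.
Proof.
move=> e; apply/eqP; rewrite -subr_eq0; apply/negPn/negP => /(herm_pos h).
have [t tx] := sec_value (u - v); rewrite hermBl.
by rewrite -tx e subrr ltxx.
Qed.

Definition gram i x : 'M[R[i]]_(trank i) :=
  \matrix_(k, l) h x (trivV i x *m delta_mx k 0) (trivV i x *m delta_mx l 0).

Lemma gram_sm i x : tdom i x -> cmx (gram i) x.
Proof.
move=> ix k l; apply: (csm_ext (F := fun y => h y (trivV i y *m delta_mx k 0) (trivV i y *m delta_mx l 0))).
  by move=> y; rewrite mxE.
exact: ((csmooth_onP _ (tdom_open i)).1 (herm_smooth h _ _) _ ix).
Qed.

Lemma mx_delta_sum p (a : 'cV[R[i]]_p) : a = \sum_k a k 0 *: delta_mx k 0.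
Proof. by rewrite {1}[a]matrix_sum_delta; apply: eq_bigr => k _; rewrite big_ord1. Qed.

Lemma herm_gram i x a c : h x (trivV i x *m a) (trivV i x *m c) =
  (a^T *m gram i x *m map_mx (@conjc R) c) 0 0.
Proof.
rewrite {1}(mx_delta_sum a) {1}(mx_delta_sum c) !mulmx_sumr herm_suml -mulmxA mxE.
apply: eq_bigr => k _; rewrite herm_sumr mxE mxE mulr_sumr; apply: eq_bigr => l _.
by rewrite -!scalemxAr hermZl hermZr !mxE; ring.
Qed.

Lemma gram_unit i x : tdom i x -> gram i x \in unitmx.
Proof.
move=> ix; rewrite -row_free_unit -kermx_eq0; apply/eqP/eqP/rowV0P => r /sub_kermxP rG.
have e : h x (trivV i x *m r^T) (trivV i x *m r^T) = 0.
  by rewrite herm_gram trmxK rG mul0mx mxE.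
have : trivV i x *m r^T = 0.
  by apply/eqP/negPn/negP => /(herm_pos h); rewrite e ltxx.
move=> /(congr1 (mulmx (triv i x))); rewrite mulmxA trivVK // mul1mx mulmx0.
by move=> /(congr1 trmx); rewrite trmxK trmx0.
Qed.

Lemma herm_triv i x u w : tdom i x -> h x u w =
  ((triv i x *m u)^T *m gram i x *m map_mx (@conjc R) (triv i x *m w)) 0 0.
Proof. by move=> ix; rewrite -herm_gram !mulmxA trivK // !mul1mx. Qed.

Lemma hsec_csm s t : csmT (fun x => h x (s x) (t x)).
Proof.
move=> x; have [i ix] := tdom_cover E x.
apply: (csm_near (F := fun y => ((triv i y *m s y)^T *m gram i y *m map_mx (@conjc R) (triv i y *m t y)) 0 0)).
  by apply: filterS (tdom_near ix) => y iy; rewrite -herm_triv.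
have := cmxM (cmxM (cmx_tr (ssec_sm s ix)) (gram_sm ix)) (cmx_conj (ssec_sm t ix)).
exact.
Qed.
Definition hsec s t : sfun M := SFun (hsec_csm s t).

(** In a trivialization the Gram matrix is inverted; uniqueness, from [herm_inj], identifies the
    vector at each nearby point with the local formula, which is smooth. *)
Lemma riesz (phi : ssec E -> sfun M) : {morph phi : s t / s + t} ->
  (forall f s, phi (sscale f s) = sfmul (sconj f) (phi s)) ->
  exists v, forall t, hsec v t = phi t.
Proof.
move=> pD pZ.
have p0 : phi 0 = 0 by apply: (addrI (phi 0)); rewrite -pD !addr0.
have pS (I : Type) (r : seq I) (P : pred I) (F : I -> ssec E) :
    phi (\sum_(i <- r | P i) F i) = \sum_(i <- r | P i) phi (F i).
  by apply: (big_morph phi) => [s t|]; [exact: pD|exact: p0].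
(* The division by [b] compensates the cut-off of the frame sections on which [phi] is evaluated. *)
pose V i b (hb : bump_on (tdom i) b) y : 'cV[R[i]]_(trank i) :=
  (b y)%:C^-1 *: ((invmx (gram i y))^T *m \col_l phi (fsec hb l) y).
have VP i b (hb : bump_on (tdom i) b) y : tdom i y -> b y != 0 -> forall t,
    h y (trivV i y *m V i b hb y) (t y) = phi t y.
  move=> iy b0 t; have bc : ((b y)%:C : R[i]) != 0 by exact: realC_neq0.
  have bJ : conjc (b y)%:C = (b y)%:C :> R[i] by exact: conjR_.
  apply: (mulfI bc); apply: (mulfI bc).
  have <- : phi (sscale (sbump hb) (sscale (sbump hb) t)) y = (b y)%:C * ((b y)%:C * phi t y).
    transitivity (conjc (b y)%:C * (conjc (b y)%:C * phi t y)); [by rewrite !pZ|by rewrite bJ].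
  have -> : (b y)%:C * ((b y)%:C * h y (trivV i y *m V i b hb y) (t y)) =
      h y (trivV i y *m V i b hb y) ((sscale (sbump hb) (sscale (sbump hb) t)) y).
    transitivity (conjc (b y)%:C * (conjc (b y)%:C * h y (trivV i y *m V i b hb y) (t y))); first by rewrite bJ.
    by rewrite /= !hermZr.
  rewrite frame_expand pS sfun_sum ssec_sum herm_sumr; apply: eq_bigr => l _.
  rewrite pZ /= hermZr; congr (_ * _).
  rewrite hermZr bJ herm_gram /V linearZ /= trmx_mul trmxK -!scalemxAl (mulmxKV (gram_unit iy)) mxE mulrA mulfV // mul1r mxE (bigD1 l) //= big1 => [|k kl].
    by rewrite !mxE eqxx rmorph1 mulr1 addr0.
  by rewrite !mxE (negbTE kl) rmorph0 mulr0.
have ex x : exists v : 'cV_(rank E x), forall t, h x v (t x) = phi t x.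
  have [i [b hb [bx ix]]] := triv_bump E x.
  by exists (trivV i x *m V i b hb x); apply: VP => //; rewrite gt_eqF.
pose v x := sval (cid (ex x)).
have vP x t : h x (v x) (t x) = phi t x by rewrite /v; case: cid.
have vs : @smooth_section _ _ _ E v.
  apply: smooth_section1 => x; have [i [b hb [bx ix]]] := triv_bump E x.
  exists i => //; apply: (cmx_near (A := V i b hb)).
    have : \forall y \near x, b y != 0.
      by apply: sm_neq0; [exact: bump_sm hb|rewrite gt_eqF].
    apply: filterS2 (tdom_near ix) => y iy b0.
    have -> : v y = trivV i y *m V i b hb y.
      by apply: (@herm_inj y) => t; rewrite vP VP.
    by rewrite mulmxA trivVK // mul1mx.
  apply: cmxZ.
    apply: csmV; first by apply: csm_real; exact: bump_sm hb.
    exact: realc_neq0.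
  apply: cmxM; first by apply: cmx_tr; apply: cmx_inv; [exact: gram_sm|exact: gram_unit].
  by move=> k l; apply: csm_ext (sfP (phi (fsec hb k)) x) => y; rewrite mxE.
by exists (SSec vs) => t; apply/sfun_eq/funext => x /=; exact: vP.
Qed.

Lemma hsec_inj s t : (forall w, hsec s w = hsec t w) -> s = t.
Proof.
move=> e; apply/ssec_eq => x; apply: (@herm_inj x) => w.
exact: (congr1 (fun f : sfun M => f x) (e w)).
Qed.

Variables (D : preconnection E) (hD : is_connection D).

Lemma hsecDr s t w : hsec s (t + w) = hsec s t + hsec s w.
Proof. by apply/sfun_eq/funext => x; rewrite sfunD /= hermDr. Qed.
Lemma hsecZr f s t : hsec s (sscale f t) = sfmul (sconj f) (hsec s t).
Proof. by apply/sfun_eq/funext => x /=; rewrite hermZr. Qed.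
Lemma hsecDl s t w : hsec (s + t) w = hsec s w + hsec t w.
Proof. by apply/sfun_eq/funext => x; rewrite sfunD /= hermDl. Qed.
Lemma hsecZl f s t : hsec (sscale f s) t = sfmul f (hsec s t).
Proof. by apply/sfun_eq/funext => x /=; rewrite hermZl. Qed.

Lemma sactD X (f g : sfun M) : sact X (f + g) = sact X f + sact X g.
Proof. by apply/sfun_eq/funext => x; rewrite sfunD /= cvf_fD //; exact: sfP. Qed.
Lemma sactM X (f g : sfun M) : sact X (sfmul f g) = sfmul (sact X f) g + sfmul f (sact X g).
Proof. by apply/sfun_eq/funext => x; rewrite sfunD /= cvf_fM //; exact: sfP. Qed.
Lemma sactJ X (f : sfun M) : sact X (sconj f) = sconj (sact X f).
Proof. by apply/sfun_eq/funext => x /=; rewrite cvf_conj //; exact: sfP. Qed.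

(** The right-hand side is conjugate linear in [t] over the smooth functions, since the derivatives
    of the conjugate of [f] in its two terms cancel; [riesz] represents it. *)
Lemma adj_ex X s : exists v, forall t, hsec v t = sact X (hsec s t) - hsec s (Dop hD X t).
Proof.
apply: riesz => [t w|f t].
  by rewrite hsecDr sactD DopD hsecDr; abelu.
rewrite hsecZr sactM DopZ hsecDr !hsecZr sactJ.
have -> (a b : sfun M) : sfmul (sconj f) (a - b) = sfmul (sconj f) a - sfmul (sconj f) b.
  by apply/sfun_eq/funext => x; rewrite sfunB /= mulrBr.
by abelu.
Qed.

Definition adjop X s : ssec E := sval (cid (adj_ex X s)).
Lemma adjopE X s t : hsec (adjop X s) t = sact X (hsec s t) - hsec s (Dop hD X t).
Proof. by rewrite /adjop; case: cid => v /= ->. Qed.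

(** A preconnection takes arbitrary sections; 0 is a default on those that are not smooth. *)
Definition adjconn : preconnection E := fun X (s : presection E) x =>
  if pselect (smooth_section s) is left hs then adjop X (SSec hs) x else 0.

Lemma adjconnE X s x : adjconn X s x = adjop X s x.
Proof.
rewrite /adjconn; case: pselect => [hs|]; last by case; exact: ssP.
by congr (ssv (adjop X _) x); exact/ssec_eq.
Qed.

Lemma adjconnP X (s : presection E) (hs : smooth_section s) : adjconn X s = adjop X (SSec hs).
Proof. by apply: functional_extensionality_dep => x; rewrite -adjconnE. Qed.

Lemma adjconn_conn : is_connection adjconn.
Proof.
split.
- by move=> X s hs; rewrite (adjconnP X hs); exact: ssP.
- move=> X s t hs ht x; have hst := ssP (SSec hs + SSec ht).
  rewrite (adjconnP X hs) (adjconnP X ht) (adjconnP X hst).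
  have -> : SSec hst = SSec hs + SSec ht by exact/ssec_eq.
  rewrite -ssecD; congr (ssv _ x); apply: hsec_inj => w.
  by rewrite hsecDl !adjopE !hsecDl sactD; abelu.
- move=> X f s hf hs x; pose F : sfun M := SFun ((csmoothTP _).1 hf).
  have hfs := ssP (sscale F (SSec hs)).
  rewrite (adjconnP X hs) (adjconnP X hfs).
  have -> : SSec hfs = sscale F (SSec hs) by exact/ssec_eq.
  transitivity ((sscale (sact X F) (SSec hs) + sscale F (adjop X (SSec hs))) x) => //.
  congr (ssv _ x); apply: hsec_inj => w.
  rewrite hsecDl !hsecZl !adjopE !hsecZl sactM.
  have -> (a b : sfun M) : sfmul F (a - b) = sfmul F a - sfmul F b.
    by apply/sfun_eq/funext => y; rewrite sfunB /= mulrBr.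
  by abelu.
- move=> f X Y Z s hf hZ hs x; rewrite !(adjconnP _ hs).
  apply: (@herm_inj x) => w; rewrite hermDl hermZl.
  have e W : h x (adjop W (SSec hs) x) (w x) = sact W (hsec (SSec hs) w) x - h x (s x) (Dop hD W w x).
    exact: (congr1 (fun f : sfun M => f x) (adjopE W (SSec hs) w)).
  rewrite !e (Dop_combine hD _ _ hf hZ) /= (cvf_combine x (hsec_csm (SSec hs) w) hZ).
  by rewrite hermDr hermZr conjR_; ring.
Qed.

Lemma adjoint_exists : is_adjoint h D adjconn.
Proof.
split=> [|X s t hs ht x]; first exact: adjconn_conn.
rewrite (adjconnP X hs).
exact: (congr1 (fun f : sfun M => f x) (adjopE X (SSec hs) (SSec ht))).
Qed.

Lemma is_adjointP D' (a : is_adjoint h D D') X s t :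
  hsec (Dop a.1 X s) t = sact X (hsec s t) - hsec s (Dop hD X t).
Proof. by apply/sfun_eq/funext => x; rewrite sfunB /= a.2 //; exact: ssP. Qed.

Lemma is_adjoint_sym D' : is_adjoint h D D' -> is_adjoint h D' D.
Proof.
move=> a; split=> // X s t hs ht x.
have e := a.2 X t s ht hs x.
rewrite [h x (s x) (D' X t x)]herm_sym e conjB_ -cvf_conj; last exact: (hsec_csm (SSec ht) (SSec hs)).
rewrite -herm_sym (_ : (fun y => _) = (fun y => h y (s y) (t y))); last first.
  by apply/funext => y; rewrite -herm_sym.
by rewrite opprB addrCA subrr addr0.
Qed.

End OneMetric.

Lemma sendo_inv (a : sendo E) : (forall x, a x \in unitmx) ->
  exists2 b : sendo E, a * b = 1 & b * a = 1.
Proof.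
move=> au.
have bs : @endo_smooth _ _ _ E (fun x => invmx (a x)).
  move=> x i ix; have au' y : tdom i y -> triv i y *m a y *m trivV i y *m (triv i y *m invmx (a y) *m trivV i y) = 1%:M.
    move=> iy; rewrite !mulmxA -[_ *m trivV i y *m triv i y]mulmxA trivK // mulmx1.
    by rewrite -[triv i y *m a y *m _]mulmxA mulmxV // mulmx1 trivVK.
  have [u _] := mulmx1_unit (au' x ix).
  apply: cmx_near (cmx_inv (seP a ix) u).
  apply: filterS (tdom_near ix) => y iy; have [uy _] := mulmx1_unit (au' y iy).
  by rewrite -[RHS](mulKmx uy) au' // mulmx1.
exists (SEndo bs); apply/sendo_eq => x; rewrite sendoM /=; [exact: mulmxV|exact: mulVmx].
Qed.

Lemma metric_compare (h h' : hermitian_metric E) :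
  exists g : sendo E, forall s t, hsec h (sapp g s) t = hsec h' s t.
Proof.
have ex s : exists v, forall t, hsec h v t = hsec h' s t.
  by apply: (@riesz h (hsec h' s)) => [t w|f t]; [exact: hsecDr|exact: hsecZr].
pose T s := sval (cid (ex s)).
have TE s t : hsec h (T s) t = hsec h' s t by rewrite /T; case: cid.
have [||g gT] := @tensorial_endo _ _ _ _ T.
- by move=> s t; apply: (@hsec_inj h) => w; rewrite hsecDl !TE hsecDl.
- by move=> f s; apply: (@hsec_inj h) => w; rewrite hsecZl !TE hsecZl.
by exists g => s t; rewrite gT.
Qed.

Lemma unitmx_inj p (A : 'M[R[i]]_p) : (forall u : 'cV_p, A *m u = 0 -> u = 0) -> A \in unitmx.
Proof.
move=> hA; rewrite -unitmx_tr -row_free_unit -kermx_eq0; apply/eqP/eqP/rowV0P => r /sub_kermxP rA.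
by rewrite -[r]trmxK (hA r^T) ?trmx0 //; apply: trmx_inj; rewrite trmx_mul trmxK rA trmx0.
Qed.

(* The adjoints of a connection for two metrics are gauge equivalent, through an
   automorphism which is positive, hence homotopic to the identity. *)
Lemma ch_tilde_adjoint (h h' : hermitian_metric E) (D D1 D2 : preconnection E) :
  is_connection D -> is_adjoint h D D1 -> is_adjoint h' D D2 ->
  ch_tilde D1 D = ch_tilde D2 D.
Proof.
move=> hD a1 a2; have [g gE] := metric_compare h h'.
pose gs (s : R) : sendo E := 1 + seZ s%:C 1 * (g - 1).
have gu (s : R) x : 0 <= s <= 1 -> gs s x \in unitmx.
  move=> /andP[s0 s1]; apply: unitmx_inj => u gu0.
  apply/eqP/negPn/negP => u0.
  have hu := herm_pos h u0; have hu' := herm_pos h' u0.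
  have gh : h x (g x *m u) u = h' x u u.
    have [t <-] := sec_value u.
    exact: (congr1 (fun f : sfun M => f x) (gE t t)).
  (* A convex combination of two positive numbers cannot vanish, so a vector killed by [gs s x] is
     0. *)
  have : h x (gs s x *m u) u = (1 - s)%:C * h x u u + s%:C * h' x u u.
    have -> : gs s x = 1%:M + s%:C *: (g x - 1%:M).
      by rewrite /gs sendoD sendoM seZE sendoB -scalemxAl mul1mx.
    rewrite mulmxDl mul1mx -scalemxAl mulmxBl mul1mx hermDl hermZl hermBl gh.
    by rewrite rmorphB rmorph1; ring.
  rewrite gu0 herm0l => /esym/eqP.
  have p1 : 0 <= (1 - s)%:C :> R[i] by rewrite lecR subr_ge0.
  have p2 : 0 <= s%:C :> R[i] by rewrite lecR.
  have q1 : 0 <= (1 - s)%:C * h x u u by apply: mulr_ge0 => //; exact: ltW.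
  have q2 : 0 <= s%:C * h' x u u by apply: mulr_ge0 => //; exact: ltW.
  rewrite (paddr_eq0 q1 q2) !mulf_eq0 !(gt_eqF hu) !(gt_eqF hu') !orbF => /andP[].
  rewrite !eq_complex /= eqxx !andbT subr_eq0 => /eqP <-.
  by rewrite oner_eq0.
have ex (s : R) : exists b : sendo E, 0 <= s <= 1 -> gs s * b = 1 /\ b * gs s = 1.
  have [s01|] := boolP (0 <= s <= 1); last by exists 1.
  by have [b b1 b2] := @sendo_inv (gs s) (fun x => gu s x s01); exists b.
pose gi (s : R) := sval (cid (ex s)).
have giP (s : R) : 0 <= s <= 1 -> gs s * gi s = 1 /\ gi s * gs s = 1 by rewrite /gi; case: cid.
(* [g] intertwines [D2] with [D1]: paired with [w] by [h], both sides of the relation equal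
   [X h'(v, w) - h'(v, D w)]. *)
have gauge : ch_tilde D1 D2 = 0.
  have gK1 (s : R) : 0 <= s <= 1 -> gs s * gi s = 1 by move=> /giP[].
  have gK2 (s : R) : 0 <= s <= 1 -> gi s * gs s = 1 by move=> /giP[].
  have G := @ch_tilde_gauge _ _ _ _ D1 a1.1 g gi gK1 gK2 D2 a2.1.
  apply: G => X v.
  apply: (@hsec_inj h) => w.
  by rewrite gE (is_adjointP hD a2) (is_adjointP hD a1) !gE.
by rewrite -(ch_tilde_cocycle a1.1 a2.1 hD) gauge add0r.
Qed.

End Hermitian.

(** * Existence of hermitian metrics *)

Section MetricExistence.
Context {R : realType} {n : nat} {M : manifold R n} (E : vbundle M).
Local Notation cj := (@conjc R).

Definition chartbump := {i : tidx E & {b : M -> R | bump_on (tdom i) b}}.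
Definition cbump (o : option chartbump) (x : M) : R :=
  if o is Some d then sval (projT2 d) x else 0.

Lemma near_gt0 (f : M -> R) (x : M) (a : R) : sm f x -> a < f x -> nbhs x [set y : M | a < f y].
Proof.
move=> /sm_continuous c h; apply: (c [set z | a < z]) => /=.
by apply: (open_nbhs_nbhs (conj _ _)) => //; exact: open_gt.
Qed.

(** For each member of a countable base on which some bump is positive, one such bump is chosen and
    indexed by the number of that member; the other indices carry [None]. *)
Lemma countable_bumps : exists d : nat -> option chartbump, forall x, exists k, 0 < cbump (d k) x.
Proof.
have [B /countable_injP [c cinj] [Bo Bb]] := manifold_countable M.
pose good (U : set M) (d : chartbump) := U `<=` [set y | 0 < sval (projT2 d) y].
have ex k : exists o : option chartbump, forall U, B U -> c U = k ->
    (exists d, good U d) -> exists2 d, o = Some d & good U d.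
  have [[U [BU cU [d gd]]]|no] := pselect (exists U, [/\ B U, c U = k & exists d, good U d]).
    exists (Some d) => U' BU' cU' _; exists d => //.
    by rewrite (cinj U' U) ?inE // cU' cU.
  by exists None => U BU cU gU; case: no; exists U.
pose d k := sval (cid (ex k)).
have dP k : forall U, B U -> c U = k -> (exists d, good U d) -> exists2 d', d k = Some d' & good U d'.
  by rewrite /d; case: cid.
exists d => x; have [i ix] := tdom_cover E x; have [b hb bx] := bump_exists (tdom_open i) ix.
have : nbhs x [set y | 0 < b y].
  exact: near_gt0 (bump_sm x hb) bx.
move=> /(Bb x) [U [BU Ux] Ub].
have [] := dP (c U) U BU erefl.
  by exists (existT _ i (exist _ b hb)).
by move=> d' e /(_ x Ux) h; exists (c U); rewrite /cbump e.
Qed.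

Variable d : nat -> option chartbump.
Hypothesis dP : forall x, exists k, 0 < cbump (d k) x.
Local Notation b k := (cbump (d k)).

(* The family of the supports is locally finite: near a point where [b j] is positive,
   the factor of index [j] vanishes as soon as [1 / (k + 1)] is small. *)
Definition lffactor k (x : M) : R := \prod_(j < k) flat 0 (k.+1%:R^-1 - b j x).

Definition lfterm k (x : M) (u v : 'cV[R[i]]_(rank E x)) : R[i] :=
  if d k is Some e then (sval (projT2 e) x)%:C * ((lffactor k x)%:C *
    ((triv (projT1 e) x *m u)^T *m map_mx cj (triv (projT1 e) x *m v)) 0 0)
  else 0.

Lemma cbump_ge0 k x : 0 <= b k x.
Proof. by rewrite /cbump; case: (d k) => // [[i [e he]]] /=; have [_ h _] := he. Qed.

Lemma cbump_sm k x : sm (b k) x.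
Proof.
rewrite /cbump; case: (d k) => [[i [e he]] /=|]; last exact: sm_cst.
exact: bump_sm he.
Qed.

Lemma lffactor_sm k x : sm (lffactor k) x.
Proof.
apply: sm_prod => j _; apply: sm_flat; apply: smB; first exact: sm_cst.
exact: cbump_sm.
Qed.

Lemma lfterm_finite (x : M) : exists N, nbhs x [set y : M | forall k u v, (N <= k)%N -> @lfterm k y u v = 0].
Proof.
have [j bj] := dP x.
have b2 : b j x / 2 < b j x by rewrite ltr_pdivrMr // ltr_pMr // ltr1n.
(* The first bound puts [j] among the factors of [lffactor], the second makes [1 / (k + 1)] at most
   [b j x / 2]. *)
pose N := maxn j.+1 (Num.truncn (b j x / 2)^-1).+1.
exists N; apply: filterS (near_gt0 (cbump_sm j x) b2) => y hy k u v Nk.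
rewrite /lfterm; case: (d k) => // e.
suff -> : lffactor k y = 0 by rewrite mul0r mulr0.
have jk : (j < k)%N by apply: leq_trans Nk; rewrite leq_max leqnn.
rewrite /lffactor (bigD1 (Ordinal jk)) //= flat_eq0 ?mul0r // subr_le0.
apply: le_trans (ltW hy).
have c0 : 0 < b j x / 2 by rewrite divr_gt0.
rewrite -[leRHS]invrK lef_pV2 ?posrE ?invr_gt0 //.
have : (b j x / 2)^-1 < (Num.truncn (b j x / 2)^-1).+1%:R by exact: truncnS_gt.
move=> /ltW h; apply: le_trans h _; rewrite ler_nat.
by apply: leq_trans (leqnSn _); apply: leq_trans Nk; rewrite leq_max leqnn orbT.
Qed.

Definition lfbound (x : M) : nat := sval (cid (lfterm_finite x)).
Lemma lfboundP (x : M) : nbhs x [set y : M | forall k u v, (lfbound x <= k)%N -> @lfterm k y u v = 0].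
Proof. by rewrite /lfbound; case: cid. Qed.

(** The number of terms is chosen at each point separately; [lfmetric_bound] allows a common bound
    near a point, which smoothness needs. *)
Definition lfmetric (x : M) (u v : 'cV[R[i]]_(rank E x)) : R[i] := \sum_(k < lfbound x) @lfterm k x u v.

Lemma lfmetric_bound (x : M) N (u v : 'cV[R[i]]_(rank E x)) : (forall k u v, (N <= k)%N -> @lfterm k x u v = 0) ->
  lfmetric u v = \sum_(k < N) @lfterm k x u v.
Proof.
move=> hN; have h0 : forall k u v, (lfbound x <= k)%N -> @lfterm k x u v = 0.
  exact: (nbhs_singleton (lfboundP x)).
have E1 A B : (A <= B)%N -> (forall k u v, (A <= k)%N -> @lfterm k x u v = 0) ->
    \sum_(k < A) @lfterm k x u v = \sum_(k < B) @lfterm k x u v.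
  move=> AB hA; rewrite (big_ord_widen B (fun k => @lfterm k x u v) AB) big_mkcond /=.
  by apply: eq_bigr => k _; case: ltnP => // Ak; rewrite hA.
rewrite /lfmetric; have [h|/ltnW h] := leqP (lfbound x) N; first exact: E1.
by rewrite (E1 _ _ h hN).
Qed.

Lemma lfterm_linear k x (a : R[i]) u v w :
  @lfterm k x (a *: u + v) w = a * @lfterm k x u w + @lfterm k x v w.
Proof.
rewrite /lfterm; case: (d k) => [e|]; last by rewrite mulr0 addr0.
rewrite mulmxDr -scalemxAr !linearD /= !linearZ /= mulmxDl -scalemxAl.
have me (A B : 'M[R[i]]_1) (c : R[i]) : (c *: A + B) 0 0 = c * A 0 0 + B 0 0 by rewrite !mxE.
by rewrite me; ring.
Qed.

Lemma lfterm_sym k x u v : @lfterm k x v u = cj (@lfterm k x u v).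
Proof.
rewrite /lfterm; case: (d k) => [e|]; last by rewrite rmorph0.
rewrite !conjM_ !conjR_ !mxE conj_sum_; congr (_ * (_ * _)).
by apply: eq_bigr => l _; rewrite !mxE conjM_ conjcK mulrC.
Qed.

Lemma sqnorm_ge0 p (u : 'cV[R[i]]_p) : 0 <= (u^T *m map_mx cj u) 0 0.
Proof.
rewrite mxE sumr_ge0 // => l _; rewrite !mxE.
by rewrite complex_norm2 lecR addr_ge0 ?sqr_ge0.
Qed.

Lemma sqnorm_gt0 p (u : 'cV[R[i]]_p) : u != 0 -> 0 < (u^T *m map_mx cj u) 0 0.
Proof.
move=> u0; rewrite lt0r sqnorm_ge0 andbT; apply: contra u0 => /eqP; rewrite mxE => /eqP.
rewrite psumr_eq0 => [/allP h|l _]; last first.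
  by rewrite !mxE complex_norm2 lecR addr_ge0 ?sqr_ge0.
apply/eqP/matrixP => l j; rewrite ord1 mxE.
have := h l (mem_index_enum l); rewrite !mxE => /eqP /eqP.
by rewrite mulf_eq0 conjc_eq0 orbb => /eqP.
Qed.

Lemma lffactor_ge0 k x : 0 <= lffactor k x.
Proof. by apply: prodr_ge0 => j _; exact: flat_ge0. Qed.

Lemma lfterm_ge0 k x u : 0 <= @lfterm k x u u.
Proof.
rewrite /lfterm; have := cbump_ge0 k x; rewrite /cbump; case: (d k) => [e|] // b0.
rewrite mulr_ge0 ?lecR // mulr_ge0 ?lecR ?lffactor_ge0 //.
exact: sqnorm_ge0.
Qed.

(** At the least [k] with [b k x] positive, all earlier bumps vanish at [x], so the factor
    [lffactor k x] is positive; the other terms are nonnegative. *)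
Lemma lfmetric_pos x u : u != 0 -> 0 < @lfmetric x u u.
Proof.
move=> u0.
have ex : exists k, 0 < b k x by exact: dP.
pose k := ex_minn ex.
have [bk kmin] : 0 < b k x /\ forall j, 0 < b j x -> (k <= j)%N.
  by rewrite /k; case: ex_minnP => m h1 h2; split.
have tk : 0 < @lfterm k x u u.
  have fp : 0 < lffactor k x.
    apply: prodr_gt0 => j _; apply: flat_gt0.
    suff -> : b j x = 0 by rewrite subr0 invr_gt0 ltr0n.
    apply/eqP; rewrite eq_le cbump_ge0 andbT leNgt; apply/negP => /kmin.
    by rewrite leqNgt ltn_ord.
  move: bk; rewrite /lfterm /cbump; case: (d k) => [[i [e he]] /= ex0|]; last by rewrite ltxx.
  rewrite mulr_gt0 ?ltcR // mulr_gt0 ?ltcR //.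
  apply: sqnorm_gt0; apply: contra u0 => /eqP h.
  have ix : tdom i x.
    by apply: contrapT => /(bump_out he) e0; rewrite e0 ltxx in ex0.
  by rewrite -[u]mul1mx -(trivK ix) -mulmxA h mulmx0.
have h0 : forall k u v, (lfbound x <= k)%N -> @lfterm k x u v = 0.
  exact: (nbhs_singleton (lfboundP x)).
have kb : (k < lfbound x)%N.
  by rewrite ltnNge; apply/negP => /h0 e; rewrite e ltxx in tk.
rewrite /lfmetric (bigD1 (Ordinal kb)) //=; apply: ltr_pwDl => //.
by apply: sumr_ge0 => j _; exact: lfterm_ge0.
Qed.

Lemma lfmetric_sm (i : tidx E) (u v : 'cV_(trank i)) :
  csmooth_on (tdom i) (fun x => @lfmetric x (trivV i x *m u) (trivV i x *m v)).
Proof.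
apply/csmooth_onP; first exact: tdom_open.
move=> x ix.
apply: (csm_near (F := fun y => \sum_(k < lfbound x) @lfterm k y (trivV i y *m u) (trivV i y *m v))).
  by apply: filterS (lfboundP x) => y hy; rewrite (lfmetric_bound _ _ hy).
apply: csm_sum => k _; rewrite /lfterm; case: (d k) => [[j [e he]] /=|]; last exact: csm_cst.
have [jx|njx] := pselect (tdom j x).
  apply: csmM; first by apply: csm_real; exact: bump_sm he.
  apply: csmM; first by apply: csm_real; exact: lffactor_sm.
  have T (w : 'cV_(trank i)) : cmx (fun y => triv j y *m (trivV i y *m w)) x.
    apply: (cmx_ext (A := fun y => triv j y *m trivV i y *m w)) => [y|]; first by rewrite mulmxA.
    by apply: cmxM; [exact: triv_sm|exact: cmx_cst].
  have := cmxM (cmx_tr (T u)) (cmx_conj (T v)); exact.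
have [_ _ [K Kcl [KU Kb]]] := he.
apply: (@csm_near _ _ _ (fun=> 0)); last exact: csm_cst.
have nK : (~` K) x by move=> /KU.
have oK : open (~` K) by rewrite openC.
apply: filterS (open_nbhs_nbhs (conj oK nK)) => y nKy; rewrite Kb //.
by rewrite mul0r.
Qed.

Definition lf_hermitian : hermitian_metric E.
Proof.
refine (@HermitianMetric R n M E (@lfmetric) _ _ lfmetric_pos lfmetric_sm).
  move=> x a u v w; rewrite /lfmetric mulr_sumr -big_split /=; apply: eq_bigr => k _.
  exact: lfterm_linear.
move=> x u v; rewrite /lfmetric conj_sum_; apply: eq_bigr => k _.
exact: lfterm_sym.
Defined.

End MetricExistence.

Lemma hermitian_metric_exists {R : realType} {n : nat} {M : manifold R n} (E : vbundle M) :
  inhabited (hermitian_metric E).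
Proof. by have [d dP] := countable_bumps E; constructor; exact: lf_hermitian dP. Qed.

(** * Functoriality *)

Section Pullback.
Context {R : realType} {n : nat} {M : manifold R n}.

Lemma isec_smooth_of (E F : vbundle M) (a : forall x, 'M[R[i]]_(rank F x, rank E x)) :
  (forall (i : tidx E) (j : tidx F) k l, csmooth_on (tdom i `&` tdom j)
    (fun x => (triv j x *m a x *m trivV i x) k l)) ->
  forall s : ssec E, @smooth_section _ _ _ F (fun x => a x *m s x).
Proof.
move=> ha s; apply/smooth_sectionP => x j jx; have [i ix] := tdom_cover E x.
apply: (cmx_near (A := fun y => (triv j y *m a y *m trivV i y) *m (triv i y *m s y))).
  apply: filterS (tdom_near ix) => y iy.
  by rewrite !mulmxA -[_ *m trivV i y *m triv i y]mulmxA trivK // mulmx1.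
apply: cmxM; last exact: ssec_sm.
move=> k l; have o : open (tdom i `&` tdom j) by apply: openI; exact: tdom_open.
exact: ((csmooth_onP _ o).1 (ha i j k l)).
Qed.

Lemma smooth_of_ssec (E : vbundle M) (s : presection E) (t : ssec E) :
  (forall x, s x = t x) -> smooth_section s.
Proof.
move=> st; suff -> : s = ssv t by exact: ssP.
exact: functional_extensionality_dep.
Qed.

Variables (E F : vbundle M) (f : bundle_iso E F).

Definition isec (s : ssec E) : ssec F := SSec (isec_smooth_of (iso_smooth f) s).
Lemma isoV_smooth' (j : tidx F) (i : tidx E) k l : csmooth_on (tdom j `&` tdom i)
   (fun x => (triv i x *m isoV f x *m trivV j x) k l).
Proof. by rewrite setIC; exact: isoV_smooth. Qed.
Definition isecV (s : ssec F) : ssec E := SSec (isec_smooth_of isoV_smooth' s).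

Section OneConnection.
Variables (D : preconnection F) (hD : is_connection D).

Lemma pullback_conn : is_connection (pullback f D).
Proof.
split.
- by move=> X s hs; exact: (ssP (isecV (Dop hD X (isec (SSec hs))))).
- move=> X s t hs ht x; rewrite /pullback -mulmxDr.
  rewrite -(conn_add hD X (ssP (isec (SSec hs))) (ssP (isec (SSec ht)))).
  congr (_ *m D X _ x); apply: functional_extensionality_dep => y /=.
  exact: mulmxDr.
- move=> X g s hg hs x; rewrite /pullback.
  have := conn_leibniz hD X hg (ssP (isec (SSec hs))) x.
  have -> : (fun y => g y *: isec (SSec hs) y) = (fun y => iso f y *m (g y *: s y)).
    by apply: functional_extensionality_dep => y /=; rewrite scalemxAr.
  by move=> ->; rewrite mulmxDr -!scalemxAr /= mulmxA isoK mul1mx.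
- move=> g X Y Z s hg hZ hs x; rewrite /pullback.
  by rewrite (conn_tensorial hD hg hZ (ssP (isec (SSec hs)))) mulmxDr -scalemxAr.
Qed.

Lemma Fform_pullback (hp : is_connection (pullback f D)) l x :
  Fform hp l x = isoV f x *m Fform hD l x *m iso f x.
Proof.
case: l => [|X [|Y [|? ?]]] /=; rewrite ?mulmx0 ?mul0mx //.
apply: sec_span => s.
have := congr1 (fun t : ssec E => t x) (curvE hp X Y s) => /= ->.
rewrite -!mulmxA.
have := congr1 (fun t : ssec F => t x) (curvE hD X Y (isec s)) => /= ->.
have e U V : pullback f D U (pullback f D V s) x = isoV f x *m D U (D V (isec s)) x.
  rewrite /pullback; congr (_ *m D U _ x); apply: functional_extensionality_dep => y.
  by rewrite mulmxA isoVK mul1mx.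
by rewrite !e !mulmxBr.
Qed.
End OneConnection.

Lemma pullback_affine (D0 D1 : preconnection F) (t : R) :
  pullback f (affine_path D0 D1 t) = affine_path (pullback f D0) (pullback f D1) t.
Proof.
apply/funext => X; apply/funext => s; apply: functional_extensionality_dep => x.
by rewrite /pullback /affine_path mulmxDr -!scalemxAr.
Qed.

Lemma cdiff_pullback (D0 D1 : preconnection F) (h0 : is_connection D0) (h1 : is_connection D1)
    (p0 : is_connection (pullback f D0)) (p1 : is_connection (pullback f D1)) X x :
  cdiff p0 p1 X x = isoV f x *m cdiff h0 h1 X x *m iso f x.
Proof.
apply: sec_span => s.
have := congr1 (fun t : ssec E => t x) (cdiffE p0 p1 X s) => /= ->.
rewrite -!mulmxA.
have := congr1 (fun t : ssec F => t x) (cdiffE h0 h1 X (isec s)) => /= ->.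
by rewrite mulmxBr.
Qed.

(** A unital ring morphism commutes with wedge products and powers; applied to conjugation by a
    bundle isomorphism. *)
Lemma lform_hom_tr p q (Phi : 'M[R[i]]_p -> 'M[R[i]]_q)
    (u v : lform (vfield M) 'M[R[i]]_p) (u' v' : lform (vfield M) 'M[R[i]]_q) k l :
  (forall a b, Phi (a + b) = Phi a + Phi b) -> (forall a, Phi (- a) = - Phi a) ->
  (forall a b, Phi (a *m b) = Phi a *m Phi b) -> Phi 1%:M = 1%:M ->
  (forall a, \tr (Phi a) = \tr a) ->
  (forall l, u' l = Phi (u l)) -> (forall l, v' l = Phi (v l)) ->
  \tr ((u' * v' ^+ k) l) = \tr ((u * v ^+ k) l).
Proof.
move=> PD PN PM P1 Pt hu hv.
have P0 : Phi 0 = 0 by apply: (addrI (Phi 0)); rewrite -PD !addr0.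
have hM (a b : lform (vfield M) 'M[R[i]]_p) (a' b' : lform (vfield M) 'M[R[i]]_q) :
    (forall l, a' l = Phi (a l)) -> (forall l, b' l = Phi (b l)) ->
    forall l, (a' * b') l = Phi ((a * b) l).
  move=> ha hb m; rewrite !lformME (bmul_map (psi := fun a b => a *m b) (f := Phi) (g := Phi)) //.
  by apply: bmul_eq => j _; [exact: ha|exact: hb].
have hX : forall l, (v' ^+ k) l = Phi ((v ^+ k) l).
  elim: k => [|k IH] m; first by rewrite !expr0; case: m => [|? ?]; [exact/esym/P1|exact/esym/P0].
  by rewrite !exprS; exact: hM.
by rewrite (hM _ _ _ _ hu hX) Pt.
Qed.

(** An equality of forms, not only of classes: curvature and connection differences are conjugated
    by [f], which traces ignore. *)
Lemma transgression_pullback (D0 D1 : preconnection F) : is_connection D0 -> is_connection D1 ->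
  transgression (pullback f D0) (pullback f D1) = transgression D0 D1.
Proof.
move=> h0 h1; have p0 := pullback_conn h0; have p1 := pullback_conn h1.
apply/funext => l; apply/funext => x.
rewrite (transgressionE p0 p1 x (ltnSn _)) (transgressionE h0 h1 x (ltnSn _)).
congr (_ * _); apply: cint_eq => t _; apply: eq_bigr => k _; congr (_ * _).
rewrite !tfE; apply: (lform_hom_tr (Phi := fun a => isoV f x *m a *m iso f x)).
- by move=> a b; rewrite mulmxDr mulmxDl.
- by move=> a; rewrite mulmxN mulNmx.
- by move=> a b; rewrite !mulmxA -[_ *m iso f x *m isoV f x]mulmxA isoVK mulmx1.
- by rewrite mulmx1 isoK.
- by move=> a; rewrite mxtrace_mulC mulmxA isoVK mul1mx.
- by case=> [|X [|? ?]]; rewrite /ev /= ?mulmx0 ?mul0mx //; exact: cdiff_pullback.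
- move=> m; rewrite /ev.
  have hp : is_connection (pullback f (affine_path D0 D1 t)) by rewrite pullback_affine; exact: aconn.
  rewrite -(Fform_pullback (aconn h0 h1 t) hp); congr (sev _ x).
  congr (_ m); apply: (Dop_ext_delta _).1 => X s.
  by apply/ssec_eq => y /=; rewrite pullback_affine.
Qed.

End Pullback.

Lemma block_mx0 (R : pzRingType) p q : block_mx (0 : 'M[R]_p) 0 0 (0 : 'M[R]_q) = 0.
Proof. exact: block_mx_const. Qed.

(** * Direct sums *)

Section DirectSums.
Context {R : realType} {n : nat} {M : manifold R n} (E F : vbundle M).
Local Notation S := (dsum E F).

Lemma dsum_smooth (s : presection S) : smooth_section s <->
  @smooth_section _ _ _ E (fun x => usubmx (s x)) /\ @smooth_section _ _ _ F (fun x => dsubmx (s x)).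
Proof.
have T i j x (v : 'cV[R[i]]_(rank E x + rank F x)) :
    @triv _ _ _ S (i, j) x *m v = col_mx (triv i x *m usubmx v) (triv j x *m dsubmx v).
  by rewrite -{1}[v]vsubmxK /= mul_block_col !mul0mx addr0 add0r.
split=> [hs|[h1 h2]].
  split; apply: smooth_section1 => x.
    have [i ix] := tdom_cover E x; have [j jx] := tdom_cover F x; exists i => // k l.
    have := (smooth_sectionP s).1 hs x (i, j) (conj ix jx) (lshift _ k) l.
    by apply: csm_ext => y; rewrite T col_mxEu.
  have [i ix] := tdom_cover E x; have [j jx] := tdom_cover F x; exists j => // k l.
  have := (smooth_sectionP s).1 hs x (i, j) (conj ix jx) (rshift _ k) l.
  by apply: csm_ext => y; rewrite T col_mxEd.
apply/smooth_sectionP => x [i j] [ix jx] k l.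
case: (split_ordP k) => a ->.
  have := (smooth_sectionP _).1 h1 x i ix a l.
  by apply: csm_ext => y; rewrite T col_mxEu.
have := (smooth_sectionP _).1 h2 x j jx a l.
by apply: csm_ext => y; rewrite T col_mxEd.
Qed.

Definition ups (s : ssec S) : ssec E := SSec ((dsum_smooth s).1 (ssP s)).1.
Definition dps (s : ssec S) : ssec F := SSec ((dsum_smooth s).1 (ssP s)).2.

Section OneConnection.
Variables (D : preconnection E) (D' : preconnection F).
Variables (hD : is_connection D) (hD' : is_connection D').

Lemma dsum_connection : is_connection (dsum_conn D D').
Proof.
split.
- move=> X s hs; apply/dsum_smooth; split.
    apply: (smooth_of_ssec (t := Dop hD X (ups (SSec hs)))) => x.
    by rewrite /dsum_conn col_mxKu.
  apply: (smooth_of_ssec (t := Dop hD' X (dps (SSec hs)))) => x.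
  by rewrite /dsum_conn col_mxKd.
- move=> X s t hs ht x; rewrite /dsum_conn add_col_mx.
  rewrite -(conn_add hD X (ssP (ups (SSec hs))) (ssP (ups (SSec ht)))).
  rewrite -(conn_add hD' X (ssP (dps (SSec hs))) (ssP (dps (SSec ht)))).
  by congr (col_mx (D X _ x) (D' X _ x)); apply: functional_extensionality_dep => y; rewrite linearD.
- move=> X g s hg hs x; rewrite /dsum_conn !scale_col_mx -[s x]vsubmxK scale_col_mx add_col_mx.
  rewrite -(conn_leibniz hD X hg (ssP (ups (SSec hs)))) -(conn_leibniz hD' X hg (ssP (dps (SSec hs)))).
  by congr (col_mx (D X _ x) (D' X _ x)); apply: functional_extensionality_dep => y; rewrite linearZ.
- move=> g X Y Z s hg hZ hs x; rewrite /dsum_conn scale_col_mx add_col_mx.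
  by rewrite (conn_tensorial hD hg hZ (ssP (ups (SSec hs)))) (conn_tensorial hD' hg hZ (ssP (dps (SSec hs)))).
Qed.

Lemma Fform_dsum (hS : is_connection (dsum_conn D D')) l x :
  Fform hS l x = block_mx (Fform hD l x) 0 0 (Fform hD' l x).
Proof.
case: l => [|X [|Y [|? ?]]]; try exact/esym/block_mx0.
apply: (@sec_span _ _ _ S) => s; rewrite -[s x in RHS]vsubmxK mul_block_col !mul0mx addr0 add0r.
have := congr1 (fun t : ssec S => t x) (curvE hS X Y s) => /= ->.
have := congr1 (fun t : ssec E => t x) (curvE hD X Y (ups s)) => /= ->.
have := congr1 (fun t : ssec F => t x) (curvE hD' X Y (dps s)) => /= ->.
have e U V : dsum_conn D D' U (dsum_conn D D' V s) x =
   col_mx (D U (D V (ups s)) x) (D' U (D' V (dps s)) x).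
  by congr (col_mx (D U _ x) (D' U _ x)); apply: functional_extensionality_dep => y; rewrite ?col_mxKu ?col_mxKd.
by rewrite !e !opp_col_mx !add_col_mx.
Qed.
End OneConnection.

Lemma dsum_affine (D0 D1 : preconnection E) (D0' D1' : preconnection F) (t : R) :
  dsum_conn (affine_path D0 D1 t) (affine_path D0' D1' t) =
  affine_path (dsum_conn D0 D0') (dsum_conn D1 D1') t.
Proof.
apply/funext => X; apply/funext => s; apply: functional_extensionality_dep => x.
by rewrite /dsum_conn /affine_path !scale_col_mx add_col_mx.
Qed.

Lemma cdiff_dsum (D0 D1 : preconnection E) (D0' D1' : preconnection F)
  (h0 : is_connection D0) (h1 : is_connection D1) (h0' : is_connection D0') (h1' : is_connection D1')
  (p0 : is_connection (dsum_conn D0 D0')) (p1 : is_connection (dsum_conn D1 D1')) X x :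
  cdiff p0 p1 X x = block_mx (cdiff h0 h1 X x) 0 0 (cdiff h0' h1' X x).
Proof.
apply: sec_span => s; rewrite -[s x in RHS]vsubmxK mul_block_col !mul0mx addr0 add0r.
have := congr1 (fun t : ssec S => t x) (cdiffE p0 p1 X s) => /= ->.
have := congr1 (fun t : ssec E => t x) (cdiffE h0 h1 X (ups s)) => /= ->.
have := congr1 (fun t : ssec F => t x) (cdiffE h0' h1' X (dps s)) => /= ->.
by rewrite !opp_col_mx !add_col_mx.
Qed.

(** Block diagonal matrices are closed under products, sums and opposites, so wedge powers are
    computed block by block. *)
Lemma lform_block_tr p q (u1 v1 : lform (vfield M) 'M[R[i]]_p) (u2 v2 : lform (vfield M) 'M[R[i]]_q)
    (u v : lform (vfield M) 'M[R[i]]_(p + q)) k l :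
  (forall l, u l = block_mx (u1 l) 0 0 (u2 l)) -> (forall l, v l = block_mx (v1 l) 0 0 (v2 l)) ->
  \tr ((u * v ^+ k) l) = \tr ((u1 * v1 ^+ k) l) + \tr ((u2 * v2 ^+ k) l).
Proof.
move=> hu hv.
have hM (a b : lform (vfield M) 'M[R[i]]_(p + q)) (a1 b1 : lform (vfield M) 'M[R[i]]_p)
   (a2 b2 : lform (vfield M) 'M[R[i]]_q) :
    (forall l, a l = block_mx (a1 l) 0 0 (a2 l)) -> (forall l, b l = block_mx (b1 l) 0 0 (b2 l)) ->
    forall l, (a * b) l = block_mx ((a1 * b1) l) 0 0 ((a2 * b2) l).
  move=> ha hb m; rewrite !lformME; elim: m a b a1 b1 a2 b2 ha hb => [|X m IH] a b a1 b1 a2 b2 ha hb /=.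
    rewrite ha hb; apply: etrans (mulmx_block _ _ _ _ _ _ _ _) _.
    by rewrite !mul0mx !mulmx0 !addr0 !add0r.
  rewrite (IH (iota_ X a) b (iota_ X a1) b1 (iota_ X a2) b2) //.
  rewrite (IH (eps a) (iota_ X b) (eps a1) (iota_ X b1) (eps a2) (iota_ X b2)) //.
  - by rewrite add_block_mx !addr0.
  - by move=> j; rewrite /eps; case: ifP => _; rewrite ha ?opp_block_mx ?oppr0.
  - by move=> j; exact: hb.
  - by move=> j; exact: ha.
have hX : forall l, (v ^+ k) l = block_mx ((v1 ^+ k) l) 0 0 ((v2 ^+ k) l).
  elim: k => [|k IH] m; last by rewrite !exprS; exact: hM.
  rewrite !expr0; case: m => [|? ?]; first exact: scalar_mx_block.
  exact/esym/block_mx0.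
by rewrite (hM _ _ _ _ _ _ hu hX) mxtrace_block.
Qed.

Lemma transgression_dsum (D0 D1 : preconnection E) (D0' D1' : preconnection F) :
  is_connection D0 -> is_connection D1 -> is_connection D0' -> is_connection D1' ->
  transgression (dsum_conn D0 D0') (dsum_conn D1 D1') = transgression D0 D1 + transgression D0' D1'.
Proof.
move=> h0 h1 h0' h1'; have p0 := dsum_connection h0 h0'; have p1 := dsum_connection h1 h1'.
apply/funext => l; apply/funext => x; rewrite !funDE.
rewrite (transgressionE p0 p1 x (ltnSn _)) (transgressionE h0 h1 x (ltnSn _)).
rewrite (transgressionE h0' h1' x (ltnSn _)) -mulrDr -cintD; last 2 first.
- apply: ccont_sum => k; apply: ccontM; first exact: ccont_cst.
  have [p _ e] := tf_poly h0 h1 l x k.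
  by apply: (@ccont_eq _ (fun t => p.[t%:C])) (ccont_horner p) => t _; rewrite e.
- apply: ccont_sum => k; apply: ccontM; first exact: ccont_cst.
  have [p _ e] := tf_poly h0' h1' l x k.
  by apply: (@ccont_eq _ (fun t => p.[t%:C])) (ccont_horner p) => t _; rewrite e.
congr (_ * _); apply: cint_eq => t _; rewrite -big_split; apply: eq_bigr => k _.
rewrite -[RHS]mulrDr; congr (_ * _); rewrite !tfE; apply: lform_block_tr.
- by case=> [|X [|? ?]]; [exact/esym/block_mx0|exact: cdiff_dsum|exact/esym/block_mx0].
- move=> m; rewrite /ev.
  have hp : is_connection (dsum_conn (affine_path D0 D1 t) (affine_path D0' D1' t)).
    by rewrite dsum_affine; exact: aconn.
  rewrite -(Fform_dsum (aconn h0 h1 t) (aconn h0' h1' t) hp).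
  suff -> : Fform (aconn p0 p1 t) = Fform hp by [].
  apply: (Dop_ext_delta _).1 => X s.
  by apply/ssec_eq => y /=; rewrite dsum_affine.
Qed.

End DirectSums.

(** * Adjoint endomorphisms at a point *)

Section Conjugation.
Context {R : realType} {n : nat} {M : manifold R n} {E : vbundle M}.
Variable h : hermitian_metric E.
Local Notation cj := (@conjc R).
Local Notation cmat := (map_mx (@conjc R)).
Local Notation cc := (@chern_const R).
Local Notation ec := (@expc R).

Lemma cmatM p q r (A : 'M[R[i]]_(p, q)) (B : 'M[R[i]]_(q, r)) : cmat (A *m B) = cmat A *m cmat B.
Proof. exact: map_mxM. Qed.
Lemma cmat1 p : cmat (1%:M : 'M[R[i]]_p) = 1%:M.
Proof. exact: map_mx1. Qed.

Lemma herm_mx x : exists H Hi : 'M[R[i]]_(rank E x), [/\ H *m Hi = 1%:M, Hi *m H = 1%:M &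
  forall u v, h x u v = (u^T *m H *m cmat v) 0 0].
Proof.
have [i ix] := tdom_cover E x; have G := gram_unit h ix.
pose H := (triv i x)^T *m gram h i x *m cmat (triv i x).
pose Hi := cmat (trivV i x) *m invmx (gram h i x) *m (trivV i x)^T.
have HH : H *m Hi = 1%:M.
  rewrite /H /Hi !mulmxA -[_ *m cmat (triv i x) *m _]mulmxA -cmatM trivVK // cmat1 mulmx1.
  by rewrite -[_ *m gram h i x *m _]mulmxA mulmxV // mulmx1 -trmx_mul trivK // trmx1.
exists H, Hi; split=> //; first exact: mulmx1C.
by move=> u v; rewrite (herm_triv h _ _ ix) trmx_mul cmatM /H !mulmxA.
Qed.

Variables (x : M) (H Hi : 'M[R[i]]_(rank E x)).
Hypotheses (HH : H *m Hi = 1%:M) (HiH : Hi *m H = 1%:M).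
Hypothesis hH : forall u v, h x u v = (u^T *m H *m cmat v) 0 0.

(** The adjoint for the metric at [x], whose matrix in the fixed basis of the fibre is [H]. *)
Definition dg (A : 'M[R[i]]_(rank E x)) := (H *m cmat A *m Hi)^T.

Lemma dgE A u v : h x (dg A *m u) v = h x u (A *m v).
Proof.
by rewrite !hH trmx_mul trmxK cmatM !mulmxA -[_ *m Hi *m H]mulmxA HiH mulmx1.
Qed.
Lemma dgM A B : dg (A *m B) = dg B *m dg A.
Proof.
rewrite /dg -trmx_mul cmatM !mulmxA; congr (_^T).
by rewrite -[_ *m Hi *m H]mulmxA HiH mulmx1.
Qed.
Lemma dgD A B : dg (A + B) = dg A + dg B.
Proof. by rewrite /dg map_mxD mulmxDr mulmxDl linearD. Qed.
Lemma dgN A : dg (- A) = - dg A.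
Proof. by rewrite /dg map_mxN mulmxN mulNmx linearN. Qed.
Lemma dg0 : dg 0 = 0.
Proof. by apply: (addrI (dg 0)); rewrite -dgD !addr0. Qed.
Lemma dg1 : dg 1%:M = 1%:M.
Proof. by rewrite /dg cmat1 mulmx1 HH trmx1. Qed.
Lemma tr_dg A : \tr (dg A) = cj (\tr A).
Proof.
rewrite /dg mxtrace_tr mxtrace_mulC mulmxA HiH mul1mx /mxtrace conj_sum_.
by apply: eq_bigr => i _; rewrite mxE.
Qed.

Lemma dg_unique (A B : 'M[R[i]]_(rank E x)) :
  (forall s t : ssec E, h x (B *m s x) (t x) = h x (s x) (A *m t x)) -> B = dg A.
Proof.
by move=> e; apply: sec_span => s; apply: (@herm_inj _ _ _ _ h) => t; rewrite dgE e.
Qed.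

Local Notation L := (lform (vfield M) 'M[R[i]]_(rank E x)).

(** Taking adjoints reverses matrix products; restoring the order of the arguments then costs the
    sign of graded commutativity. *)
Lemma lform_dgM a b (u v u' v' : L) : parity a u -> parity b v ->
  (forall l, u' l = dg (u l)) -> (forall l, v' l = dg (v l)) ->
  forall l, dg ((u * v) l) = sg (a && b) ((v' * u') l).
Proof.
move=> hu hv eu ev l; rewrite lformME.
have dg0 : dg 0 = 0 by apply: (addrI (dg 0)); rewrite -dgD !addr0.
rewrite (bmul_map (psi := fun a b => b *m a) (f := dg) (g := dg) dgD dgN dgM).
have pu : parity a (dg \o u) by move=> k hk; rewrite /= hu.
have pv : parity b (dg \o v) by move=> k hk; rewrite /= hv.
rewrite (bmul_flip _ _ _ pu pv); first last.
- by move=> A B C; rewrite mulmxBl.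
- by move=> A B C; rewrite mulmxBr.
congr sg; rewrite lformME; apply: bmul_eq => k _; [exact/esym/ev|exact/esym/eu].
Qed.

Lemma lform_dgX (v v' : L) k : parity false v -> (forall l, v' l = dg (v l)) ->
  forall l, (v' ^+ k) l = dg ((v ^+ k) l).
Proof.
move=> pv e; elim: k => [|k IH] l.
  rewrite !expr0; case: l => [|? ?]; first exact/esym/dg1.
  by apply/esym; apply: (addrI (dg 0)); rewrite -dgD !addr0.
by rewrite [v ^+ _]exprS (lform_dgM pv (parity_exp k pv) e IH) exprSr.
Qed.

(** The [k.+1] factors contribute one sign each. The reversal of the product is undone by cyclicity,
    without sign because [v] is even. *)
Lemma tr_dg_power (u v u' v' : L) a k l : parity a u -> parity false v ->
  (forall l, u' l = - dg (u l)) -> (forall l, v' l = - dg (v l)) ->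
  \tr ((u' * v' ^+ k) l) = (-1) ^+ k.+1 * cj (\tr ((u * v ^+ k) l)).
Proof.
move=> pu pv eu ev.
pose u2 : L := fun l => dg (u l); pose v2 : L := fun l => dg (v l).
have -> : u' = - u2 by apply/funext => m; rewrite eu.
have -> : v' = - v2 by apply/funext => m; rewrite ev.
have p0 : dg 0 = 0 by apply: (addrI (dg 0)); rewrite -dgD !addr0.
have pu2 : parity a u2 by move=> m hm; rewrite /u2 pu.
have pv2 : parity false v2 by move=> m hm; rewrite /v2 pv.
have key : \tr ((u2 * v2 ^+ k : L) l) = cj (\tr ((u * v ^+ k) l)).
  rewrite -tr_dg (lform_dgM pu (parity_exp k pv) (fun _ => erefl) (lform_dgX k pv (v' := v2) (fun _ => erefl))).
  rewrite andbF /=.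
  have := lmul_cyc (tr := fun A : 'M[R[i]]_(rank E x) => \tr A) _ _ pu2 (parity_exp k pv2) l.
  rewrite andbF /= => -> //; first by move=> A B; rewrite raddfB.
  by move=> A B; rewrite mxtrace_mulC.
have e1 : (- u2 : L) * (- v2 : L) ^+ k = (if odd k then u2 * v2 ^+ k else - (u2 * v2 ^+ k)).
  by rewrite exprNn -signr_odd; case: (odd k); rewrite ?expr1 ?expr0 ?mulN1r ?mul1r ?mulrNN ?mulNr.
have e2 : (-1) ^+ k.+1 = (if odd k then 1 else -1) :> R[i].
  by rewrite -signr_odd /=; case: (odd k); rewrite ?expr0 ?expr1.
rewrite e1 e2; case: (odd k); first by rewrite mul1r.
by rewrite mulN1r -key funNE raddfN.
Qed.

Section AdjointPair.
Variables (D D' : preconnection E) (hD : is_connection D) (a : is_adjoint h D D').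

(** Moving two derivatives across the metric reverses their order, and the derivatives of the
    function [h(s, t)] cancel because the bracket acts on functions as a commutator. *)
Lemma Fform_adjoint (hD' : is_connection D') l : Fform hD' l x = - dg (Fform hD l x).
Proof.
have dg0 : dg 0 = 0 by apply: (addrI (dg 0)); rewrite -dgD !addr0.
case: l => [|X [|Y [|? ?]]]; try by rewrite /= dg0 oppr0.
rewrite -[LHS]opprK; congr (- _); apply: dg_unique => s t.
have c1 := congr1 (fun t : ssec E => t x) (curvE hD' X Y s).
have c2 := congr1 (fun s : ssec E => s x) (curvE hD X Y t).
have d1 : Fform hD' [:: X; Y] x *m s x = (Dop hD' X (Dop hD' Y s) - Dop hD' Y (Dop hD' X s)
    - Dop hD' (bracket X Y) s) x by exact: c1.
have d2 : Fform hD [:: X; Y] x *m t x = (Dop hD X (Dop hD Y t) - Dop hD Y (Dop hD X t)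
    - Dop hD (bracket X Y) t) x by exact: c2.
rewrite mulNmx d1 d2.
have P U v w : hsec h (Dop hD' U v) w = sact U (hsec h v w) - hsec h v (Dop hD U w).
  by rewrite -(is_adjointP hD a); congr hsec; exact/ssec_eq.
have sactB' U f g : sact U (f - g) = sact U f - sact U g by exact: sactB.
have e : hsec h (- (Dop hD' X (Dop hD' Y s) - Dop hD' Y (Dop hD' X s) - Dop hD' (bracket X Y) s)) t =
    hsec h s (Dop hD X (Dop hD Y t) - Dop hD Y (Dop hD X t) - Dop hD (bracket X Y) t).
  have hB v w z : hsec h (v - w) z = hsec h v z - hsec h w z.
    by apply/sfun_eq/funext => y; rewrite sfunB /= hermBl.
  have hN v z : hsec h (- v) z = - hsec h v z.
    by apply/sfun_eq/funext => y; rewrite sfunN /= hermNl.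
  have hBr v w z : hsec h z (v - w) = hsec h z v - hsec h z w.
    by apply/sfun_eq/funext => y; rewrite sfunB /= hermBr.
  rewrite hN !hB !hBr !P !sactB' sact_br; abelu.
exact: (congr1 (fun f : sfun M => f x) e).
Qed.
End AdjointPair.

Lemma cdiff_adjoint (D0 D1 D0' D1' : preconnection E) (h0 : is_connection D0)
  (h1 : is_connection D1) (h0' : is_connection D0') (h1' : is_connection D1')
  (a0 : is_adjoint h D0 D0') (a1 : is_adjoint h D1 D1') X :
  cdiff h0' h1' X x = - dg (cdiff h0 h1 X x).
Proof.
rewrite -[LHS]opprK; congr (- _); apply: dg_unique => s t.
rewrite mulNmx (_ : _ *m s x = D1' X s x - D0' X s x); last first.
  exact: (congr1 (fun t : ssec E => t x) (cdiffE h0' h1' X s)).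
rewrite (_ : _ *m t x = D1 X t x - D0 X t x); last first.
  exact: (congr1 (fun t : ssec E => t x) (cdiffE h0 h1 X t)).
rewrite hermNl hermBl hermBr (a0.2 X s t (ssP s) (ssP t) x) (a1.2 X s t (ssP s) (ssP t) x).
ring.
Qed.

End Conjugation.

Section ConjugateForms.
Context {R : realType} {n : nat} {M : manifold R n} {E : vbundle M}.
Variable h : hermitian_metric E.
Local Notation cj := (@conjc R).
Local Notation cc := (@chern_const R).
Local Notation ec := (@expc R).

Lemma is_adjoint_affine (D0 D1 D0' D1' : preconnection E) (t : R) :
  is_adjoint h D0 D0' -> is_adjoint h D1 D1' ->
  is_adjoint h (affine_path D0 D1 t) (affine_path D0' D1' t).
Proof.
move=> a0 a1; split; first exact: (aconn a0.1 a1.1).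
move=> X s v hs hv x; rewrite /affine_path hermDl hermDr !hermZl !hermZr !conjR_.
by rewrite (a0.2 X s v hs hv x) (a1.2 X s v hs hv x) rmorphB rmorph1; ring.
Qed.

Lemma chern_const_conj : cj cc = - cc.
Proof.
rewrite /chern_const conjN_ opprK; set z := 2 * _ * _.
have -> : cj z^-1 = (cj z)^-1 by exact: fmorphV.
suff -> : cj z = - z by rewrite invrN opprK.
have e2 : cj 2 = 2 by exact: (rmorph_nat (@conjc R) 2).
have ei : cj 'i = - 'i by exact: conjCi.
by rewrite /z !conjM_ conjR_ e2 ei mulrN.
Qed.

Lemma expc_conj k : cj (ec k) = (-1) ^+ k * ec k.
Proof.
have -> : cj (ec k) = (cj cc) ^+ k / k`!%:R.
  rewrite /expc (conjM_ (cc ^+ k) (k`!%:R^-1)).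
  have -> : cj (cc ^+ k) = cj cc ^+ k by exact: rmorphXn.
  congr (_ * _); have -> : cj (k`!%:R^-1) = (cj k`!%:R)^-1 by exact: fmorphV.
  by congr (_^-1); exact: rmorph_nat.
by rewrite chern_const_conj (exprNn cc) -mulrA.
Qed.

Lemma cint_conj (f : R -> R[i]) : ccont f ->
  cj (cintegral01 f) = cintegral01 (fun t => cj (f t)).
Proof.
move=> [c1 c2]; rewrite !cint_E; apply: complexP_; rewrite ?ReJ_ ?ImJ_ /=.
  by apply: II_eq => s _; rewrite ReJ_.
rewrite -mulN1r -IIZ //; apply: II_eq => s _.
by rewrite ImJ_ mulN1r.
Qed.

Lemma tf_ccont (D0 D1 : preconnection E) (h0 : is_connection D0) (h1 : is_connection D1) N l x :
  ccont (fun t => \sum_(k < N) ec k * tf (form1 (cdiff h0 h1)) (Fform (aconn h0 h1 t)) k l x).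
Proof.
apply: ccont_sum => k; apply: ccontM; first exact: ccont_cst.
have [p _ e] := tf_poly h0 h1 l x k.
by apply: (@ccont_eq _ (fun t => p.[t%:C])) (ccont_horner p) => t _; rewrite e.
Qed.

(** The signs cancel: [(-1) ^+ k] from the conjugate of [c ^+ k], as [c] is purely imaginary,
    [(-1) ^+ k.+1] from the adjoints, and one more from the leading factor [c]. *)
Lemma cform_transgression (D0 D1 D0' D1' : preconnection E) :
  is_connection D0 -> is_connection D1 -> is_adjoint h D0 D0' -> is_adjoint h D1 D1' ->
  cform (transgression D0 D1) = transgression D0' D1'.
Proof.
move=> h0 h1 a0 a1; apply/funext => l; apply/funext => x.
rewrite /cform (transgressionE h0 h1 x (ltnSn _)) (transgressionE a0.1 a1.1 x (ltnSn _)).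
have term (t : R) k : cj (ec k * tf (form1 (cdiff h0 h1)) (Fform (aconn h0 h1 t)) k l x) =
    -1 * (ec k * tf (form1 (cdiff a0.1 a1.1)) (Fform (aconn a0.1 a1.1 t)) k l x).
  rewrite conjM_ expc_conj !tfE.
  have [H [Hi [HH HiH hH]]] := herm_mx h x.
  have p1 : parity true (ev x (form1 (cdiff h0 h1))) by case=> [|? [|? ?]].
  have p2 : parity false (ev x (Fform (aconn h0 h1 t))) by case=> [|? [|? [|? ?]]].
  rewrite (tr_dg_power HH HiH k l p1 p2 (u' := ev x (form1 (cdiff a0.1 a1.1))) (v' := ev x (Fform (aconn a0.1 a1.1 t)))).
  - by rewrite exprS; ring.
  - case=> [|X [|? ?]]; try by rewrite /ev /= dg0 oppr0.
    exact: (cdiff_adjoint HiH hH h0 h1 a0.1 a1.1 a0 a1 X).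
  - by move=> m; apply: (Fform_adjoint HiH hH (aconn h0 h1 t)); exact: is_adjoint_affine.
rewrite [LHS](conjM_ cc) chern_const_conj (cint_conj (tf_ccont h0 h1 _ l x)) mulNr -mulrN; congr (_ * _).
rewrite -mulN1r -cintZ; last first.
  apply: (@ccont_eq _ (fun t => -1 * \sum_(k < (size l).+1) ec k * tf (form1 (cdiff a0.1 a1.1)) (Fform (aconn a0.1 a1.1 t)) k l x)).
    move=> t _; rewrite conj_sum_ mulr_sumr; apply: eq_bigr => k _.
    by rewrite (term t k).
  by apply: ccontM; [exact: ccont_cst|exact: tf_ccont].
apply: cint_eq => t _; rewrite conj_sum_ mulr_sumr; apply: eq_bigr => k _.
by rewrite (term t k) !mulN1r opprK.
Qed.

Lemma ch_adjoint (D D' : preconnection E) : is_connection D -> is_adjoint h D D' ->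
  ch D' = cform (ch D).
Proof.
move=> hD a; apply/funext => l; apply/funext => x.
rewrite /cform (chE hD x (ltnSn _)) (chE a.1 x (ltnSn _)) [RHS]conj_sum_; apply: eq_bigr => k _.
rewrite [RHS]conjM_ expc_conj.
have [H [Hi [HH HiH hH]]] := herm_mx h x.
have p1 : parity false (1 : lform (vfield M) 'M[R[i]]_(rank E x)) by case.
have p2 : parity false (ev x (Fform hD)) by case=> [|? [|? [|? ?]]].
have := tr_dg_power HH HiH k l p1 p2 (u' := -1) (v' := ev x (Fform a.1)).
rewrite mulN1r mul1r funNE raddfN -!evX => key.
have -> : strace ((Fform a.1 ^+ k) l) x = (-1) ^+ k * cj (strace ((Fform hD ^+ k) l) x).
  apply: oppr_inj; rewrite -mulNr -mulN1r -exprS; apply: key => [m|m].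
    rewrite funNE; congr (- _); case: m => [|? ?]; first exact/esym/dg1.
    exact/esym/dg0.
  exact: (Fform_adjoint HiH hH hD a).
ring.
Qed.

End ConjugateForms.

(** * The morphism *)

Section Metrics.
Context {R : realType} {n : nat} {M : manifold R n}.

Section SumMetric.
Variables (E F : vbundle M) (hE : hermitian_metric E) (hF : hermitian_metric F).
Local Notation S := (dsum E F).

Definition dsum_metric : hermitian_metric S.
Proof.
refine (@HermitianMetric R n M S (fun x (u v : 'cV_(rank E x + rank F x)) =>
  hE x (usubmx u) (usubmx v) + hF x (dsubmx u) (dsubmx v)) _ _ _ _).
- by move=> x a u v w; rewrite !linearP !herm_linear; ring.
- by move=> x u v; rewrite [RHS]conjD_ -!herm_sym.
- move=> x u u0; have ge0 (G : vbundle M) (h : hermitian_metric G) w : 0 <= h x w w.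
    by have [->|/(herm_pos h)/ltW //] := eqVneq w 0; rewrite herm0l.
  have [e|e] := eqVneq (usubmx u) 0; last by apply: ltr_pwDl => //; exact: herm_pos.
  rewrite e herm0l add0r; apply: herm_pos; apply: contra u0 => /eqP d.
  by rewrite -[u]vsubmxK e d col_mx0.
- move=> [i j] u v; apply/csmooth_onP; first exact: tdom_open.
  move=> x [ix jx].
  have T y (w : 'cV_(trank i + trank j)) : @trivV _ _ _ S (i, j) y *m w =
      col_mx (trivV i y *m usubmx w) (trivV j y *m dsubmx w).
    by rewrite -{1}[w]vsubmxK /= mul_block_col !mul0mx addr0 add0r.
  apply: (csm_ext (F := fun y => hE y (trivV i y *m usubmx u) (trivV i y *m usubmx v) +
    hF y (trivV j y *m dsubmx u) (trivV j y *m dsubmx v))).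
    by move=> y; rewrite !T !col_mxKu !col_mxKd.
  apply: csmD.
    exact: ((csmooth_onP _ (tdom_open i)).1 (herm_smooth hE _ _)).
  exact: ((csmooth_onP _ (tdom_open j)).1 (herm_smooth hF _ _)).
Defined.

Lemma is_adjoint_dsum (D D1 : preconnection E) (D' D1' : preconnection F) :
  is_adjoint hE D D1 -> is_adjoint hF D' D1' ->
  is_adjoint dsum_metric (dsum_conn D D') (dsum_conn D1 D1').
Proof.
move=> a a'; split; first exact: dsum_connection a.1 a'.1.
move=> X s t hs ht x; have [us ds] := (dsum_smooth s).1 hs; have [ut dt] := (dsum_smooth t).1 ht.
rewrite /= /dsum_conn !col_mxKu !col_mxKd (a.2 X _ _ us ut x) (a'.2 X _ _ ds dt x).
rewrite cvf_fD; first by ring.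
  exact: (hsec_csm hE (SSec us) (SSec ut)).
exact: (hsec_csm hF (SSec ds) (SSec dt)).
Qed.
End SumMetric.

Section PulledMetric.
Variables (E F : vbundle M) (f : bundle_iso E F) (h : hermitian_metric F).

Definition pullback_metric : hermitian_metric E.
Proof.
refine (@HermitianMetric R n M E (fun x u v => h x (iso f x *m u) (iso f x *m v)) _ _ _ _).
- by move=> x a u v w; rewrite mulmxDr -scalemxAr herm_linear.
- by move=> x u v; rewrite -herm_sym.
- move=> x u u0; apply: herm_pos; apply: contra u0 => /eqP e.
  by rewrite -[u]mul1mx -(isoK f) -mulmxA e mulmx0.
- move=> i u v; apply/csmooth_onP; first exact: tdom_open.
  move=> x ix; have [j jx] := tdom_cover F x.
  have C (w : 'cV_(trank i)) : cmx (fun y => triv j y *m (iso f y *m (trivV i y *m w))) x.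
    apply: (cmx_ext (A := fun y => (triv j y *m iso f y *m trivV i y) *m w)).
      by move=> y; rewrite !mulmxA.
    apply: cmxM; last exact: cmx_cst.
    move=> k l; have o : open (tdom i `&` tdom j) by apply: openI; exact: tdom_open.
    exact: ((csmooth_onP _ o).1 (iso_smooth f k l) x (conj ix jx)).
  apply: (csm_near (F := fun y => ((triv j y *m (iso f y *m (trivV i y *m u)))^T *m gram h j y *m
     map_mx (@conjc R) (triv j y *m (iso f y *m (trivV i y *m v)))) 0 0)).
    by apply: filterS (tdom_near jx) => y jy; rewrite -herm_triv.
  have := cmxM (cmxM (cmx_tr (C u)) (gram_sm h jx)) (cmx_conj (C v)); exact.
Defined.

Lemma is_adjoint_pullback (D D' : preconnection F) : is_adjoint h D D' ->
  is_adjoint pullback_metric (pullback f D) (pullback f D').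
Proof.
move=> a; split; first exact: pullback_conn a.1.
move=> X s t hs ht x; rewrite /= /pullback !mulmxA isoVK !mul1mx.
exact: (a.2 X _ _ (ssP (isec f (SSec hs))) (ssP (isec f (SSec ht))) x).
Qed.
End PulledMetric.

Lemma csmZ_ (c : R[i]) (w : M -> R[i]) : csmT w -> csmT (fun x => c * w x).
Proof. by move=> hw x; apply: csmM => //; exact: csm_cst. Qed.

Lemma is_form_scale c (w : preform (M := M)) : is_form w -> is_form (scaleform c w).
Proof.
move=> /is_formP [w1 w2]; apply/is_formP; split=> [l|x]; first exact: csmZ_.
exact: form_at_Z.
Qed.

Lemma scale_parity b c (w : preform (M := M)) : of_parity b w -> of_parity b (scaleform c w).
Proof. by move=> hw l hl; apply/funext => x; rewrite /scaleform hw // mulr0. Qed.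

Lemma dform_scale c (w : preform (M := M)) : is_form w -> dform (scaleform c w) = scaleform c (dform w).
Proof.
move=> /is_formP [w1 _]; apply/funext => l; apply/funext => x; rewrite /scaleform /dform mulrDr.
rewrite !mulr_sumr; congr (_ + _); apply: eq_bigr => i _.
  rewrite mulrCA; congr (_ * _).
  have cT : csmT (fun _ : M => c) by move=> y; exact: csm_cst.
  by rewrite (cvf_fM _ _ cT (w1 _)) cvf_cst mul0r add0r.
by rewrite mulr_sumr; apply: eq_bigr => j _; rewrite mulrCA.
Qed.

(** Half the difference of a representative and its conjugate is imaginary. It differs from the
    representative by half their sum, which the hypothesis makes exact. *)
Lemma conj_opp_imaginary (a : oform_mod M) : conj_mod a = - a -> purely_imaginary a.
Proof.
rewrite {1 2}(class_of_repr a); set w : oform (M := M) := repr a => h.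
have hw := odd_formP w; rewrite conj_mod_class // -class_ofN // in h.
have ho := odd_form_conj hw.
move: h; rewrite (class_ofE ho) (class_ofE (odd_formN hw)) => /oclass_eq [u hu /= e].
pose v : preform (M := M) := scaleform 2^-1 ((w : preform (M := M)) - cform w).
have hv : odd_form v.
  have h := odd_formB hw ho.
  by split; [exact: is_form_scale h.1|exact: scale_parity h.2].
exists (mkoform hv).
  move=> l x; rewrite /= /v /scaleform !funBE /cform.
  have -> : (w : preform (M := M)) l x - conjc ((w : preform (M := M)) l x) = (0 +i* (2 * complex.Im ((w : preform (M := M)) l x))).
    by apply: complexP_; rewrite ?ReD_ ?ImD_ ?ReN_ ?ImN_ ?ReJ_ ?ImJ_ /=; ring.
  have -> : 2^-1 = (2^-1 : R)%:C :> R[i] by rewrite fmorphV rmorph_nat.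
  by rewrite ReM_ /= mulr0 mul0r subr0.
rewrite -(class_ofE hv) (class_of_repr a) -/w.
apply: (class_of_eq (u := scaleform 2^-1 u)) => //.
  by split; [exact: is_form_scale hu.1|exact: scale_parity hu.2].
rewrite dform_scale; last exact: hu.1.
rewrite -e; apply/funext => l; apply/funext => x.
rewrite !funBE /v /scaleform !funBE !funNE /cform.
have two0 : (2 : R[i]) != 0 by rewrite pnatr_eq0.
by field.
Qed.

Lemma imaginary_closed (a : oform_mod M) : purely_imaginary a -> dmod a = 0 -> in_iHodd a.
Proof.
move=> [w wi ->]; rewrite dmod_oclass => dw; have hw := odd_formP w.
have hv : odd_form (scaleform (- 'i%C) w).
  by split; [exact: is_form_scale hw.1|exact: scale_parity hw.2].
exists (mkoform hv); split.
- by move=> l x /=; rewrite /scaleform ImM_ wi /=; ring.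
- rewrite /= dform_scale; last exact: hw.1.
  by rewrite dw; apply/funext => l; apply/funext => x; rewrite /scaleform mulr0.
- rewrite -class_of_val; congr class_of; apply/funext => l; apply/funext => x.
  by rewrite /= /scaleform mulrA mulrN -expr2 sqr_i opprK mul1r.
Qed.

End Metrics.

(** * Extension from triples to the quotient group *)

Section Assembly.
Context {R : realType} {n : nat} {M : manifold R n}.
Local Notation FG := {freeg (triple M) / int}.

HB.instance Definition _ := GRing.isZmodMorphism.Build (oform_mod M) (oform_mod M)
  (@conj_mod R n M) (@conj_modB R n M).
HB.instance Definition _ := GRing.isZmodMorphism.Build (oform_mod M) (preform (M := M))
  (@dmod R n M) (@dmodB R n M).

HB.instance Definition _ := GRing.isZmodMorphism.Build (preform (M := M)) (preform (M := M))
  (@cform R n M) (@cformB R n M).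

Section FreeExtension.
Variables (V : zmodType) (b : triple M -> V).

Definition fgext (g : FG) : V := \sum_(t <- dom g) b t *~ coeff t g.

(** Additivity compares sums over three supports, which are extended to a common one. *)
Lemma fgext_widen (g : FG) (s : seq (triple M)) : uniq s -> {subset dom g <= s} ->
  fgext g = \sum_(t <- s) b t *~ coeff t g.
Proof.
move=> us sub; rewrite [RHS](bigID (fun t => t \in dom g)) /= [X in _ + X]big1 ?addr0.
  rewrite -big_filter; apply: perm_big; apply: uniq_perm; rewrite ?filter_uniq ?uniq_dom //.
  by move=> t; rewrite mem_filter; case: (boolP (t \in dom g)) => // /sub ->.
by move=> t /coeff_outdom ->; rewrite mulr0z.
Qed.

Lemma fgextB : {morph fgext : g h / g - h}.
Proof.
move=> g h; pose s := undup (dom g ++ dom h ++ dom (g - h)).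
have us : uniq s by exact: undup_uniq.
rewrite !(fgext_widen us); first last.
- by move=> t th; rewrite mem_undup !mem_cat th ?orbT.
- by move=> t th; rewrite mem_undup !mem_cat th ?orbT.
- by move=> t th; rewrite mem_undup !mem_cat th ?orbT.
by rewrite -sumrB; apply: eq_bigr => t _; rewrite coeffB mulrzBr.
Qed.

Lemma fgext_gen t : fgext (gen t) = b t.
Proof. by rewrite /fgext /gen domU1 big_seq1 coeffU eqxx mulr1. Qed.
End FreeExtension.

Definition metric_of (E : vbundle M) : hermitian_metric E :=
  sval (cid (let: inhabits h := hermitian_metric_exists E in ex_intro (fun _ => True) h I)).

Definition Bval (t : triple M) : oform_mod M :=
  Bfrak t (adjconn (metric_of (tbundle t)) (tconnP t)).

Lemma BvalE (t : triple M) (h : hermitian_metric (tbundle t)) (D' : preconnection (tbundle t)) :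
  is_adjoint h (tconn t) D' -> Bval t = Bfrak t D'.
Proof.
move=> a; rewrite /Bval /Bfrak.
by rewrite (ch_tilde_adjoint (tconnP t) (adjoint_exists (metric_of (tbundle t)) (tconnP t)) a).
Qed.

Lemma conj_ch_tilde (E : vbundle M) (h : hermitian_metric E) (D0 D1 D0' D1' : preconnection E) :
  is_connection D0 -> is_connection D1 -> is_adjoint h D0 D0' -> is_adjoint h D1 D1' ->
  conj_mod (ch_tilde D0 D1) = ch_tilde D0' D1'.
Proof.
move=> h0 h1 a0 a1; rewrite /ch_tilde conj_mod_class; last exact: transgression_odd.
by rewrite (cform_transgression h0 h1 a0 a1).
Qed.

Lemma conj_modK (a : oform_mod M) : conj_mod (conj_mod a) = a.
Proof.
rewrite (class_of_repr a); have ha := odd_formP (repr a).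
rewrite conj_mod_class // conj_mod_class; last exact: odd_form_conj.
by congr class_of; apply/funext => l; apply/funext => x; rewrite /cform conjcK.
Qed.

(** The adjoint of [D'] is the given connection again, so conjugation exchanges the ends of the
    transgression, which changes its sign by the cocycle relation. *)
Lemma conj_Bval (t : triple M) : conj_mod (Bval t) = - Bval t.
Proof.
rewrite /Bval /Bfrak; set D' := adjconn _ _.
have a : is_adjoint (metric_of _) (tconn t) D' by exact: adjoint_exists.
have hD := tconnP t.
rewrite raddfD raddfB /= conj_modK (conj_ch_tilde a.1 hD (is_adjoint_sym hD a) a).
by rewrite (ch_tildeN a.1 hD); abel.
Qed.

Lemma dmod_Bval (t : triple M) : dmod (Bval t) = ch_hat_triple t - cform (ch_hat_triple t).
Proof.
rewrite /Bval /Bfrak; set D' := adjconn _ _.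
have a : is_adjoint (metric_of _) (tconn t) D' by exact: adjoint_exists.
have hD := tconnP t.
rewrite raddfD raddfB /= dmod_conj /ch_tilde dmod_class; last exact: (transgression_odd a.1 hD).
rewrite (dform_transgression a.1 hD) (ch_adjoint hD a) /ch_hat_triple cformB; abel.
Qed.

Lemma Bval_relator (g : FG) : relator g -> fgext Bval g = 0.
Proof.
case=> [E F DE DF hE hF f a b e|E F DE DF hE hF hEF a b].
  rewrite fgextB !fgext_gen; apply/eqP; rewrite subr_eq0; apply/eqP.
  (* Conjugating the transgression on [E] requires adjoints for a single metric. With the metric
     pulled back from [F], the adjoint of the pulled back connection is the pull-back of the
     adjoint. *)
  pose hm := metric_of F; pose h := pullback_metric f hm.
  have aF : is_adjoint hm DF (adjconn hm hF) by exact: adjoint_exists.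
  have aE : is_adjoint h DE (adjconn h hE) by exact: adjoint_exists.
  have aP := is_adjoint_pullback f aF.
  have hP := pullback_conn f hF.
  rewrite (BvalE (t := Triple hE a) aE) (BvalE (t := Triple hF b) aF) /Bfrak /=.
  rewrite e conj_modD (conj_ch_tilde hE hP aE aP).
  have -> : ch_tilde (adjconn hm hF) DF = ch_tilde (pullback f (adjconn hm hF)) (pullback f DF).
    by rewrite /ch_tilde transgression_pullback //; exact: aF.1.
  (* The transgression is routed through the adjoint of [DE] and through [DE]; the two outer pieces
     cancel the change of [a] and of its conjugate. *)
  rewrite -(ch_tilde_cocycle aP.1 aE.1 hP) -(ch_tilde_cocycle aE.1 hE hP).
  rewrite (ch_tildeN aE.1 aP.1); abel.
rewrite fgextB; apply/eqP; rewrite subr_eq0; apply/eqP.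
have fD g1 g2 : fgext Bval (g1 + g2) = fgext Bval g1 + fgext Bval g2.
  have f0 : fgext Bval 0 = 0 by rewrite /fgext dom0 big_nil.
  by rewrite -{1}[g2]opprK fgextB -[- g2]sub0r fgextB f0 sub0r opprK.
rewrite fD !fgext_gen.
pose mE := metric_of E; pose mF := metric_of F.
have aE : is_adjoint mE DE (adjconn mE hE) by exact: adjoint_exists.
have aF : is_adjoint mF DF (adjconn mF hF) by exact: adjoint_exists.
rewrite (BvalE (t := Triple hE a) aE) (BvalE (t := Triple hF b) aF).
rewrite (BvalE (t := Triple hEF (a + b)) (is_adjoint_dsum aE aF)) /Bfrak /=.
have -> : ch_tilde (dsum_conn (adjconn mE hE) (adjconn mF hF)) (dsum_conn DE DF) =
    ch_tilde (adjconn mE hE) DE + ch_tilde (adjconn mF hF) DF.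
  rewrite /ch_tilde (transgression_dsum aE.1 hE aF.1 hF) class_ofD //.
    exact: transgression_odd aE.1 hE.
  exact: transgression_odd aF.1 hF.
rewrite conj_modD; abel.
Qed.

(** Membership quantifies over all subgroups that contain the relators; it is applied to the kernel
    of [fgext Bval]. *)
Lemma fgext_relation (g : FG) : g \in relation_pred -> fgext Bval g = 0.
Proof.
move=> /asboolP /(_ [set g | fgext Bval g = 0]); apply => //=.
- by rewrite /fgext dom0 big_nil.
- by move=> a b ha hb; rewrite fgextB ha hb subrr.
- exact: Bval_relator.
Qed.

Definition Bmor (x : Kch M) : oform_mod M := fgext Bval (repr x : FG).

Lemma Bmor_pi (g : FG) : Bmor (\pi_(Kch M) g) = fgext Bval g.
Proof.
apply/eqP; rewrite -subr_eq0 /Bmor -fgextB; apply/eqP; apply: fgext_relation.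
have := @Quotient.idealrBE FG relation_pred (repr (\pi_(Kch M) g)) g.
by rewrite reprK eqxx.
Qed.

Lemma BmorB : {morph Bmor : x y / x - y}.
Proof.
move=> x y; rewrite -{1}[x]reprK -{1}[y]reprK -raddfB Bmor_pi fgextB. by [].
Qed.

HB.instance Definition _ := GRing.isZmodMorphism.Build (Kch M) (oform_mod M) Bmor BmorB.

End Assembly.

(** The first two clauses provide metrics and adjoint transposes, so that the formula for [B] on
    triples is not vacuous. As this formula holds for every metric and every adjoint, it contains
    the independence of both. *)
Theorem mainTheorem2 (R : realType) (n : nat) (M : manifold R n) :
  (forall E : vbundle M, inhabited (hermitian_metric E)) /\
  (forall (E : vbundle M) (h : hermitian_metric E) (D : preconnection E),
     is_connection D -> exists Dstar, is_adjoint h D Dstar) /\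
  exists B : {additive Kch M -> oform_mod M},
    [/\ forall (t : triple M) (h : hermitian_metric (tbundle t))
          (Dstar : preconnection (tbundle t)),
          is_adjoint h (tconn t) Dstar -> B (Kclass t) = Bfrak t Dstar,
        forall x : Kch M, purely_imaginary (B x),
        forall t : triple M,
          dmod (B (Kclass t)) =
          scaleform (2 * 'i%C) (imform (ch_hat_triple t))
      & forall x : Kch M, MK0 x -> in_iHodd (B x)].
Proof.
have imE (w : preform (M := M)) : scaleform (2 * 'i%C) (imform w) = w - cform w.
  apply/funext => l; apply/funext => x; rewrite !funBE /scaleform /imform /cform.
  apply: complexP_; rewrite ?ReD_ ?ImD_ ?ReN_ ?ImN_ ?ReJ_ ?ImJ_ !(ReM_, ImM_) /=; ring.
split; first exact: hermitian_metric_exists.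
split; first by move=> E h D hD; exists (adjconn h hD); exact: adjoint_exists.
have im x : purely_imaginary (@Bmor R n M x).
  apply: conj_opp_imaginary; rewrite /Bmor /fgext raddf_sum -sumrN; apply: eq_bigr => t _.
  by rewrite raddfMz /= conj_Bval mulNrz.
exists (@Bmor R n M : {additive _ -> _}); split=> //.
- by move=> t h D' a; rewrite /= /Kclass Bmor_pi fgext_gen; exact: BvalE a.
- by move=> t; rewrite /= /Kclass Bmor_pi fgext_gen imE dmod_Bval.
- move=> x [m hm]; apply: imaginary_closed; first exact: im.
  (* [Bmor] and [ch_hat] are computed on the same representative of [x], so the identity on triples
     extends term by term. *)
  have -> : dmod (Bmor x) = ch_hat x - cform (ch_hat x).
    rewrite /Bmor /fgext raddf_sum /ch_hat; elim: (dom _) => [|t s IH].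
      by rewrite !big_nil raddf0 subrr.
    rewrite !big_cons IH raddfMz /= dmod_Bval.
    have cD (u v : preform (M := M)) : cform (u + v) = cform u + cform v by exact: raddfD.
    have cZ (u : preform (M := M)) (c : int) : cform (u *~ c) = cform u *~ c by exact: raddfMz.
    by move: (ch_hat_triple t) (coeff t _) => u c; rewrite (cD (u *~ c)) cZ mulrzBl; abel.
  (* Integer constants are real, so [ch_hat x] equals its conjugate. *)
  rewrite hm; apply/funext => l; apply/funext => y; rewrite !funBE /cform.
  have -> : conjc (int_form m l y) = int_form m l y.
    by case: l => [|? ?]; [exact: (rmorph_int (@conjc R))|exact: (rmorph0 (@conjc R))].
  by rewrite subrr.
Qed.
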